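(* Let $f\in H^2$, let $h\in H^4$ with $\nabla\cdot h=0$, and suppose $\|\nabla h\|_{L^\infty}<\sqrt{\pi\delta}\,\tfrac12\nu\lambda_1$. For any tempered set $\mathfrak D\in\mathcal D_H$ there are random variables $T^*_{\mathfrak D},L^*_{\mathfrak D}:\Omega\to(0,\infty)$ such that any two solutions $\mathbf v_1,\mathbf v_2$ of the random anisotropic Navier–Stokes equations driven by colored noise $$\frac{d\mathbf v}{dt}+\nu A_1\mathbf v+B(\mathbf v+hy_\delta(\theta_t\omega))=f-\nu A_1h\,y_\delta(\theta_t\omega)+h\,y_\delta(\theta_t\omega)$$ corresponding to initial values $\mathbf v_{1,0},\mathbf v_{2,0}\in\mathfrak D(\theta_{-T^*_{\mathfrak D}(\omega)}\omega)$ satisfy $$\big\|\mathbf v_1(T^*_{\mathfrak D}(\omega),\theta_{-T^*_{\mathfrak D}(\omega)}\omega,\mathbf v_{1,0})-\mathbf v_2(T^*_{\mathfrak D}(\omega),\theta_{-T^*_{\mathfrak D}(\omega)}\omega,\mathbf v_{2,0})\big\|_{H^3}^2\le L^*_{\mathfrak D}(\omega)\,\|\mathbf v_{1,0}-\mathbf v_{2,0}\|^2,\qquad\omega\in\Omega.$$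
   Context: Setting. $L,\nu,\delta>0$; $\mathbb T^2=[0,L]^2$ with periodic boundary conditions and coordinates $(x,y)$; $\lambda_1=4\pi^2/L^2$. $H=\{u\in (L^2_{per}(\mathbb T^2))^2:\int_{\mathbb T^2}u=0,\ \operatorname{div}u=0\}$ with the $L^2$ norm $\|\cdot\|$; $P$ is the Helmholtz–Leray orthogonal projection onto $H$; $A=-P\Delta$ is the Stokes operator; $H^s=D(A^{s/2})$ with $\|u\|_{H^s}=\|A^{s/2}u\|$. For $u=(u_1,u_2)$: $A_1u=-P(\partial_{yy}u_1,\partial_{xx}u_2)$ and $B(u)=P((u\cdot\nabla)u)$. Noise. $\Omega=\{\omega\in C(\mathbb R,\mathbb R):\omega(0)=0\}$ with the compact-open topology, Borel $\sigma$-algebra and Wiener measure $\mathbb P$; $\theta_t\omega(\cdot)=\omega(t+\cdot)-\omega(t)$. The colored noise is $\zeta_\delta(\omega)=-\frac1{\delta^2}\int_{-\infty}^0e^{s/\delta}\omega(s)\,ds$, and $y_\delta(\omega)=\int_{-\infty}^0e^{s}\zeta_\delta(\theta_s\omega)\,ds$, so that $\frac{d}{dt}y_\delta(\theta_t\omega)=-y_\delta(\theta_t\omega)+\zeta_\delta(\theta_t\omega)$. $\Omega$ is identified with a $\theta$-invariant subset of full measure on which $t\mapsto y_\delta(\theta_t\omega)$ is continuous, $|y_\delta(\theta_t\omega)|/|t|\to0$, and $\frac1t\int_0^t|y_\delta(\theta_s\omega)|^m ds\to\mathbb E|y_\delta|^m$ as $t\to\pm\infty$ for all $m\ge1$. Solutions.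 For $v_0\in H$, $\omega\in\Omega$, the random equation has a unique weak solution $\mathbf v(\cdot,\omega,v_0)\in C([0,\infty);H)\cap L^2_{loc}(0,\infty;H^1)$ with $\mathbf v(0)=v_0$; $\mathbf v_i(t,\omega,\mathbf v_{i,0})$ denotes this solution with $v_0=\mathbf v_{i,0}$. A random variable $\zeta$ is tempered if $\lim_{t\to\infty}e^{-\varepsilon t}|\zeta(\theta_{-t}\omega)|=0$ for all $\varepsilon>0$. A random set in $H$ is a nonempty-set-valued map $\mathfrak D$ with $\omega\mapsto\operatorname{dist}_H(x,\mathfrak D(\omega))$ measurable for each $x$; it is tempered if $\sup_{x\in\mathfrak D(\omega)}\|x\|\le\zeta(\omega)$ for some tempered random variable $\zeta$. $\mathcal D_H$ is the collection of tempered random sets in $H$. *)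

(* Defs.v *)
From HB Require Import structures.
From mathcomp Require Import all_boot all_order all_algebra.
From mathcomp Require Import all_classical all_reals all_analysis.
From mathcomp Require Import ess_sup_inf.
Set Implicit Arguments.
Unset Strict Implicit.
Unset Printing Implicit Defensive.
Import Order.TTheory GRing.Theory Num.Theory.
Import numFieldNormedType.Exports.
Local Open Scope classical_set_scope.
Local Open Scope ring_scope.

(* Functions on the torus of side L are represented by L-periodic functions on
   the plane, and elements of L^2 by everywhere-defined representatives: equality
   in L^2 is never Leibniz equality but the vanishing of [normL2]. *)
Section torus.
Context {R : realType}.
Implicit Types (L s lam : R) (k q : R * R -> R).
Implicit Types (u v w e f g h phi : R * R -> R * R).

Definition leb2 : set (R * R) -> \bar R :=
  (@lebesgue_measure R \x @lebesgue_measure R)%E.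

Definition cell L : set (R * R) := `[0, L] `*` `[0, L].

Definition intT L k : R := \int[leb2]_(p in cell L) k p.

Definition c1 u : R * R -> R := fun p => (u p).1.
Definition c2 u : R * R -> R := fun p => (u p).2.

Definition periodic (T : Type) L (k : R * R -> T) : Prop :=
  forall p : R * R, k (p.1 + L, p.2) = k p /\ k (p.1, p.2 + L) = k p.

Definition dx k : R * R -> R := fun p => derive1 (fun x : R => k (x, p.2)) p.1.
Definition dy k : R * R -> R := fun p => derive1 (fun y : R => k (p.1, y)) p.2.
Definition laplacian k : R * R -> R := fun p => dx (dx k) p + dy (dy k) p.

(* Iterated partial derivative along a word: [true] is d/dx, [false] is d/dy. *)
Definition partials (a : seq bool) k : R * R -> R :=
  foldr (fun b k' => if b then dx k' else dy k') k a.

Definition smooth k : Prop :=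
  forall a : seq bool,
    continuous (partials a k) /\
    forall p : R * R, derivable (fun x : R => partials a k (x, p.2)) p.1 1 /\
                      derivable (fun y : R => partials a k (p.1, y)) p.2 1.

Definition test_scalar L q : Prop := smooth q /\ periodic L q.

Definition L2per L u : Prop :=
  [/\ measurable_fun setT u, periodic L u &
      leb2.-integrable (cell L) (fun p => (c1 u p ^+ 2 + c2 u p ^+ 2)%:E)].

Definition inner L u v : R :=
  intT L (fun p => c1 u p * c1 v p + c2 u p * c2 v p).

Definition normL2 L u : R := Num.sqrt (inner L u u).

(* Divergence in the sense of periodic distributions. *)
Definition div_free L u : Prop :=
  forall q, test_scalar L q -> intT L (fun p => c1 u p * dx q p + c2 u p * dy q p) = 0.

Definition inH L u : Prop :=
  [/\ L2per L u, intT L (c1 u) = 0, intT L (c2 u) = 0 & div_free L u].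

(* Smooth elements of H.  The Leray projection P onto H fixes them, hence
   <P T, phi> = <T, phi> for every such phi and every distribution T; this is why
   P does not appear when an expression is tested against such a field. *)
Definition test_field L phi : Prop :=
  [/\ test_scalar L (c1 phi), test_scalar L (c2 phi) & inH L phi].

(* g = A u = - P Delta u, in the sense of distributions; the domain of A is
   {u in H | A u in H}. *)
Definition stokes L u g : Prop :=
  [/\ inH L u, inH L g &
      forall phi, test_field L phi ->
        inner L g phi =
        - inner L u (fun p => (laplacian (c1 phi) p, laplacian (c2 phi) p))].

Definition stokes_eigen L lam e : Prop := stokes L e (fun p => lam *: e p).

(* w = A^{s/2} u.  The Stokes operator is positive self-adjoint with compact
   resolvent, so by the spectral theorem A^{s/2} is multiplication by lam^{s/2} on
   the component along each eigenvector. *)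
Definition stokes_pow L s u w : Prop :=
  [/\ inH L u, inH L w &
      forall lam e, stokes_eigen L lam e ->
        inner L w e = (lam `^ (s / 2)) * inner L u e].

Definition inHs L s u : Prop := exists w, stokes_pow L s u w.

(* ||A^{s/2} u||, and +oo when u is not in D(A^{s/2}).  All w with w = A^{s/2} u
   agree almost everywhere, so the infimum is over at most one value. *)
Definition normHs L s u : \bar R :=
  ereal_inf [set (normL2 L w)%:E | w in [set w | stokes_pow L s u w]].

Definition weak_partial L (d : (R * R -> R) -> R * R -> R) u g : Prop :=
  L2per L g /\
  forall q, test_scalar L q ->
    intT L (fun p => c1 u p * d q p) = - intT L (fun p => c1 g p * q p) /\
    intT L (fun p => c2 u p * d q p) = - intT L (fun p => c2 g p * q p).

(* ||nabla u||_{L^oo}, with the Euclidean norm of the 2 x 2 matrix nabla u; it is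
   +oo when u has no weak gradient in L^2. *)
Definition grad_Linfty L u : \bar R :=
  ereal_inf [set N | exists ux uy : R * R -> R * R,
    [/\ weak_partial L dx u ux, weak_partial L dy u uy &
        N = ess_sup leb2 (fun p =>
              (Num.sqrt (c1 ux p ^+ 2 + c2 ux p ^+ 2 +
                         c1 uy p ^+ 2 + c2 uy p ^+ 2))%:E)]].

Definition lambda1 L : R := 4 * pi ^+ 2 / L ^+ 2.

(* <A_1 u, phi>, where A_1 u = - P (d_yy u_1, d_xx u_2), after moving the
   derivatives onto the test field. *)
Definition A1_pair L u phi : R :=
  - intT L (fun p => c1 u p * dy (dy (c1 phi)) p + c2 u p * dx (dx (c2 phi)) p).

(* <B(u), phi>, where B(u) = P ((u . nabla) u): for div u = 0 one has
   (u . nabla) u = div (u (x) u), and the derivative is moved onto phi. *)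
Definition B_pair L u phi : R :=
  - intT L (fun p =>
      c1 u p * c1 u p * dx (c1 phi) p + c2 u p * c1 u p * dy (c1 phi) p +
      c1 u p * c2 u p * dx (c2 phi) p + c2 u p * c2 u p * dy (c2 phi) p).

(* Weak solution of dv/dt + nu A_1 v + B(v + h z) = f - nu A_1 h z + h z with
   v(0) = v0, for a scalar forcing z.  Since the topology on H is given by
   [normL2], C([0, oo); H) is spelled out with it. *)
Definition weak_solution L (nu : R) f h (z : R -> R) (v0 : R * R -> R * R)
    (v : R -> R * R -> R * R) : Prop :=
  [/\ forall t, 0 <= t -> inH L (v t),
      forall t, 0 <= t ->
        normL2 L (fun p => v r p - v t p)
          @[r --> within [set r : R | 0 <= r] (nbhs t)] --> (0 : R),
      forall a b : R, 0 < a -> a <= b ->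
        (\int[lebesgue_measure]_(t in `[a, b]) (normHs L 1 (v t) ^+ 2) < +oo)%E,
      normL2 L (fun p => v 0 p - v0 p) = 0 &
      forall phi, test_field L phi -> forall t, 0 <= t ->
        inner L (v t) phi +
          \int[lebesgue_measure]_(r in `[0, t])
            (nu * A1_pair L (v r) phi + B_pair L (fun p => v r p + z r *: h p) phi) =
        inner L v0 phi +
          \int[lebesgue_measure]_(r in `[0, t])
            (inner L f phi - nu * z r * A1_pair L h phi + z r * inner L h phi)].

End torus.

Section wiener_space.
Context (R : realType).

Definition wpath : Type := {w : R -> R | continuous w /\ w 0 = 0}.

HB.instance Definition _ := gen_eqMixin wpath.
HB.instance Definition _ := gen_choiceMixin wpath.

Lemma cst0_wpath : continuous (fun _ : R => 0 : R) /\ (fun _ : R => 0 : R) 0 = 0.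
Proof. by split=> // x; exact: cst_continuous. Qed.

HB.instance Definition _ := isPointed.Build wpath (exist _ _ cst0_wpath).

Definition wpath_open : set (set wpath) :=
  [set A | exists2 U : set {compact-open, R -> R},
             open U & A = [set w : wpath | U (sval w)]].

Definition Omega := g_sigma_algebraType wpath_open.
HB.instance Definition _ := Measurable.on Omega.

Definition path_of (w : Omega) : R -> R := sval w.
Coercion path_of : Omega >-> Funclass.

Lemma theta_subproof (t : R) (w : Omega) :
  continuous (fun s => w (t + s) - w t) /\ w (t + 0) - w t = 0.
Proof.
case: w => w [cw w0]; rewrite /path_of /=; split; last by rewrite addr0 subrr.
move=> s; apply: cvgB; last exact: cvg_cst.
apply: (@continuous_comp _ _ _ (fun s => t + s) w); last exact: cw.
by apply: cvgD; [exact: cvg_cst | exact: cvg_id].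
Qed.

Definition theta (t : R) (w : Omega) : Omega := exist _ _ (theta_subproof t w).

(* Two-sided Wiener measure: increments over consecutive intervals of the whole
   line are independent and centred Gaussian with variance the length; together
   with w(0) = 0 this determines the law. *)
Definition is_wiener (P : probability Omega R) : Prop :=
  forall (n : nat) (t : nat -> R) (B : nat -> set R),
    (forall i, (i < n)%N -> t i < t i.+1) ->
    (forall i, measurable (B i)) ->
    P [set w : Omega | forall i, (i < n)%N -> B i (w (t i.+1) - w (t i))] =
    (\prod_(i < n) normal_prob 0 (Num.sqrt (t i.+1 - t i)) (B i))%E.

Definition zeta_delta (delta : R) (w : Omega) : R :=
  - (delta ^- 2 * \int[lebesgue_measure]_(s in `]-oo, 0]) (expR (s / delta) * w s)).

Definition y_delta (delta : R) (w : Omega) : R :=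
  \int[lebesgue_measure]_(s in `]-oo, 0]) (expR s * zeta_delta delta (theta s w)).

(* The theta-invariant sets of full measure with which Omega may be identified;
   the time average over [t, 0] with t < 0 is written over [- t, 0] with t > 0. *)
Definition admissible (delta : R) (P : probability Omega R) (Om : set Omega) : Prop :=
  measurable Om /\ P Om = 1%E /\ (forall t w, Om w -> Om (theta t w)) /\
  forall w, Om w ->
    [/\ continuous (fun t => y_delta delta (theta t w)),
        `|y_delta delta (theta t w)| / `|t| @[t --> +oo] --> (0 : R),
        `|y_delta delta (theta t w)| / `|t| @[t --> -oo] --> (0 : R) &
        forall m : R, 1 <= m ->
          let Em := fine 'E_P[fun w' => `|y_delta delta w'| `^ m] in
          (t^-1 * \int[lebesgue_measure]_(s in `[0, t])
             (`|y_delta delta (theta s w)| `^ m) @[t --> +oo] --> Em) /\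
          (t^-1 * \int[lebesgue_measure]_(s in `[- t, 0])
             (`|y_delta delta (theta s w)| `^ m) @[t --> +oo] --> Em)].

Definition tempered_rv (Om : set Omega) (X : Omega -> R) : Prop :=
  measurable_fun Om X /\
  forall eps : R, 0 < eps -> forall w, Om w ->
    expR (- (eps * t)) * `|X (theta (- t) w)| @[t --> +oo] --> (0 : R).

Definition distH (L : R) (x : R * R -> R * R) (D : set (R * R -> R * R)) : R :=
  inf [set normL2 L (fun p => x p - d p) | d in D].

Definition random_set (L : R) (Om : set Omega)
    (D : Omega -> set (R * R -> R * R)) : Prop :=
  (forall w, Om w -> D w !=set0 /\ D w `<=` [set u | inH L u]) /\
  forall x, inH L x -> measurable_fun Om (fun w => distH L x (D w)).

Definition tempered_set (L : R) (Om : set Omega)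
    (D : Omega -> set (R * R -> R * R)) : Prop :=
  random_set L Om D /\
  exists X : Omega -> R, tempered_rv Om X /\
    forall w, Om w -> forall x, D w x -> normL2 L x <= X w.

End wiener_space.

(* Submission.v *)
From HB Require Import structures.
From mathcomp Require Import all_boot all_order all_algebra.
From mathcomp Require Import all_classical all_reals all_analysis.
From mathcomp Require Import ess_sup_inf measurable_realfun.
From mathcomp Require Import ring lra zify.
Require Import Defs.
Set Implicit Arguments.
Unset Strict Implicit.
Unset Printing Implicit Defensive.
Import Order.TTheory GRing.Theory Num.Theory.
Import numFieldNormedType.Exports.
Local Open Scope classical_set_scope.
Local Open Scope ring_scope.

(** The waiting time can be the constant 1: parabolic smoothing over a unit time
    interval only sees the norm of the initial values and the supremum of the
    forcing on [0, 1], and the Lipschitz constant is a function of the least integer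
    bounding both.

    In the real Fourier basis k^perp/|k| cos(kap k.p + th) the operator A_1 is
    diagonal, so that each coefficient of a solution solves a scalar equation
    x' = - nu kap^2 a_k x + g with a_k comparable to |k|^2, and the coefficients of
    the quadratic term are bounded by |k| times a convolution of amplitudes.  The
    energy inequality bounds the solution in L^oo L^2 and L^2 H^1.  A weighted
    energy estimate, closed by the lattice form of Ladyzhenskaya's inequality and a
    Gronwall inequality with an integrable coefficient, gives with the weight
    min(|k|, N) a bound in H^1 on [1/2, 1], and with the weight 1 the Lipschitz
    estimate in L^2 for the difference of two solutions.  From there on Duhamel's
    formula alternates with a pointwise estimate of convolutions: each further
    twentieth of the time interval improves the decay of the coefficients, until
    those of the solutions decay like |k|^-4 and those of the difference like
    |k|^-5, which is enough for the H^3 norm in dimension two. *)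

(** * Lattice sums *)

(** The solutions are only weak: they are tested with smooth fields, and their H^1 norm is square
    integrable in time merely away from t = 0, so no energy identity is available at the outset.
    Each mode is tested separately, the modes of a box K are summed, and the energy inequality
    follows once the flux <B(u), P_K u> through the edge of the box is shown to vanish as K grows.
    Both L^2 estimates start at a time s > 0, and s tends to 0 at the end by continuity in L^2.
    Gronwall's inequality is applied to sums that have to be finite beforehand, whence a bounded
    weight in the H^1 estimate. In the bootstrap the quadratic term costs one power of |k| and the
    linear part returns two, so a step gains one power whenever the convolution preserves the decay;
    at decay |k|^-2 it does not quite, and the forcing stops the solutions at |k|^-4. Their
    exponents are 2, 5/2, 7/2, 4, and those of the difference 1, 2, 3, 4, 5: nine steps of length
    1/20 fit into [1/2, 1]. *)

Section lattice.
Context {R : realType}.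
Implicit Types (k l m : int * int) (S : seq (int * int)).

(** The sup norm plus one: positive at k = 0, so that negative powers make sense there, and still
    subadditive. *)
Definition br k : nat := (maxn `|k.1| `|k.2|).+1.

Definition zr (M : nat) : seq int :=
  [seq Posz a | a <- iota 0 M.+1] ++ [seq Negz a | a <- iota 0 M].

Definition box (M : nat) : seq (int * int) := [seq (i, j) | i <- zr M, j <- zr M].

Lemma big_uniq1 (I : eqType) (s : seq I) (a : I) (F : I -> R) : uniq s ->
  \sum_(i <- s | i == a) F i = if a \in s then F a else 0.
Proof.
move=> us; case: ifPn => [as_|na]; last first.
  rewrite big_seq_cond big_pred0// => i; apply/negbTE.
  by apply: contra na => /andP[+ /eqP <-].
rewrite (big_rem _ as_) eqxx big1_seq /= ?addr0// => i /andP[/eqP ->].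
by rewrite mem_rem_uniq// inE eqxx.
Qed.

Lemma mem_zr M (i : int) : (i \in zr M) = (`|i| <= M)%N.
Proof.
rewrite mem_cat; apply/orP/idP => [[]/mapP[a]|].
- by rewrite mem_iota => aM ->; lia.
- by rewrite mem_iota => aM ->; lia.
- case: i => n nM; [left|right]; apply/mapP; exists n => //; rewrite mem_iota; lia.
Qed.

Lemma uniq_zr M : uniq (zr M).
Proof.
rewrite cat_uniq !map_inj_uniq ?iota_uniq//=; try by move=> ? ? [].
by rewrite andbT; apply/hasPn => _ /mapP[a _ ->]; apply/negP => /mapP[b _].
Qed.

Lemma mem_box M k : (k \in box M) = (br k <= M.+1)%N.
Proof.
case: k => i j; rewrite /br /=; apply/allpairsP/idP => [[[a b]] /=|].
  by rewrite !mem_zr => -[aM bM [-> ->]]; rewrite ltnS geq_max aM.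
rewrite ltnS geq_max => /andP[iM jM]; exists (i, j) => /=.
by rewrite !mem_zr.
Qed.

Lemma uniq_box M : uniq (box M).
Proof. by apply: allpairs_uniq; rewrite ?uniq_zr// => -[? ?] [? ?] /=. Qed.

Lemma br_add l m : (br (l + m)%R <= br l + br m)%N.
Proof. by case: l m => [a b] [c d]; rewrite /br /=; lia. Qed.

Lemma br_opp k : br (- k) = br k.
Proof. by case: k => a b; rewrite /br /= !abszN. Qed.

Lemma sub_box M N : (M <= N)%N -> {subset box M <= box N}.
Proof. by move=> MN k; rewrite !mem_box => /leq_trans; apply. Qed.

Lemma ler_sum_subseq (I : eqType) (s t : seq I) (F : I -> R) :
  uniq s -> {subset s <= t} -> (forall i, 0 <= F i) ->
  \sum_(i <- s) F i <= \sum_(i <- t) F i.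
Proof.
move=> us st F0; have [t' pt] : exists t', perm_eq t (s ++ t').
  elim: s us t st => [|x s IH] /=; first by move=> _ t _; exists t.
  move=> /andP[xs us] t st.
  have xt : x \in t by apply: st; rewrite mem_head.
  have [|t' Ht'] := IH us (rem x t).
    move=> y ys; have := st y; rewrite inE ys orbT => /(_ isT) yt.
    have : y \in x :: rem x t by rewrite -(perm_mem (perm_to_rem xt)).
    by rewrite inE => /orP[/eqP yx|//]; rewrite -yx ys in xs.
  by exists t'; rewrite (perm_trans (perm_to_rem xt))//= perm_cons.
by rewrite (perm_big _ pt) big_cat /= lerDl sumr_ge0.
Qed.

Lemma seq_sub_box S : exists M, {subset S <= box M}.
Proof.
exists (\max_(k <- S) br k)%N => k kS; rewrite mem_box.
by apply: leqW; rewrite (big_rem k)//= leq_maxl.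
Qed.

(** Reflection reduces the box to the quadrant of nonnegative entries at the cost of a factor 4, and
    there the shell max(a, b) = j has at most 2 (j + 1) points. *)
Lemma sum_shell M (F : nat -> R) : (forall n, 0 <= F n) ->
  \sum_(k <- box M) F (br k) <= 8 * \sum_(j < M.+1) j.+1%:R * F j.+1.
Proof.
move=> Submission.
have half (G : nat -> R) : (forall n, 0 <= G n) ->
    \sum_(i <- zr M) G `|i|%N <= 2 * \sum_(a < M.+1) G a :> R.
  move=> G0; rewrite /zr big_cat -[in leRHS](big_mkord xpredT G) mulr_natl mulr2n.
  apply: lerD; rewrite big_map.
    by rewrite /index_iota subn0.
  by rewrite big_nat_recl// /index_iota subn0 ler_wpDl.
rewrite big_allpairs /=.
have E1 i : \sum_(j <- zr M) F (br (i, j)) <= 2 * \sum_(b < M.+1) F (maxn `|i| b).+1.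
  by apply: (half (fun b => F (maxn `|i| b).+1)).
apply: le_trans (ler_sum _ (fun i _ => E1 i)) _.
apply: le_trans (half (fun a => 2 * \sum_(b < M.+1) F (maxn a b).+1) _) _.
  by move=> n; rewrite mulr_ge0// sumr_ge0.
rewrite -mulr_sumr mulrA.
suff : \sum_(i < M.+1) \sum_(b < M.+1) F (maxn i b).+1 <=
    2 * \sum_(j < M.+1) j.+1%:R * F j.+1 by lra.
(* Each weight j + 1 is written as the number of i <= j, once for the pairs with i <= b and once for
   those with b <= i. The diagonal is counted twice, which only helps. *)
have -> : 2 * \sum_(j < M.+1) j.+1%:R * F j.+1 =
    \sum_(j < M.+1) \sum_(i < M.+1 | (i <= j)%N) F j.+1 +
    \sum_(j < M.+1) \sum_(i < M.+1 | (i <= j)%N) F j.+1.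
  rewrite -mulr2n mulr_natl; congr (_ *+ _); apply: eq_bigr => j _.
  rewrite [RHS]big_const iter_addr_0 -[RHS]mulr_natl; congr (_%:R * _); apply/esym.
  have -> : #|[pred i : 'I_M.+1 | (i <= j)%N]| = count (fun i => (i <= j)%N) (iota 0 M.+1).
    rewrite cardE size_filter -val_enum_ord count_map.
    by rewrite enumT; apply: eq_count => i.
  rewrite -size_filter.
  have -> : [seq i <- iota 0 M.+1 | (i <= j)%N] = iota 0 j.+1.
    have := ltn_ord j; move: (nat_of_ord j) => n nM.
    have -> : M.+1 = (n.+1 + (M - n))%N by lia.
    rewrite iotaD filter_cat.
    rewrite (eq_in_filter (a2 := predT)) ?filter_predT; last first.
      by move=> x; rewrite mem_iota add0n ltnS => /andP[_ ->].
    rewrite (eq_in_filter (a2 := pred0)) ?filter_pred0 ?cats0//.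
    by move=> x; rewrite mem_iota add0n => /andP[nx _] /=; apply/negbTE; rewrite -ltnNge.
  by rewrite size_iota.
rewrite [X in _ <= X + _](_ : _ =
    \sum_(i < M.+1) \sum_(j < M.+1 | (i <= j)%N) F j.+1); last first.
  by rewrite (exchange_big_dep xpredT).
rewrite -big_split /=; apply: ler_sum => i _.
rewrite [X in _ <= X + _]big_mkcond [X in _ <= _ + X]big_mkcond -big_split /=.
apply: ler_sum => b _.
have [ib|bi] := leqP i b.
  by case: ifP => _; rewrite ?addr0 ?lerDl.
by rewrite (ltnW bi) add0r.
Qed.

(** A shell of radius j carries O(j) points of weight 1/j, so each of the r shells contributes at
    most 8. *)
Lemma sum_inv_br S (r : nat) : uniq S ->
  \sum_(k <- S | (br k <= r)%N) ((br k)%:R : R)^-1 <= 8 * r%:R.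
Proof.
move=> uS; case: r => [|r].
  by rewrite big_pred0 ?mulr0// => k; rewrite leqn0.
rewrite -big_filter.
apply: le_trans (ler_sum_subseq (t := box r) _ _ _) _.
- exact: filter_uniq.
- by move=> k; rewrite mem_filter mem_box => /andP[].
- by move=> k; rewrite invr_ge0.
apply: le_trans (sum_shell r (F := fun n => (n%:R)^-1) _) _.
  by move=> n; rewrite invr_ge0.
rewrite ler_pM2l//.
under eq_bigr do rewrite divff ?pnatr_eq0//.
by rewrite sumr_const card_ord.
Qed.

(* Decay exponents of Fourier coefficients are counted in half-integer powers of br. *)
Definition rt k : R := Num.sqrt (br k)%:R.

Lemma rt_ge1 k : 1 <= rt k.
Proof. by rewrite /rt -[leLHS]sqrtr1 ler_sqrt// ler1n. Qed.

Lemma rt_gt0 k : 0 < rt k.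
Proof. exact: lt_le_trans (rt_ge1 k). Qed.

Lemma rt_sqr k : rt k ^+ 2 = (br k)%:R.
Proof. by rewrite sqr_sqrtr. Qed.

Lemma rt_add l m : rt (l + m) <= rt l + rt m.
Proof.
rewrite -(@ler_pXn2r _ 2) ?nnegrE ?addr_ge0 ?(ltW (rt_gt0 _))//.
rewrite sqrrD !rt_sqr.
have : (br (l + m))%:R <= (br l)%:R + (br m)%:R :> R.
  by rewrite -natrD ler_nat br_add.
have := mulr_gt0 (rt_gt0 l) (rt_gt0 m); lra.
Qed.

(** The exponent 5/2 exceeds the dimension 2: by shells the sum is at most 8 times the sum of
    j^(-3/2), which is below 3. *)
Lemma sum_rt5 S : uniq S -> \sum_(k <- S) rt k ^- 5 <= 24.
Proof.
move=> uS; have [M SM] := seq_sub_box S.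
apply: le_trans (ler_sum_subseq uS SM _) _.
  by move=> k; rewrite invr_ge0 exprn_ge0// ltW// rt_gt0.
apply: le_trans (sum_shell M (F := fun n => (Num.sqrt n%:R) ^- 5) _) _.
  by move=> n; rewrite invr_ge0 exprn_ge0// sqrtr_ge0.
(* The induction needs the remainder on the right: b^-3 <= 2/a - 2/b for the square roots a, b of
   consecutive integers makes the sum telescope. *)
suff : \sum_(j < M.+1) j.+1%:R * (Num.sqrt j.+1%:R) ^- 5 <=
   3 - 2 * (Num.sqrt M.+1%:R)^-1 :> R.
  have : 0 <= (Num.sqrt M.+1%:R : R)^-1 by rewrite invr_ge0 sqrtr_ge0.
  lra.
have E n : n.+1%:R * (Num.sqrt n.+1%:R) ^- 5 = (Num.sqrt n.+1%:R) ^- 3 :> R.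
  have p0 : 0 < Num.sqrt n.+1%:R :> R by rewrite sqrtr_gt0.
  rewrite -[X in X / _](@sqr_sqrtr _ n.+1%:R)//.
  by rewrite -[5%N]/(2 + 3)%N exprD invfM mulrA divff ?mul1r// expf_neq0// lt0r_neq0.
elim: M {SM} => [|M IH].
  by rewrite big_ord_recl big_ord0 E sqrtr1 expr1n invr1; lra.
rewrite big_ord_recr /= E.
apply: le_trans (lerD IH (lexx _)) _.
set a := Num.sqrt M.+1%:R; set b := Num.sqrt M.+2%:R.
have a0 : 0 < a by rewrite sqrtr_gt0.
have b0 : 0 < b by rewrite sqrtr_gt0.
have ab : b ^+ 2 = a ^+ 2 + 1 by rewrite !sqr_sqrtr// -natr1.
have ab' : a <= b by rewrite ler_sqrt// ler_nat.
have -> : b ^- 3 = (b ^+ 2)^-1 * b^-1 by field; exact: lt0r_neq0.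
suff : (b ^+ 2)^-1 * b^-1 <= 2 * a^-1 - 2 * b^-1 by lra.
have -> : 2 * a^-1 - 2 * b^-1 = (b ^+ 2 - a ^+ 2) * (2 / (a * b * (a + b))).
  field; rewrite !lt0r_neq0//; lra.
rewrite ab addrAC subrr add0r mul1r -invfM ler_pdivlMr ?mulr_gt0 ?addr_gt0//.
rewrite mulrC ler_pdivrMr ?mulr_gt0 ?exprn_gt0//; first by nra.
by rewrite ltr_wpDl ?sqr_ge0.
Qed.

Definition conv (M : nat) (P Q : int * int -> R) k : R :=
  \sum_(l <- box M) \sum_(m <- box M | l + m == k) P l * Q m.

Lemma cauchy_sum (I : Type) (s : seq I) (F G : I -> R) (A B : R) :
  0 <= A -> 0 <= B ->
  \sum_(i <- s) F i ^+ 2 <= A ^+ 2 -> \sum_(i <- s) G i ^+ 2 <= B ^+ 2 ->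
  \sum_(i <- s) F i * G i <= A * B.
Proof.
move=> A0 B0 FA GB.
(* [A] or [B] may be zero; shifting both by [e] allows the division in the weighted Young
   inequality, and [e] tends to 0 afterwards. *)
have key (e : R) : 0 < e -> \sum_(i <- s) F i * G i <= (A + e) * (B + e).
  move=> e0; have A'0 : 0 < A + e by lra.
  have B'0 : 0 < B + e by lra.
  have H i : F i * G i <=
      (B + e) / (A + e) / 2 * F i ^+ 2 + (A + e) / (B + e) / 2 * G i ^+ 2.
    set a := A + e; set b := B + e.
    have -> : b / a / 2 * F i ^+ 2 + a / b / 2 * G i ^+ 2 =
        F i * G i + (b * F i - a * G i) ^+ 2 / (2 * a * b).
      by field; rewrite !lt0r_neq0.
    by rewrite lerDl divr_ge0 ?sqr_ge0// !mulr_ge0// ltW.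
  apply: le_trans (ler_sum _ (fun i _ => H i)) _.
  rewrite big_split /= -!mulr_sumr.
  apply: (@le_trans _ _ ((B + e) / (A + e) / 2 * (A + e) ^+ 2 +
     (A + e) / (B + e) / 2 * (B + e) ^+ 2)); last first.
    rewrite le_eqVlt; apply/orP; left; apply/eqP; field.
    by rewrite !lt0r_neq0.
  apply: lerD; apply: ler_wpM2l.
  - by rewrite !divr_ge0 ?(ltW A'0) ?(ltW B'0).
  - by apply: le_trans FA _; rewrite ler_pXn2r ?nnegrE//; lra.
  - by rewrite !divr_ge0 ?(ltW A'0) ?(ltW B'0).
  - by apply: le_trans GB _; rewrite ler_pXn2r ?nnegrE//; lra.
apply/ler_addgt0Pr => e e0.
pose d := Num.min 1 (e / (A + B + 1)).
have AB0 : 0 < A + B + 1 by lra.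
have d0 : 0 < d by rewrite lt_min ltr01 divr_gt0.
have d1 : d <= 1 by rewrite ge_min lexx.
have de : d * (A + B + 1) <= e by rewrite -ler_pdivlMr// ge_min lexx orbT.
apply: le_trans (key d d0) _; nra.
Qed.

Lemma cauchy_sum2 (S : seq (int * int)) (F G : int * int -> int * int -> R) (A B : R) :
  0 <= A -> 0 <= B ->
  \sum_(l <- S) \sum_(m <- S) F l m ^+ 2 <= A ^+ 2 ->
  \sum_(l <- S) \sum_(m <- S) G l m ^+ 2 <= B ^+ 2 ->
  \sum_(l <- S) \sum_(m <- S) F l m * G l m <= A * B.
Proof.
move=> A0 B0.
have E (H : int * int -> int * int -> R) : \sum_(l <- S) \sum_(m <- S) H l m =
   \sum_(p <- [seq (l, m) | l <- S, m <- S]) H p.1 p.2 by rewrite big_allpairs.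
rewrite !E => FA GB.
exact: (cauchy_sum (F := fun p => F p.1 p.2) (G := fun p => G p.1 p.2)).
Qed.

(* The half of Ladyzhenskaya's inequality where the frequency of [a] is the
   smaller one: the weight [br l] is moved from [c] to [a]. *)
Lemma ladyzhenskaya_half S (a c b : int * int -> R) (A B C : R) :
  uniq S -> (forall k, 0 <= a k) -> (forall k, 0 <= c k) -> (forall k, 0 <= b k) ->
  0 <= A -> 0 <= B -> 0 <= C ->
  \sum_(k <- S) (br k)%:R * a k ^+ 2 <= A ^+ 2 ->
  \sum_(k <- S) (br k)%:R * c k ^+ 2 <= C ^+ 2 ->
  (forall s, uniq s -> \sum_(k <- s) b k ^+ 2 <= B ^+ 2) ->
  \sum_(l <- S) \sum_(m <- S | (br l <= br m)%N) a l * c m * b (l + m)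
    <= 3 * (A * B * C).
Proof.
move=> uS a0 c0 b0 A0 B0 C0 hA hC hB.
(* The second Cauchy factor is bounded by sqrt 8 * C, the 8 coming from [sum_inv_br]; 3 rounds up
   the root. *)
have -> : 3 * (A * B * C) = (A * B) * (3 * C) by ring.
pose F l m := rt l * a l * b (l + m).
pose G l m := if (br l <= br m)%N then (rt l)^-1 * c m else 0.
rewrite [leLHS](_ : _ = \sum_(l <- S) \sum_(m <- S) F l m * G l m); last first.
  apply: eq_bigr => l _; rewrite big_mkcond; apply: eq_bigr => m _.
  rewrite /F /G; case: ifP => _; last by rewrite mulr0.
  by field; exact: lt0r_neq0 (rt_gt0 l).
apply: cauchy_sum2; rewrite ?mulr_ge0//.
  rewrite exprMn; apply: (@le_trans _ _ (\sum_(l <- S) (br l)%:R * a l ^+ 2 * B ^+ 2)).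
    apply: ler_sum => l _.
    under eq_bigr do rewrite /F exprMn exprMn rt_sqr.
    rewrite -mulr_sumr ler_wpM2l// ?mulr_ge0 ?sqr_ge0//.
    rewrite -(big_map (fun m => l + m) xpredT (fun k => b k ^+ 2)).
    by apply: hB; rewrite map_inj_uniq//; exact: addrI.
  by rewrite -mulr_suml ler_wpM2r ?sqr_ge0.
rewrite exchange_big /=.
apply: (@le_trans _ _ (\sum_(m <- S) c m ^+ 2 * (8 * (br m)%:R))).
  apply: ler_sum => m _.
  rewrite (_ : \sum_(i <- S) _ =
      c m ^+ 2 * \sum_(i <- S | (br i <= br m)%N) ((br i)%:R)^-1).
    by rewrite ler_wpM2l ?sqr_ge0// sum_inv_br.
  rewrite [in RHS]big_mkcond mulr_sumr; apply: eq_bigr => l _; rewrite /G.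
  case: ifP => _; last by rewrite expr0n mulr0.
  by rewrite exprMn exprVn rt_sqr mulrC.
rewrite (_ : \sum_(m <- S) _ = 8 * \sum_(m <- S) (br m)%:R * c m ^+ 2).
  by rewrite exprMn; have := sqr_ge0 C; nra.
by rewrite mulr_sumr; apply: eq_bigr => m _; ring.
Qed.

(** The lattice form of the bound of a product in L^2 by the H^(1/2) norms of its factors: the
    double sum is split according to which of the two frequencies is smaller. The hypothesis on [b]
    ranges over all finite sets because l + m leaves [S]. *)
Lemma ladyzhenskaya S (a c b : int * int -> R) (A B C : R) :
  uniq S -> (forall k, 0 <= a k) -> (forall k, 0 <= c k) -> (forall k, 0 <= b k) ->
  0 <= A -> 0 <= B -> 0 <= C ->
  \sum_(k <- S) (br k)%:R * a k ^+ 2 <= A ^+ 2 ->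
  \sum_(k <- S) (br k)%:R * c k ^+ 2 <= C ^+ 2 ->
  (forall s, uniq s -> \sum_(k <- s) b k ^+ 2 <= B ^+ 2) ->
  \sum_(l <- S) \sum_(m <- S) a l * c m * b (l + m) <= 6 * (A * B * C).
Proof.
move=> uS a0 c0 b0 A0 B0 C0 hA hC hB.
have H1 := ladyzhenskaya_half uS a0 c0 b0 A0 B0 C0 hA hC hB.
have H2 := ladyzhenskaya_half uS c0 a0 b0 C0 B0 A0 hC hA hB.
apply: (@le_trans _ _ (\sum_(l <- S) \sum_(m <- S | (br l <= br m)%N) a l * c m * b (l + m) +
   \sum_(l <- S) \sum_(m <- S | (br l <= br m)%N) c l * a m * b (l + m))); last by nra.
rewrite [X in _ <= _ + X](_ : _ = \sum_(l <- S) \sum_(m <- S | (br m <= br l)%N) a l * c m * b (l + m)).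
  rewrite -big_split /=; apply: ler_sum => l _.
  rewrite [X in _ <= X + _]big_mkcond [X in _ <= _ + X]big_mkcond -big_split /=.
  apply: ler_sum => m _.
  have p0 : 0 <= a l * c m * b (l + m) by rewrite !mulr_ge0.
  have [lm|lm] := leqP (br l) (br m).
    by case: ifP => _; rewrite ?lerDl ?addr0.
  by rewrite (ltnW lm) add0r.
rewrite (exchange_big_dep xpredT)//=; apply: eq_bigr => l _; apply: eq_bigr => m _.
by rewrite (addrC m l) (mulrC (c m)).
Qed.

Lemma sum_conv (K M : nat) (P Q b : int * int -> R) :
  \sum_(k <- box K) b k * conv M P Q k =
  \sum_(l <- box M) \sum_(m <- box M) P l * Q m * (if l + m \in box K then b (l + m) else 0).
Proof.
under eq_bigr do rewrite /conv mulr_sumr.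
rewrite exchange_big /=; apply: eq_bigr => l _.
under eq_bigr do rewrite mulr_sumr big_mkcond.
rewrite exchange_big /=; apply: eq_bigr => m _.
rewrite -big_mkcond; under eq_bigl do rewrite eq_sym.
rewrite (big_uniq1 _ (fun k => b k * (P l * Q m)) (uniq_box K)).
by case: ifP => _; rewrite ?mulr0// mulrC.
Qed.

Lemma trilinear_conv (K M : nat) (P Q b : int * int -> R) (A B C : R) :
  (forall k, 0 <= P k) -> (forall k, 0 <= Q k) -> (forall k, 0 <= b k) ->
  0 <= A -> 0 <= B -> 0 <= C ->
  \sum_(k <- box M) (br k)%:R * P k ^+ 2 <= A ^+ 2 ->
  \sum_(k <- box M) (br k)%:R * Q k ^+ 2 <= C ^+ 2 ->
  \sum_(k <- box K) b k ^+ 2 <= B ^+ 2 ->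
  \sum_(k <- box K) b k * conv M P Q k <= 6 * (A * B * C).
Proof.
move=> P0 Q0 b0 A0 B0 C0 hA hC hB; rewrite sum_conv.
apply: (ladyzhenskaya (b := fun k => if k \in box K then b k else 0)) => //.
- exact: uniq_box.
- by move=> k; case: ifP.
- move=> s us; apply: (@le_trans _ _ (\sum_(k <- s | k \in box K) b k ^+ 2)).
    rewrite [leRHS]big_mkcond ler_sum// => k _.
    by case: ifP => //; rewrite expr0n.
  rewrite -big_filter; apply: le_trans hB; apply: ler_sum_subseq.
  + exact: filter_uniq.
  + by move=> k; rewrite mem_filter => /andP[].
  + by move=> k; exact: sqr_ge0.
Qed.

Lemma rt_expD l m (j : nat) :
  rt (l + m) ^+ j <= 2 ^+ j * (rt l ^+ j + rt m ^+ j).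
Proof.
have [rl rm] := (ltW (rt_gt0 l), ltW (rt_gt0 m)).
wlog lm : l m rl rm / rt l <= rt m.
  move=> H; have /orP[lm|lm] := le_total (rt l) (rt m); first exact: H.
  by rewrite addrC [X in _ <= _ * X]addrC; exact: H.
apply: (@le_trans _ _ ((2 * rt m) ^+ j)).
  apply: lerXn2r; rewrite ?nnegrE ?mulr_ge0 ?(ltW (rt_gt0 _))//.
  by apply: le_trans (rt_add _ _) _; lra.
by rewrite exprMn ler_wpM2l ?exprn_ge0// lerDr exprn_ge0.
Qed.

(** Replacing the larger of the two values by the smaller collects all powers, at least 5 of them,
    on one point; adding both possibilities removes the case distinction. *)
Lemma inv_rt_mix l m (i j n : nat) : (5 <= n)%N -> (n <= i + j)%N ->
  rt l ^- i * rt m ^- j <= rt l ^- 5 + rt m ^- 5.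
Proof.
move=> n5 nij.
wlog lm : l m i j nij / rt l <= rt m.
  move=> H; have /orP[lm|lm] := le_total (rt l) (rt m); first exact: H.
  by rewrite mulrC addrC; apply: H => //; rewrite addnC.
have pl := rt_gt0 l; have pm := rt_gt0 m.
apply: (@le_trans _ _ (rt l ^- 5)); last by rewrite lerDl invr_ge0 exprn_ge0// ltW.
apply: (@le_trans _ _ (rt l ^- i * rt l ^- j)).
  rewrite ler_wpM2l ?invr_ge0 ?exprn_ge0 ?(ltW pl)//.
  by rewrite lef_pV2 ?posrE ?exprn_gt0// lerXn2r// nnegrE ltW.
rewrite -invfM -exprD lef_pV2 ?posrE ?exprn_gt0//.
by apply: ler_weXn2l; rewrite ?rt_ge1//; lia.
Qed.

(** On l + m = k the weight [rt k ^+ j] is shared out to l and m. Since j is at most either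
    exponent, powers adding up to at least 5 remain, and these are summable over l and over k - l.
    The constant 96 is 2 * (24 + 24) by [sum_rt5]. *)
Lemma conv_decay (M al be j : nat) (P Q : int * int -> R) (A B : R) k :
  (j <= al)%N -> (j <= be)%N -> (j + 5 <= al + be)%N -> 0 <= A -> 0 <= B ->
  (forall l, 0 <= P l) -> (forall l, 0 <= Q l) ->
  (forall l, P l <= A * rt l ^- al) -> (forall l, Q l <= B * rt l ^- be) ->
  conv M P Q k <= 2 ^+ j * 96 * A * B * rt k ^- j.
Proof.
move=> jal jbe jab A0 B0 P0 Q0 PA QB.
rewrite ler_pdivlMr ?exprn_gt0 ?rt_gt0// mulrC.
have rt0 l n : 0 <= rt l ^- n by rewrite invr_ge0 exprn_ge0// ltW// rt_gt0.
pose T l m := rt l ^- 5 + rt m ^- 5.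
have H l m : l + m = k -> rt k ^+ j * (P l * Q m) <= 2 ^+ j * A * B * (2 * T l m).
  move=> lmk.
  apply: (@le_trans _ _ (2 ^+ j * (rt l ^+ j + rt m ^+ j) * (A * rt l ^- al * (B * rt m ^- be)))).
    by apply: ler_pM => //; rewrite ?exprn_ge0 ?mulr_ge0 ?(ltW (rt_gt0 _))// -?lmk ?rt_expD// ler_pM.
  have E (n a : nat) q : (n <= a)%N -> rt q ^+ n * rt q ^- a = rt q ^- (a - n).
    move=> na; rewrite -[X in rt q ^- X](subnK na) exprD invfM mulrCA divff ?mulr1//.
    by rewrite expf_neq0// lt0r_neq0// rt_gt0.
  have -> : 2 ^+ j * (rt l ^+ j + rt m ^+ j) * (A * rt l ^- al * (B * rt m ^- be)) =
     2 ^+ j * A * B * (rt l ^- (al - j) * rt m ^- be + rt l ^- al * rt m ^- (be - j)).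
    by rewrite -(E _ _ l jal) -(E _ _ m jbe); ring.
  apply: ler_wpM2l; first by rewrite !mulr_ge0// exprn_ge0.
  rewrite mulr_natl mulr2n; apply: lerD; apply: (@inv_rt_mix _ _ _ _ 5%N) => //; lia.
rewrite /conv mulr_sumr.
apply: (@le_trans _ _ (\sum_(l <- box M) 2 ^+ j * A * B * (2 * T l (k - l)))).
  apply: ler_sum => l _; rewrite mulr_sumr.
  have c0 m : 0 <= 2 ^+ j * A * B * (2 * T l m).
    by rewrite !mulr_ge0 ?addr_ge0 ?exprn_ge0.
  apply: (@le_trans _ _ (\sum_(m <- box M | m == k - l) 2 ^+ j * A * B * (2 * T l m))).
    rewrite big_mkcond [leRHS]big_mkcond ler_sum// => m _.
    by rewrite -(inj_eq (addrI l) m) addrCA subrr addr0; case: eqP => // /H.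
  rewrite (big_uniq1 _ (fun m => 2 ^+ j * A * B * (2 * T l m)) (uniq_box M)).
  by case: ifP.
rewrite -mulr_sumr -mulr_sumr big_split /=.
have H1 := sum_rt5 (uniq_box M).
have H2 : \sum_(i <- box M) rt (k - i) ^- 5 <= 24.
  rewrite -(big_map (fun i => k - i) xpredT (fun q => rt q ^- 5)) sum_rt5//.
  by rewrite map_inj_uniq ?uniq_box//; exact: subrI.
have c0 : 0 <= 2 ^+ j * A * B by rewrite !mulr_ge0 ?exprn_ge0.
have -> : 2 ^+ j * 96 * A * B = 2 ^+ j * A * B * (2 * 48) by ring.
by apply: ler_wpM2l => //; lra.
Qed.

End lattice.

(** * Calculus on the periodic cell *)

Section joint_measurability.
Context {R : realType} d (T : measurableType d).

(** The first variable is rounded down to the grid of mesh 1/(n + 1): the rounded function is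
    measurable on each of countably many strips, and continuity recovers [F] in the limit. This
    serves both for the plane and for the evaluation of random paths. *)
Lemma measurable_caratheodory (F : R * T -> R) :
  (forall t, continuous (fun x => F (x, t))) ->
  (forall x, measurable_fun setT (fun t => F (x, t))) -> measurable_fun setT F.
Proof.
move=> cF mF.
pose q (n : nat) (x : R) : R := (Num.floor (x * n.+1%:R))%:~R / n.+1%:R.
apply: (@measurable_fun_cvg _ _ _ _ (fun n p => F (q n p.1, p.2))); last first.
  move=> [x t] _ /=; have qx : q n x @[n --> \oo] --> x.
    apply/cvgrPdist_le => e e0; near=> n.
    have n0 : 0 < n.+1%:R :> R by rewrite ltr0n.
    have /andP[f1 f2] := floor_itv (x * n.+1%:R).
    have f1' : (Num.floor (x * n.+1%:R))%:~R <= x * n.+1%:R by exact: f1.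
    have f2' : x * n.+1%:R <= (Num.floor (x * n.+1%:R))%:~R + 1.
      by rewrite ltW//; move: f2; rewrite intrD.
    rewrite /q; move: f1' f2'; set z : R := (Num.floor _)%:~R => f1' f2'.
    have -> : x - z / n.+1%:R = (x * n.+1%:R - z) / n.+1%:R by field; rewrite lt0r_neq0//.
    rewrite ger0_norm ?divr_ge0 ?subr_ge0 ?(ltW n0)//.
    apply: (@le_trans _ _ (n.+1%:R^-1)).
      rewrite -[leRHS]mul1r ler_wpM2r ?invr_ge0 ?(ltW n0)//.
      by rewrite lerBlDl.
    rewrite invf_ple ?posrE//; near: n.
    exists (Num.truncn e^-1).+1 => // n /= tn.
    apply: (le_trans (ltW (truncnS_gt _))); rewrite ler_nat; exact: leqW.
  by have := cvg_comp _ _ qx (cF t x).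
move=> n _ Y mY; rewrite setTI.
rewrite (_ : _ @^-1` Y = \bigcup_(z : int)
   ([set x | Num.floor (x * n.+1%:R) = z] `*` [set t | Y (F (z%:~R / n.+1%:R, t))])).
  apply: countable_bigcupT_measurable; first exact: countableP.
  move=> z; apply: measurableX.
    rewrite (_ : [set x | _] = `[z%:~R / n.+1%:R, (z + 1)%:~R / n.+1%:R[%classic)//.
    apply/seteqP; split => x /=; rewrite in_itv/=.
      move=> <-; rewrite ler_pdivrMr// ltr_pdivlMr//; exact: floor_itv.
    by rewrite ler_pdivrMr// ltr_pdivlMr// => /floor_def.
  by rewrite -[X in measurable X]setTI; exact: mF.
apply/seteqP; split => [[x t] /= h|[x t] [z _ [/= <-]]//].
by exists (Num.floor (x * n.+1%:R)).
Unshelve. all: by end_near. Qed.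

End joint_measurability.

Section plane.
Context {R : realType}.
Notation mu := (@lebesgue_measure R).
Notation mu2 := (mu \x mu)%E.
Implicit Types (k : R * R -> R) (L : R).

Lemma continuous_measurable2 k : continuous k -> measurable_fun setT k.
Proof.
move=> ck; apply: measurable_caratheodory.
  move=> y x; apply: (@continuous_comp _ _ _ (fun x => (x, y)) k); last exact: ck.
  exact: (cvg_pair (@cvg_id _ (nbhs x)) (cvg_cst y)).
move=> x; apply: continuous_measurable_fun => y.
apply: (@continuous_comp _ _ _ (fun y => (x, y)) k); last exact: ck.
exact: (cvg_pair (cvg_cst x) (@cvg_id _ (nbhs y))).
Qed.

Notation T2 := (measurableTypeR R * measurableTypeR R)%type.

Lemma measurable_cell L : @measurable _ T2 (cell L).
Proof. by apply: measurableX; exact: measurable_itv. Qed.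

Lemma mu2X (A B : set R) : measurable A -> measurable B ->
  mu2 (A `*` B) = (mu A * mu B)%E.
Proof. by move=> mA mB; rewrite product_measure1E. Qed.

Lemma mu2_cell L : 0 <= L -> mu2 (cell L) = (L ^+ 2)%:E.
Proof.
move=> L0; rewrite mu2X ?measurable_itv// lebesgue_measure_itv/= lte_fin.
by case: ltgtP L0 => // [L0|<-] _; rewrite ?sube0 ?mule0 ?expr0n//= -EFinM.
Qed.

Lemma mu2_cell_fin L : (mu2 (cell L) < +oo)%E.
Proof.
rewrite mu2X ?measurable_itv// !lebesgue_measure_itv.
by case: ifP; rewrite ?mul0e ?ltry// => _; rewrite -EFinB -EFinM ltry.
Qed.

Lemma integrable_cell L k (C : R) : measurable_fun setT k ->
  (forall p, cell L p -> `|k p| <= C) -> mu2.-integrable (cell L) (EFin \o k).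
Proof.
move=> mk kC; apply: (@measurable_bounded_integrable _ _ _ mu2).
- exact: measurable_cell.
- exact: mu2_cell_fin.
- exact: measurable_funS mk.
- by exists C; split; [exact: num_real|move=> M CM p pc; exact: le_trans (kC _ pc) (ltW CM)].
Qed.

(** The two sides carry different measurable structures on the plane; pushing forward along the
    identity identifies the integrals. *)
Lemma integrable_leb2 L (f : R * R -> \bar R) :
  leb2.-integrable (cell L) f <-> mu2.-integrable (cell L) f.
Proof.
have E : measurable_fun (cell L) f ->
    (\int[mu2]_(p in cell L) `|f p| = \int[leb2]_(p in cell L) `|f p|)%E.
  move=> mf.
  have mid : @measurable_fun _ _ T2 (R * R)%type setT idfun.
    by move=> _ Y mY; rewrite setTI.
  have H := @ge0_integral_pushforward _ _ T2 (R * R)%type R idfun mid mu2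
    (cell L) (fun p => `|f p|)%E (measurable_cell L).
  rewrite -H//; exact: measurableT_comp.
split=> /integrableP[mf fy]; apply/integrableP; split=> //.
  by rewrite E.
by rewrite -E.
Qed.

Lemma Fubini_cell_xy L k : mu2.-integrable (cell L) (EFin \o k) ->
  (\int[mu2]_(p in cell L) (k p)%:E =
   \int[mu]_(x in `[0%R, L]) \int[mu]_(y in `[0%R, L]) (k (x, y))%:E)%E.
Proof.
move=> ik; rewrite integral_mkcond.
rewrite -(@integral12_prod_meas1 _ _ _ _ _ mu mu); last first.
  by have /(integrable_mkcond (mu := mu2) (EFin \o k)) [+ _] := measurable_cell L; apply.
rewrite /= [RHS]integral_mkcond; apply: eq_integral => x _.
rewrite /fubini_F patchE; case: ifPn => xL.
  rewrite [RHS]integral_mkcond; apply: eq_integral => y _.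
  rewrite !patchE; congr (if _ then _ else _).
  have xL' := set_mem xL.
  apply/idP/idP => [/set_mem[? ?]|/set_mem yL]; apply/mem_set => //; split => //.
rewrite integral0_eq// => y _; rewrite patchE; case: ifPn => //.
by rewrite inE => -[xL' _]; move: xL; rewrite notin_setE.
Qed.

Lemma Fubini_cell_yx L k : mu2.-integrable (cell L) (EFin \o k) ->
  (\int[mu2]_(p in cell L) (k p)%:E =
   \int[mu]_(y in `[0%R, L]) \int[mu]_(x in `[0%R, L]) (k (x, y))%:E)%E.
Proof.
move=> ik; rewrite integral_mkcond.
rewrite -(@integral21_prod_meas1 _ _ _ _ _ mu mu); last first.
  by have /(integrable_mkcond (mu := mu2) (EFin \o k)) [+ _] := measurable_cell L; apply.
rewrite /= [RHS]integral_mkcond; apply: eq_integral => y _.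
rewrite /fubini_G patchE; case: ifPn => yL.
  rewrite [RHS]integral_mkcond; apply: eq_integral => x _.
  rewrite !patchE; congr (if _ then _ else _).
  have yL' := set_mem yL.
  apply/idP/idP => [/set_mem[? ?]|/set_mem xL]; apply/mem_set => //; split => //.
rewrite integral0_eq// => x _; rewrite patchE; case: ifPn => //.
by rewrite inE => -[_ yL']; move: yL; rewrite notin_setE.
Qed.

Lemma continuous_cell_bounded L k : continuous k ->
  exists C, forall p, cell L p -> `|k p| <= C.
Proof.
move=> ck; have cc : compact (cell L) by apply: compact_setX; exact: segment_compact.
have /compact_bounded[M [Mr HM]] : compact (k @` cell L).
  by apply: continuous_compact => //; apply: continuous_subspaceT.
exists (M + 1) => p pc; apply: HM; first by rewrite ltrDl.
by exists p.
Qed.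

Lemma continuous_integrable_cell L k : continuous k ->
  mu2.-integrable (cell L) (EFin \o k).
Proof.
move=> ck; have [C kC] := continuous_cell_bounded L ck.
by apply: integrable_cell kC; exact: continuous_measurable2.
Qed.

Lemma FTC2_derivable (F : R -> R) (a b : R) : a < b ->
  (forall x, derivable F x 1) -> continuous (derive1 F) ->
  (\int[mu]_(x in `[a, b]) (derive1 F x)%:E = (F b - F a)%:E)%E.
Proof.
move=> ab dF cF; rewrite EFinB; apply: continuous_FTC2; [exact: ab|exact: continuous_subspaceT| |by []].
have cont x : {for x, continuous F} by apply/differentiable_continuous/derivable1_diffP.
split; first by move=> x _; exact: dF.
- exact: cvg_at_right_filter (cont a).
- exact: cvg_at_left_filter (cont b).
Qed.

Lemma intT_dx L k : 0 < L -> (forall p, derivable (fun x => k (x, p.2)) p.1 1) ->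
  continuous (dx k) -> (forall y, k (L, y) = k (0, y)) -> intT L (dx k) = 0.
Proof.
move=> L0 dk ck kL; rewrite /intT /Rintegral (Fubini_cell_yx (k := dx k)); last exact: continuous_integrable_cell.
rewrite integral0_eq// => y _.
rewrite (FTC2_derivable (F := fun x => k (x, y)))//= ?kL ?subrr//.
- by move=> x; exact: (dk (x, y)).
- move=> x; apply: (@continuous_comp _ _ _ (fun x => (x, y)) (dx k)); last exact: ck.
  exact: (cvg_pair (@cvg_id _ (nbhs x)) (cvg_cst y)).
Qed.

Lemma intT_dy L k : 0 < L -> (forall p, derivable (fun y => k (p.1, y)) p.2 1) ->
  continuous (dy k) -> (forall x, k (x, L) = k (x, 0)) -> intT L (dy k) = 0.
Proof.
move=> L0 dk ck kL; rewrite /intT /Rintegral (Fubini_cell_xy (k := dy k)); last exact: continuous_integrable_cell.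
rewrite integral0_eq// => x _.
rewrite (FTC2_derivable (F := fun y => k (x, y)))//= ?kL ?subrr//.
- by move=> y; exact: (dk (x, y)).
- move=> y; apply: (@continuous_comp _ _ _ (fun y => (x, y)) (dy k)); last exact: ck.
  exact: (cvg_pair (cvg_cst x) (@cvg_id _ (nbhs y))).
Qed.

End plane.

(** * Trigonometric functions *)

Section trig.
Context {R : realType}.
Notation mu := (@lebesgue_measure R).
Notation mu2 := (mu \x mu)%E.
Variable L : R.
Hypothesis L0 : 0 < L.
Implicit Types (k l m : int * int) (th : R) (p : R * R) (f g q : R * R -> R).

Definition kap : R := 2 * pi / L.

Lemma kap_gt0 : 0 < kap.
Proof. by rewrite divr_gt0 ?mulr_gt0 ?pi_gt0. Qed.

Definition phase k p : R := kap * (k.1%:~R * p.1 + k.2%:~R * p.2).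

(** Cosines with a free phase: differentiation shifts the phase by pi/2 and a product is a half sum
    of two such functions, so sines never need separate treatment. *)
Definition tri k th : R * R -> R := fun p => cos (phase k p + th).

Definition tpoly (s : seq (R * ((int * int) * R))) : R * R -> R :=
  fun p => \sum_(x <- s) x.1 * tri x.2.1 x.2.2 p.

Lemma cos_period (x : R) (n : int) : cos (x + (pi *+ 2) *~ n) = cos x.
Proof.
case: n => n; first by rewrite -pmulrn (periodicn (@cosD2pi R)).
by rewrite NegzE -nmulrn -[in RHS](subrK ((pi *+ 2) *+ n.+1) x) (periodicn (@cosD2pi R)).
Qed.

Lemma kap_period (n : int) : kap * (n%:~R * L) = (pi *+ 2) *~ n.
Proof.
by rewrite /kap -[RHS]mulrzr mulr2n; field; exact: lt0r_neq0.
Qed.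

Lemma periodic_tri k th : periodic L (tri k th).
Proof.
move=> [x y]; rewrite /tri /phase /=; split.
  rewrite -[in RHS](cos_period _ k.1) -kap_period; congr cos; ring.
rewrite -[in RHS](cos_period _ k.2) -kap_period; congr cos; ring.
Qed.

Lemma continuous_phase k : continuous (phase k).
Proof.
move=> p; apply: cvgM; first exact: cvg_cst.
by apply: cvgD; apply: cvgM; [exact: cvg_cst|exact: cvg_fst|exact: cvg_cst|exact: cvg_snd].
Qed.

Lemma continuous_tri k th : continuous (tri k th).
Proof.
move=> p; apply: (@continuous_comp _ _ _ (fun p => phase k p + th) cos).
  by apply: cvgD; [exact: continuous_phase|exact: cvg_cst].
exact: continuous_cos.
Qed.

Lemma is_derive_cos_affine (a b x : R) :
  is_derive x 1 (fun x => cos (a * x + b)) (a * cos (a * x + b + pi / 2)).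
Proof.
rewrite cosDpihalf.
have H : is_derive x (1 : R) (fun x => a * x + b) a.
  have := is_deriveD (is_deriveZ a (is_derive_id x (1 : R))) (is_derive_cst b x (1 : R)).
  by move=> H; apply: is_derive_eq; rewrite addr0 /GRing.scale /= mulr1.
have := @is_derive1_comp R cos (fun x => a * x + b) x _ _ (is_derive_cos (a * x + b)) H.
rewrite (_ : (cos \o _) = (fun x => cos (a * x + b)))//.
by move=> H'; apply: is_derive_eq; rewrite mulrC.
Qed.

Lemma is_derive_tri_x k th p :
  is_derive p.1 1 (fun x => tri k th (x, p.2)) (kap * k.1%:~R * tri k (th + pi / 2) p).
Proof.
have := is_derive_cos_affine (kap * k.1%:~R) (kap * (k.2%:~R * p.2) + th) p.1.
rewrite (_ : (fun x => cos _) = (fun x => tri k th (x, p.2))); last first.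
  by apply/funext => x; rewrite /tri /phase /=; congr cos; ring.
by rewrite /tri /phase => H; apply: is_derive_eq; congr (_ * cos _); ring.
Qed.

Lemma is_derive_tri_y k th p :
  is_derive p.2 1 (fun y => tri k th (p.1, y)) (kap * k.2%:~R * tri k (th + pi / 2) p).
Proof.
have := is_derive_cos_affine (kap * k.2%:~R) (kap * (k.1%:~R * p.1) + th) p.2.
rewrite (_ : (fun x => cos _) = (fun y => tri k th (p.1, y))); last first.
  by apply/funext => x; rewrite /tri /phase /=; congr cos; ring.
by rewrite /tri /phase => H; apply: is_derive_eq; congr (_ * cos _); ring.
Qed.

Definition tp_dx (s : seq (R * ((int * int) * R))) :=
  [seq (x.1 * (kap * x.2.1.1%:~R), (x.2.1, x.2.2 + pi / 2)) | x <- s].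
Definition tp_dy (s : seq (R * ((int * int) * R))) :=
  [seq (x.1 * (kap * x.2.1.2%:~R), (x.2.1, x.2.2 + pi / 2)) | x <- s].

Lemma is_derive_tpoly_x s p :
  is_derive p.1 1 (fun x => tpoly s (x, p.2)) (tpoly (tp_dx s) p).
Proof.
elim: s => [|[c [k th]] s IH]; rewrite /tpoly.
  rewrite (_ : (fun x => _) = (fun=> 0)).
    by rewrite big_nil; exact: is_derive_cst.
  by apply/funext => x; rewrite big_nil.
rewrite (_ : (fun x => _) = (fun x => c * tri k th (x, p.2)) + (fun x => tpoly s (x, p.2))).
  rewrite big_cons /=; apply: is_deriveD => //.
  have := is_deriveZ c (is_derive_tri_x k th p) => H; apply: is_derive_eq.
  by rewrite /GRing.scale /=; ring.
by apply/funext => x; rewrite big_cons.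
Qed.

Lemma is_derive_tpoly_y s p :
  is_derive p.2 1 (fun y => tpoly s (p.1, y)) (tpoly (tp_dy s) p).
Proof.
elim: s => [|[c [k th]] s IH]; rewrite /tpoly.
  rewrite (_ : (fun x => _) = (fun=> 0)).
    by rewrite big_nil; exact: is_derive_cst.
  by apply/funext => x; rewrite big_nil.
rewrite (_ : (fun x => _) = (fun y => c * tri k th (p.1, y)) + (fun y => tpoly s (p.1, y))).
  rewrite big_cons /=; apply: is_deriveD => //.
  have := is_deriveZ c (is_derive_tri_y k th p) => H; apply: is_derive_eq.
  by rewrite /GRing.scale /=; ring.
by apply/funext => x; rewrite big_cons.
Qed.

Lemma dx_tpoly s : dx (tpoly s) = tpoly (tp_dx s).
Proof.
apply/funext => p; rewrite /dx derive1E.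
exact: (@derive_val _ _ _ _ _ _ _ (is_derive_tpoly_x s p)).
Qed.

Lemma dy_tpoly s : dy (tpoly s) = tpoly (tp_dy s).
Proof.
apply/funext => p; rewrite /dy derive1E.
exact: (@derive_val _ _ _ _ _ _ _ (is_derive_tpoly_y s p)).
Qed.

Lemma continuous_tpoly s : continuous (tpoly s).
Proof.
elim: s => [|x s IH] p.
  rewrite (_ : tpoly [::] = fun=> 0); first exact: cvg_cst.
  by apply/funext => q; rewrite /tpoly big_nil.
rewrite (_ : tpoly (x :: s) = fun p => x.1 * tri x.2.1 x.2.2 p + tpoly s p).
  apply: cvgD; last exact: IH.
  by apply: cvgM; [exact: cvg_cst|exact: continuous_tri].
by apply/funext => q; rewrite /tpoly big_cons.
Qed.

Lemma partials_tpoly a s : exists t, partials a (tpoly s) = tpoly t.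
Proof.
elim: a => [|b a [t IH]]; first by exists s.
rewrite /= IH; case: b.
  by exists (tp_dx t); rewrite dx_tpoly.
by exists (tp_dy t); rewrite dy_tpoly.
Qed.

Lemma test_scalar_tpoly s : test_scalar L (tpoly s).
Proof.
split; last first.
  move=> p; rewrite /tpoly; split; apply: eq_bigr => x _; congr (_ * _).
    by have [] := periodic_tri x.2.1 x.2.2 p.
  by have [] := periodic_tri x.2.1 x.2.2 p.
move=> a; have [t ->] := partials_tpoly a s; split; first exact: continuous_tpoly.
by move=> p; split; [have [] := is_derive_tpoly_x t p|have [] := is_derive_tpoly_y t p].
Qed.

Lemma tpolyD s t p : tpoly s p + tpoly t p = tpoly (s ++ t) p.
Proof. by rewrite /tpoly big_cat. Qed.

Lemma phaseD k l p : phase (k + l) p = phase k p + phase l p.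
Proof. by rewrite /phase /= !intrD; ring. Qed.

Lemma phaseN k p : phase (- k) p = - phase k p.
Proof. by rewrite /phase /= !intrN; ring. Qed.

Lemma triM k th l th' p : tri k th p * tri l th' p =
  2^-1 * tri (k + l) (th + th') p + 2^-1 * tri (k - l) (th - th') p.
Proof.
rewrite /tri !phaseD phaseN.
have -> : phase k p + phase l p + (th + th') = (phase k p + th) + (phase l p + th') by ring.
have -> : phase k p - phase l p + (th - th') = (phase k p + th) - (phase l p + th') by ring.
by move: (phase k p + th) (phase l p + th') => a b; rewrite cosD cosB; field.
Qed.

(** Closure under products makes |u|^2 an admissible test function when u is a trigonometric
    field. *)
Lemma tpolyM s t : exists r, forall p, tpoly s p * tpoly t p = tpoly r p.
Proof.
have one c k th : exists r, forall p, c * tri k th p * tpoly t p = tpoly r p.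
  elim: t => [|[c' [k' th']] t [r IH]].
    by exists [::] => p; rewrite /tpoly !big_nil mulr0.
  exists ([:: (c * c' / 2, (k + k', th + th')); (c * c' / 2, (k - k', th - th'))] ++ r) => p.
  rewrite -tpolyD -IH {1}/tpoly big_cons -/(tpoly t p) /= mulrDr; congr (_ + _).
  rewrite /tpoly !big_cons big_nil /=.
  by rewrite mulrACA triM; field.
elim: s => [|[c [k th]] s [r IH]].
  by exists [::] => p; rewrite /tpoly !big_nil mul0r.
have [r' H] := one c k th.
exists (r' ++ r) => p; rewrite -tpolyD -IH -H {1}/tpoly big_cons -/(tpoly s p) /=.
by rewrite mulrDl.
Qed.

Lemma tri0 th p : tri 0 th p = cos th.
Proof. by rewrite /tri /phase /= !mul0r addr0 mulr0 add0r. Qed.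

Lemma intTD f g : mu2.-integrable (cell L) (EFin \o f) ->
  mu2.-integrable (cell L) (EFin \o g) ->
  intT L (fun p => f p + g p) = intT L f + intT L g.
Proof. by move=> fi gi; apply: RintegralD => //; exact: measurable_cell. Qed.

Lemma intTZ c f : mu2.-integrable (cell L) (EFin \o f) ->
  intT L (fun p => c * f p) = c * intT L f.
Proof. by move=> fi; apply: RintegralZl => //; exact: measurable_cell. Qed.

Lemma intTB f g : mu2.-integrable (cell L) (EFin \o f) ->
  mu2.-integrable (cell L) (EFin \o g) ->
  intT L (fun p => f p - g p) = intT L f - intT L g.
Proof. by move=> fi gi; apply: RintegralB => //; exact: measurable_cell. Qed.

Lemma integrableTD f g : mu2.-integrable (cell L) (EFin \o f) ->
  mu2.-integrable (cell L) (EFin \o g) ->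
  mu2.-integrable (cell L) (EFin \o (fun p => f p + g p)).
Proof. by move=> fi gi; apply: (@integrableD _ _ _ mu2 _ (measurable_cell L) _ _ fi gi). Qed.

Lemma integrableTZ c f : mu2.-integrable (cell L) (EFin \o f) ->
  mu2.-integrable (cell L) (EFin \o (fun p => c * f p)).
Proof. by move=> fi; apply: (@integrableZl _ _ _ mu2 _ (measurable_cell L) c _ fi). Qed.

Lemma intT0 : intT L (fun=> 0) = 0.
Proof. by rewrite /intT /Rintegral integral0. Qed.

Lemma integrableT0 : mu2.-integrable (cell L) (EFin \o (fun=> 0)).
Proof. exact: integrable0. Qed.

Lemma intT_sum (I : Type) (s : seq I) (F : I -> R * R -> R) :
  (forall i, mu2.-integrable (cell L) (EFin \o F i)) ->
  mu2.-integrable (cell L) (EFin \o (fun p => \sum_(i <- s) F i p)) /\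
  intT L (fun p => \sum_(i <- s) F i p) = \sum_(i <- s) intT L (F i).
Proof.
move=> Fi; elim: s => [|i s [IH1 IH2]].
  rewrite big_nil (_ : (fun p => _) = (fun=> 0)); last by apply/funext => p; rewrite big_nil.
  by split; [exact: integrableT0|exact: intT0].
rewrite big_cons (_ : (fun p => _) = (fun p => F i p + \sum_(i <- s) F i p)); last first.
  by apply/funext => p; rewrite big_cons.
by split; [exact: integrableTD|rewrite intTD// IH2].
Qed.

Lemma integrable_tri k th : mu2.-integrable (cell L) (EFin \o tri k th).
Proof. exact/continuous_integrable_cell/continuous_tri. Qed.

Lemma intT_tri k th : intT L (tri k th) = if k == 0 then L ^+ 2 * cos th else 0.
Proof.
case: eqP => [->|/eqP k0].
  rewrite (_ : tri 0 th = fun=> cos th); last by apply/funext => p; rewrite tri0.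
  rewrite /intT Rintegral_cst; last exact: measurable_cell.
  have -> : fine (leb2 (cell L)) = L ^+ 2 by have /(congr1 fine) := mu2_cell (ltW L0).
  exact: mulrC.
have kp := lt0r_neq0 kap_gt0.
have [k1|k1] := eqVneq k.1 0; last first.
  (* A nonconstant mode is the derivative of a periodic function: the phase is moved back by pi/2
     and the amplitude divided by the wave number. *)
  have -> : tri k th = dx (tpoly [:: ((kap * k.1%:~R)^-1, (k, th - pi / 2))]).
    rewrite dx_tpoly; apply/funext => p; rewrite /tpoly big_seq1 /= mulVf ?mul1r ?subrK//.
    by rewrite mulf_neq0// intr_eq0.
  apply: intT_dx => //.
  - by move=> p; have [] := is_derive_tpoly_x [:: ((kap * k.1%:~R)^-1, (k, th - pi / 2))] p.
  - by rewrite dx_tpoly; exact: continuous_tpoly.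
  - move=> y; have [_ /(_ (0, y))[/= + _]] := test_scalar_tpoly [:: ((kap * k.1%:~R)^-1, (k, th - pi / 2))].
    by rewrite add0r.
have k2 : k.2 != 0 by case: (k) k0 k1 => a b /= ab a0; apply: contra ab => /eqP ->; rewrite a0.
have -> : tri k th = dy (tpoly [:: ((kap * k.2%:~R)^-1, (k, th - pi / 2))]).
  rewrite dy_tpoly; apply/funext => p; rewrite /tpoly big_seq1 /= mulVf ?mul1r ?subrK//.
  by rewrite mulf_neq0// intr_eq0.
apply: intT_dy => //.
- by move=> p; have [] := is_derive_tpoly_y [:: ((kap * k.2%:~R)^-1, (k, th - pi / 2))] p.
- by rewrite dy_tpoly; exact: continuous_tpoly.
- move=> y; have [_ /(_ (y, 0))[/= _]] := test_scalar_tpoly [:: ((kap * k.2%:~R)^-1, (k, th - pi / 2))].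
  by rewrite add0r.
Qed.

Lemma intT_tri2 k th l th' : intT L (fun p => tri k th p * tri l th' p) =
  2^-1 * (if k + l == 0 then L ^+ 2 * cos (th + th') else 0) +
  2^-1 * (if k == l then L ^+ 2 * cos (th - th') else 0).
Proof.
rewrite (_ : (fun p => _) = (fun p => 2^-1 * tri (k + l) (th + th') p +
    2^-1 * tri (k - l) (th - th') p)); last by apply/funext => p; rewrite triM.
rewrite intTD; try exact/integrableTZ/integrable_tri.
by rewrite !intTZ ?intT_tri ?subr_eq0//; exact: integrable_tri.
Qed.

(* Each of the four resonances contributes at most a quarter of the area. *)
Lemma intT_tri3 k th l th' m th'' :
  `|intT L (fun p => tri l th' p * tri m th'' p * tri k th p)| <=
  L ^+ 2 / 4 * ((l + m == k)%:R + (l + m == - k)%:R + (l - m == k)%:R + (l - m == - k)%:R).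
Proof.
rewrite (_ : (fun p => _) = (fun p => 2^-1 * (tri (l + m) (th' + th'') p * tri k th p) +
    2^-1 * (tri (l - m) (th' - th'') p * tri k th p))); last first.
  by apply/funext => p; rewrite triM; ring.
have itt a b c d : mu2.-integrable (cell L) (EFin \o (fun p => tri a b p * tri c d p)).
  apply: continuous_integrable_cell => p; apply: cvgM; exact: continuous_tri.
rewrite intTD; try exact/integrableTZ.
rewrite !intTZ// !intT_tri2 !addr_eq0.
have c1 (b : bool) x : `|if b then L ^+ 2 * cos x else 0| <= L ^+ 2 * b%:R.
  case: b; rewrite ?normr0 ?mulr0// normrM ger0_norm ?sqr_ge0// mulr1.
  by rewrite -[leRHS]mulr1 ler_wpM2l ?sqr_ge0// cos_max.
have h (x y : R) : `|2^-1 * x + 2^-1 * y| <= 2^-1 * `|x| + 2^-1 * `|y|.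
  apply: le_trans (ler_normD _ _) _.
    by rewrite !normrM (@ger0_norm _ 2^-1) ?invr_ge0.
have H (x y z w X Y Z W : R) : `|x| <= X -> `|y| <= Y -> `|z| <= Z -> `|w| <= W ->
   `|2^-1 * (2^-1 * x + 2^-1 * y) + 2^-1 * (2^-1 * z + 2^-1 * w)| <= (X + Y + Z + W) / 4.
  move=> xX yY zZ wW; apply: le_trans (h _ _) _.
  have := h x y; have := h z w; lra.
apply: le_trans (H _ _ _ _ _ _ _ _ (c1 _ _) (c1 _ _) (c1 _ _) (c1 _ _)) _.
rewrite le_eqVlt; apply/orP; left; apply/eqP; ring.
Qed.

Lemma dxM f q : test_scalar L f -> test_scalar L q ->
  dx (fun p => f p * q p) = (fun p => f p * dx q p + dx f p * q p).
Proof.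
move=> [sf _] [sq _]; have [_ df] := sf [::]; have [_ dq] := sq [::].
apply/funext => p; rewrite /dx derive1E.
have := deriveM (df p).1 (dq p).1; rewrite -!derive1E /= => ->.
by case: p => x y /=; congr (_ + _); exact: mulrC.
Qed.

Lemma dyM f q : test_scalar L f -> test_scalar L q ->
  dy (fun p => f p * q p) = (fun p => f p * dy q p + dy f p * q p).
Proof.
move=> [sf _] [sq _]; have [_ df] := sf [::]; have [_ dq] := sq [::].
apply/funext => p; rewrite /dy derive1E.
have := deriveM (df p).2 (dq p).2; rewrite -!derive1E /= => ->.
by case: p => x y /=; congr (_ + _); exact: mulrC.
Qed.

Lemma IBP_x f q : test_scalar L f -> test_scalar L q ->
  intT L (fun p => f p * dx q p) = - intT L (fun p => dx f p * q p).
Proof.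
move=> tf tq; have E := dxM tf tq; move: tf tq => [sf pf] [sq pq].
apply/eqP; rewrite -subr_eq0 opprK; apply/eqP.
have [cf df] := sf [::]; have [cf' _] := sf [:: true].
have [cq dq] := sq [::]; have [cq' _] := sq [:: true].
rewrite -intTD; last 2 first.
- by apply: continuous_integrable_cell => p; apply: cvgM; [exact: cf|exact: cq'].
- by apply: continuous_integrable_cell => p; apply: cvgM; [exact: cf'|exact: cq].

rewrite -E; apply: (intT_dx L0).
- by move=> p; have := derivableM (df p).1 (dq p).1.
- rewrite E => p; apply: cvgD; apply: cvgM; [exact: cf|exact: cq'|exact: cf'|exact: cq].
- by move=> y; have [/= + _] := pf (0, y); have [/= + _] := pq (0, y); rewrite add0r => -> ->.
Qed.

Lemma IBP_y f q : test_scalar L f -> test_scalar L q ->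
  intT L (fun p => f p * dy q p) = - intT L (fun p => dy f p * q p).
Proof.
move=> tf tq; have E := dyM tf tq; move: tf tq => [sf pf] [sq pq].
apply/eqP; rewrite -subr_eq0 opprK; apply/eqP.
have [cf df] := sf [::]; have [cf' _] := sf [:: false].
have [cq dq] := sq [::]; have [cq' _] := sq [:: false].
rewrite -intTD; last 2 first.
- by apply: continuous_integrable_cell => p; apply: cvgM; [exact: cf|exact: cq'].
- by apply: continuous_integrable_cell => p; apply: cvgM; [exact: cf'|exact: cq].

rewrite -E; apply: (intT_dy L0).
- by move=> p; have := derivableM (df p).2 (dq p).2.
- rewrite E => p; apply: cvgD; apply: cvgM; [exact: cf|exact: cq'|exact: cf'|exact: cq].
- by move=> y; have [/= _ +] := pf (y, 0); have [/= _ +] := pq (y, 0); rewrite add0r => -> ->.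
Qed.

End trig.

(** * Square integrable functions *)

Section square_integrable.
Context {R : realType}.
Notation mu := (@lebesgue_measure R).
Notation mu2 := (mu \x mu)%E.
Variable L : R.
Hypothesis L0 : 0 < L.
Implicit Types (f g b : R * R -> R).

Definition L2s f : Prop :=
  measurable_fun setT f /\ mu2.-integrable (cell L) (EFin \o (fun p => f p ^+ 2)).

Definition ip f g : R := intT L (fun p => f p * g p).

Definition nrm f : R := Num.sqrt (ip f f).

Lemma integrable_dominated f g : measurable_fun setT f ->
  (forall p, cell L p -> `|f p| <= g p) ->
  mu2.-integrable (cell L) (EFin \o g) -> mu2.-integrable (cell L) (EFin \o f).
Proof.
move=> mf fg; apply: (@le_integrable _ _ _ mu2 _ (measurable_cell L)).
  by apply/measurable_EFinP; apply: measurable_funS mf.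
move=> p pc /=; rewrite lee_fin; apply: le_trans (fg p pc) _.
exact: ler_norm.
Qed.

Lemma L2s_MM f g b (C : R) : L2s f -> L2s g -> measurable_fun setT b ->
  (forall p, cell L p -> `|b p| <= C) ->
  mu2.-integrable (cell L) (EFin \o (fun p => f p * g p * b p)).
Proof.
move=> [mf f2] [mg g2] mb bC.
apply: (@integrable_dominated _ (fun p => C * (f p ^+ 2 + g p ^+ 2))).
- by apply: measurable_funM => //; exact: measurable_funM.
- move=> p pc; rewrite !normrM mulrC.
  apply: ler_pM => //; rewrite ?mulr_ge0 ?bC//.
  rewrite -[f p ^+ 2]real_normK ?num_real// -[g p ^+ 2]real_normK ?num_real//.
  have := normr_ge0 (f p); have := normr_ge0 (g p); nra.
- by apply: integrableTZ; exact: integrableTD.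
Qed.

Lemma L2s_M f g : L2s f -> L2s g ->
  mu2.-integrable (cell L) (EFin \o (fun p => f p * g p)).
Proof.
move=> lf lg.
have := @L2s_MM _ _ (fun=> 1) 1 lf lg (measurable_cst _) (fun p _ => _).
rewrite (_ : (fun p => _ * _ * 1) = (fun p => f p * g p)); last first.
  by apply/funext => p; rewrite mulr1.
by apply; rewrite normr1.
Qed.

Lemma L2s_D f g : L2s f -> L2s g -> L2s (fun p => f p + g p).
Proof.
move=> lf lg; split; first by apply: measurable_funD; [case: lf|case: lg].
rewrite (_ : (fun p => _ ^+ 2) = (fun p => f p ^+ 2 + 2 * (f p * g p) + g p ^+ 2)); last first.
  by apply/funext => p; ring.
apply: integrableTD; last by case: lg.
by apply: integrableTD; [case: lf|apply: integrableTZ; exact: L2s_M].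
Qed.

Lemma L2s_Z c f : L2s f -> L2s (fun p => c * f p).
Proof.
move=> [mf lf]; split; first exact: measurable_funM.
rewrite (_ : (fun p => _ ^+ 2) = (fun p => c ^+ 2 * f p ^+ 2)); last first.
  by apply/funext => p; ring.
exact: integrableTZ.
Qed.

Lemma L2s_B f g : L2s f -> L2s g -> L2s (fun p => f p - g p).
Proof.
move=> lf lg.
rewrite (_ : (fun p => _) = (fun p => f p + (-1) * g p)); last first.
  by apply/funext => p; ring.
by apply: L2s_D => //; exact: L2s_Z.
Qed.

Lemma L2s_bounded f (C : R) : measurable_fun setT f ->
  (forall p, cell L p -> `|f p| <= C) -> L2s f.
Proof.
move=> mf fC; split=> //; apply: (@integrable_cell _ _ _ (C ^+ 2)).
  exact: measurable_funX.
move=> p pc; rewrite normrX lerXn2r ?nnegrE// ?fC//.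
exact: le_trans (fC p pc).
Qed.

Lemma L2s_continuous f : continuous f -> L2s f.
Proof.
move=> cf; have [C fC] := continuous_cell_bounded L cf.
by apply: L2s_bounded fC; exact: continuous_measurable2.
Qed.

Lemma L2s_1 : L2s (fun=> 1).
Proof. by apply: L2s_continuous => p; exact: cvg_cst. Qed.

Lemma L2s_integrable f : L2s f -> mu2.-integrable (cell L) (EFin \o f).
Proof.
move=> lf; have := L2s_M lf L2s_1.
by rewrite (_ : (fun p => f p * 1) = f)//; apply/funext => p; rewrite mulr1.
Qed.

Lemma ipC f g : ip f g = ip g f.
Proof. by rewrite /ip; congr intT; apply/funext => p; rewrite mulrC. Qed.

Lemma ipDl f g b : L2s f -> L2s g -> L2s b ->
  ip (fun p => f p + g p) b = ip f b + ip g b.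
Proof.
move=> lf lg lb; rewrite /ip -intTD; try exact: L2s_M.
by congr intT; apply/funext => p; rewrite mulrDl.
Qed.

Lemma ipZl c f b : L2s f -> L2s b -> ip (fun p => c * f p) b = c * ip f b.
Proof.
move=> lf lb; rewrite /ip -intTZ; last exact: L2s_M.
by congr intT; apply/funext => p; rewrite mulrA.
Qed.

Lemma ipBl f g b : L2s f -> L2s g -> L2s b ->
  ip (fun p => f p - g p) b = ip f b - ip g b.
Proof.
move=> lf lg lb; rewrite /ip -intTB; try exact: L2s_M.
by congr intT; apply/funext => p; rewrite mulrBl.
Qed.

Lemma ip_ge0 f : 0 <= ip f f.
Proof. by apply: Rintegral_ge0 => p _; rewrite -expr2 sqr_ge0. Qed.

Lemma nrm_ge0 f : 0 <= nrm f.
Proof. exact: sqrtr_ge0. Qed.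

Lemma nrm_sqr f : nrm f ^+ 2 = ip f f.
Proof. by rewrite sqr_sqrtr// ip_ge0. Qed.

Lemma ip_sqrB f g t : L2s f -> L2s g ->
  ip (fun p => f p - t * g p) (fun p => f p - t * g p) =
  ip f f - 2 * t * ip f g + t ^+ 2 * ip g g.
Proof.
move=> lf lg; have lt := L2s_Z t lg; have ld := L2s_B lf lt.
rewrite ipBl// ipZl// ![ip _ (fun p => _ - _)]ipC !ipBl// !ipZl// (ipC g f); ring.
Qed.

Lemma cauchy_ip f g : L2s f -> L2s g -> `|ip f g| <= nrm f * nrm g.
Proof.
move=> lf lg.
have key t : 0 <= nrm f ^+ 2 - 2 * t * ip f g + t ^+ 2 * nrm g ^+ 2.
  by rewrite !nrm_sqr -ip_sqrB// ip_ge0.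
have [a0 b0] := (nrm_ge0 f, nrm_ge0 g).
rewrite -(@ler_pXn2r _ 2) ?nnegrE ?mulr_ge0// real_normK ?num_real// exprMn.
(* When [g] has norm 0 the quadratic is affine in t, and a nonzero slope would make it negative at
   the value of t chosen below. *)
have [g0|g0] := eqVneq (nrm g) 0.
  rewrite g0 expr0n mulr0.
  have [->|i0] := eqVneq (ip f g) 0; first by rewrite expr0n.
  have := key ((nrm f ^+ 2 + 1) / (2 * ip f g)).
  rewrite g0 expr0n mulr0 addr0.
  have -> : 2 * ((nrm f ^+ 2 + 1) / (2 * ip f g)) * ip f g = nrm f ^+ 2 + 1 by field.
  lra.
have gp : 0 < nrm g ^+ 2 by rewrite exprn_gt0// lt_def g0.
have := mulr_ge0 (key (ip f g / nrm g ^+ 2)) (ltW gp).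
have -> : (nrm f ^+ 2 - 2 * (ip f g / nrm g ^+ 2) * ip f g +
   (ip f g / nrm g ^+ 2) ^+ 2 * nrm g ^+ 2) * nrm g ^+ 2 =
   nrm f ^+ 2 * nrm g ^+ 2 - ip f g ^+ 2 by field.
lra.
Qed.

Lemma nrmB f g : L2s f -> L2s g -> nrm (fun p => f p - g p) <= nrm f + nrm g.
Proof.
move=> lf lg; rewrite -(@ler_pXn2r _ 2) ?nnegrE ?addr_ge0 ?nrm_ge0// nrm_sqr.
have -> : (fun p => f p - g p) = (fun p => f p - 1 * g p).
  by apply/funext => p; rewrite mul1r.
rewrite ip_sqrB// -!nrm_sqr.
have := cauchy_ip lf lg; rewrite ler_norml => /andP[+ _].
have := nrm_ge0 f; have := nrm_ge0 g; nra.
Qed.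

Lemma nrmN f : nrm (fun p => - f p) = nrm f.
Proof. by rewrite /nrm /ip; congr (Num.sqrt (intT _ _)); apply/funext => p; rewrite mulrNN. Qed.

Lemma nrmD f g : L2s f -> L2s g -> nrm (fun p => f p + g p) <= nrm f + nrm g.
Proof.
move=> lf lg; rewrite -(nrmN g).
have -> : (fun p => f p + g p) = (fun p => f p - (- g p)).
  by apply/funext => p; rewrite opprK.
apply: nrmB => //; rewrite (_ : (fun p => - g p) = (fun p => (-1) * g p)); first exact: L2s_Z.
by apply/funext => p; rewrite mulN1r.
Qed.

Lemma nrmZ c f : L2s f -> nrm (fun p => c * f p) = `|c| * nrm f.
Proof.
move=> lf; rewrite /nrm -sqrtr_sqr -sqrtrM ?sqr_ge0//; congr Num.sqrt.
by rewrite ipZl ?(ipC _ (fun p => c * f p)) ?ipZl//; [ring|exact: L2s_Z].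
Qed.

Lemma nrmBC f g : nrm (fun p => f p - g p) = nrm (fun p => g p - f p).
Proof. by rewrite -nrmN; congr nrm; apply/funext => p; rewrite opprB. Qed.

Lemma nrmM_bounded f b (C : R) : L2s f -> measurable_fun setT b -> 0 <= C ->
  (forall p, cell L p -> `|b p| <= C) ->
  L2s (fun p => f p * b p) /\ nrm (fun p => f p * b p) <= C * nrm f.
Proof.
move=> lf mb C0 bC.
have H p : cell L p -> (f p * b p) ^+ 2 <= C ^+ 2 * f p ^+ 2.
  move=> pc; rewrite exprMn mulrC ler_wpM2r ?sqr_ge0//.
  by rewrite -[leLHS]real_normK ?num_real// lerXn2r ?nnegrE ?bC.
have lfb : L2s (fun p => f p * b p).
  split; first by apply: measurable_funM => //; case: lf.
  apply: (@integrable_dominated _ (fun p => C ^+ 2 * f p ^+ 2)).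
  - by apply: measurable_funX; apply: measurable_funM => //; case: lf.
  - by move=> p pc; rewrite ger0_norm ?sqr_ge0// H.
  - by apply: integrableTZ; case: lf.
split=> //; rewrite -(@ler_pXn2r _ 2) ?nnegrE ?mulr_ge0 ?nrm_ge0//.
rewrite exprMn !nrm_sqr /ip -intTZ; last by have := L2s_M lf lf.
apply: le_Rintegral.
- exact: measurable_cell.
- by have := L2s_M lfb lfb.
- by apply: integrableTZ; have := L2s_M lf lf.
- by move=> p pc; rewrite -!expr2 H.
Qed.

Lemma nrm_integral f : L2s f ->
  (\int[mu2]_(p in cell L) (f p ^+ 2)%:E = (nrm f ^+ 2)%:E)%E.
Proof.
move=> [mf f2]; have /fineK <- := integrable_fin_num (measurable_cell L) f2.
rewrite nrm_sqr; congr (_%:E); by rewrite /ip /intT /Rintegral; congr fine.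
Qed.

Lemma integral_abs_le f : L2s f ->
  (\int[mu2]_(p in cell L) `|f p|%:E <= (nrm f * L)%:E)%E.
Proof.
move=> lf.
have la : L2s (fun p => `|f p|).
  split; first by apply: measurableT_comp => //; case: lf.
  case: lf => _; congr (integrable _ _ _); apply/funext => p /=.
  by rewrite real_normK ?num_real.
have ia := L2s_integrable la.
have /fineK <- := integrable_fin_num (measurable_cell L) ia.
have E : nrm (fun p => `|f p|) = nrm f.
  rewrite /nrm /ip; congr (Num.sqrt (intT _ _)); apply/funext => p.
  by rewrite -!expr2 real_normK ?num_real.
have n1 : nrm (fun=> 1) = L.
  rewrite /nrm /ip /intT (_ : (fun p => _) = (fun=> 1)); last by apply/funext => p; rewrite mulr1.
  rewrite Rintegral_cst; last exact: measurable_cell.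
  have -> : fine (leb2 (cell L)) = L ^+ 2 by have /(congr1 fine) := mu2_cell (ltW L0).
  by rewrite mul1r sqrtr_sqr gtr0_norm.
rewrite lee_fin -E -[X in _ <= _ * X]n1.
apply: le_trans (cauchy_ip la L2s_1); apply: le_trans (ler_norm _).
rewrite /ip /intT /Rintegral; under [in leRHS]eq_integral do rewrite mulr1.
exact: lexx.
Qed.

(** Partial sums of the indices N_i make the choice monotone while staying above each N_j. *)
Lemma cauchy_subseq (f : nat -> R * R -> R) :
  (forall e, 0 < e -> exists N : nat, forall m n, (N <= m)%N -> (N <= n)%N ->
     nrm (fun p => f m p - f n p) <= e) ->
  exists phi : nat -> nat, forall j m n, (phi j <= m)%N -> (phi j <= n)%N ->
     nrm (fun p => f m p - f n p) <= 2^-1 ^+ j /\ (phi j <= phi j.+1)%N.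
Proof.
move=> cf.
have /choice[N HN] : forall j : nat, exists N : nat, forall m n, (N <= m)%N -> (N <= n)%N ->
     nrm (fun p => f m p - f n p) <= 2^-1 ^+ j.
  by move=> j; apply: cf; rewrite exprn_gt0.
exists (fun j => \sum_(i < j.+1) N i)%N => j m n jm jn; split; last first.
  by rewrite [leqRHS]big_ord_recr leq_addr.
by apply: HN; [apply: leq_trans jm|apply: leq_trans jn]; rewrite big_ord_recr leq_addl.
Qed.

(** Elements of L^2 are functions defined at every point, so the limit has to be periodic everywhere
    and not only almost everywhere. *)
Lemma riesz_fischer (f : nat -> R * R -> R) : (forall n, L2s (f n)) ->
  (forall e, 0 < e -> exists N : nat, forall m n, (N <= m)%N -> (N <= n)%N ->
     nrm (fun p => f m p - f n p) <= e) ->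
  exists g, [/\ L2s g, (forall n, periodic L (f n)) -> periodic L g &
    forall e, 0 < e -> exists N : nat, forall n, (N <= n)%N ->
      nrm (fun p => g p - f n p) <= e].
Proof.
move=> lf cf; have [phi Hphi] := cauchy_subseq cf.
have phiS j : (phi j <= phi j.+1)%N by have [] := Hphi j _ _ (leqnn _) (leqnn _).
have phi_mono i j : (i <= j)%N -> (phi i <= phi j)%N.
  by move=> /subnK <-; elim: (j - i)%N => // n IH; exact: leq_trans (phiS _).
pose G j := f (phi j).
have lG j : L2s (G j) by exact: lf.
pose d j p : R := G j.+1 p - G j p.
have ld j : L2s (d j) by exact: L2s_B.
have mE (k : R * R -> R) : measurable_fun setT k -> measurable_fun (cell L) (EFin \o k).
  by move=> mk; apply/measurable_EFinP; apply: measurable_funS mk.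
have mabs j : measurable_fun (cell L) (fun p => `|d j p|%:E).
  by apply: (mE (fun p => `|d j p|)); apply: measurableT_comp => //; case: (ld j).
(* The increments of the subsequence are summable in L^1, hence the telescoping series converges
   absolutely almost everywhere. *)
pose D p : \bar R := (\sum_(0 <= j <oo) `|d j p|%:E)%E.
have D0 p : (0 <= D p)%E by apply: nneseries_ge0 => j _ _; rewrite lee_fin.
have mD : measurable_fun (cell L) D.
  by apply: ge0_emeasurable_sum => // j p _ _; rewrite lee_fin.
have iD : mu2.-integrable (cell L) D.
  apply/integrableP; split=> //.
  under eq_integral do rewrite gee0_abs//.
  rewrite integral_nneseries//; last exact: measurable_cell.
  apply: (@le_lt_trans _ _ (\sum_(0 <= j <oo) (L * 2^-1 ^+ j)%:E)%E).
    apply: lee_nneseries => [j *|j *].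
      by apply: integral_ge0 => p _; rewrite lee_fin.
    apply: le_trans (integral_abs_le (ld j)) _; rewrite lee_fin mulrC ler_wpM2l ?(ltW L0)//.
    by have [] := Hphi j (phi j.+1) (phi j) (phiS j) (leqnn _).
  have cg : geometric L (2^-1 : R) = (fun j => L * 2^-1 ^+ j) by [].
  have hg : cvgn (series (geometric L (2^-1 : R))).
    by apply: is_cvg_geometric_series; rewrite ger0_norm ?invr_ge0// invf_lt1 ?ltr1n.
  have := EFin_lim hg; rewrite (_ : EFin \o _ = fun n => (\sum_(0 <= j < n) (L * 2^-1 ^+ j)%:E)%E).
    by move=> ->; rewrite ltry.
  by apply/funext => n /=; rewrite /series/= -sumEFin.
(* The upper limit exists at every point, is measurable and inherits periodicity; almost everywhere
   on the cell it is the limit. *)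
pose g p : R := fine (limn_esup (fun j => (G j p)%:E)).
have mg : measurable_fun setT g.
  apply: measurableT_comp; first exact: (fine_measurable measurableT).
  apply: measurable_fun_limn_esup => j; apply/measurable_EFinP; by case: (lG j).
have Gg : {ae mu2, forall p, cell L p -> G j p @[j --> \oo] --> g p}.
  have := integrable_ae (measurable_cell L) iD.
  apply: filterS => p /= H pc; have Dfin := H pc.
  have cd : cvgn (series (fun j => d j p)).
    apply: normed_cvg; apply: nnseries_is_cvg => [j|]; first exact: normr_ge0.
    by have := Dfin; rewrite ge0_fin_numE.
  have cG : cvgn (fun j => G j p).
    rewrite (_ : (fun j => G j p) = (fun j => G 0%N p + series (fun j => d j p) j)).
      by apply: is_cvgD => //; exact: is_cvg_cst.
    by apply/funext => j; exact: (eq_sum_telescope (fun j => G j p) j).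
  have : (G j p)%:E @[j --> \oo] --> (limn (fun j => G j p))%:E.
    by apply: cvg_EFin; [exact: nearW|exact: cG].
  move=> /cvg_limn_einf_sup[_ E]; rewrite /g E /=; exact: cG.
(* Fatou's lemma carries a bound for the distances along the subsequence over to the limit. *)
have bound e n : 0 <= e -> (forall j, (n <= j)%N -> nrm (fun p => G j p - f (phi n) p) <= e) ->
    (\int[mu2]_(p in cell L) ((g p - f (phi n) p) ^+ 2)%:E <= (e ^+ 2)%:E)%E.
  move=> e0 He.
  pose h j p : \bar R := ((G (n + j)%N p - f (phi n) p) ^+ 2)%:E.
  have mh j : measurable_fun (cell L) (h j).
    apply: (mE (fun p => (G (n + j)%N p - f (phi n) p) ^+ 2)).
    by apply: measurable_funX; apply: measurable_funB; [case: (lG (n + j)%N)|case: (lf (phi n))].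
  apply: (@le_trans _ _ (\int[mu2]_(p in cell L) limn_einf (h^~ p))%E).
    apply: ae_ge0_le_integral.
    - exact: measurable_cell.
    - by move=> p _; rewrite lee_fin sqr_ge0.
    - apply: (mE (fun p => (g p - f (phi n) p) ^+ 2)).
      by apply: measurable_funX; apply: measurable_funB => //; case: (lf (phi n)).
    - move=> p _; rewrite limn_einf_lim; apply: lime_ge; first exact: is_cvg_einfs.
      by apply: nearW => j; apply: le_ereal_inf_tmp => _ [i _ <-]; rewrite lee_fin sqr_ge0.
    - apply: (emeasurable_fun_cvg (fun j p => einfs (h^~ p) j)) => [j|p _].
        exact: measurable_fun_einfs.
      by rewrite limn_einf_lim; exact: is_cvg_einfs.
    - apply: (@filterS _ _ (ae_filter_ringOfSetsType mu2) _ _ _ Gg) => p H pc.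
      have : h j p @[j --> \oo] --> ((g p - f (phi n) p) ^+ 2)%:E.
        apply: cvg_EFin; first by apply: nearW.
        rewrite /h /comp /=; under eq_fun do rewrite expr2; rewrite expr2.
        have c1 : G (n + j)%N p - f (phi n) p @[j --> \oo] --> g p - f (phi n) p.
          apply: cvgB; last exact: cvg_cst.
          by have := H pc; rewrite -(cvg_shiftn n); under eq_fun do rewrite addnC.
        exact: cvgM.
      by move=> /cvg_limn_einf_sup[-> _].
  apply: le_trans (fatou mu2 (measurable_cell L) mh _) _.
    by move=> j p _; rewrite lee_fin sqr_ge0.
  rewrite limn_einf_lim; apply: lime_le; first exact: is_cvg_einfs.
  apply: nearW => j; apply: (@le_trans _ _ (\int[mu2]_(p in cell L) h j p)%E).
    by apply: ereal_inf_lbound; exists j => //=.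
  rewrite (nrm_integral (f := fun p => G (n + j)%N p - f (phi n) p)); last exact: L2s_B.
  by rewrite lee_fin lerXn2r ?nnegrE ?nrm_ge0 ?He// leq_addr.
have half j : nrm (fun p => g p - f (phi j) p) <= 2^-1 ^+ j /\ L2s (fun p => g p - f (phi j) p).
  have e0 : 0 <= 2^-1 ^+ j :> R by rewrite exprn_ge0.
  have H : (\int[mu2]_(p in cell L) ((g p - f (phi j) p) ^+ 2)%:E <= ((2^-1 ^+ j) ^+ 2)%:E)%E.
    apply: bound => // i ji; have [] := Hphi j (phi i) (phi j) _ (leqnn _) => //; exact: phi_mono.
  have mgf : measurable_fun setT (fun p => g p - f (phi j) p).
    by apply: measurable_funB => //; case: (lf (phi j)).
  have lgf : L2s (fun p => g p - f (phi j) p).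
    split=> //; apply/integrableP; split.
      by apply: mE; exact: measurable_funX.
    under eq_integral do rewrite gee0_abs ?lee_fin ?sqr_ge0//.
    exact: le_lt_trans H (ltry _).
  split=> //; rewrite -(@ler_pXn2r _ 2) ?nnegrE ?nrm_ge0//.
  by rewrite -lee_fin -nrm_integral.
have lg : L2s g.
  rewrite (_ : g = fun p => (g p - f (phi 0%N) p) + f (phi 0%N) p).
    by apply: L2s_D; [exact: (half 0%N).2|exact: lf].
  by apply/funext => p; rewrite subrK.
exists g; split=> //.
- move=> pf p; rewrite /g; split; congr (fine (limn_esup _)); apply/funext => j; congr EFin.
    by have [] := pf (phi j) p.
  by have [] := pf (phi j) p.
- move=> e e0.
  have : 2^-1 ^+ j @[j --> \oo] --> (0 : R).
    by apply: cvg_expr; rewrite ger0_norm ?invr_ge0// invf_lt1 ?ltr1n.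
  move=> /cvgrPdist_le /(_ (e / 2)) /(_ (divr_gt0 e0 (ltr0n _ 2))) [j _ /(_ j (leqnn j))].
  rewrite /= sub0r normrN ger0_norm ?exprn_ge0// => je.
  exists (phi j) => n jn.
  rewrite (_ : (fun p => g p - f n p) = (fun p => (g p - f (phi j) p) + (f (phi j) p - f n p))).
    apply: le_trans (nrmD (half j).2 (L2s_B (lf _) (lf _))) _.
    by have := (half j).1; have [] := Hphi j (phi j) n (leqnn _) jn; lra.
  by apply/funext => p; ring.
Qed.

End square_integrable.

(** * Completeness of the trigonometric system *)

Section step_limit.
Context {R : realType}.

Lemma bernoulli (x : R) (n : nat) : 0 <= x -> x <= 1 -> 1 - n%:R * x <= (1 - x) ^+ n.
Proof.
move=> x0 x1; elim: n => [|n IH]; first by rewrite mul0r subr0 expr0.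
rewrite exprS -natr1; have n0 : 0 <= n%:R :> R by [].
have p0 : 0 <= (1 - x) ^+ n by rewrite exprn_ge0 ?subr_ge0.
nra.
Qed.

Lemma bernoulli_pos (x : R) (n : nat) : 0 <= x -> 1 + n%:R * x <= (1 + x) ^+ n.
Proof.
move=> x0; elim: n => [|n IH]; first by rewrite mul0r addr0 expr0.
rewrite exprS -natr1; have n0 : 0 <= n%:R :> R by [].
have p0 : 0 <= (1 + x) ^+ n by rewrite exprn_ge0 ?addr_ge0.
nra.
Qed.

Lemma bernoulli_inv (x : R) (n : nat) : 0 <= x -> x <= 1 ->
  (1 - x) ^+ n * (1 + n%:R * x) <= 1.
Proof.
move=> x0 x1; apply: (@le_trans _ _ ((1 - x) ^+ n * (1 + x) ^+ n)).
  by rewrite ler_wpM2l ?exprn_ge0 ?subr_ge0// bernoulli_pos.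
rewrite -exprMn exprn_ile1//; nra.
Qed.

(** With x = s^2, one factor s^n keeps n s^n bounded by Bernoulli's inequality and the other tends
    to 0. *)
Lemma cvg_mulrn_expr (x : R) : 0 <= x -> x < 1 -> n%:R * x ^+ n @[n --> \oo] --> (0 : R).
Proof.
move=> x0 x1; pose s := Num.sqrt x.
have s0 : 0 <= s := sqrtr_ge0 x.
have s1 : s < 1 by rewrite -sqrtr1 ltr_sqrt.
have sx : x = s ^+ 2 by rewrite sqr_sqrtr.
have B n : n%:R * s ^+ n * (1 - s) <= 1.
  have [s00|sp] := eqVneq s 0.
    case: n => [|n]; first by rewrite !mul0r.
    by rewrite s00 expr0n mulr0 mul0r.
  have sgt : 0 < s by rewrite lt_def sp.
  have h0 : 0 <= s^-1 - 1 by rewrite subr_ge0 invf_ge1// ltW.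
  have := bernoulli_pos n h0; rewrite [1 + (s^-1 - 1)]addrC subrK exprVn => H.
  have sn : 0 < s ^+ n by rewrite exprn_gt0.
  have : (1 + n%:R * (s^-1 - 1)) * s ^+ n <= 1 by rewrite -ler_pdivlMr// div1r.
  have E : n%:R * (s^-1 - 1) * s ^+ n = n%:R * s ^+ n * (1 - s) / s by field.
  rewrite mulrDl mul1r E.
  have : n%:R * s ^+ n * (1 - s) <= n%:R * s ^+ n * (1 - s) / s.
    rewrite ler_peMr// ?mulr_ge0 ?subr_ge0 ?(ltW s1)// ?exprn_ge0//.
    by rewrite invf_ge1// ltW.
  lra.
have s1' : 0 < 1 - s by rewrite subr_gt0.
apply: (@squeeze_cvgr _ _ _ _ (fun=> 0) (fun n => (1 - s)^-1 * s ^+ n)).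
- apply: nearW => n; rewrite mulr_ge0 ?exprn_ge0//=.
  rewrite sx exprAC expr2 mulrA ler_wpM2r ?exprn_ge0//.
  by rewrite -div1r ler_pdivlMr.
- exact: cvg_cst.
- rewrite -[X in _ --> X](mulr0 (1 - s)^-1); apply: cvgM; first exact: cvg_cst.
  by apply: cvg_expr; rewrite ger0_norm.
Qed.

(** The polynomials of the elementary proof of the Stone-Weierstrass theorem: on [0, 1] they tend to
    the indicator function of [0, 1/2). *)
Definition step (N : nat) (s : R) : R := (1 - s ^+ N) ^+ (N * 2 ^ N).

Lemma step_itv N s : 0 <= s -> s <= 1 -> 0 <= step N s <= 1.
Proof.
move=> s0 s1; rewrite /step exprn_ge0 ?subr_ge0 ?exprn_ile1//=.
  by rewrite subr_ge0 exprn_ile1.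
by rewrite gerBl exprn_ge0.
Qed.

(* The exponent N 2^N, rather than 2^N, makes the limit vanish at s = 1/2 as well. *)
Lemma cvg_step (s : R) : 0 <= s -> s <= 1 -> step N s @[N --> \oo] --> ((s < 2^-1)%R%:R : R).
Proof.
move=> s0 s1; have sN N : 0 <= s ^+ N <= 1 by rewrite exprn_ge0// exprn_ile1.
have E N : (N * 2 ^ N)%:R * s ^+ N = N%:R * (2 * s) ^+ N :> R.
  by rewrite natrM natrX exprMn mulrA.
have [sh|hs] := ltP s 2^-1.
  have c0 : 1 - N%:R * (2 * s) ^+ N @[N --> \oo] --> (1 - 0 : R).
    apply: cvgB; first exact: cvg_cst.
    apply: cvg_mulrn_expr; first by rewrite mulr_ge0.
    by move: sh; rewrite -ltr_pdivlMl// mulr1.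
  rewrite subr0 in c0; apply: squeeze_cvgr c0 (cvg_cst _).
  apply: nearW => N; have /andP[a b] := sN N.
  have /andP[_ ->] := step_itv N s0 s1.
  by rewrite andbT -E bernoulli.
apply: (@squeeze_cvgr _ _ _ _ (fun=> 0) (fun N => (N.+1%:R)^-1)).
- apply: nearW => N; have /andP[a b] := sN N.
  have /andP[-> _] := step_itv N s0 s1; rewrite /=.
  have := bernoulli_inv (N * 2 ^ N) a b; rewrite E.
  have h : N.+1%:R <= 1 + N%:R * (2 * s) ^+ N.
    rewrite -natr1 addrC lerD2l ler_peMr// exprn_ege1//.
    by rewrite -ler_pdivrMl// mulr1.
  move=> H; rewrite -[leRHS]div1r ler_pdivlMr//; apply: le_trans H.
  by rewrite ler_wpM2l// exprn_ge0 ?subr_ge0.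
- exact: cvg_cst.
- exact: cvg_harmonic.
Qed.

End step_limit.

(** * Completeness in one variable *)

Section completeness1.
Context {R : realType}.
Notation mu := (@lebesgue_measure R).
Variable L : R.
Hypothesis L0 : 0 < L.
Implicit Types (f a b q : R -> R).

Definition tr1 (n : int) (th x : R) : R := cos (kap L * n%:~R * x + th).

Lemma continuous_tr1 n th : continuous (tr1 n th).
Proof.
move=> x; apply: (@continuous_comp _ _ _ (fun x => kap L * n%:~R * x + th) cos).
  by apply: cvgD; [apply: cvgM; [exact: cvg_cst|exact: cvg_id]|exact: cvg_cst].
exact: continuous_cos.
Qed.

Lemma tr1M n th m th' x : tr1 n th x * tr1 m th' x =
  2^-1 * tr1 (n + m) (th + th') x + 2^-1 * tr1 (n - m) (th - th') x.
Proof.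
rewrite /tr1 intrD intrB.
have -> : kap L * (n%:~R + m%:~R) * x + (th + th') =
  (kap L * n%:~R * x + th) + (kap L * m%:~R * x + th') by ring.
have -> : kap L * (n%:~R - m%:~R) * x + (th - th') =
  (kap L * n%:~R * x + th) - (kap L * m%:~R * x + th') by ring.
by move: (kap L * n%:~R * x + th) (kap L * m%:~R * x + th') => u v; rewrite cosD cosB; field.
Qed.

Variable f : R -> R.
Hypothesis fi : mu.-integrable `[0, L] (EFin \o f).

Lemma integrable_fM a : continuous a -> mu.-integrable `[0, L] (EFin \o (fun x => f x * a x)).
Proof.
move=> ca; have /compact_bounded[C [_ HC]] : compact (a @` `[0, L]).
  apply: continuous_compact; last exact: segment_compact.
  exact: continuous_subspaceT.
have [mf _] := integrableP _ _ _ fi.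
apply: (@le_integrable _ _ _ mu `[0, L] (measurable_itv _) _ (fun x => (`|C + 1| * f x)%:E)).
- apply/measurable_EFinP; apply: measurable_funM; first exact/measurable_EFinP.
  by apply: measurable_funTS; exact: continuous_measurable_fun.
- move=> x xL; rewrite /= lee_fin !normrM normr_id mulrC ler_wpM2r//.
  apply: le_trans (ler_norm _); apply: HC; first by rewrite ltrDl.
  by exists x.
- exact: (@integrableZl _ _ _ mu `[0, L] (measurable_itv _) `|C + 1| _ fi).
Qed.

(** The class of such [a] is linear and stable under multiplication by trigonometric functions,
    hence by every polynomial in them. *)
Definition orth a : Prop := continuous a /\
  forall n th, \int[mu]_(x in `[0, L]) (f x * a x * tr1 n th x) = 0.

Lemma orth_lin a b (c d : R) : orth a -> orth b -> orth (fun x => c * a x + d * b x).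
Proof.
move=> [ca oa] [cb ob]; split.
  by move=> x; apply: cvgD; apply: cvgM; [exact: cvg_cst|exact: ca|exact: cvg_cst|exact: cb].
move=> n th.
have ia e : continuous e -> mu.-integrable `[0, L] (EFin \o (fun x => f x * e x * tr1 n th x)).
  move=> ce; rewrite (_ : (fun x => _) = (fun x => f x * (e x * tr1 n th x))).
    by apply: integrable_fM => x; apply: cvgM; [exact: ce|exact: continuous_tr1].
  by apply/funext => x; rewrite mulrA.
have E : (fun x => f x * (c * a x + d * b x) * tr1 n th x) =
   (fun x => c * (f x * a x * tr1 n th x) + d * (f x * b x * tr1 n th x)).
  by apply/funext => x; ring.
rewrite E RintegralD//=.
- by rewrite !RintegralZl ?oa ?ob ?mulr0 ?addr0//; exact: ia.
- exact: (@integrableZl _ _ _ mu `[0, L] (measurable_itv _) c _ (ia _ ca)).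
- exact: (@integrableZl _ _ _ mu `[0, L] (measurable_itv _) d _ (ia _ cb)).
Qed.

Lemma orth_tr a m th' : orth a -> orth (fun x => a x * tr1 m th' x).
Proof.
move=> oa; split.
  by move=> x; apply: cvgM; [exact: oa.1|exact: continuous_tr1].
move=> n th.
have E : (fun x => f x * (a x * tr1 m th' x) * tr1 n th x) =
  (fun x => 2^-1 * (f x * a x * tr1 (m + n) (th' + th) x) +
            2^-1 * (f x * a x * tr1 (m - n) (th' - th) x)).
  by apply/funext => x; rewrite -mulrA -[X in _ * X]mulrA tr1M; ring.
have ia k t : mu.-integrable `[0, L] (EFin \o (fun x => f x * a x * tr1 k t x)).
  rewrite (_ : (fun x => _) = (fun x => f x * (a x * tr1 k t x))).
    by apply: integrable_fM => x; apply: cvgM; [exact: oa.1|exact: continuous_tr1].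
  by apply/funext => x; rewrite mulrA.
rewrite E RintegralD//=; try exact: (@integrableZl _ _ _ mu `[0, L] (measurable_itv _) _ _ (ia _ _)).
by rewrite !RintegralZl// !oa.2 !mulr0 addr0.
Qed.

Definition orth_mul q : Prop := forall a, orth a -> orth (fun x => a x * q x).

Lemma orth_mulX q n : orth_mul q -> orth_mul (fun x => q x ^+ n).
Proof.
move=> oq; elim: n => [|n IH] a oa.
  by rewrite (_ : (fun x => _) = a)//; apply/funext => x; rewrite expr0 mulr1.
rewrite (_ : (fun x => _) = (fun x => (a x * q x) * q x ^+ n)); first exact/IH/oq.
by apply/funext => x; rewrite exprS mulrA.
Qed.

Lemma orth_mul_affine q (c d : R) : orth_mul q -> orth_mul (fun x => c + d * q x).
Proof.
move=> oq a oa; rewrite (_ : (fun x => _) = (fun x => c * a x + d * (a x * q x))).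
  by apply: orth_lin => //; exact: oq.
by apply/funext => x; ring.
Qed.

Hypothesis f0 : forall n th, \int[mu]_(x in `[0, L]) (f x * tr1 n th x) = 0.

Lemma orth1 : orth (fun=> 1).
Proof.
split; first by move=> x; exact: cvg_cst.
by move=> n th; rewrite -[RHS](f0 n th); apply: eq_Rintegral => x _; rewrite mulr1.
Qed.

(** A trigonometric polynomial of degree one in y with values in [0, 1] that is below 1/2 exactly on
    the arc 0 < y < x. Applying [step N] to it gives trigonometric polynomials that tend to the
    indicator function of the arc. *)
Definition arc (x y : R) : R := 2^-1 + cos (kap L * x / 2) / 4 - 4^-1 * tr1 1 (- (kap L * x / 2)) y.

Lemma arcE x y : arc x y = 2^-1 - sin (pi * y / L) * sin (pi * (x - y) / L) / 2.
Proof.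
rewrite /arc /tr1.
have -> : kap L * 1%:~R * y - kap L * x / 2 = pi * y / L - pi * (x - y) / L.
  by rewrite /kap; field; exact: lt0r_neq0.
have -> : kap L * x / 2 = pi * y / L + pi * (x - y) / L.
  by rewrite /kap; field; exact: lt0r_neq0.
by rewrite cosB cosD; field.
Qed.

Lemma arc_itv x y : 0 <= arc x y <= 1.
Proof.
rewrite arcE; have := sin_max (pi * y / L); have := sin_max (pi * (x - y) / L).
rewrite !ler_norml => /andP[? ?] /andP[? ?]; apply/andP; split; nra.
Qed.

Lemma arc_lt x y : 0 <= x <= L -> 0 <= y <= L -> (arc x y < 2^-1) = (0 < y < x).
Proof.
move=> /andP[x0 xL] /andP[y0 yL].
have pL z : 0 <= z -> 0 <= pi * z / L by move=> z0; rewrite divr_ge0 ?(ltW L0)// mulr_ge0 ?pi_ge0.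
have pL1 z : z <= L -> pi * z / L <= pi.
  by move=> zL; rewrite ler_pdivrMr// ler_wpM2l ?pi_ge0.
have pL2 z : 0 < z -> 0 < pi * z / L by move=> z0; rewrite divr_gt0 ?mulr_gt0 ?pi_gt0.
have pL3 z : z < L -> pi * z / L < pi.
  by move=> zL; rewrite ltr_pdivrMr// ltr_pM2l ?pi_gt0.
have sy : 0 <= sin (pi * y / L) by rewrite sin_ge0_pi// pL ?pL1.
rewrite arcE.
apply/idP/andP => [H|[y0' yx]].
  have H' : 0 < sin (pi * y / L) * sin (pi * (x - y) / L) by lra.
  have sy' : 0 < sin (pi * y / L).
    by rewrite lt_def sy andbT; apply: contraTneq H' => ->; rewrite mul0r ltxx.
  split.
    rewrite lt_def y0 andbT; apply: contraTneq sy' => ->.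
    by rewrite mulr0 mul0r sin0 ltxx.
  rewrite ltNge; apply: contraTN H' => xy; rewrite -leNgt.
  have -> : pi * (x - y) / L = - (pi * (y - x) / L) by field; exact: lt0r_neq0.
  rewrite sinN mulrN oppr_le0 mulr_ge0// sin_ge0_pi//.
  by rewrite pL ?subr_ge0// pL1//; lra.
have h1 : 0 < sin (pi * y / L) by rewrite sin_gt0_pi// pL2// pL3//; lra.
have h2 : 0 < sin (pi * (x - y) / L) by rewrite sin_gt0_pi// pL2 ?pL3//; lra.
have := mulr_gt0 h1 h2; lra.
Qed.

Lemma integral_step x N : \int[mu]_(y in `[0, L]) (f y * step N (arc x y)) = 0.
Proof.
have oa : orth_mul (fun y => step N (arc x y)).
  have o1 : orth_mul (tr1 1 (- (kap L * x / 2))) by move=> a; exact: orth_tr.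
  have o2 : orth_mul (arc x).
    have := orth_mul_affine (2^-1 + cos (kap L * x / 2) / 4) (- 4^-1) o1.
    by rewrite (_ : (fun x => _) = arc x)//; apply/funext => y; rewrite /arc mulNr.
  have := orth_mulX (N * 2 ^ N) (orth_mul_affine 1 (- 1) (orth_mulX N o2)).
  rewrite (_ : (fun x => _) = (fun y => step N (arc x y)))//.
  by apply/funext => y; rewrite /step mulN1r.
have [_ /(_ 0 0) E] := oa _ orth1; rewrite -[RHS]E.
apply: eq_Rintegral => y _.
by rewrite /tr1 mulr0 mul0r add0r cos0 mulr1 mul1r.
Qed.

(** The functions [step N (arc x y)] are bounded by 1, so dominated convergence turns orthogonality
    into a vanishing integral over the arc. *)
Lemma integral_oo x : 0 <= x <= L -> \int[mu]_(y in `]0, x[) f y = 0.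
Proof.
move=> xL; have /andP[x0 xL'] := xL.
have [mf _] := integrableP _ _ _ fi.
have carc : continuous (arc x).
  move=> y; apply: cvgB; first exact: cvg_cst.
  by apply: cvgM; [exact: cvg_cst|exact: continuous_tr1].
have mstep N : measurable_fun `[0, L] (fun y => step N (arc x y)).
  apply: measurable_funTS; apply: measurable_funX; apply: measurable_funB => //.
  by apply: measurable_funX; exact: continuous_measurable_fun.
have H1 N : measurable_fun `[0, L] (fun y => (f y * step N (arc x y))%:E).
  by apply/measurable_EFinP; apply: measurable_funM => //; exact/measurable_EFinP.
have H3 y : (f y * step N (arc x y))%:E @[N --> \oo] --> (f y * (arc x y < 2^-1)%R%:R)%:E.
  apply: cvg_EFin; first exact: nearW.
  apply: cvgM; first exact: cvg_cst.
  by have /andP[? ?] := arc_itv x y; exact: cvg_step.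
have H2 : measurable_fun `[0, L] (fun y => (f y * (arc x y < 2^-1)%R%:R)%:E).
  by apply: (emeasurable_fun_cvg (fun N y => (f y * step N (arc x y))%:E)).
have H4 : mu.-integrable `[0, L] (fun y => `|f y|%:E).
  by have := integrable_abse fi.
have H5 : {ae mu, forall y N, `[0, L]%classic y -> (`|(f y * step N (arc x y))%:E| <= `|f y|%:E)%E}.
  apply: aeW => y N _; rewrite lee_fin normrM ler_piMr//.
  have /andP[u0 u1] := arc_itv x y; have /andP[v0 v1] := step_itv N u0 u1.
  by rewrite ger0_norm.
have H6 : {ae mu, forall y, `[0, L]%classic y ->
    (f y * step N (arc x y))%:E @[N --> \oo] --> (f y * (arc x y < 2^-1)%R%:R)%:E}.
  by apply: aeW => y _; exact: H3.
have [H7 _ H8] := @dominated_convergence _ _ _ mu _ (measurable_itv _) _ _ _ H1 H2 H6 H4 H5.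
have H9 : (\int[mu]_(y in `[0%R, L]) (f y * (arc x y < 2^-1)%R%:R)%:E = 0)%E.
  move: H8; rewrite (_ : [sequence _]_n = fun=> 0%E).
    by move=> /cvg_lim <-//; rewrite lim_cst.
  apply/funext => N /=; have := integral_step x N; rewrite /Rintegral => E.
  have ii : mu.-integrable `[0, L] (EFin \o (fun y => f y * step N (arc x y))).
    apply: integrable_fM => y.
    apply: (@continuous_comp _ _ _ (arc x) (step N)); first exact: carc.
    have cX n (z : R) : {for z, continuous (fun s : R => s ^+ n)} by exact: exprn_continuous.
    apply: (@continuous_comp _ _ _ (fun s : R => 1 - s ^+ N) (fun s : R => s ^+ (N * 2 ^ N))).
      by apply: cvgB; [exact: cvg_cst|exact: cX].
    exact: cX.
  have := @integrable_fin_num _ _ _ mu _ (measurable_itv _) _ ii.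
  by move=> /fineK <-; rewrite E.
rewrite (_ : `]0, x[%classic = `[0, L] `&` `]0, x[); last first.
  apply/seteqP; split=> y /=; rewrite !in_itv/=; last by case.
  by move=> /andP[y0 yx]; split; apply/andP; split => //; lra.
rewrite Rintegral_mkcondr /Rintegral.
rewrite -[RHS]/(fine 0%E) -H9; congr fine; apply: eq_integral => y.
move=> /set_mem; rewrite /= in_itv/= => yL; rewrite (arc_lt xL yL) patchE.
case: ifPn => [/set_mem|]; rewrite ?notin_setE /= in_itv/=.
  by move=> ->; rewrite mulr1.
by move=> /negP/negbTE ->; rewrite mulr0.
Qed.

(** The integrals over all initial segments vanish, so the Lebesgue differentiation theorem gives
    the value 0 almost everywhere. *)
Lemma ae_zero1 : {ae mu, forall x, `[0, L]%classic x -> f x = 0}.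
Proof.
pose g := f \_ `[0, L].
have gi : mu.-integrable setT (EFin \o g).
  have [+ _] := integrable_mkcond (mu := mu) (EFin \o f) (measurable_itv `[0, L]).
  by move=> /(_ fi); rewrite restrict_EFin.
have sub (A : set R) : measurable A -> mu.-integrable A (EFin \o g).
  by move=> mA; apply: integrableS gi.
have G0 x : \int[mu]_(y in `]-oo, x]) g y = 0.
  have [x0|x0] := ltP x 0.
    rewrite /Rintegral integral0_eq// => y /=; rewrite in_itv/= => yx.
    rewrite /g patchE; case: ifPn => // /set_mem /=; rewrite in_itv/= => /andP[y0 _].
    by have := le_lt_trans (le_trans y0 yx) x0; rewrite ltxx.
  have xL : 0 <= Num.min x L <= L by rewrite le_min x0 (ltW L0) ge_min lexx orbT.
  have sub' (A : set R) : A `<=` `[0, L] -> measurable A -> mu.-integrable A (EFin \o f).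
    by move=> AL mA; apply: integrableS fi.
  have minL y : y <= Num.min x L -> y <= L by move=> h; rewrite (le_trans h)// ge_min lexx orbT.
  rewrite -Rintegral_mkcondr (_ : `]-oo, x] `&` `[0, L] = `[0, Num.min x L]%classic); last first.
    apply/seteqP; split => y /=; rewrite !in_itv/= le_min; last by move=> /and3P[-> -> ->].
    by move=> [-> /andP[-> ->]].
  rewrite -Rintegral_itv_obnd_cbnd -?Rintegral_itv_bndo_bndc ?integral_oo//.
  - by apply: sub' => // y /=; rewrite !in_itv/= => /andP[/ltW-> /ltW/minL ->].
  - by apply: sub' => // y /=; rewrite !in_itv/= => /andP[/ltW-> /minL ->].
have lg : locally_integrable setT g.
  split; [by have /integrableP[/measurable_EFinP] := gi|exact: openT|].
  move=> K _ cK; have /integrableP[_] := sub K (compact_measurable cK).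
  by [].
have H := FTC1Ny (fun y => sub _ (measurable_itv _)) lg.
apply: (@filterS _ _ (ae_filter_ringOfSetsType mu) _ _ _ H) => x [_]; rewrite (_ : (fun _ => _) = cst 0); last by apply/funext => y; exact: G0.
by rewrite derive1_cst /g => + xL; rewrite patchE mem_set.
Qed.

End completeness1.

(** * Completeness in two variables *)

Section completeness2.
Context {R : realType}.
Notation mu := (@lebesgue_measure R).
Notation mu2 := (mu \x mu)%E.
Notation T2 := (measurableTypeR R * measurableTypeR R)%type.
Variable L : R.
Hypothesis L0 : 0 < L.
Variable u : R * R -> R.
Hypothesis lu : L2s L u.
Hypothesis u0 : forall k th, ip L u (tri L k th) = 0.

Let K (p : R * R) : \bar R := ((EFin \o u) \_ (cell L)) p.

Let mK : @measurable_fun _ _ T2 _ setT K.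
Proof.
have [mu_ _] := lu; apply/(measurable_restrictT _ (measurable_cell L)).
by apply/measurable_EFinP; apply: measurable_funS mu_.
Qed.

Let iKb (b : R * R -> R) : continuous b ->
  mu2.-integrable setT (fun p => K p * (b p)%:E)%E.
Proof.
move=> cb.
have : mu2.-integrable (cell L) (EFin \o (fun p => u p * b p)).
  exact: (L2s_M lu (L2s_continuous L cb)).
have [+ _] := integrable_mkcond (mu := mu2) (EFin \o (fun p => u p * b p)) (measurable_cell L).
move=> H /H; congr (integrable _ _ _); apply/funext => p.
by rewrite /K !patchE; case: ifP => _ //; rewrite mul0e.
Qed.

Let F (m : int) (th x : R) : \bar R := (\int[mu]_y (K (x, y) * (tr1 L m th y)%:E))%E.

Let ctr1 m th : continuous (fun p : R * R => tr1 L m th p.2).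
Proof.
move=> p; apply: (@continuous_comp _ _ _ (fun p : R * R => p.2) (tr1 L m th)); first exact: cvg_snd.
exact: continuous_tr1.
Qed.

Let ctr0 m th : continuous (fun p : R * R => tr1 L m th p.1).
Proof.
move=> p; apply: (@continuous_comp _ _ _ (fun p : R * R => p.1) (tr1 L m th)); first exact: cvg_fst.
exact: continuous_tr1.
Qed.

Let iF m th : mu.-integrable setT (F m th).
Proof.
have := integrable_fubini_F (iKb (@ctr1 m th)).
by rewrite /fubini_F.
Qed.

Let K_out x y : ~ `[0, L]%classic x -> K (x, y) = 0%E.
Proof. by move=> xL; rewrite /K patchE memNset// => -[]. Qed.

Let K_in x y : `[0, L]%classic x -> `[0, L]%classic y -> K (x, y) = (u (x, y))%:E.
Proof. by move=> xL yL; rewrite /K patchE mem_set. Qed.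

(** By Fubini the coefficients in x of the partial transform [F m th] are coefficients of [u], since
    a product of one-variable modes is the half sum of two modes of the plane. [F m th] is finite
    only almost everywhere, whence the detour through [fine]. *)
Let F_ae0 m th : {ae mu, forall x, `[0, L]%classic x -> F m th x = 0%E}.
Proof.
pose f x := fine (F m th x).
have finF := integrable_ae measurableT (iF m th).
have mF : measurable_fun setT (F m th) by have /integrableP[] := iF m th.
have mf : measurable_fun setT f.
  by apply: measurableT_comp mF; exact: (fine_measurable measurableT).
have mfL : measurable_fun `[0, L] (EFin \o f).
  by apply/measurable_EFinP; apply: measurable_funS mf.
have iFL : mu.-integrable `[0, L] (F m th) by apply: integrableS (iF m th).
have fi : mu.-integrable `[0, L] (EFin \o f).
  apply: (@le_integrable _ _ _ mu _ (measurable_itv _) _ (F m th)) => // x _.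
  by rewrite /f /=; case: (F m th x) => //=; rewrite ?normr0 ?leey.
have fF : {ae mu, forall x, F m th x = (f x)%:E}.
  apply: (@filterS _ _ (ae_filter_ringOfSetsType mu) _ _ _ finF) => x /(_ I) H.
  by rewrite /f fineK.
have f0 n th' : \int[mu]_(x in `[0, L]) (f x * tr1 L n th' x) = 0.
  pose b (p : R * R) := tr1 L m th p.2 * tr1 L n th' p.1.
  have cb : continuous b by move=> p; apply: cvgM; [exact: ctr1|exact: ctr0].
  have ib := iKb cb.
  pose F' x : \bar R := (\int[mu]_y (K (x, y) * (b (x, y))%:E))%E.
  have iF' : mu.-integrable setT F' by have := integrable_fubini_F ib; rewrite /fubini_F.
  have F'0 : (\int[mu]_x F' x = 0)%E.
    have := integral12_prod_meas1 ib; rewrite /fubini_F -/(F' _) => ->.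
    have : intT L (fun p => u p * b p) = 0.
      have E : b = (fun p => 2^-1 * tri L (n, m) (th' + th) p + 2^-1 * tri L (n, - m) (th' - th) p).
        apply/funext => p; rewrite /b /tr1 /tri /phase /= intrN.
        have -> : kap L * (n%:~R * p.1 + m%:~R * p.2) + (th' + th) =
          (kap L * n%:~R * p.1 + th') + (kap L * m%:~R * p.2 + th) by ring.
        have -> : kap L * (n%:~R * p.1 + - m%:~R * p.2) + (th' - th) =
          (kap L * n%:~R * p.1 + th') - (kap L * m%:~R * p.2 + th) by ring.
        move: (kap L * n%:~R * p.1 + th') (kap L * m%:~R * p.2 + th) => v w.
        by rewrite cosD cosB; field.
      have lt k t := L2s_continuous L (@continuous_tri _ L k t).
      have Z k t := L2s_Z 2^-1 (lt k t).
      rewrite E -[LHS]/(ip L u (fun p => _)) ipC ipDl// !ipZl// ![ip L (tri _ _ _) u]ipC !u0.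
      by rewrite !mulr0 addr0.
    rewrite /intT /Rintegral => H.
    have iub : mu2.-integrable (cell L) (EFin \o (fun p => u p * b p)).
      exact: (L2s_M lu (L2s_continuous L cb)).
    have := @integrable_fin_num _ _ _ mu2 _ (measurable_cell L) _ iub.
    move=> /fineK; rewrite /comp [X in X%:E](_ : _ = 0)// => E0.
    transitivity (\int[mu2]_(p in cell L) (u p * b p)%:E)%E; last by rewrite -E0.
    rewrite [RHS]integral_mkcond; apply: eq_integral => p _.
    by rewrite /K !patchE; case: ifP => _ //; rewrite mul0e.
  rewrite /Rintegral; apply/eqP; rewrite -(inj_eq (@EFin_inj R)) /=; apply/eqP.
  have mtr : measurable_fun setT (tr1 L n th').
    by apply: continuous_measurable_fun; exact: continuous_tr1.
  have E : (\int[mu]_(x in `[0%R, L]) (f x * tr1 L n th' x)%:E = 0)%E.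
    rewrite -F'0 [LHS]integral_mkcond; apply: ae_eq_integral => //.
    - apply/(measurable_restrictT _ (measurable_itv _)).
      by apply/measurable_EFinP; apply: measurable_funM; apply: measurable_funTS.
    - by have /integrableP[] := iF'.
    - have H1 := ae_integrable1 (iKb (@ctr1 m th)).
      apply: (@filterS2 _ _ (ae_filter_ringOfSetsType mu) _ _ _ _ H1 fF) => x H2 H3 _.
      rewrite /F' patchE; case: ifPn => [xL|/negP xL].
        rewrite EFinM -H3 /F -integralZr//.
        by apply: eq_integral => y _; rewrite /b /= EFinM muleA.
      rewrite integral0_eq// => y _; rewrite K_out ?mul0e//.
      by move=> h; apply: xL; exact: mem_set.
  by rewrite E.
have := ae_zero1 L0 fi f0.
move=> H; apply: (@filterS2 _ _ (ae_filter_ringOfSetsType mu) _ _ _ _ H fF) => x H1 H2 xL.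
by rewrite H2 H1.
Qed.

(** For almost every x all partial coefficients vanish at once, because the frequencies are
    countable and the phases 0 and -pi/2 span all others; then the one-variable result applies to
    the slice of [u] at x. *)
Lemma trig_complete : nrm L u = 0.
Proof.
pose half (b : bool) : R := if b then 0 else - (pi / 2).
have Fall : {ae mu, forall x, forall n : nat,
    if unpickle n is Some (m, b) then `[0, L]%classic x -> F m (half b) x = 0%E else True}.
  apply: ae_foralln => n; case: unpickle => [[m b]|]; first exact: F_ae0.
  exact: aeW.
have cst1 : continuous (fun _ : R * R => 1 : R) by move=> p; exact: cvg_cst.
have iK : mu2.-integrable setT K.
  have := iKb cst1; congr (integrable _ _ _); apply/funext => p.
  by rewrite mule1.
have Kx := ae_integrable1 iK.
have Z : {ae mu, forall x, (\int[mu]_y `|K (x, y)| = 0)%E}.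
  apply: (@filterS2 _ _ (ae_filter_ringOfSetsType mu) _ _ _ _ Fall Kx) => x H1 H2.
  have [xL|xL] := pselect (`[0, L]%classic x); last first.
    by apply: integral0_eq => y _; rewrite K_out// abse0.
  have gi : mu.-integrable `[0, L] (EFin \o (fun y => u (x, y))).
    have H3 : mu.-integrable `[0, L] (fun y => K (x, y)) by apply: integrableS H2.
    apply: eq_integrable H3 => //= y /set_mem yL.
    by rewrite K_in.
  have E m th : (\int[mu]_(y in `[0%R, L]) (u (x, y) * tr1 L m th y)%:E = F m th x)%E.
    rewrite integral_mkcond /F; apply: eq_integral => y _; rewrite patchE.
    case: ifPn => [/set_mem yL|/negP yL]; first by rewrite K_in// EFinM.
    rewrite /K patchE memNset ?mul0e// => -[_ yL']; apply: yL; exact: mem_set.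
  have F0 m b : F m (half b) x = 0%E by have := H1 (pickle (m, b)); rewrite pickleK; exact.
  have g0 m th : \int[mu]_(y in `[0, L]) (u (x, y) * tr1 L m th y) = 0.
    have ia th' : mu.-integrable `[0, L] (EFin \o (fun y => u (x, y) * tr1 L m th' y)).
      exact: (integrable_fM gi (@continuous_tr1 _ L m th')).
    have -> : (fun y => u (x, y) * tr1 L m th y) =
       (fun y => cos th * (u (x, y) * tr1 L m (half true) y) +
          - sin th * (u (x, y) * tr1 L m (half false) y)).
      by apply/funext => y; rewrite /tr1 /half addr0 cosBpihalf cosD; ring.
    rewrite RintegralD//=.
    - by rewrite !RintegralZl// /Rintegral !E (F0 m true) (F0 m false) !mulr0 addr0.
    - exact: (@integrableZl _ _ _ mu `[0, L] (measurable_itv _) _ _ (ia _)).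
    - exact: (@integrableZl _ _ _ mu `[0, L] (measurable_itv _) _ _ (ia _)).
  have A := ae_zero1 L0 gi g0.
  have mKx : measurable_fun setT (fun y => K (x, y)) by have /integrableP[] := H2.
  have [_ ->//] := ae_eq_integral_abs mu measurableT mKx.
  apply: (@filterS _ _ (ae_filter_ringOfSetsType mu) _ _ _ A) => y H3 _ /=.
  rewrite /K patchE; case: ifPn => // /set_mem[_ yL] /=.
  by rewrite H3.
have mAK : @measurable_fun _ _ T2 _ setT (fun p => `|K p|)%E by exact: measurableT_comp.
have K0 : (\int[mu2]_p `|K p| = 0)%E.
  rewrite fubini_tonelli1//.
  rewrite -[RHS](integral0 mu setT); apply: ae_eq_integral => //.
    by apply: measurable_fun_fubini_tonelli_F => //= p; exact: abse_ge0.
  by apply: (@filterS _ _ (ae_filter_ringOfSetsType mu) _ _ _ Z) => x Hx _.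
have [+ _] := ae_eq_integral_abs mu2 measurableT mK.
move=> /(_ K0) A.
have [mu_ u2] := lu.
suff : nrm L u ^+ 2 = 0 by move=> /eqP; rewrite sqrf_eq0 => /eqP.
apply/eqP; rewrite -(inj_eq (@EFin_inj R)) -nrm_integral//; apply/eqP.
rewrite -[RHS](integral0 mu2 (cell L)); apply: ae_eq_integral => //.
- exact: measurable_cell.
- by apply/measurable_EFinP; apply: measurable_funS (measurable_funX 2 mu_).
- apply: (@filterS _ _ (ae_filter_ringOfSetsType mu2) _ _ _ A) => p /(_ I) Kp pc.
  have : K p = (u p)%:E by rewrite /K patchE mem_set.
  by rewrite Kp => -[<-]; rewrite expr0n.
Qed.

End completeness2.

(** * Fourier projections *)

Section projection.
Context {R : realType}.
Variable L : R.
Hypothesis L0 : 0 < L.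
Implicit Types (k l m : int * int) (b : bool) (f g : R * R -> R).
Local Notation tri := (tri L).
Local Notation ip := (ip L).
Local Notation nrm := (nrm L).
Local Notation L2s := (L2s L).

(** [true] selects the cosine, [false] the sine. *)
Definition half b : R := if b then 0 else - (pi / 2).

Lemma L2s_tri k th : L2s (tri k th).
Proof. exact/L2s_continuous/continuous_tri. Qed.

Lemma L2s_tpoly s : L2s (tpoly L s).
Proof. exact/L2s_continuous/continuous_tpoly. Qed.

(** Every nonzero mode occurs twice in a box, as k and as -k, so the normalisation is by the area
    and not by half of it. *)
Definition co f k b : R := ip f (tri k (half b)) / L ^+ 2.

Definition mproj (mul : int * int -> R) (M : nat) f : R * R -> R :=
  tpoly L ([seq (mul k * co f k true, (k, half true)) | k <- box M] ++
           [seq (mul k * co f k false, (k, half false)) | k <- box M]).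

Definition proj := mproj (fun=> 1).

Lemma mprojE mul M f p : mproj mul M f p =
  \sum_(k <- box M) (mul k * co f k true * tri k (half true) p +
                     mul k * co f k false * tri k (half false) p).
Proof. by rewrite /mproj /tpoly big_cat !big_map big_split. Qed.

Lemma tri_split k th p : tri k th p =
  cos th * tri k (half true) p - sin th * tri k (half false) p.
Proof. by rewrite /tri /half addr0 cosBpihalf cosD; ring. Qed.

Lemma tri_opp k th p : tri (- k) th p = tri k (- th) p.
Proof. by rewrite /tri phaseN -cosN opprD opprK. Qed.

Lemma ip_suml (I : Type) (s : seq I) (F : I -> R * R -> R) g :
  (forall i, L2s (F i)) -> L2s g ->
  ip (fun p => \sum_(i <- s) F i p) g = \sum_(i <- s) ip (F i) g.
Proof.
move=> LF lg; have [_ <-] := intT_sum s (fun i => L2s_M (LF i) lg).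
by congr intT; apply/funext => p; rewrite mulr_suml.
Qed.

Lemma ip_tri k th l th' : ip (tri k th) (tri l th') =
  2^-1 * (if k + l == 0 then L ^+ 2 * cos (th + th') else 0) +
  2^-1 * (if k == l then L ^+ 2 * cos (th - th') else 0).
Proof. exact: intT_tri2. Qed.

Lemma ip_split f k th : L2s f ->
  ip f (tri k th) = cos th * ip f (tri k (half true)) - sin th * ip f (tri k (half false)).
Proof.
move=> lf; rewrite ipC.
rewrite (_ : tri k th = fun p => cos th * tri k (half true) p - sin th * tri k (half false) p).
  by rewrite ipBl ?ipZl ?(ipC _ f)//; try exact: L2s_tri; apply: L2s_Z; exact: L2s_tri.
by apply/funext => p; rewrite tri_split.
Qed.

Lemma ip_opp f k th : ip f (tri (- k) th) = ip f (tri k (- th)).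
Proof. by congr ip; apply/funext => p; rewrite tri_opp. Qed.

Let coL f k b : ip f (tri k (half b)) = L ^+ 2 * co f k b.
Proof. by rewrite /co mulrC divfK// expf_neq0// lt0r_neq0. Qed.

Lemma L2s_mproj mul M f : L2s (mproj mul M f).
Proof. exact: L2s_tpoly. Qed.

Lemma periodic_mproj mul M f : periodic L (mproj mul M f).
Proof. exact: (test_scalar_tpoly L0 _).2. Qed.

Section multiplier.
Variable mul : int * int -> R.
Hypothesis mul_even : forall k, mul (- k) = mul k.

(** A mode of frequency k meets the terms of index k and -k; evenness of the multiplier lets the two
    halves add up. *)
Lemma ip_mproj M f k b : L2s f ->
  ip (mproj mul M f) (tri k (half b)) =
  if k \in box M then mul k * ip f (tri k (half b)) else 0.
Proof.
move=> lf; rewrite (_ : mproj mul M f = fun p => \sum_(k <- box M) (mul k * co f k true *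
   tri k (half true) p + mul k * co f k false * tri k (half false) p)); last first.
  by apply/funext => p; rewrite mprojE.
rewrite ip_suml; last exact: L2s_tri; last first.
  by move=> i; apply: L2s_D; apply: L2s_Z; exact: L2s_tri.
pose T l := L ^+ 2 * (2^-1 * (if l == - k then mul l * (co f l true * cos (half b) + co f l false * cos (half false + half b)) else 0)
  + 2^-1 * (if l == k then mul l * (co f l true * cos (half b) + co f l false * cos (half false - half b)) else 0)).
rewrite (eq_bigr T); last first.
  move=> l _; rewrite ipDl ?ipZl ?ip_tri; try (by apply: L2s_Z; exact: L2s_tri); try exact: L2s_tri.
  rewrite /T addr_eq0 {1 3}/half add0r sub0r cosN.
  by case: ifP => _; case: ifP => _; ring.
rewrite -mulr_sumr big_split /= -!mulr_sumr -!big_mkcond.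
rewrite !(big_uniq1 _ (fun l => _) (uniq_box M)) !mem_box br_opp.
case: ifP => _; last by rewrite mulr0 addr0 mulr0.
have E : co f (- k) true = co f k true by rewrite /co ip_opp /half oppr0.
have E' : co f (- k) false = - co f k false.
  rewrite /co ip_opp /half opprK ip_split// cos_pihalf sin_pihalf mul0r mul1r sub0r.
  by rewrite mulNr.
rewrite E E' mul_even coL {T}; case: b; rewrite /half ?addr0 ?subr0 ?cos0 ?cosN ?cos_pihalf.
  by field.
by rewrite subrr cos0 -opprD cosN -splitr cospi; field.
Qed.

Lemma ip_mprojl M f g : L2s f -> L2s g ->
  ip (mproj mul M f) g = L ^+ 2 * \sum_(k <- box M) mul k * (co f k true * co g k true + co f k false * co g k false).
Proof.
move=> lf lg; rewrite (_ : mproj mul M f = fun p => \sum_(k <- box M) (mul k * co f k true *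
   tri k (half true) p + mul k * co f k false * tri k (half false) p)); last first.
  by apply/funext => p; rewrite mprojE.
rewrite ip_suml//; last by move=> i; apply: L2s_D; apply: L2s_Z; exact: L2s_tri.
rewrite mulr_sumr; apply: eq_bigr => k _.
rewrite ipDl ?ipZl//; try (by apply: L2s_Z; exact: L2s_tri); try exact: L2s_tri.
by rewrite !(ipC _ _ g) !coL; ring.
Qed.

Lemma co_mproj M f k b : L2s f ->
  co (mproj mul M f) k b = if k \in box M then mul k * co f k b else 0.
Proof. by move=> lf; rewrite /co ip_mproj//; case: ifP; rewrite ?mul0r// mulrA. Qed.

Definition msum M f := \sum_(k <- box M) mul k ^+ 2 * (co f k true ^+ 2 + co f k false ^+ 2).

Lemma nrm_mproj M f : L2s f -> nrm (mproj mul M f) ^+ 2 = L ^+ 2 * msum M f.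
Proof.
move=> lf; rewrite nrm_sqr ip_mprojl//; last exact: L2s_mproj.
congr (_ * _); rewrite /msum big_seq [RHS]big_seq; apply: eq_bigr => k kM.
by rewrite !co_mproj// kM; ring.
Qed.

Lemma nrm_mprojB M N f : L2s f -> (M <= N)%N ->
  nrm (fun p => mproj mul N f p - mproj mul M f p) ^+ 2 = L ^+ 2 * (msum N f - msum M f).
Proof.
move=> lf MN; have lM := L2s_mproj mul M f; have lN := L2s_mproj mul N f.
have E : ip (mproj mul N f) (mproj mul M f) = nrm (mproj mul M f) ^+ 2.
  rewrite ipC ip_mprojl// nrm_mproj//; congr (_ * _).
  rewrite /msum big_seq [RHS]big_seq; apply: eq_bigr => k kM.
  by rewrite !co_mproj// (sub_box MN kM); ring.
rewrite nrm_sqr (_ : (fun p => _) = (fun p => mproj mul N f p - 1 * mproj mul M f p)); last first.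
  by apply/funext => p; rewrite mul1r.
by rewrite ip_sqrB// E -!nrm_sqr !nrm_mproj//; ring.
Qed.

End multiplier.

Lemma nrm_sub_proj M f : L2s f ->
  nrm (fun p => f p - proj M f p) ^+ 2 = nrm f ^+ 2 - nrm (proj M f) ^+ 2.
Proof.
move=> lf; have lp : L2s (proj M f) by exact: L2s_mproj.
have E : ip (proj M f) f = nrm (proj M f) ^+ 2.
  rewrite nrm_mproj// ip_mprojl//; congr (_ * _); apply: eq_bigr => k _.
  by ring.
rewrite nrm_sqr (_ : (fun p => _) = (fun p => f p - 1 * proj M f p)); last first.
  by apply/funext => p; rewrite mul1r.
by rewrite ip_sqrB// (ipC _ f) E -!nrm_sqr; ring.
Qed.

Lemma bessel M f : L2s f ->
  L ^+ 2 * \sum_(k <- box M) (co f k true ^+ 2 + co f k false ^+ 2) <= nrm f ^+ 2.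
Proof.
move=> lf; rewrite (_ : \sum_(k <- box M) _ = msum (fun=> 1) M f); last first.
  by apply: eq_bigr => k _; rewrite expr1n mul1r.
by rewrite -nrm_mproj// -subr_ge0 -nrm_sub_proj// sqr_ge0.
Qed.

Lemma coB f g k b : L2s f -> L2s g -> co (fun p => f p - g p) k b = co f k b - co g k b.
Proof. by move=> lf lg; rewrite /co ipBl ?mulrBl//; exact: L2s_tri. Qed.

Lemma coD f g k b : L2s f -> L2s g -> co (fun p => f p + g p) k b = co f k b + co g k b.
Proof. by move=> lf lg; rewrite /co ipDl ?mulrDl//; exact: L2s_tri. Qed.

Lemma coZ c f k b : L2s f -> co (fun p => c * f p) k b = c * co f k b.
Proof. by move=> lf; rewrite /co ipZl ?mulrA//; exact: L2s_tri. Qed.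

Lemma co_le f k b : L2s f -> `|co f k b| <= nrm f / L.
Proof.
move=> lf; rewrite /co normrM normfV (@ger0_norm _ (L ^+ 2)) ?sqr_ge0//.
rewrite ler_pdivrMr ?exprn_gt0//.
have -> : nrm f / L * L ^+ 2 = nrm f * L by field; exact: lt0r_neq0.
apply: le_trans (cauchy_ip lf (L2s_tri _ _)) _.
rewrite ler_wpM2l ?nrm_ge0// -(@ler_pXn2r _ 2) ?nnegrE ?nrm_ge0 ?(ltW L0)//.
rewrite nrm_sqr ip_tri; have L2 : 0 <= L ^+ 2 := sqr_ge0 L.
have h x : L ^+ 2 * cos x <= L ^+ 2 by rewrite ler_piMr// cos_le1.
case: ifP => _; case: ifP => _; rewrite ?mulr0 ?addr0 ?add0r.
- have := h (half b + half b); have := h (half b - half b); lra.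
- have := h (half b + half b); lra.
- have := h (half b - half b); lra.
- by [].
Qed.

Lemma co_cvg (F : nat -> R * R -> R) g k b c : (forall n, L2s (F n)) -> L2s g ->
  (forall e, 0 < e -> exists N : nat, forall n, (N <= n)%N -> nrm (fun p => g p - F n p) <= e) ->
  (exists N : nat, forall n, (N <= n)%N -> co (F n) k b = c) ->
  co g k b = c.
Proof.
move=> lF lg Fg [N0 HN0]; apply/eqP; rewrite -subr_eq0 -normr_le0.
apply/ler_addgt0Pr => e e0; rewrite add0r.
have [N HN] := Fg (e * L) (mulr_gt0 e0 L0).
have := HN (maxn N N0) (leq_maxl _ _).
rewrite -(HN0 (maxn N N0)) ?leq_maxr// -coB//.
move=> H; apply: le_trans (co_le _ _ (L2s_B lg (lF _))) _.
by rewrite ler_pdivrMr.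
Qed.

Lemma co_inj f g : L2s f -> L2s g -> (forall k b, co f k b = co g k b) ->
  nrm (fun p => f p - g p) = 0.
Proof.
move=> lf lg fg; apply: trig_complete => //; first exact: L2s_B.
move=> k th; rewrite ip_split; last exact: L2s_B.
by rewrite !coL !coB// !fg !subrr !mulr0 subr0.
Qed.

(** The square sums increase and are bounded, so by orthogonality the truncations form a Cauchy
    sequence. Powers of the Stokes operator are constructed in this way. *)
Lemma synthesis (mul : int * int -> R) f : (forall k, mul (- k) = mul k) -> L2s f ->
  (exists B, forall M, msum mul M f <= B) ->
  exists g, [/\ L2s g, periodic L g, forall k b, co g k b = mul k * co f k b &
    forall e, 0 < e -> exists N : nat, forall n, (N <= n)%N ->
      nrm (fun p => g p - mproj mul n f p) <= e].
Proof.
move=> mE lf [B HB]; pose S M := msum mul M f.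
have S_nd : {homo S : m n / (m <= n)%N >-> m <= n}.
  move=> m n mn; apply: ler_sum_subseq; [exact: uniq_box|exact: sub_box|].
  by move=> k; rewrite mulr_ge0 ?addr_ge0 ?sqr_ge0.
have cS : cvgn S.
  apply: nondecreasing_is_cvgn => //; exists B => _ [M _ <-]; exact: HB.
have cauchy (e : R) : 0 < e -> exists N : nat, forall m n : nat, (N <= m)%N -> (N <= n)%N ->
     nrm (fun p => mproj mul m f p - mproj mul n f p) <= e.
  move=> e0; have eL : 0 < (e / L) ^+ 2 by rewrite exprn_gt0// divr_gt0.
  have /cvgrPdist_lt /(_ _ eL) [N _ HN] := cS.
  exists N => m n Nm Nn.
  wlog mn : m n Nm Nn / (n <= m)%N.
    move=> H; have [nm|/ltnW mn] := leqP n m; first exact: H.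
    by rewrite nrmBC; exact: H.
  rewrite -(@ler_pXn2r _ 2) ?nnegrE ?nrm_ge0 ?(ltW e0)// nrm_mprojB// -/(S _) -/(S _).
  have h1 := HN n Nn; have h2 : S m <= limn S by apply: nondecreasing_cvgn_le.
  have h3 : limn S - S n < (e / L) ^+ 2 by apply: le_lt_trans h1; exact: ler_norm.
  rewrite -ler_pdivlMl ?exprn_gt0//.
  rewrite exprMn exprVn mulrC in h3; lra.
have [g [lg pg Fg]] := riesz_fischer L0 (fun n => L2s_mproj mul n f) cauchy.
exists g; split => //; first by apply: pg => n; exact: periodic_mproj.
move=> k b; apply: (@co_cvg (fun n => mproj mul n f)) => //.
  by move=> n; exact: L2s_mproj.
by exists (br k) => n kn; rewrite co_mproj// mem_box (leqW kn).
Qed.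

(** The projections converge to some function with the same coefficients as [f]; completeness
    identifies it with [f]. *)
Lemma proj_cvg f e : L2s f -> 0 < e -> exists N : nat, forall n, (N <= n)%N ->
  nrm (fun p => f p - proj n f p) <= e.
Proof.
move=> lf e0.
have [|g [lg pg cg Fg]] := @synthesis (fun=> 1) f (fun=> erefl) lf.
  exists (nrm f ^+ 2 / L ^+ 2) => M; rewrite ler_pdivlMr ?exprn_gt0// mulrC.
  apply: le_trans (bessel M lf); rewrite /msum.
  by under eq_bigr do rewrite expr1n mul1r.
have fg0 : nrm (fun p => f p - g p) = 0.
  by apply: co_inj => // k b; rewrite cg mul1r.
have [N HN] := Fg e e0; exists N => n Nn.
rewrite (_ : (fun p => _) = (fun p => (f p - g p) + (g p - proj n f p))); last first.
  by apply/funext => p; ring.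
apply: le_trans (nrmD (L2s_B lf lg) (L2s_B lg (L2s_mproj _ _ _))) _.
by rewrite fg0 add0r HN.
Qed.

End projection.

(** * Fourier coefficients of solenoidal fields *)

Section fields.
Context {R : realType}.
Variable L : R.
Hypothesis L0 : 0 < L.
Implicit Types (k l m : int * int) (b : bool) (f g : R * R -> R) (u v w : R * R -> R * R).
Local Notation tri := (tri L).
Local Notation ip := (ip L).
Local Notation nrm := (nrm L).
Local Notation L2s := (L2s L).
Local Notation co := (co L).
Local Notation proj := (proj L).
Local Notation kap := (kap L).
Local Notation mu := (@lebesgue_measure R).
Local Notation mu2 := (mu \x mu)%E.

Lemma L2per_comp u : L2per L u -> [/\ L2s (c1 u), L2s (c2 u), periodic L (c1 u) & periodic L (c2 u)].
Proof.
move=> [mu_ pu iu].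
have m1 : measurable_fun setT (c1 u) by exact: (measurableT_comp measurable_fst mu_).
have m2 : measurable_fun setT (c2 u) by exact: (measurableT_comp measurable_snd mu_).
have iu' := (integrable_leb2 _ _).1 iu.
split; last 2 first.
- by move=> p; have [e1 e2] := pu p; rewrite /c1 e1 e2.
- by move=> p; have [e1 e2] := pu p; rewrite /c2 e1 e2.
- split=> //; apply: integrable_dominated iu'; first exact: measurable_funX.
  by move=> p _; rewrite ger0_norm ?sqr_ge0// lerDl sqr_ge0.
- split=> //; apply: integrable_dominated iu'; first exact: measurable_funX.
  by move=> p _; rewrite ger0_norm ?sqr_ge0// lerDr sqr_ge0.
Qed.

Lemma L2per_intro u : L2s (c1 u) -> L2s (c2 u) -> periodic L (c1 u) -> periodic L (c2 u) ->
  L2per L u.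
Proof.
move=> [m1 i1] [m2 i2] p1 p2; split.
- exact/measurable_fun_pairP.
- move=> p; have [e1 e2] := p1 p; have [e3 e4] := p2 p.
  by split; apply/eqP; rewrite -pair_eqE /pair_eq; apply/andP; split; apply/eqP.
- by apply/integrable_leb2; exact: integrableTD.
Qed.

Lemma inner_ip u v : L2per L u -> L2per L v ->
  inner L u v = ip (c1 u) (c1 v) + ip (c2 u) (c2 v).
Proof.
move=> /L2per_comp[u1 u2 _ _] /L2per_comp[v1 v2 _ _].
by rewrite /inner intTD//; exact: L2s_M.
Qed.

Definition en k : R := Num.sqrt (k.1%:~R ^+ 2 + k.2%:~R ^+ 2).
(** Together with [dir2] the unit vector k^perp / |k|; at k = 0 both components are 0, so the mean
    value never enters. *)
Definition dir1 k : R := - (k.2%:~R / en k).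
Definition dir2 k : R := k.1%:~R / en k.

Lemma en_sqr k : en k ^+ 2 = k.1%:~R ^+ 2 + k.2%:~R ^+ 2.
Proof. by rewrite sqr_sqrtr// addr_ge0 ?sqr_ge0. Qed.

Lemma en_ge0 k : 0 <= en k. Proof. exact: sqrtr_ge0. Qed.

Lemma en_neq0 k : k != 0 -> en k != 0.
Proof.
move=> k0; rewrite -sqrf_eq0 en_sqr paddr_eq0 ?sqr_ge0// !sqrf_eq0 !intr_eq0.
by apply: contra k0; case: k => a b /= /andP[/eqP -> /eqP ->].
Qed.

Lemma en_opp k : en (- k) = en k.
Proof. by rewrite /en /= !mulrNz !sqrrN. Qed.

Lemma absz_br k : (`|k.1%:~R| <= (br k)%:R :> R) /\ (`|k.2%:~R| <= (br k)%:R :> R).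
Proof.
clear L0; by split; rewrite -intr_norm -abszE -pmulrn ler_nat /br; lia.
Qed.

Definition phi k b : R * R -> R * R := fun p =>
  (dir1 k * tri k (half b) p, dir2 k * tri k (half b) p).

Lemma c1_phi k b : c1 (phi k b) = tpoly L [:: (dir1 k, (k, half b))].
Proof. by apply/funext => p; rewrite /tpoly big_seq1. Qed.

Lemma c2_phi k b : c2 (phi k b) = tpoly L [:: (dir2 k, (k, half b))].
Proof. by apply/funext => p; rewrite /tpoly big_seq1. Qed.

Lemma tpoly1 c k th : tpoly L [:: (c, (k, th))] = fun p => c * tri k th p.
Proof. by apply/funext => p; rewrite /tpoly big_seq1. Qed.

Lemma dx_tri c k th : dx (fun p => c * tri k th p) = fun p => c * (kap * k.1%:~R) * tri k (th + pi / 2) p.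
Proof. by rewrite -tpoly1 dx_tpoly /= tpoly1. Qed.

Lemma dy_tri c k th : dy (fun p => c * tri k th p) = fun p => c * (kap * k.2%:~R) * tri k (th + pi / 2) p.
Proof. by rewrite -tpoly1 dy_tpoly /= tpoly1. Qed.

Lemma tri_dpi k th p : tri k (th + pi / 2 + pi / 2) p = - tri k th p.
Proof. by rewrite /tri -addrA -splitr addrA cosDpi. Qed.

Lemma dir_orth k : k.1%:~R * dir1 k + k.2%:~R * dir2 k = 0.
Proof. by rewrite /dir1 /dir2; ring. Qed.

Lemma dir_sqr k : k != 0 -> dir1 k ^+ 2 + dir2 k ^+ 2 = 1.
Proof.
move=> k0; rewrite /dir1 /dir2 sqrrN !expr_div_n -mulrDl addrC -en_sqr divff//.
by rewrite expf_neq0// en_neq0.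
Qed.

Lemma dir0 : dir1 0 = 0 /\ dir2 0 = 0.
Proof. by rewrite /dir1 /dir2 mul0r oppr0. Qed.

Lemma test_scalar_Ztri c k th : test_scalar L (fun p => c * tri k th p).
Proof. by rewrite -tpoly1; exact: test_scalar_tpoly. Qed.

Lemma L2s_Ztri c k th : L2s (fun p => c * tri k th p).
Proof. by rewrite -tpoly1; exact: L2s_tpoly. Qed.

Lemma inH_tpoly s t : intT L (tpoly L s) = 0 -> intT L (tpoly L t) = 0 ->
  (forall p, tpoly L (tp_dx L s) p + tpoly L (tp_dy L t) p = 0) ->
  inH L (fun p => (tpoly L s p, tpoly L t p)).
Proof.
move=> s0 t0 st0; split => //.
  apply: L2per_intro; rewrite -/(tpoly L s) -/(tpoly L t); try exact: L2s_tpoly.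
    exact: (test_scalar_tpoly L0 s).2.
  exact: (test_scalar_tpoly L0 t).2.
move=> q tq; have [sq pq] := tq.
have [cq _] := sq [::]; have [cqx _] := sq [:: true]; have [cqy _] := sq [:: false].
rewrite intTD; last 2 first.
- by apply: continuous_integrable_cell => p; apply: cvgM; [exact: continuous_tpoly|exact: cqx].
- by apply: continuous_integrable_cell => p; apply: cvgM; [exact: continuous_tpoly|exact: cqy].
rewrite -[c1 _]/(tpoly L s) -[c2 _]/(tpoly L t).
rewrite (IBP_x L0 (test_scalar_tpoly L0 s) tq) (IBP_y L0 (test_scalar_tpoly L0 t) tq).
rewrite -opprD -intTD; last 2 first.
- by rewrite dx_tpoly; apply: continuous_integrable_cell => p; apply: cvgM; [exact: continuous_tpoly|exact: cq].
- by rewrite dy_tpoly; apply: continuous_integrable_cell => p; apply: cvgM; [exact: continuous_tpoly|exact: cq].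
rewrite (_ : (fun p => _) = fun=> 0) ?intT0 ?oppr0//.
by apply/funext => p; rewrite -mulrDl dx_tpoly dy_tpoly st0 mul0r.
Qed.

Lemma test_field_phi k b : test_field L (phi k b).
Proof.
have E : phi k b = fun p => (tpoly L [:: (dir1 k, (k, half b))] p, tpoly L [:: (dir2 k, (k, half b))] p).
  by apply/funext => p; rewrite /phi !tpoly1.
split; [rewrite c1_phi; exact: test_scalar_tpoly|rewrite c2_phi; exact: test_scalar_tpoly|].
have z c : (c = dir1 k \/ c = dir2 k) -> intT L (tpoly L [:: (c, (k, half b))]) = 0.
  move=> ck; rewrite tpoly1 intTZ; last exact: integrable_tri.
  rewrite intT_tri//; case: eqP => [k0|]; rewrite ?mulr0//.
  by move: ck; rewrite k0; have [-> ->] := dir0; case => ->; rewrite mul0r.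
rewrite E; apply: inH_tpoly; rewrite ?z//; try by [left|right].
move=> p; rewrite /tp_dx /tp_dy /= !tpoly1.
rewrite -mulrDl.
have -> : dir1 k * (kap * k.1%:~R) + dir2 k * (kap * k.2%:~R) =
  kap * (k.1%:~R * dir1 k + k.2%:~R * dir2 k) by ring.
by rewrite dir_orth mulr0 mul0r.
Qed.

Lemma L2per_phi k b : L2per L (phi k b).
Proof. by have [_ _ []] := test_field_phi k b. Qed.

Definition xc u k b : R := dir1 k * co (c1 u) k b + dir2 k * co (c2 u) k b.

Lemma inner_phi u k b : L2per L u -> inner L u (phi k b) = L ^+ 2 * xc u k b.
Proof.
move=> lu; rewrite inner_ip//; last exact: L2per_phi.
have [l1 l2 _ _] := L2per_comp lu.
rewrite (ipC _ (c1 u)) (ipC _ (c2 u)) c1_phi c2_phi !tpoly1.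
rewrite !ipZl//; try exact: L2s_tri.
rewrite (ipC _ _ (c1 u)) (ipC _ _ (c2 u)) /xc /Submission.co; field; exact: lt0r_neq0.
Qed.

Lemma inH_co0 u b : inH L u -> co (c1 u) 0 b = 0 /\ co (c2 u) 0 b = 0.
Proof.
move=> [lu m1 m2 _]; have [l1 l2 _ _] := L2per_comp lu.
have H f : L2s f -> intT L f = 0 -> co f 0 b = 0.
  move=> lf f0; rewrite /Submission.co /Submission.ip (_ : (fun p => _) = (fun p => cos (half b) * f p)).
    by rewrite intTZ ?f0 ?mulr0 ?mul0r//; exact: L2s_integrable.
  by apply/funext => p; rewrite tri0 mulrC.
by split; exact: H.
Qed.

Lemma inH_div u k th : inH L u ->
  k.1%:~R * ip (c1 u) (tri k th) + k.2%:~R * ip (c2 u) (tri k th) = 0.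
Proof.
move=> [lu _ _ du]; have [l1 l2 _ _] := L2per_comp lu.
have := du (fun p => 1 * tri k (th - pi / 2) p) (test_scalar_Ztri _ _ _).
rewrite dx_tri dy_tri subrK.
rewrite intTD; try by apply: L2s_M => //; exact: L2s_Ztri.
rewrite -/(Submission.ip L (c1 u) _) -/(Submission.ip L (c2 u) _) (ipC _ (c1 u)) (ipC _ (c2 u)).
rewrite !ipZl//; try exact: L2s_tri.
rewrite (ipC _ _ (c1 u)) (ipC _ _ (c2 u)) => H.
apply: (mulfI (lt0r_neq0 (kap_gt0 L0))); rewrite mulr0 -[RHS]H; ring.
Qed.

(** Vanishing divergence makes the coefficient vector orthogonal to k, hence a multiple of k^perp in
    the plane: one scalar per mode carries the field. *)
Lemma co_xc u k b : inH L u ->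
  co (c1 u) k b = dir1 k * xc u k b /\ co (c2 u) k b = dir2 k * xc u k b.
Proof.
move=> uH; have [->|k0] := eqVneq k 0.
  have [-> ->] := inH_co0 b uH; have [-> ->] := dir0.
  by rewrite !mul0r.
have /(congr1 (fun x => x / L ^+ 2)) := inH_div k (half b) uH.
rewrite mul0r mulrDl -!mulrA -!/(Submission.co _ _ _ _) => D.
have e0 := en_neq0 k0; have E := en_sqr k.
rewrite /xc /dir1 /dir2.
set x := co (c1 u) k b in D *; set y := co (c2 u) k b in D *.
set p : R := k.1%:~R in D E *; set q : R := k.2%:~R in D E *.
have e2 : en k ^+ 2 != 0 by rewrite expf_neq0.
split; apply: (mulfI e2).
  have -> : en k ^+ 2 * (- (q / en k) * (- (q / en k) * x + p / en k * y)) = q ^+ 2 * x - p * (q * y).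
    by field.
  have -> : q * y = - (p * x) by lra.
  by rewrite E; ring.
rewrite [RHS](_ : _ = p ^+ 2 * y - q * (p * x)); last first.
  by field.
have -> : p * x = - (q * y) by lra.
by rewrite E; ring.
Qed.

(** The modulus of the complex Fourier coefficient, with cosine and sine part combined. *)
Definition X u k : R := Num.sqrt (xc u k true ^+ 2 + xc u k false ^+ 2).

Lemma X_ge0 u k : 0 <= X u k. Proof. exact: sqrtr_ge0. Qed.

Lemma X_sqr u k : X u k ^+ 2 = xc u k true ^+ 2 + xc u k false ^+ 2.
Proof. by rewrite sqr_sqrtr// addr_ge0 ?sqr_ge0. Qed.

Lemma xc_X u k b : `|xc u k b| <= X u k.
Proof.
rewrite -(@ler_pXn2r _ 2) ?nnegrE ?X_ge0// real_normK ?num_real// X_sqr.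
by case: b; rewrite ?lerDl ?lerDr sqr_ge0.
Qed.

Lemma X_co u k : inH L u ->
  X u k ^+ 2 = (co (c1 u) k true ^+ 2 + co (c1 u) k false ^+ 2) +
               (co (c2 u) k true ^+ 2 + co (c2 u) k false ^+ 2).
Proof.
move=> uH; have [-> ->] := co_xc k true uH; have [-> ->] := co_xc k false uH.
have [->|k0] := eqVneq k 0.
  rewrite X_sqr; have z b : xc u 0 b = 0 by rewrite /xc; have [-> ->] := dir0; rewrite !mul0r addr0.
  by rewrite !z !mulr0; ring.
rewrite X_sqr -[LHS]mul1r -(dir_sqr k0); ring.
Qed.

Lemma bessel_X M u : inH L u -> L ^+ 2 * \sum_(k <- box M) X u k ^+ 2 <= normL2 L u ^+ 2.
Proof.
move=> uH; have lu : L2per L u by case: uH.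
have [l1 l2 _ _] := L2per_comp lu.
rewrite /normL2 inner_ip// sqr_sqrtr ?addr_ge0 ?ip_ge0// -!nrm_sqr.
have := bessel L0 M l1; have := bessel L0 M l2.
have -> : \sum_(k <- box M) X u k ^+ 2 =
    \sum_(k <- box M) (co (c1 u) k true ^+ 2 + co (c1 u) k false ^+ 2) +
    \sum_(k <- box M) (co (c2 u) k true ^+ 2 + co (c2 u) k false ^+ 2).
  by rewrite -big_split; apply: eq_bigr => k _; exact: X_co.
rewrite mulrDr; lra.
Qed.

End fields.

(** * The quadratic term *)

Section nonlinearity.
Context {R : realType}.
Variable L : R.
Hypothesis L0 : 0 < L.
Implicit Types (k l m : int * int) (b : bool) (f g : R * R -> R) (u v w : R * R -> R * R).
Local Notation tri := (tri L).
Local Notation ip := (ip L).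
Local Notation nrm := (nrm L).
Local Notation L2s := (L2s L).
Local Notation co := (co L).
Local Notation proj := (proj L).
Local Notation kap := (kap L).
Local Notation xc := (xc L).
Local Notation X := (X L).
Local Notation phi := (phi L).
Local Notation mu := (@lebesgue_measure R).
Local Notation mu2 := (mu \x mu)%E.

Definition subf u v : R * R -> R * R := fun p => u p - v p.
Definition addZ u (z : R) v : R * R -> R * R := fun p => u p + z *: v p.

Lemma inH_addZ u z v : inH L u -> inH L v -> inH L (addZ u z v).
Proof.
move=> [lu u1 u2 du] [lv v1 v2 dv].
have [lu1 lu2 pu1 pu2] := L2per_comp lu; have [lv1 lv2 pv1 pv2] := L2per_comp lv.
have e1 : c1 (addZ u z v) = fun p => c1 u p + z * c1 v p by [].
have e2 : c2 (addZ u z v) = fun p => c2 u p + z * c2 v p by [].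
split.
- apply: L2per_intro; rewrite ?e1 ?e2.
  + by apply: L2s_D => //; exact: L2s_Z.
  + by apply: L2s_D => //; exact: L2s_Z.
  + by move=> p; have [-> ->] := pu1 p; have [-> ->] := pv1 p.
  + by move=> p; have [-> ->] := pu2 p; have [-> ->] := pv2 p.
- rewrite e1 intTD ?intTZ ?u1 ?v1 ?mulr0 ?addr0//; try exact: L2s_integrable.
  by apply: integrableTZ; exact: L2s_integrable.
- rewrite e2 intTD ?intTZ ?u2 ?v2 ?mulr0 ?addr0//; try exact: L2s_integrable.
  by apply: integrableTZ; exact: L2s_integrable.
- move=> q tq; have := du q tq; have := dv q tq; rewrite e1 e2 => Hv Hu.
  have lx : L2s (dx q) by apply: L2s_continuous; have [/(_ [:: true])[]] := tq.
  have ly : L2s (dy q) by apply: L2s_continuous; have [/(_ [:: false])[]] := tq.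
  rewrite (_ : (fun p => _) = (fun p => (c1 u p * dx q p + c2 u p * dy q p) +
     z * (c1 v p * dx q p + c2 v p * dy q p))); last by apply/funext => p; ring.
  rewrite intTD ?intTZ ?Hu ?Hv ?mulr0 ?addr0//; try apply: integrableTZ;
    by apply: integrableTD; exact: L2s_M.
Qed.

Lemma subf_addZ u v : subf u v = addZ u (-1) v.
Proof. by apply/funext => p; rewrite /subf /addZ scaleN1r. Qed.

Lemma inH_subf u v : inH L u -> inH L v -> inH L (subf u v).
Proof. by rewrite subf_addZ; exact: inH_addZ. Qed.

Lemma xc_addZ u z v k b : L2per L u -> L2per L v ->
  xc (addZ u z v) k b = xc u k b + z * xc v k b.
Proof.
move=> /L2per_comp[u1 u2 _ _] /L2per_comp[v1 v2 _ _].
rewrite /Submission.xc -[c1 (addZ _ _ _)]/(fun p => c1 u p + z * c1 v p).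
rewrite -[c2 (addZ _ _ _)]/(fun p => c2 u p + z * c2 v p).
rewrite !coD ?coZ//; try exact: L2s_Z.
by ring.
Qed.

Lemma X_addZ u z v k : L2per L u -> L2per L v ->
  X (addZ u z v) k <= X u k + `|z| * X v k.
Proof.
move=> lu lv; rewrite {1}/Submission.X !xc_addZ//.
set a := xc u k true; set b := xc u k false; set c := xc v k true; set d := xc v k false.
have Xu := X_sqr L u k; have Xv := X_sqr L v k; rewrite -/a -/b -/c -/d in Xu Xv.
have xu := X_ge0 L u k; have xv := X_ge0 L v k.
rewrite -(@ler_pXn2r _ 2) ?nnegrE ?addr_ge0 ?mulr_ge0 ?sqrtr_ge0//.
rewrite sqr_sqrtr ?addr_ge0 ?sqr_ge0// [in leRHS]sqrrD Xu exprMn real_normK ?num_real// Xv.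
suff : z * (a * c + b * d) <= X u k * (`|z| * X v k) by lra.
rewrite mulrCA; apply: le_trans (ler_norm _) _; rewrite normrM ler_wpM2l//.
rewrite -(@ler_pXn2r _ 2) ?nnegrE ?mulr_ge0// real_normK ?num_real// exprMn Xu Xv.
have := sqr_ge0 (a * d - b * c); lra.
Qed.

Definition Tri3 f g k th : R := intT L (fun p => f p * g p * tri k th p).

Lemma tri_le1 k th p : `|tri k th p| <= 1.
Proof. by rewrite /tri ler_norml cos_geN1 cos_le1. Qed.

Lemma measurable_tri k th : measurable_fun setT (tri k th).
Proof. by apply: continuous_measurable2; exact: continuous_tri. Qed.

Lemma integrable_Tri3 f g k th : L2s f -> L2s g ->
  mu2.-integrable (cell L) (EFin \o (fun p => f p * g p * tri k th p)).
Proof.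
by move=> lf lg; apply: (@L2s_MM _ _ _ _ _ 1) => //; [exact: measurable_tri|move=> p _; exact: tri_le1].
Qed.

Lemma Tri3_bound f g k th : L2s f -> L2s g -> `|Tri3 f g k th| <= nrm f * nrm g.
Proof.
move=> lf lg.
have [lt nt] := @nrmM_bounded _ L g (tri k th) 1 lg (@measurable_tri k th) ler01 (fun p _ => tri_le1 k th p).
rewrite /Tri3 (_ : (fun p => _) = (fun p => f p * (g p * tri k th p))); last by apply/funext => p; ring.
apply: le_trans (cauchy_ip lf lt) _; rewrite ler_wpM2l ?nrm_ge0//.
by rewrite mul1r in nt.
Qed.

Lemma Tri3_diff f g f' g' k th : L2s f -> L2s g -> L2s f' -> L2s g' ->
  Tri3 f g k th - Tri3 f' g' k th =
  Tri3 (fun p => f p - f' p) g k th + Tri3 f' (fun p => g p - g' p) k th.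
Proof.
move=> lf lg lf' lg'; rewrite /Tri3 -intTB; try exact: integrable_Tri3.
rewrite -intTD; try by apply: integrable_Tri3 => //; exact: L2s_B.
by congr intT; apply/funext => p; ring.
Qed.

Definition amp f k : R := `|co f k true| + `|co f k false|.

Lemma amp_ge0 f k : 0 <= amp f k. Proof. exact: addr_ge0. Qed.

Lemma amp_opp f k : L2s f -> amp f (- k) = amp f k.
Proof.
move=> lf; rewrite /amp /Submission.co !ip_opp /half oppr0 opprK (ip_split k (pi / 2))//.
by rewrite cos_pihalf sin_pihalf mul0r mul1r sub0r mulNr normrN.
Qed.

Lemma box_opp M k : (- k \in box M) = (k \in box M).
Proof. by rewrite !mem_box br_opp. Qed.

Lemma big_box_opp M (F : int * int -> R) : \sum_(k <- box M) F (- k) = \sum_(k <- box M) F k.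
Proof.
rewrite -(big_map (fun k => - k) xpredT F); apply: perm_big; apply: uniq_perm.
- by rewrite map_inj_uniq ?uniq_box//; exact: oppr_inj.
- exact: uniq_box.
move=> k; apply/mapP/idP => [[j jM ->]|kM]; first by rewrite box_opp.
by exists (- k); rewrite ?box_opp// opprK.
Qed.

Lemma conv_cond M (P Q : int * int -> R) k :
  conv M P Q k = \sum_(l <- box M) \sum_(m <- box M) P l * Q m * (l + m == k)%:R.
Proof.
apply: eq_bigr => l _; rewrite big_mkcond /=; apply: eq_bigr => m _.
by case: ifP => _; rewrite ?mulr1 ?mulr0.
Qed.

Lemma ler_conv M (P P' Q Q' : int * int -> R) k :
  (forall l, 0 <= P l <= P' l) -> (forall l, 0 <= Q l <= Q' l) -> conv M P Q k <= conv M P' Q' k.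
Proof.
move=> PP QQ; apply: ler_sum => l _; apply: ler_sum => m _.
by have /andP[p0 pp] := PP l; have /andP[q0 qq] := QQ m; exact: ler_pM.
Qed.

Lemma convC M (P Q : int * int -> R) k : conv M P Q k = conv M Q P k.
Proof.
rewrite !conv_cond exchange_big /=; apply: eq_bigr => l _; apply: eq_bigr => m _.
by rewrite addrC (mulrC (P m)).
Qed.

Lemma convDr M (P Q Q' : int * int -> R) k :
  conv M P (fun m => Q m + Q' m) k = conv M P Q k + conv M P Q' k.
Proof.
rewrite -big_split; apply: eq_bigr => l _ /=; rewrite -big_split; apply: eq_bigr => m _.
by rewrite mulrDr.
Qed.

Lemma convZ M c d (P Q : int * int -> R) k :
  conv M (fun m => c * P m) (fun m => d * Q m) k = c * d * conv M P Q k.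
Proof.
rewrite /conv mulr_sumr; apply: eq_bigr => l _ /=; rewrite mulr_sumr; apply: eq_bigr => m _.
by ring.
Qed.

(** Each of the four resonances contributes a quarter, and all four give the same convolution
    because boxes and amplitudes are invariant under k -> -k. *)
Lemma Tri3_conv M f g k th : L2s f -> L2s g ->
  `|Tri3 (proj M f) (proj M g) k th| <= L ^+ 2 * conv M (amp f) (amp g) k.
Proof.
move=> lf lg.
pose cf (f : R * R -> R) (x : (int * int) * bool) := co f x.1 x.2.
pose tr (x : (int * int) * bool) := tri x.1 (half x.2).
pose s := [seq (k, true) | k <- box M] ++ [seq (k, false) | k <- box M].
have sE (G : (int * int) * bool -> R) :
    \sum_(x <- s) G x = \sum_(l <- box M) (G (l, true) + G (l, false)).
  by rewrite /s big_cat !big_map big_split.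
have E h p : proj M h p = \sum_(x <- s) cf h x * tr x p.
  rewrite /s big_cat !big_map /Submission.proj mprojE big_split /=.
  by congr (_ + _); apply: eq_bigr => l _; rewrite !mul1r.
have -> : Tri3 (proj M f) (proj M g) k th =
    \sum_(x <- s) \sum_(y <- s) cf f x * cf g y * intT L (fun p => tr x p * tr y p * tri k th p).
  have ii x y : mu2.-integrable (cell L) (EFin \o (fun p => tr x p * tr y p * tri k th p)).
    by apply: integrable_Tri3; exact: L2s_tri.
  have is_ x := intT_sum s (fun y => integrableTZ (cf f x * cf g y) (ii x y)).
  have [_ Es] := intT_sum s (fun x => (is_ x).1).
  rewrite /Tri3 (_ : (fun p => _) = (fun p => \sum_(x <- s) \sum_(y <- s)
     cf f x * cf g y * (tr x p * tr y p * tri k th p))).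
    rewrite Es; apply: eq_bigr => x _; rewrite (is_ x).2; apply: eq_bigr => y _.
    by rewrite intTZ.
  apply/funext => p; rewrite !E mulr_suml mulr_suml; apply: eq_bigr => x _.
  by rewrite mulr_sumr mulr_suml; apply: eq_bigr => y _; ring.
pose ind l m : R := (l + m == k)%:R + (l + m == - k)%:R + (l - m == k)%:R + (l - m == - k)%:R.
apply: (@le_trans _ _ (\sum_(x <- s) \sum_(y <- s)
   `|cf f x| * `|cf g y| * (L ^+ 2 / 4 * ind x.1 y.1))).
  apply: le_trans (ler_norm_sum _ _ _) _; apply: ler_sum => x _.
  apply: le_trans (ler_norm_sum _ _ _) _; apply: ler_sum => y _.
  by rewrite !normrM ler_wpM2l ?mulr_ge0//; exact: intT_tri3.
have -> : \sum_(x <- s) \sum_(y <- s) `|cf f x| * `|cf g y| * (L ^+ 2 / 4 * ind x.1 y.1) =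
   L ^+ 2 / 4 * \sum_(l <- box M) \sum_(m <- box M) amp f l * amp g m * ind l m.
  rewrite sE mulr_sumr; apply: eq_bigr => l _ /=; rewrite !sE mulr_sumr -big_split.
  apply: eq_bigr => m _ /=; rewrite /cf /amp /=; ring.
have sp l m : amp f l * amp g m * ind l m = amp f l * amp g m * (l + m == k)%:R +
   amp f l * amp g m * (l + m == - k)%:R + amp f l * amp g m * (l - m == k)%:R +
   amp f l * amp g m * (l - m == - k)%:R by rewrite /ind; ring.
under eq_bigr do under eq_bigr do rewrite sp.
under eq_bigr do rewrite !big_split.
rewrite !big_split /= -conv_cond.
have e2 : \sum_(l <- box M) \sum_(m <- box M) amp f l * amp g m * (l + m == - k)%:R = conv M (amp f) (amp g) k.
  rewrite -big_box_opp conv_cond; apply: eq_bigr => l _; rewrite -big_box_opp; apply: eq_bigr => m _.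
  by rewrite !amp_opp// -opprD eqr_opp.
have e3 : \sum_(l <- box M) \sum_(m <- box M) amp f l * amp g m * (l - m == k)%:R = conv M (amp f) (amp g) k.
  rewrite conv_cond; apply: eq_bigr => l _; rewrite -big_box_opp; apply: eq_bigr => m _.
  by rewrite !amp_opp// opprK.
have e4 : \sum_(l <- box M) \sum_(m <- box M) amp f l * amp g m * (l - m == - k)%:R = conv M (amp f) (amp g) k.
  rewrite -big_box_opp conv_cond; apply: eq_bigr => l _; apply: eq_bigr => m _.
  by rewrite !amp_opp// -opprD eqr_opp.
rewrite e2 e3 e4; lra.
Qed.

Lemma amp_X u k : inH L u -> amp (c1 u) k <= 2 * X u k /\ amp (c2 u) k <= 2 * X u k.
Proof.
move=> uH; rewrite /amp.
have d1 : `|dir1 k| <= 1 :> R.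
  have [->|k0] := eqVneq k 0; first by have [-> _] := @dir0 R; rewrite normr0.
  rewrite -(@ler_pXn2r _ 2) ?nnegrE// real_normK ?num_real// expr1n -(@dir_sqr R k)//.
  by rewrite lerDl sqr_ge0.
have d2 : `|dir2 k| <= 1 :> R.
  have [->|k0] := eqVneq k 0; first by have [_ ->] := @dir0 R; rewrite normr0.
  rewrite -(@ler_pXn2r _ 2) ?nnegrE// real_normK ?num_real// expr1n -(@dir_sqr R k)//.
  by rewrite lerDr sqr_ge0.
have [-> ->] := co_xc L0 k true uH; have [-> ->] := co_xc L0 k false uH.
rewrite !(normrM (dir1 k)) !(normrM (dir2 k)) -!mulrDr mulr_natl mulr2n.
by split; (rewrite -[leRHS]mul1r; apply: ler_pM => //; apply: lerD; exact: xc_X).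
Qed.

(** The contraction of a 2 x 2 tensor with k^perp / |k| and k, which is how the divergence of the
    tensor of products u_i u_j acts along a mode. *)
Definition dcomb k (a b c d : R) : R :=
  dir1 k * k.1%:~R * a + dir1 k * k.2%:~R * b + dir2 k * k.1%:~R * c + dir2 k * k.2%:~R * d.

Lemma dcombB k (a b c d a' b' c' d' : R) :
  dcomb k a b c d - dcomb k a' b' c' d' = dcomb k (a - a') (b - b') (c - c') (d - d').
Proof.
rewrite /dcomb; move: (dir1 k * k.1%:~R) (dir1 k * k.2%:~R) (dir2 k * k.1%:~R) (dir2 k * k.2%:~R).
by move=> p q r s; ring.
Qed.

Lemma Bphi u k b : L2per L u -> B_pair L u (phi k b) =
  - (kap * dcomb k (Tri3 (c1 u) (c1 u) k (half b + pi / 2))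
                   (Tri3 (c2 u) (c1 u) k (half b + pi / 2))
                   (Tri3 (c1 u) (c2 u) k (half b + pi / 2))
                   (Tri3 (c2 u) (c2 u) k (half b + pi / 2))).
Proof.
move=> /L2per_comp[l1 l2 _ _]; rewrite /B_pair c1_phi c2_phi !tpoly1 !dx_tri !dy_tri.
congr (- _); rewrite /dcomb /Tri3.
have i11 := integrable_Tri3 k (half b + pi / 2) l1 l1.
have i21 := integrable_Tri3 k (half b + pi / 2) l2 l1.
have i12 := integrable_Tri3 k (half b + pi / 2) l1 l2.
have i22 := integrable_Tri3 k (half b + pi / 2) l2 l2.
rewrite -!intTZ//.
rewrite -!intTD; try by do ?apply: integrableTD; exact: integrableTZ.
rewrite -intTZ; last by do ?apply: integrableTD; exact: integrableTZ.
by congr intT; apply/funext => p; ring.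
Qed.

Definition PM u M : R * R -> R * R := fun p => (proj M (c1 u) p, proj M (c2 u) p).

Lemma L2per_PM u M : L2per L (PM u M).
Proof.
apply: L2per_intro; rewrite -?[c1 _]/(proj M (c1 u)) -?[c2 _]/(proj M (c2 u)).
- exact: L2s_mproj.
- exact: L2s_mproj.
- exact: periodic_mproj.
- exact: periodic_mproj.
Qed.

Lemma proj_subf M f g : L2s f -> L2s g ->
  (fun p => proj M f p - proj M g p) = proj M (fun p => f p - g p).
Proof.
move=> lf lg; apply/funext => p; rewrite /Submission.proj !mprojE -sumrB; apply: eq_bigr => k _.
by rewrite !coB//; ring.
Qed.

Lemma Tri3_sub_conv M f f' g g' k th (A A' B B' : int * int -> R) : L2s f -> L2s f' -> L2s g -> L2s g' ->
  (forall l, amp (fun p => f p - f' p) l <= 2 * A l) -> (forall l, amp f' l <= 2 * A' l) ->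
  (forall l, amp g l <= 2 * B l) -> (forall l, amp (fun p => g p - g' p) l <= 2 * B' l) ->
  `|Tri3 (proj M f) (proj M g) k th - Tri3 (proj M f') (proj M g') k th| <=
  4 * L ^+ 2 * (conv M A B k + conv M A' B' k).
Proof.
move=> lf lf' lg lg' HA HA' HB HB'; rewrite Tri3_diff; try exact: L2s_mproj.
rewrite !proj_subf//; apply: le_trans (ler_normD _ _) _.
have lfs := L2s_B lf lf'; have lgs := L2s_B lg lg'.
apply: le_trans (lerD (Tri3_conv M k th lfs lg) (Tri3_conv M k th lf' lgs)) _.
rewrite -mulrDr -mulrA mulrCA ler_wpM2l ?sqr_ge0// mulrDr.
have -> : 4 * conv M A B k = conv M (fun m => 2 * A m) (fun m => 2 * B m) k.
  by rewrite convZ; congr (_ * _); rewrite -natrM.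
have -> : 4 * conv M A' B' k = conv M (fun m => 2 * A' m) (fun m => 2 * B' m) k.
  by rewrite convZ; congr (_ * _); rewrite -natrM.
by apply: lerD; apply: ler_conv => l; rewrite amp_ge0 /=.
Qed.

Lemma dir_le1 k : `|dir1 k| <= 1 :> R /\ `|dir2 k| <= 1 :> R.
Proof.
have [->|k0] := eqVneq k 0; first by have [-> ->] := @dir0 R; rewrite normr0.
by split; rewrite -(@ler_pXn2r _ 2) ?nnegrE// real_normK ?num_real// expr1n -(@dir_sqr R k)//
  ?lerDl ?lerDr sqr_ge0.
Qed.

Lemma B_combination k (a b c d e : R) :
  `|a| <= e -> `|b| <= e -> `|c| <= e -> `|d| <= e ->
  `|kap * dcomb k a b c d| <= 4 * kap * (br k)%:R * e.
Proof.
move=> ae be ce de; have [d1 d2] := dir_le1 k; have [k1 k2] := absz_br (R := R) k.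
have one (x y z : R) : `|x| <= 1 -> `|y| <= (br k)%:R -> `|z| <= e -> `|x * y * z| <= (br k)%:R * e.
  by move=> x1 yb ze; rewrite !normrM; apply: ler_pM => //; rewrite -[leRHS]mul1r; exact: ler_pM.
rewrite (normrM kap) (ger0_norm (ltW (kap_gt0 L0))).
have -> : 4 * kap * (br k)%:R * e = kap * (4 * ((br k)%:R * e)) by ring.
rewrite ler_wpM2l ?(ltW (kap_gt0 L0))//.
have := one _ _ _ d1 k1 ae; have := one _ _ _ d1 k2 be.
have := one _ _ _ d2 k1 ce; have := one _ _ _ d2 k2 de.
rewrite /dcomb !ler_norml; lra.
Qed.

(** Each difference of products splits into terms with one factor from u - v and one from u or v.
    The 16 collects the four products and twice the factor 2 between [amp] and [X]. *)
Lemma Bphi_sub_conv M u v k b : inH L u -> inH L v ->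
  `|B_pair L (PM u M) (phi k b) - B_pair L (PM v M) (phi k b)| <=
  16 * kap * L ^+ 2 * (br k)%:R * conv M (X (subf u v)) (fun m => X u m + X v m) k.
Proof.
move=> uH vH; have lu : L2per L u by case: uH.
have lv : L2per L v by case: vH.
have [u1 u2 _ _] := L2per_comp lu; have [v1 v2 _ _] := L2per_comp lv.
rewrite !Bphi; try exact: L2per_PM.
have -> : forall x y : R, - x - (- y) = y - x by move=> x y; ring.
rewrite -(mulrBr kap) dcombB.
set th := half b + pi / 2.
have wH : inH L (subf u v) by exact: inH_subf.
have bnd f f' g g' : L2s f -> L2s f' -> L2s g -> L2s g' ->
  (forall l, amp (fun p => f p - f' p) l <= 2 * X (subf u v) l) -> (forall l, amp f' l <= 2 * X v l) ->
  (forall l, amp g l <= 2 * X u l) -> (forall l, amp (fun p => g p - g' p) l <= 2 * X (subf u v) l) ->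
  `|Tri3 (proj M f') (proj M g') k th - Tri3 (proj M f) (proj M g) k th| <=
    4 * L ^+ 2 * conv M (X (subf u v)) (fun m => X u m + X v m) k.
  move=> lf lf' lg lg' H1 H2 H3 H4; rewrite distrC convDr (convC _ _ (X v)).
  exact: Tri3_sub_conv.
have -> : 16 * kap * L ^+ 2 * (br k)%:R * conv M (X (subf u v)) (fun m => X u m + X v m) k =
  4 * kap * (br k)%:R * (4 * L ^+ 2 * conv M (X (subf u v)) (fun m => X u m + X v m) k) by ring.
apply: B_combination.
- by apply: bnd => // l; [exact: (amp_X l wH).1|exact: (amp_X l vH).1|exact: (amp_X l uH).1|exact: (amp_X l wH).1].
- by apply: bnd => // l; [exact: (amp_X l wH).2|exact: (amp_X l vH).2|exact: (amp_X l uH).1|exact: (amp_X l wH).1].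
- by apply: bnd => // l; [exact: (amp_X l wH).1|exact: (amp_X l vH).1|exact: (amp_X l uH).2|exact: (amp_X l wH).2].
- by apply: bnd => // l; [exact: (amp_X l wH).2|exact: (amp_X l vH).2|exact: (amp_X l uH).2|exact: (amp_X l wH).2].
Qed.

Lemma nrm_proj_le M f : L2s f -> nrm (proj M f) <= nrm f.
Proof.
move=> lf; rewrite -(@ler_pXn2r _ 2) ?nnegrE ?nrm_ge0//.
by have := nrm_sub_proj L0 M lf; have := sqr_ge0 (nrm (fun p => f p - proj M f p)); lra.
Qed.

Lemma Tri3_proj_cvg f g k th (e : R) : L2s f -> L2s g -> 0 < e -> exists N : nat, forall M, (N <= M)%N ->
  `|Tri3 f g k th - Tri3 (proj M f) (proj M g) k th| <= e.
Proof.
move=> lf lg e0; set B := nrm f + nrm g + 1.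
have f0 := nrm_ge0 L f; have g0 := nrm_ge0 L g.
have [B0 fB gB] : [/\ 0 < B, nrm f <= B & nrm g <= B] by rewrite /B; split; lra.
clearbody B.
have e20 : 0 < e / (2 * B) by rewrite divr_gt0// mulr_gt0.
have [N1 H1] := proj_cvg L0 lf e20; have [N2 H2] := proj_cvg L0 lg e20.
exists (maxn N1 N2) => M; rewrite geq_max => /andP[M1 M2].
have lpf : L2s (proj M f) by exact: L2s_mproj.
have lpg : L2s (proj M g) by exact: L2s_mproj.
rewrite Tri3_diff//; apply: le_trans (ler_normD _ _) _.
apply: le_trans (lerD (Tri3_bound k th (L2s_B lf lpf) lg) (Tri3_bound k th lpf (L2s_B lg lpg))) _.
have a := H1 M M1; have c := H2 M M2; have d := nrm_proj_le M lf.
have pB : nrm (proj M f) <= B by exact: le_trans d fB.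
apply: (@le_trans _ _ (e / (2 * B) * B + B * (e / (2 * B)))).
  exact: (lerD (ler_pM (nrm_ge0 _ _) (nrm_ge0 _ _) a gB) (ler_pM (nrm_ge0 _ _) (nrm_ge0 _ _) pB c)).
by rewrite le_eqVlt; apply/orP; left; apply/eqP; field; rewrite lt0r_neq0.
Qed.

Lemma dist_approx (a b a' b' S e : R) : `|a - a'| <= e / 2 -> `|b - b'| <= e / 2 ->
  `|a' - b'| <= S -> `|a - b| <= S + e.
Proof. by rewrite !ler_norml; lra. Qed.

Lemma Bphi_proj_cvg u k b (e : R) : L2per L u -> 0 < e -> exists N : nat, forall M, (N <= M)%N ->
  `|B_pair L u (phi k b) - B_pair L (PM u M) (phi k b)| <= e.
Proof.
move=> lu e0; have [u1 u2 _ _] := L2per_comp lu.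
pose th : R := half b + pi / 2.
have k0 := kap_gt0 L0; have b0 : 0 < (br k)%:R :> R by rewrite ltr0n.
have e'0 : 0 < e / (4 * kap * (br k)%:R) by apply: divr_gt0 => //; apply: mulr_gt0 => //; apply: mulr_gt0.
have [N1 H1] := Tri3_proj_cvg k th u1 u1 e'0; have [N2 H2] := Tri3_proj_cvg k th u2 u1 e'0.
have [N3 H3] := Tri3_proj_cvg k th u1 u2 e'0; have [N4 H4] := Tri3_proj_cvg k th u2 u2 e'0.
exists (maxn (maxn N1 N2) (maxn N3 N4)) => M; rewrite !geq_max => /andP[/andP[M1 M2] /andP[M3 M4]].
rewrite !Bphi//; last exact: L2per_PM.
have -> : forall x y : R, - x - (- y) = y - x by move=> x y; ring.
rewrite -(mulrBr kap) dcombB.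
have -> : e = 4 * kap * (br k)%:R * (e / (4 * kap * (br k)%:R)).
  by field; rewrite !lt0r_neq0.
by apply: B_combination; rewrite distrC; [exact: H1|exact: H2|exact: H3|exact: H4].
Qed.

(** The estimate for truncated fields passes to the fields themselves at the price of [e]. Finite
    boxes with an arbitrarily small error replace infinite convolutions throughout. *)
Lemma Bphi_sub u v k b (e : R) : inH L u -> inH L v -> 0 < e -> exists N : nat, forall M, (N <= M)%N ->
  `|B_pair L u (phi k b) - B_pair L v (phi k b)| <=
  16 * kap * L ^+ 2 * (br k)%:R * conv M (X (subf u v)) (fun m => X u m + X v m) k + e.
Proof.
move=> uH vH e0; have e2 : 0 < e / 2 by rewrite divr_gt0.
have lu : L2per L u by case: uH.
have lv : L2per L v by case: vH.
have [N1 H1] := Bphi_proj_cvg k b lu e2; have [N2 H2] := Bphi_proj_cvg k b lv e2.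
exists (maxn N1 N2) => M; rewrite geq_max => /andP[M1 M2].
exact: dist_approx (H1 M M1) (H2 M M2) (Bphi_sub_conv M k b uH vH).
Qed.

Lemma inH0 : inH L (fun=> (0, 0)).
Proof.
have [_ _ pH] := test_field_phi L0 0 true; have := inH_subf pH pH.
rewrite (_ : subf _ _ = fun=> (0, 0))//.
by apply/funext => p; rewrite /subf subrr.
Qed.

Lemma X0 k : X (fun=> (0, 0)) k = 0.
Proof.
have z0 b : co (fun=> 0) k b = 0.
  rewrite /Submission.co /Submission.ip (_ : (fun p => _) = fun=> 0) ?intT0 ?mul0r//.
  by apply/funext => p; rewrite mul0r.
have z b : xc (fun=> (0, 0)) k b = 0 by rewrite /Submission.xc !z0 !mulr0 addr0.
by rewrite /Submission.X !z expr0n addr0 sqrtr0.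
Qed.

Lemma Bphi_conv u k b (e : R) : inH L u -> 0 < e -> exists N : nat, forall M, (N <= M)%N ->
  `|B_pair L u (phi k b)| <= 16 * kap * L ^+ 2 * (br k)%:R * conv M (X u) (X u) k + e.
Proof.
move=> uH e0; have [N HN] := Bphi_sub k b uH inH0 e0.
exists N => M NM; have := HN M NM.
have B0 : B_pair L (fun=> (0, 0)) (phi k b) = 0.
  rewrite /B_pair [X in intT L X](_ : _ = fun=> 0) ?intT0 ?oppr0//.
  by apply/funext => p; rewrite /c1 /c2 /= !mul0r !addr0.
rewrite B0 subr0 (_ : subf _ _ = u); last first.
  by apply/funext => p; rewrite /subf; apply/eqP; rewrite -pair_eqE /pair_eq /= !subr0 !eqxx.
by rewrite (_ : (fun m => _) = X u)//; apply/funext => m; rewrite X0 addr0.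
Qed.

Lemma dx_mproj mul M f p : dx (mproj L mul M f) p = \sum_(k <- box M)
  (mul k * co f k true * (kap * k.1%:~R * tri k (half true + pi / 2) p) +
   mul k * co f k false * (kap * k.1%:~R * tri k (half false + pi / 2) p)).
Proof.
rewrite /mproj dx_tpoly /tpoly /tp_dx map_cat big_cat !big_map big_split /=.
by congr (_ + _); apply: eq_bigr => k _; rewrite -!mulrA.
Qed.

Lemma dy_mproj mul M f p : dy (mproj L mul M f) p = \sum_(k <- box M)
  (mul k * co f k true * (kap * k.2%:~R * tri k (half true + pi / 2) p) +
   mul k * co f k false * (kap * k.2%:~R * tri k (half false + pi / 2) p)).
Proof.
rewrite /mproj dy_tpoly /tpoly /tp_dy map_cat big_cat !big_map big_split /=.
by congr (_ + _); apply: eq_bigr => k _; rewrite -!mulrA.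
Qed.

Lemma test_scalar_proj M f : test_scalar L (proj M f).
Proof. exact: test_scalar_tpoly. Qed.

Definition Bfun w (f g : R * R -> R) : R * R -> R := fun p =>
  c1 w p * c1 w p * dx f p + c2 w p * c1 w p * dy f p +
  c1 w p * c2 w p * dx g p + c2 w p * c2 w p * dy g p.

Lemma continuous_test q : test_scalar L q -> [/\ continuous q, continuous (dx q) & continuous (dy q)].
Proof. by move=> [sq _]; split; [have [] := sq [::]|have [] := sq [:: true]|have [] := sq [:: false]]. Qed.

Lemma integrable_Bfun w f g : L2per L w -> test_scalar L f -> test_scalar L g ->
  mu2.-integrable (cell L) (EFin \o Bfun w f g).
Proof.
move=> /L2per_comp[l1 l2 _ _] /continuous_test[_ fx fy] /continuous_test[_ gx gy].
have H (a a' c : R * R -> R) : L2s a -> L2s a' -> continuous c ->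
    mu2.-integrable (cell L) (EFin \o (fun p => a p * a' p * c p)).
  move=> la lb cc; have [C HC] := continuous_cell_bounded L cc.
  by apply: L2s_MM HC => //; exact: continuous_measurable2.
by do ?apply: integrableTD; exact: H.
Qed.

Lemma B_proj_sum w u M : L2per L w -> inH L u ->
  B_pair L w (PM u M) = \sum_(k <- box M)
    (xc u k true * B_pair L w (phi k true) + xc u k false * B_pair L w (phi k false)).
Proof.
move=> lw uH.
have tp k b : test_scalar L (c1 (phi k b)) /\ test_scalar L (c2 (phi k b)).
  by have [] := test_field_phi L0 k b.
have ii k b : mu2.-integrable (cell L) (EFin \o Bfun w (c1 (phi k b)) (c2 (phi k b))).
  by apply: integrable_Bfun => //; have [] := tp k b.
have i2 k : mu2.-integrable (cell L) (EFin \o (fun p =>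
    xc u k true * Bfun w (c1 (phi k true)) (c2 (phi k true)) p +
    xc u k false * Bfun w (c1 (phi k false)) (c2 (phi k false)) p)).
  by apply: integrableTD; exact: integrableTZ.
transitivity (- intT L (fun p => \sum_(k <- box M)
    (xc u k true * Bfun w (c1 (phi k true)) (c2 (phi k true)) p +
    xc u k false * Bfun w (c1 (phi k false)) (c2 (phi k false)) p))).
  congr (- intT L _); apply/funext => p.
  rewrite -[c1 (PM u M)]/(proj M (c1 u)) -[c2 (PM u M)]/(proj M (c2 u)).
  rewrite /Submission.proj !dx_mproj !dy_mproj !mulr_sumr -!big_split; apply: eq_bigr => k _ /=.
  have [-> ->] := co_xc L0 k true uH; have [-> ->] := co_xc L0 k false uH.
  rewrite /Bfun !c1_phi !c2_phi !tpoly1 !dx_tri !dy_tri.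
  by ring.
rewrite (intT_sum (box M) i2).2 -sumrN; apply: eq_bigr => k _.
rewrite intTD ?intTZ//; try exact: integrableTZ.
by rewrite /B_pair opprD !mulrN.
Qed.

Lemma tpoly_sqrD s t : exists r, forall p, tpoly L s p * tpoly L s p + tpoly L t p * tpoly L t p = tpoly L r p.
Proof.
have [r1 H1] := tpolyM L s s; have [r2 H2] := tpolyM L t t.
by exists (r1 ++ r2) => p; rewrite H1 H2 tpolyD.
Qed.

Definition mPM mul u M : R * R -> R * R :=
  fun p => (mproj L mul M (c1 u) p, mproj L mul M (c2 u) p).

Lemma inH_mPM mul u M : (forall k, mul (- k) = mul k) -> inH L u -> inH L (mPM mul u M).
Proof.
move=> mulN uH; have lu : L2per L u by case: uH.
have [u1 u2 _ _] := L2per_comp lu.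
have z0 f : L2s f -> co f 0 true = 0 -> intT L (mproj L mul M f) = 0.
  move=> lf f0; have H0 : co (mproj L mul M f) 0 true = 0.
    by rewrite co_mproj ?f0 ?mulr0 ?if_same.
  move: H0; rewrite /Submission.co /Submission.ip (_ : (fun p => _) = mproj L mul M f).
    move/(congr1 (fun x => x * L ^+ 2)); rewrite mul0r divfK//.
    by rewrite expf_neq0// lt0r_neq0.
  by apply/funext => p; rewrite tri0 /half cos0 mulr1.
have [e1 e2] := inH_co0 true uH.
apply: inH_tpoly => //; [exact: z0 u1 e1|exact: z0 u2 e2|].
move=> p; rewrite -dx_tpoly -dy_tpoly -/(mproj L mul M (c1 u)) -/(mproj L mul M (c2 u)).
rewrite dx_mproj dy_mproj -big_split big1// => k _ /=.
have [-> ->] := co_xc L0 k true uH; have [-> ->] := co_xc L0 k false uH.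
have D := @dir_orth R k; set d1 := dir1 k in D *; set d2 := dir2 k in D *.
set t1 := tri _ _ _; set t2 := tri _ _ _; move: (mul k) => c.
have -> : c * (d2 * xc u k true) * (kap * k.2%:~R * t1) = c * kap * xc u k true * t1 * (k.2%:~R * d2) by ring.
have -> : c * (d2 * xc u k false) * (kap * k.2%:~R * t2) = c * kap * xc u k false * t2 * (k.2%:~R * d2) by ring.
have -> : k.2%:~R * d2 = - (k.1%:~R * d1) by lra.
by ring.
Qed.

Lemma inH_PM u M : inH L u -> inH L (PM u M).
Proof. by move=> uH; apply: (@inH_mPM (fun=> 1)). Qed.

Lemma derive1_sqrD (f g : R -> R) (x : R) : derivable f x 1 -> derivable g x 1 ->
  derive1 (fun y => f y * f y + g y * g y) x = 2 * (f x * derive1 f x + g x * derive1 g x).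
Proof.
move=> df dg; rewrite !derive1E.
have If := derivableP df; have Ig := derivableP dg.
have H := @derive_val _ _ _ _ _ _ _ (is_deriveD (is_deriveM If If) (is_deriveM Ig Ig)).
transitivity ('D_1 (f * f + g * g) x) => //.
by rewrite H /GRing.scale /=; ring.
Qed.

(** For w = [PM u M] the integrand is half of w . grad |w|^2, and |w|^2 is a trigonometric
    polynomial, hence a test function for div w = 0. *)
Lemma B_cancel u M : inH L u -> B_pair L (PM u M) (PM u M) = 0.
Proof.
move=> uH; have [_ _ _ dw] := inH_PM M uH.
set w1 := proj M (c1 u); set w2 := proj M (c2 u).
have tw1 : test_scalar L w1 by exact: test_scalar_proj.
have tw2 : test_scalar L w2 by exact: test_scalar_proj.
have [r Hr] := tpoly_sqrD
  ([seq (1 * co (c1 u) k true, (k, half true)) | k <- box M] ++ [seq (1 * co (c1 u) k false, (k, half false)) | k <- box M])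
  ([seq (1 * co (c2 u) k true, (k, half true)) | k <- box M] ++ [seq (1 * co (c2 u) k false, (k, half false)) | k <- box M]).
have Er : tpoly L r = fun p => w1 p * w1 p + w2 p * w2 p by apply/funext => p; rewrite -Hr.
have [sw1 _] := tw1; have [sw2 _] := tw2.
have [_ dw1] := sw1 [::]; have [_ dw2] := sw2 [::].
have e1 : c1 (PM u M) = w1 by [].
have e2 : c2 (PM u M) = w2 by [].
have xr p : dx (tpoly L r) p = 2 * (w1 p * dx w1 p + w2 p * dx w2 p).
  case: p => x y; rewrite Er /dx /=.
  by apply: derive1_sqrD; [exact: (dw1 (x, y)).1|exact: (dw2 (x, y)).1].
have yr p : dy (tpoly L r) p = 2 * (w1 p * dy w1 p + w2 p * dy w2 p).
  case: p => x y; rewrite Er /dy /=.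
  by apply: derive1_sqrD; [exact: (dw1 (x, y)).2|exact: (dw2 (x, y)).2].
have := dw _ (test_scalar_tpoly L0 r); rewrite e1 e2.
rewrite (_ : (fun p => _) = fun p => 2 * Bfun (PM u M) w1 w2 p); last first.
  apply/funext => p; rewrite xr yr /Bfun e1 e2.
  by move: (w1 p) (w2 p) (dx w1 p) (dx w2 p) (dy w1 p) (dy w2 p) => a b c d e f; ring.
rewrite intTZ; last by apply: integrable_Bfun => //; exact: L2per_PM.
move/eqP; rewrite mulf_eq0 pnatr_eq0 /= => /eqP H.
by rewrite /B_pair -/(Bfun (PM u M) w1 w2) H oppr0.
Qed.

End nonlinearity.

(** * The linear operators *)

Section spectral.
Context {R : realType}.
Variable L : R.
Hypothesis L0 : 0 < L.
Implicit Types (k l m : int * int) (b : bool) (f g q : R * R -> R) (u v w e : R * R -> R * R).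
Local Notation tri := (tri L).
Local Notation ip := (ip L).
Local Notation nrm := (nrm L).
Local Notation L2s := (L2s L).
Local Notation co := (co L).
Local Notation proj := (proj L).
Local Notation kap := (kap L).
Local Notation xc := (xc L).
Local Notation X := (X L).
Local Notation phi := (phi L).
Local Notation PM := (PM L).
Local Notation mu := (@lebesgue_measure R).
Local Notation mu2 := (mu \x mu)%E.

(** The symbol of A_1 up to [kap ^+ 2], namely (k_1^4 + k_2^4) / |k|^2. *)
Definition am k : R := dir1 k ^+ 2 * k.2%:~R ^+ 2 + dir2 k ^+ 2 * k.1%:~R ^+ 2.

Lemma A1_phi u k b : inH L u ->
  A1_pair L u (phi k b) = kap ^+ 2 * am k * L ^+ 2 * xc u k b.
Proof.
move=> uH; have lu : L2per L u by case: uH.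
have [l1 l2 _ _] := L2per_comp lu.
rewrite /A1_pair c1_phi c2_phi !tpoly1 !dy_tri !dx_tri.
rewrite (_ : (fun p => _) = (fun p =>
   (- (dir1 k * (kap * k.2%:~R) ^+ 2)) * (c1 u p * tri k (half b) p) +
   (- (dir2 k * (kap * k.1%:~R) ^+ 2)) * (c2 u p * tri k (half b) p))); last first.
  by apply/funext => p; rewrite tri_dpi; ring.
have i1 := L2s_M l1 (L2s_tri L k (half b)); have i2 := L2s_M l2 (L2s_tri L k (half b)).
rewrite intTD ?intTZ//; try exact: integrableTZ.
have E f : ip f (tri k (half b)) = L ^+ 2 * co f k b.
  by rewrite /Submission.co mulrC divfK// expf_neq0// lt0r_neq0.
rewrite -!/(Submission.ip L _ _) !E; have [-> ->] := co_xc L0 k b uH.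
by rewrite /am; ring.
Qed.

Lemma xc0 u b : xc u 0 b = 0.
Proof. by rewrite /Submission.xc; have [-> ->] := @dir0 R; rewrite !mul0r addr0. Qed.

Lemma X_0 u : X u 0 = 0.
Proof. by rewrite /Submission.X !xc0 expr0n addr0 sqrtr0. Qed.

Lemma en_br k : k != 0 -> (br k)%:R <= 2 * en k :> R.
Proof.
move=> k0; rewrite -(@ler_pXn2r _ 2) ?nnegrE ?mulr_ge0 ?en_ge0// exprMn en_sqr.
have H : (br k ^ 2 <= 4 * (`|k.1| ^ 2 + `|k.2| ^ 2))%N.
  have : (0 < maxn `|k.1| `|k.2|)%N.
    by rewrite leq_max !lt0n !absz_eq0; apply: contraNT k0; case: (k) => [a b] /=; rewrite negb_or !negbK => /andP[/eqP -> /eqP ->].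
  rewrite /br; case: (leqP `|k.1| `|k.2|) => _; nia.
have E (i : int) : i%:~R ^+ 2 = (`|i| ^ 2)%:R :> R.
  by rewrite natrX natr_absz intr_norm real_normK ?num_real.
have -> : 2 ^+ 2 = 4%:R :> R by rewrite -natrX.
by rewrite !E -natrD -natrM -natrX ler_nat.
Qed.

(** Because k_1^4 + k_2^4 >= |k|^4 / 2, the anisotropic operator loses only a factor 2 against the
    Laplacian; the remaining 4 is the square of the constant in [en_br]. *)
Lemma am_lower k : k != 0 -> (br k)%:R ^+ 2 <= 8 * am k.
Proof.
move=> k0; have e0 := @en_neq0 R k k0; have e2 : 0 < en k ^+ 2 :> R by rewrite exprn_even_gt0.
apply: (@le_trans _ _ (4 * en k ^+ 2)).
  by have := en_br k0; rewrite -(@ler_pXn2r _ 2) ?nnegrE ?mulr_ge0 ?en_ge0// exprMn; lra.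
rewrite -(ler_pM2r e2) /am /dir1 /dir2 sqrrN !expr_div_n.
have -> : 8 * (k.2%:~R ^+ 2 / en k ^+ 2 * k.2%:~R ^+ 2 + k.1%:~R ^+ 2 / en k ^+ 2 * k.1%:~R ^+ 2) * en k ^+ 2 =
   8 * (k.2%:~R ^+ 2 * k.2%:~R ^+ 2 + k.1%:~R ^+ 2 * k.1%:~R ^+ 2) :> R by field.
rewrite en_sqr; have := sqr_ge0 (k.1%:~R ^+ 2 - k.2%:~R ^+ 2 : R); lra.
Qed.

Lemma am_ge0 k : 0 <= am k.
Proof. by apply: addr_ge0; apply: mulr_ge0; exact: sqr_ge0. Qed.

Lemma am_upper k : am k <= 2 * (br k)%:R ^+ 2.
Proof.
have [k1 k2] := absz_br (R := R) k; have [d1 d2] := @dir_le1 R k.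
have H (a c d : R) : `|a| <= 1 -> `|c| <= d -> a ^+ 2 * c ^+ 2 <= d ^+ 2.
  move=> a1 cd; rewrite -[leRHS]mul1r; apply: ler_pM; rewrite ?sqr_ge0//.
    by rewrite -[leLHS]real_normK ?num_real// expr_le1.
  by rewrite -[leLHS]real_normK ?num_real// ler_pXn2r ?nnegrE//; exact: le_trans cd.
by have := H _ _ _ d1 k2; have := H _ _ _ d2 k1; rewrite /am; lra.
Qed.

Lemma am_X u k : (br k)%:R ^+ 2 * X u k ^+ 2 <= 8 * am k * X u k ^+ 2.
Proof.
have [->|k0] := eqVneq k 0; first by rewrite X_0 expr0n !mulr0.
by rewrite ler_wpM2r ?sqr_ge0// am_lower.
Qed.

Lemma Bphi_PM_conv M u k b : inH L u ->
  `|B_pair L (PM u M) (phi k b)| <= 16 * kap * L ^+ 2 * (br k)%:R * conv M (X u) (X u) k.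
Proof.
move=> uH; have := Bphi_sub_conv L0 M k b uH (inH0 L0).
have B0 : B_pair L (PM (fun=> (0, 0)) M) (phi k b) = 0.
  have z f : (forall k b, co f k b = 0) -> proj M f = fun=> 0.
    by move=> f0; apply/funext => p; rewrite /Submission.proj mprojE big1// => j _; rewrite !f0 !mulr0 !mul0r addr0.
  have z0 j b' : co (fun=> 0) j b' = 0.
    rewrite /Submission.co /Submission.ip (_ : (fun p => _) = fun=> 0) ?intT0 ?mul0r//.
    by apply/funext => p; rewrite mul0r.
  rewrite /B_pair [X in intT L X](_ : _ = fun=> 0) ?intT0 ?oppr0//.
  apply/funext => p; rewrite -[c1 (PM _ M)]/(proj M (fun=> 0)) -[c2 (PM _ M)]/(proj M (fun=> 0)).
  by rewrite z// !mul0r !addr0.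
rewrite B0 subr0 (_ : subf _ _ = u); last first.
  by apply/funext => p; rewrite /subf; apply/eqP; rewrite -pair_eqE /pair_eq /= !subr0 !eqxx.
by rewrite (_ : (fun m => _) = X u)//; apply/funext => m; rewrite X0 addr0.
Qed.

Lemma pair_bound (x y a c P C : R) : `|x| <= P -> `|y| <= P -> `|a| <= C -> `|c| <= C ->
  `|x * a + y * c| <= 2 * (P * C).
Proof.
move=> xP yP aC bC; apply: le_trans (ler_normD _ _) _; rewrite !normrM.
have := ler_pM (normr_ge0 _) (normr_ge0 _) xP aC.
have := ler_pM (normr_ge0 _) (normr_ge0 _) yP bC; lra.
Qed.

Lemma sum2B (x y a c d e : R) : x * a + y * c - (x * d + y * e) = x * (a - d) + y * (c - e).
Proof. by ring. Qed.

Lemma near_bound (a c S e : R) : `|a - c| <= e -> `|c| <= S -> `|a| <= S + e.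
Proof. by rewrite !ler_norml; lra. Qed.

(** For M >= K the cancellation makes the flux of [PM u M] into the box K the opposite of what the
    modes between K and M receive, so that one factor contains high modes only. Then M tends to
    infinity with K fixed. [A] bounds an H^(1/2) norm and [B] the H^1 norm of the modes outside the
    box. *)
Lemma B_tail u K (A B : R) : inH L u -> 0 <= A -> 0 <= B ->
  (forall M, \sum_(k <- box M) (br k)%:R * X u k ^+ 2 <= A ^+ 2) ->
  (forall M, \sum_(k <- box M | k \notin box K) (br k)%:R ^+ 2 * X u k ^+ 2 <= B ^+ 2) ->
  `|B_pair L u (PM u K)| <= 192 * kap * L ^+ 2 * A ^+ 2 * B.
Proof.
move=> uH A0 B0 HA HB; have lu : L2per L u by case: uH.
pose bb M k : R := B_pair L (PM u M) (phi k true).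
pose T M k : R := xc u k true * B_pair L (PM u M) (phi k true) +
                  xc u k false * B_pair L (PM u M) (phi k false).
have step1 M : (K <= M)%N -> `|B_pair L (PM u M) (PM u K)| <= 192 * kap * L ^+ 2 * A ^+ 2 * B.
  move=> KM; have := B_cancel L0 M uH; rewrite !B_proj_sum//; try exact: L2per_PM.
  rewrite -!/(T M _) (bigID (fun k => k \in box K)) /=.
  have -> : \sum_(k <- box M | k \in box K) T M k = \sum_(k <- box K) T M k.
    rewrite -big_filter; apply: perm_big; apply: uniq_perm; rewrite ?filter_uniq ?uniq_box//.
    by move=> k; rewrite mem_filter; case: (boolP (k \in box K)) => //= kK; rewrite (sub_box KM).
  move/eqP; rewrite addr_eq0 => /eqP ->; rewrite normrN.
  apply: le_trans (ler_norm_sum _ _ _) _.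
  apply: (@le_trans _ _ (\sum_(k <- box M | k \notin box K)
     32 * kap * L ^+ 2 * ((br k)%:R * X u k * conv M (X u) (X u) k))).
    apply: ler_sum => k _.
    have := pair_bound (xc_X L u k true) (xc_X L u k false) (Bphi_PM_conv M k true uH)
       (Bphi_PM_conv M k false uH) => H; apply: le_trans H _.
    by rewrite le_eqVlt; apply/orP; left; apply/eqP; ring.
  rewrite -mulr_sumr.
  have -> : 192 * kap * L ^+ 2 * A ^+ 2 * B = 32 * kap * L ^+ 2 * (6 * (A * B * A)) by ring.
  have kp := kap_gt0 L0; rewrite ler_wpM2l//; first exact: mulr_ge0 (mulr_ge0 _ (ltW kp)) (sqr_ge0 _).
  pose b k : R := if k \notin box K then (br k)%:R * X u k else 0.
  rewrite big_mkcond /= (_ : \sum_(k <- _) _ = \sum_(k <- box M) b k * conv M (X u) (X u) k); last first.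
    by apply: eq_bigr => k _; rewrite /b; case: ifP; rewrite ?mul0r.
  apply: trilinear_conv => //; try exact: X_ge0.
    by move=> k; rewrite /b; case: ifP => // _; rewrite mulr_ge0 ?X_ge0.
  rewrite (_ : \sum_(k <- _) _ = \sum_(k <- box M | k \notin box K) (br k)%:R ^+ 2 * X u k ^+ 2)//.
  rewrite [RHS]big_mkcond /=; apply: eq_bigr => k _.
  by rewrite /b; case: ifP; rewrite ?exprMn ?expr0n.
apply/ler_addgt0Pr => e e0.
suff [M KM HM] : exists2 M, (K <= M)%N & `|B_pair L u (PM u K) - B_pair L (PM u M) (PM u K)| <= e.
  exact: near_bound HM (step1 M KM).
pose D M k b : R := xc u k b * (B_pair L u (phi k b) - B_pair L (PM u M) (phi k b)).
have small k b d : 0 < d -> exists N : nat, forall M, (N <= M)%N -> `|D M k b| <= d.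
  move=> d0; have x1 : 0 < `|xc u k b| + 1 by have := normr_ge0 (xc u k b); lra.
  have d1 : 0 < d / (`|xc u k b| + 1) by exact: divr_gt0.
  have [N HN] := Bphi_proj_cvg L0 k b lu d1; exists N => M NM.
  rewrite /D normrM; have := HN M NM; rewrite ler_pdivlMr// => H; apply: le_trans H.
  rewrite mulrC ler_wpM2l//; lra.
have sm (s : seq (int * int)) d : 0 < d -> exists N : nat, forall M, (N <= M)%N ->
    `|\sum_(k <- s) (D M k true + D M k false)| <= d.
  elim: s d => [|k s IH] d d0; first by exists 0 => M _; rewrite big_nil normr0 ltW.
  have d3 : 0 < d / 3 by rewrite divr_gt0.
  have [N1 H1] := small k true _ d3; have [N2 H2] := small k false _ d3; have [N3 H3] := IH _ d3.
  exists (maxn N1 (maxn N2 N3)) => M; rewrite !geq_max => /and3P[M1 M2 M3].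
  rewrite big_cons; move: (H1 M M1) (H2 M M2) (H3 M M3); move: (D M k true) (D M k false) => x y.
  by move: (\sum_(_ <- _) _) => z; rewrite !ler_norml; lra.
have [N HN] := sm (box K) e e0; exists (maxn K N); rewrite ?leq_maxl//.
have := HN (maxn K N) (leq_maxr _ _).
rewrite !B_proj_sum//; last exact: L2per_PM.
set S := \sum_(k <- box K) (D _ k true + _); rewrite [X in _ -> `|X| <= _](_ : _ = S)//.
by rewrite /S -sumrB; apply: eq_bigr => k _; exact: sum2B.
Qed.

Lemma derive1_shift (f : R -> R) (c x : R) : (forall t, f (t + c) = f t) ->
  derive1 f (x + c) = derive1 f x.
Proof.
move=> fc; rewrite /derive1.
rewrite (_ : (fun h => h^-1 *: (f (h + (x + c)) - f (x + c))) = fun h => h^-1 *: (f (h + x) - f x))//.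
by apply/funext => h; rewrite addrA !fc.
Qed.

Lemma partials_rcons a c q : partials (rcons a c) q = partials a (if c then dx q else dy q).
Proof. by rewrite /partials foldr_rcons. Qed.

Lemma test_scalar_dx q : test_scalar L q -> test_scalar L (dx q).
Proof.
move=> [sq pq]; split; first by move=> a; have := sq (rcons a true); rewrite partials_rcons.
move=> p; have [_ _] := pq p; split; rewrite /dx /=.
  by apply: derive1_shift => t; have [] := pq (t, p.2).
by congr derive1; apply/funext => x; have [_] := pq (x, p.2).
Qed.

Lemma test_scalar_dy q : test_scalar L q -> test_scalar L (dy q).
Proof.
move=> [sq pq]; split; first by move=> a; have := sq (rcons a false); rewrite partials_rcons.
move=> p; have [_ _] := pq p; split; rewrite /dy /=.
  by congr derive1; apply/funext => x; have [] := pq (p.1, x).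
by apply: derive1_shift => t; have [_] := pq (p.1, t).
Qed.

Lemma tri_laplacian q c k th : test_scalar L q ->
  intT L (fun p => c * tri k th p * laplacian q p) =
  - (kap ^+ 2 * en k ^+ 2) * intT L (fun p => c * tri k th p * q p).
Proof.
move=> tq; have tx := test_scalar_dx tq; have ty := test_scalar_dy tq.
have tt c' th' := test_scalar_Ztri L0 c' k th'.
have [cq cx cy] := continuous_test tq.
have [_ cxx _] := continuous_test tx; have [_ _ cyy] := continuous_test ty.
have ct th' := @continuous_tri _ L k th'.
have ii (g h : R * R -> R) : continuous g -> continuous h ->
    mu2.-integrable (cell L) (EFin \o (fun p => g p * h p)).
  by move=> cg ch; apply: continuous_integrable_cell => p; apply: cvgM; [exact: cg|exact: ch].
have cc (c' : R) th' : continuous (fun p => c' * tri k th' p).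
  by move=> p; apply: cvgM; [exact: cvg_cst|exact: ct].
rewrite (_ : (fun p => _) = (fun p => c * tri k th p * dx (dx q) p + c * tri k th p * dy (dy q) p)); last first.
  by apply/funext => p; rewrite /laplacian mulrDr.
rewrite intTD; try exact: ii.
pose k1 : R := kap * k.1%:~R; pose k2 : R := kap * k.2%:~R.
have E1 : intT L (fun p => c * tri k th p * dx (dx q) p) =
    - intT L (fun p => c * k1 * tri k (th + pi / 2) p * dx q p).
  by have := IBP_x L0 (tt c th) tx; rewrite dx_tri.
have E2 : intT L (fun p => c * k1 * tri k (th + pi / 2) p * dx q p) =
    - intT L (fun p => c * k1 * k1 * tri k (th + pi / 2 + pi / 2) p * q p).
  by have := IBP_x L0 (tt (c * k1) (th + pi / 2)) tq; rewrite dx_tri.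
have E3 : intT L (fun p => c * tri k th p * dy (dy q) p) =
    - intT L (fun p => c * k2 * tri k (th + pi / 2) p * dy q p).
  by have := IBP_y L0 (tt c th) ty; rewrite dy_tri.
have E4 : intT L (fun p => c * k2 * tri k (th + pi / 2) p * dy q p) =
    - intT L (fun p => c * k2 * k2 * tri k (th + pi / 2 + pi / 2) p * q p).
  by have := IBP_y L0 (tt (c * k2) (th + pi / 2)) tq; rewrite dy_tri.
have [I EI] : exists I, I = intT L (fun p => c * tri k th p * q p) by eexists.
have E5 d : intT L (fun p => c * d * d * tri k (th + pi / 2 + pi / 2) p * q p) = - d ^+ 2 * I.
  rewrite EI -intTZ; last exact: ii.
  by congr intT; apply/funext => p; rewrite tri_dpi; ring.
have Ex : intT L (fun p => c * tri k th p * dx (dx q) p) = k1 ^+ 2 * - I.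
  by rewrite E1 E2 opprK E5 mulNr mulrN.
have Ey : intT L (fun p => c * tri k th p * dy (dy q) p) = k2 ^+ 2 * - I.
  by rewrite E3 E4 opprK E5 mulNr mulrN.
rewrite -EI; apply: etrans (congr2 +%R Ex Ey) _.
by rewrite en_sqr /k1 /k2; ring.
Qed.

Lemma phi_laplacian u k b : inH L u -> test_scalar L (c1 u) -> test_scalar L (c2 u) ->
  inner L (phi k b) (fun p => (laplacian (c1 u) p, laplacian (c2 u) p)) =
  - (kap ^+ 2 * en k ^+ 2) * inner L (phi k b) u.
Proof.
move=> uH t1 t2; have lap q : test_scalar L q -> continuous (laplacian q).
  move=> tq; have [_ cxx _] := continuous_test (test_scalar_dx tq).
  have [_ _ cyy] := continuous_test (test_scalar_dy tq).
  by move=> p; apply: cvgD; [exact: cxx|exact: cyy].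
have lu : L2per L u by case: uH.
have [u1 u2 _ _] := L2per_comp lu.
have lp := L2s_Ztri L; have c1p := c1_phi L k b; have c2p := c2_phi L k b.
rewrite tpoly1 in c1p; rewrite tpoly1 in c2p.
have i1 : L2s (laplacian (c1 u)) by exact: L2s_continuous (lap _ t1).
have i2 : L2s (laplacian (c2 u)) by exact: L2s_continuous (lap _ t2).
rewrite /inner !c1p !c2p.
rewrite -[c1 (fun p => _)]/(laplacian (c1 u)) -[c2 (fun p => _)]/(laplacian (c2 u)).
rewrite !intTD; try by apply: L2s_M.
apply: etrans (congr2 +%R (tri_laplacian (dir1 k) k (half b) t1) (tri_laplacian (dir2 k) k (half b) t2)) _.
exact/esym/mulrDr.
Qed.

Lemma stokes_eigen_phi k b : stokes_eigen L (kap ^+ 2 * en k ^+ 2) (phi k b).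
Proof.
have [t1 t2 pH] := test_field_phi L0 k b.
split=> //.
  have := inH_addZ (kap ^+ 2 * en k ^+ 2) (inH0 L0) pH.
  rewrite (_ : addZ _ _ _ = fun p => (kap ^+ 2 * en k ^+ 2) *: phi k b p)//.
  by apply/funext => p; rewrite /addZ; apply/eqP; rewrite -pair_eqE /pair_eq /= !add0r !eqxx.
move=> psi [tp1 tp2 psiH]; rewrite phi_laplacian//.
rewrite mulNr opprK /inner -intTZ.
  congr intT; apply/funext => p.
  change (kap ^+ 2 * en k ^+ 2 * c1 (phi k b) p * c1 psi p + kap ^+ 2 * en k ^+ 2 * c2 (phi k b) p * c2 psi p =
    kap ^+ 2 * en k ^+ 2 * (c1 (phi k b) p * c1 psi p + c2 (phi k b) p * c2 psi p)).
  by rewrite mulrDr !mulrA.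
have [l1 l2 _ _] := L2per_comp (L2per_phi L0 k b).
have : L2per L psi by case: psiH.
by move=> /L2per_comp[m1 m2 _ _]; apply: integrableTD; exact: L2s_M.
Qed.

(** An eigenvector need not be a single mode, but all its modes lie on the circle kap^2 |k|^2 = lam;
    this is why powers defined through eigenvectors act as Fourier multipliers. *)
Lemma eigen_xc lam e k b : stokes_eigen L lam e ->
  (lam - kap ^+ 2 * en k ^+ 2) * xc e k b = 0.
Proof.
move=> [eH leH H]; have tp := test_field_phi L0 k b; have [t1 t2 pH] := tp.
have le : L2per L e by case: eH.
have lle : L2per L (fun p => lam *: e p) by case: leH.
have sym u v : inner L u v = inner L v u.
  by congr intT; apply/funext => p; rewrite (mulrC (c1 u p)) (mulrC (c2 u p)).
have [e1 e2 _ _] := L2per_comp le.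
have := H _ tp; rewrite inner_phi//.
have -> : xc (fun p => lam *: e p) k b = lam * xc e k b.
  rewrite /Submission.xc -[c1 (fun p => lam *: e p)]/(fun p => lam * c1 e p).
  by rewrite -[c2 (fun p => lam *: e p)]/(fun p => lam * c2 e p) !coZ//; ring.
have -> : inner L e (fun p => (laplacian (c1 (phi k b)) p, laplacian (c2 (phi k b)) p)) =
   - (kap ^+ 2 * en k ^+ 2) * inner L e (phi k b).
  rewrite /inner -intTZ.
    congr intT; apply/funext => p.
    change (c1 e p * laplacian (c1 (phi k b)) p + c2 e p * laplacian (c2 (phi k b)) p =
      - (kap ^+ 2 * en k ^+ 2) * (c1 e p * c1 (phi k b) p + c2 e p * c2 (phi k b) p)).
    rewrite c1_phi c2_phi !tpoly1 /laplacian !dx_tri !dy_tri !tri_dpi en_sqr.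
    by ring.
  have [l1 l2 _ _] := L2per_comp (L2per_phi L0 k b).
  by apply: integrableTD; exact: L2s_M.
rewrite inner_phi// => E.
have L2 : L ^+ 2 != 0 by rewrite expf_neq0// lt0r_neq0.
by apply: (mulfI L2); rewrite mulr0; move: E; lra.
Qed.

Definition lamb k : R := kap ^+ 2 * en k ^+ 2.

Lemma lamb_ge0 k : 0 <= lamb k.
Proof. by rewrite /lamb mulr_ge0 ?sqr_ge0. Qed.

Lemma stokes_pow_xc s u w k b : stokes_pow L s u w ->
  xc w k b = (lamb k `^ (s / 2)) * xc u k b.
Proof.
move=> [uH wH H]; have := H _ _ (stokes_eigen_phi k b).
have lu : L2per L u by case: uH.
have lw : L2per L w by case: wH.
rewrite !inner_phi// -/(lamb k) mulrCA; apply: mulfI.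
by rewrite expf_neq0// lt0r_neq0.
Qed.

Lemma stokes_pow_X s u w k : stokes_pow L s u w -> X w k = (lamb k `^ (s / 2)) * X u k.
Proof.
move=> H; rewrite /Submission.X !(stokes_pow_xc _ _ H) !exprMn -mulrDr sqrtrM ?sqr_ge0//.
by rewrite sqrtr_sqr ger0_norm// powR_ge0.
Qed.

Lemma inHs_inH s u : inHs L s u -> inH L u.
Proof. by move=> [w []]. Qed.

Lemma X_le u k : inH L u -> X u k <= normL2 L u / L.
Proof.
move=> uH; rewrite ler_pdivlMr// -(@ler_pXn2r _ 2) ?nnegrE ?mulr_ge0 ?X_ge0 ?sqrtr_ge0 ?(ltW L0)//.
have [M kM] := seq_sub_box [:: k].
apply: le_trans (bessel_X L0 M uH); rewrite exprMn mulrC ler_wpM2l ?sqr_ge0//.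
rewrite (big_rem k) ?kM ?mem_head//= lerDl.
by apply: sumr_ge0 => j _; exact: sqr_ge0.
Qed.

Lemma powR_half_nat k (j : nat) : lamb k `^ (j.*2%:R / 2) = (kap * en k) ^+ j.*2.
Proof.
have -> : j.*2%:R / 2 = j%:R :> R by rewrite -muln2 natrM mulfK.
by rewrite powR_mulrn ?lamb_ge0// /lamb -exprMn -exprM mulnC muln2.
Qed.

(** A single coefficient of A^j u is bounded by its norm, and dividing by the power of the
    eigenvalue gives the decay. Even orders keep all exponents natural numbers. *)
Lemma inHs_decay (j : nat) u : inHs L j.*2%:R u ->
  exists2 C, 0 <= C & forall k, X u k <= C * (br k)%:R ^- j.*2.
Proof.
move=> [w sp]; have wH : inH L w by case: sp.
exists (normL2 L w / L * (2 / kap) ^+ j.*2).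
  have kp := kap_gt0 L0.
  by rewrite mulr_ge0 ?divr_ge0 ?sqrtr_ge0 ?(ltW L0)// exprn_ge0// divr_ge0// ltW.
move=> k; have [->|k0] := eqVneq k 0.
  rewrite X_0 mulr_ge0 ?invr_ge0 ?exprn_ge0//.
  have kp := kap_gt0 L0.
  by rewrite mulr_ge0 ?divr_ge0 ?sqrtr_ge0 ?(ltW L0)// exprn_ge0// divr_ge0// ltW.
have kp := kap_gt0 L0.
have b0 : 0 < (br k)%:R :> R by rewrite ltr0n.
rewrite ler_pdivlMr ?exprn_gt0//.
have := X_le k wH; rewrite (stokes_pow_X k sp) powR_half_nat => H.
apply: (@le_trans _ _ ((kap * en k) ^+ j.*2 * X u k * (2 / kap) ^+ j.*2)); last first.
  by rewrite ler_wpM2r ?exprn_ge0// divr_ge0// ltW.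
rewrite mulrC mulrAC -exprMn; apply: ler_wpM2r; first exact: X_ge0.
have -> : kap * en k * (2 / kap) = 2 * en k by field; rewrite lt0r_neq0.
by rewrite lerXn2r ?nnegrE ?mulr_ge0 ?en_ge0//; exact: en_br.
Qed.

End spectral.

(** * Sobolev norms as weighted sums of Fourier coefficients *)

Section sobolev.
Context {R : realType}.
Variable L : R.
Hypothesis L0 : 0 < L.
Implicit Types (k l m : int * int) (b : bool) (f g q : R * R -> R) (u v w e : R * R -> R * R).
Local Notation tri := (tri L).
Local Notation ip := (ip L).
Local Notation nrm := (nrm L).
Local Notation L2s := (L2s L).
Local Notation co := (co L).
Local Notation proj := (proj L).
Local Notation kap := (kap L).
Local Notation xc := (xc L).
Local Notation X := (X L).
Local Notation phi := (phi L).
Local Notation lamb := (lamb L).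
Local Notation mPM := (mPM L).

Lemma normL2_sqr u : L2per L u -> normL2 L u ^+ 2 = nrm (c1 u) ^+ 2 + nrm (c2 u) ^+ 2.
Proof.
by move=> lu; rewrite /normL2 inner_ip// sqr_sqrtr ?addr_ge0 ?ip_ge0// !nrm_sqr.
Qed.

(** Stated with an error [d] because all sums run over finite boxes. *)
Lemma parseval_X u (d : R) : inH L u -> 0 < d -> exists N : nat, forall M, (N <= M)%N ->
  normL2 L u ^+ 2 <= L ^+ 2 * \sum_(k <- box M) X u k ^+ 2 + d.
Proof.
move=> uH d0; have lu : L2per L u by case: uH.
have [l1 l2 _ _] := L2per_comp lu.
have d1 : 0 < Num.sqrt (d / 2) by rewrite sqrtr_gt0 divr_gt0.
have d2 : Num.sqrt (d / 2) ^+ 2 = d / 2 by rewrite sqr_sqrtr// ltW// divr_gt0.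
have H f : L2s f -> exists N : nat, forall M, (N <= M)%N ->
    nrm f ^+ 2 <= L ^+ 2 * \sum_(k <- box M) (co f k true ^+ 2 + co f k false ^+ 2) + d / 2.
  move=> lf; have [N HN] := proj_cvg L0 lf d1; exists N => M NM.
  have := HN M NM; rewrite -(@ler_pXn2r _ 2) ?nnegrE ?nrm_ge0 ?(ltW d1)// d2 (nrm_sub_proj L0 M lf).
  rewrite (@nrm_mproj _ L L0 (fun=> 1) (fun=> erefl))// /msum.
  have -> : \sum_(k <- box M) 1 ^+ 2 * (co f k true ^+ 2 + co f k false ^+ 2) =
     \sum_(k <- box M) (co f k true ^+ 2 + co f k false ^+ 2).
    by apply: eq_bigr => k _; rewrite expr1n mul1r.
  by lra.
have [N1 H1] := H _ l1; have [N2 H2] := H _ l2.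
exists (maxn N1 N2) => M; rewrite geq_max => /andP[M1 M2].
rewrite normL2_sqr//; have := H1 M M1; have := H2 M M2.
have -> : \sum_(k <- box M) X u k ^+ 2 =
    \sum_(k <- box M) (co (c1 u) k true ^+ 2 + co (c1 u) k false ^+ 2) +
    \sum_(k <- box M) (co (c2 u) k true ^+ 2 + co (c2 u) k false ^+ 2).
  by rewrite -big_split; apply: eq_bigr => k _; exact: X_co.
by lra.
Qed.

Lemma lamb_opp k : lamb (- k) = lamb k.
Proof. by rewrite /Submission.lamb en_opp. Qed.

Lemma lim_eq (a c : nat -> R) (x y t : R) :
  (forall d, 0 < d -> exists N : nat, forall n, (N <= n)%N -> `|x - a n| <= d) ->
  (forall d, 0 < d -> exists N : nat, forall n, (N <= n)%N -> `|y - c n| <= d) ->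
  (forall n, a n = t * c n) -> x = t * y.
Proof.
move=> ha hc E; apply/eqP; rewrite -subr_eq0 -normr_le0; apply/ler_addgt0Pr => d d0.
have t1 : 0 < `|t| + 1 by have := normr_ge0 t; lra.
have d2 : 0 < d / 2 by rewrite divr_gt0.
have d3 : 0 < d / 2 / (`|t| + 1) by rewrite divr_gt0.
have [N1 H1] := ha _ d2; have [N2 H2] := hc _ d3.
have := H1 _ (leq_maxl N1 N2); have := H2 _ (leq_maxr N1 N2).
set n := maxn N1 N2 => hy hx.
have -> : x - t * y = (x - a n) - t * (y - c n) by rewrite E; ring.
rewrite add0r; apply: le_trans (ler_normB _ _) _; rewrite normrM.
have : `|t| * `|y - c n| <= d / 2.
  rewrite -[leRHS](divfK (lt0r_neq0 t1)) mulrC; apply: ler_pM => //.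
  by rewrite lerDl.
by move: hx; lra.
Qed.

Lemma ip_cvg (F : nat -> R * R -> R) f g : (forall n, L2s (F n)) -> L2s f -> L2s g ->
  (forall d, 0 < d -> exists N : nat, forall n, (N <= n)%N -> nrm (fun p => f p - F n p) <= d) ->
  forall d, 0 < d -> exists N : nat, forall n, (N <= n)%N -> `|ip f g - ip (F n) g| <= d.
Proof.
move=> lF lf lg H d d0.
have g1 : 0 < nrm g + 1 by have := nrm_ge0 L g; lra.
have d1 : 0 < d / (nrm g + 1) by rewrite divr_gt0.
have [N HN] := H _ d1; exists N => n Nn.
rewrite -ipBl//; apply: le_trans (cauchy_ip (L2s_B lf (lF n)) lg) _.
rewrite -[leRHS](divfK (lt0r_neq0 g1)).
by apply: ler_pM (HN n Nn) _; rewrite ?nrm_ge0// lerDl.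
Qed.

Lemma cvg2D (a a' : nat -> R) (x x' : R) :
  (forall d, 0 < d -> exists N : nat, forall n, (N <= n)%N -> `|x - a n| <= d) ->
  (forall d, 0 < d -> exists N : nat, forall n, (N <= n)%N -> `|x' - a' n| <= d) ->
  forall d, 0 < d -> exists N : nat, forall n, (N <= n)%N -> `|x + x' - (a n + a' n)| <= d.
Proof.
move=> h h' d d0; have d2 : 0 < d / 2 by rewrite divr_gt0.
have [N HN] := h _ d2; have [N' HN'] := h' _ d2; exists (maxn N N') => n.
rewrite geq_max => /andP[n1 n2]; have := HN _ n1; have := HN' _ n2; rewrite !ler_norml; lra.
Qed.

(** Each component is synthesised separately; zero divergence and the relation to eigenvectors hold
    for the truncations and pass to the limit. *)
Lemma stokes_pow_intro (s B : R) u : inH L u ->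
  (forall M, L ^+ 2 * \sum_(k <- box M) (lamb k `^ (s / 2)) ^+ 2 * X u k ^+ 2 <= B) ->
  exists2 w, stokes_pow L s u w & normL2 L w ^+ 2 <= B.
Proof.
move=> uH HB; have lu : L2per L u by case: uH.
have [u1 u2 _ _] := L2per_comp lu.
pose mul k : R := lamb k `^ (s / 2).
have mulN k : mul (- k) = mul k by rewrite /mul lamb_opp.
have L2 : 0 < L ^+ 2 by rewrite exprn_gt0.
have H1 M : msum L mul M (c1 u) <= B / L ^+ 2.
  rewrite ler_pdivlMr// mulrC; apply: le_trans (HB M); rewrite ler_wpM2l ?(ltW L2)//.
  apply: ler_sum => k _; rewrite ler_wpM2l ?sqr_ge0// X_co// lerDl.
  by rewrite addr_ge0 ?sqr_ge0.
have H2 M : msum L mul M (c2 u) <= B / L ^+ 2.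
  rewrite ler_pdivlMr// mulrC; apply: le_trans (HB M); rewrite ler_wpM2l ?(ltW L2)//.
  apply: ler_sum => k _; rewrite ler_wpM2l ?sqr_ge0// X_co// lerDr.
  by rewrite addr_ge0 ?sqr_ge0.
have [g1 [lg1 pg1 cg1 Fg1]] := synthesis L0 mulN u1 (ex_intro _ _ H1).
have [g2 [lg2 pg2 cg2 Fg2]] := synthesis L0 mulN u2 (ex_intro _ _ H2).
pose w : R * R -> R * R := fun p => (g1 p, g2 p).
have lm M f : L2s (mproj L mul M f) by exact: L2s_mproj.
have lw : L2per L w by apply: L2per_intro.
have wH : inH L w.
  have m0 f g : (forall k b, co g k b = mul k * co f k b) -> co f 0 true = 0 -> intT L g = 0.
    move=> E f0; have := E 0 true; rewrite f0 mulr0.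
    rewrite /Submission.co /Submission.ip (_ : (fun p => _) = g).
      by move/(congr1 (fun x => x * L ^+ 2)); rewrite mul0r divfK// lt0r_neq0.
    by apply/funext => p; rewrite tri0 /half cos0 mulr1.
  have [e1 e2] := inH_co0 true uH.
  split=> //; [exact: m0 cg1 e1|exact: m0 cg2 e2|].
  move=> q tq; have [cq cx cy] := continuous_test tq.
  have lx : L2s (dx q) by exact: L2s_continuous.
  have ly : L2s (dy q) by exact: L2s_continuous.
  rewrite intTD; try exact: L2s_M.
  rewrite -/(Submission.ip L _ _) -/(Submission.ip L _ _).
  have C := cvg2D (ip_cvg (fun n => lm n _) lg1 lx Fg1) (ip_cvg (fun n => lm n _) lg2 ly Fg2).
  rewrite -[RHS](mul0r 0); apply: (lim_eq C (c := fun=> 0)).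
    by move=> d d0; exists 0 => n _; rewrite subrr normr0 ltW.
  move=> n; have [_ _ _ dm] := inH_mPM L0 n mulN uH; have := dm q tq.
  rewrite -[c1 (mPM mul u n)]/(mproj L mul n (c1 u)) -[c2 (mPM mul u n)]/(mproj L mul n (c2 u)) mul0r => <-.
  exact: (esym (intTD (L2s_M (lm _ _) lx) (L2s_M (lm _ _) ly))).
have sp : stokes_pow L s u w.
  split=> // lam e eig; have [eH _ _] := eig; have le : L2per L e by case: eH.
  have [l1 l2 _ _] := L2per_comp le.
  rewrite !inner_ip//.
  have C := cvg2D (ip_cvg (fun n => lm n _) lg1 l1 Fg1) (ip_cvg (fun n => lm n _) lg2 l2 Fg2).
  have pc f : L2s f -> forall d, 0 < d -> exists N : nat, forall n, (N <= n)%N ->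
      nrm (fun p => f p - proj n f p) <= d by move=> lf d; exact: proj_cvg.
  have lp n f : L2s (proj n f) by exact: L2s_mproj.
  have C' := cvg2D (ip_cvg (fun n => lp n _) u1 l1 (pc _ u1)) (ip_cvg (fun n => lp n _) u2 l2 (pc _ u2)).
  apply: (lim_eq C C') => n.
  rewrite !(ip_mprojl L0)// -!mulrDr mulrCA; congr (_ * _).
  rewrite -!big_split mulr_sumr; apply: eq_bigr => k _ /=.
  have [-> ->] := co_xc L0 k true eH; have [-> ->] := co_xc L0 k false eH.
  have key b : mul k * xc e k b = lam `^ (s / 2) * xc e k b.
    have /eqP := eigen_xc L0 k b eig; rewrite mulf_eq0 => /orP[|/eqP ->]; last by rewrite !mulr0.
    by rewrite subr_eq0 => /eqP ->.
  transitivity (co (c1 u) k true * dir1 k * (mul k * xc e k true) + co (c1 u) k false * dir1 k * (mul k * xc e k false) +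
    (co (c2 u) k true * dir2 k * (mul k * xc e k true) + co (c2 u) k false * dir2 k * (mul k * xc e k false))).
    by ring.
  by rewrite !key; ring.
exists w => //; apply/ler_addgt0Pr => d d0.
have [N HN] := parseval_X wH d0; apply: le_trans (HN N (leqnn N)) _; rewrite lerD2r.
apply: le_trans (HB N); rewrite ler_wpM2l ?(ltW L2)//; apply: ler_sum => k _.
by rewrite (stokes_pow_X L0 k sp) exprMn.
Qed.

Lemma normHs_le (s B : R) u : inH L u ->
  (forall M, L ^+ 2 * \sum_(k <- box M) (lamb k `^ (s / 2)) ^+ 2 * X u k ^+ 2 <= B) ->
  (normHs L s u ^+ 2 <= B%:E)%E.
Proof.
move=> uH HB; have [w sp wB] := stokes_pow_intro uH HB.
have H : (normHs L s u <= (normL2 L w)%:E)%E by apply: ereal_inf_lbound; exists w.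
have H0 : (0 <= normHs L s u)%E.
  by apply: le_ereal_inf_tmp => _ [w' _ <-]; rewrite lee_fin sqrtr_ge0.
apply: (@le_trans _ _ ((normL2 L w)%:E ^+ 2)%E); last by rewrite -EFin_expe lee_fin.
by rewrite !expe2; exact: lee_pmul.
Qed.

(** Outside the domain of the power the infimum runs over the empty set and is +oo, so the bound
    covers that case as well. *)
Lemma normHs_ge (s : R) u M :
  ((L ^+ 2 * \sum_(k <- box M) (lamb k `^ (s / 2)) ^+ 2 * X u k ^+ 2)%:E <= normHs L s u ^+ 2)%E.
Proof.
set a := L ^+ 2 * _.
have a0 : 0 <= a.
  by rewrite mulr_ge0 ?sqr_ge0//; apply: sumr_ge0 => k _; rewrite mulr_ge0 ?sqr_ge0.
have H : ((Num.sqrt a)%:E <= normHs L s u)%E.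
  apply: le_ereal_inf_tmp => _ [w sp <-]; rewrite lee_fin.
  have wH : inH L w by case: sp.
  rewrite -(@ler_pXn2r _ 2) ?nnegrE ?sqrtr_ge0// sqr_sqrtr//.
  apply: le_trans (bessel_X L0 M wH); rewrite ler_wpM2l ?sqr_ge0//.
  by apply: ler_sum => k _; rewrite (stokes_pow_X L0 k sp) exprMn.
rewrite -[leLHS]/(a%:E) -(sqr_sqrtr a0) EFin_expe !expe2.
by apply: lee_pmul => //; rewrite lee_fin sqrtr_ge0.
Qed.

End sobolev.

(** * Fourier coefficients of a solution *)

Section interval_integral.
Context {R : realType}.
Local Notation mu := (@lebesgue_measure R).
Implicit Types (f g : R -> R) (a b c t : R).

Definition Ir f a b : R := \int[mu]_(r in `[a, b]) f r.

Lemma integrable_itv f a b : continuous f -> mu.-integrable `[a, b] (EFin \o f).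
Proof.
move=> cf; apply: continuous_compact_integrable; first exact: segment_compact.
exact: continuous_subspaceT.
Qed.

Lemma Ir_ext f a b : continuous f ->
  (\int[mu]_(r in `[a, b]) (f r)%:E = (Ir f a b)%:E)%E.
Proof.
by move=> cf; rewrite /Ir /Rintegral fineK//; apply: integrable_fin_num => //; exact: integrable_itv.
Qed.

Lemma IrD f g a b : continuous f -> continuous g ->
  Ir (fun r => f r + g r) a b = Ir f a b + Ir g a b.
Proof. by move=> cf cg; apply: RintegralD => //; exact: integrable_itv. Qed.

Lemma IrB f g a b : continuous f -> continuous g ->
  Ir (fun r => f r - g r) a b = Ir f a b - Ir g a b.
Proof. by move=> cf cg; apply: RintegralB => //; exact: integrable_itv. Qed.

Lemma IrZ c f a b : continuous f -> Ir (fun r => c * f r) a b = c * Ir f a b.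
Proof. by move=> cf; apply: RintegralZl => //; exact: integrable_itv. Qed.

Lemma Ir_le f g a b : continuous f -> continuous g ->
  (forall r, a <= r <= b -> f r <= g r) -> Ir f a b <= Ir g a b.
Proof.
move=> cf cg fg; apply: le_Rintegral; [by []|exact: integrable_itv|exact: integrable_itv|].
by move=> x /=; rewrite in_itv /=; exact: fg.
Qed.

Lemma Ir0 a b : Ir (fun=> 0) a b = 0.
Proof. by rewrite /Ir /Rintegral integral0. Qed.

Lemma Ir_ge0 f a b : continuous f -> (forall r, a <= r <= b -> 0 <= f r) -> 0 <= Ir f a b.
Proof. by move=> cf f0; rewrite -(Ir0 a b); apply: Ir_le => // r; exact: cvg_cst. Qed.

Lemma continuous_sumr (I : Type) (s : seq I) (F : I -> R -> R) :
  (forall i, continuous (F i)) -> continuous (fun r => \sum_(i <- s) F i r).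
Proof.
move=> cF; elim: s => [|i s IH] r.
  rewrite (_ : (fun r => _) = fun=> 0); first exact: cvg_cst.
  by apply/funext => x; rewrite big_nil.
rewrite (_ : (fun r => _) = fun r => F i r + \sum_(j <- s) F j r).
  by apply: cvgD; [exact: cF|exact: IH].
by apply/funext => x; rewrite big_cons.
Qed.

Lemma Ir_sum (I : Type) (s : seq I) (F : I -> R -> R) a b : (forall i, continuous (F i)) ->
  Ir (fun r => \sum_(i <- s) F i r) a b = \sum_(i <- s) Ir (F i) a b.
Proof.
move=> cF; elim: s => [|i s IH].
  rewrite big_nil -[RHS](Ir0 a b); congr Ir; apply/funext => x; exact: big_nil.
rewrite big_cons -IH -IrD//; last exact: continuous_sumr.
by congr Ir; apply/funext => x; rewrite big_cons.
Qed.

Lemma Ir_cst c a b : a <= b -> Ir (fun=> c) a b = c * (b - a).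
Proof.
move=> ab; rewrite /Ir Rintegral_cst//= lebesgue_measure_itv/= lte_fin.
by move: ab; rewrite le_eqVlt => /predU1P[->|->]; rewrite ?ltxx ?subrr.
Qed.

Lemma Ir_split f a b c : continuous f -> a <= b -> b <= c -> Ir f a c = Ir f a b + Ir f b c.
Proof.
move=> cf ab bc; apply/eqP; rewrite addrC -subr_eq; apply/eqP.
rewrite /Ir Rintegral_itvB ?bnd_simp//; last exact: integrable_itv.
apply: Rintegral_itv_obnd_cbnd.
by apply: integrableS (integrable_itv b c cf) => //; apply: subset_itv; rewrite bnd_simp.
Qed.

Lemma Ir_FTC2 F f a b : a <= b -> continuous F -> continuous f ->
  (forall x, a < x < b -> is_derive x 1 F (f x)) -> Ir f a b = F b - F a.
Proof.
move=> ab cF cf dF; move: ab; rewrite le_eqVlt => /predU1P[<-|ab].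
  by rewrite subrr /Ir set_itv1 Rintegral_set1.
have := @continuous_FTC2 _ f F a b ab (continuous_subspaceT cf).
move=> H; rewrite /Ir /Rintegral H//.
- split=> [x||].
  + by rewrite in_itv /= => /dF d; apply: ex_derive.
  + by apply: cvg_at_right_filter; exact: cF.
  + by apply: cvg_at_left_filter; exact: cF.
- by move=> x; rewrite in_itv /= => /dF d; rewrite derive1E; apply: derive_val.
Qed.

Lemma Ir_FTC1 f t : continuous f -> 0 < t -> is_derive t 1 (fun x => Ir f 0 x) (f t).
Proof.
move=> cf t0; have t1 : t < t + 1 by rewrite ltrDl.
have [d e] := continuous_FTC1_closed t1 (integrable_itv 0 (t + 1) cf) t0 (cf t).
by rewrite -e derive1E; exact: derivableP.
Qed.

(** The equation holds for t > 0 only, whereas [x] and [g] are continuous on the whole line, so that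
    integrals over any interval make sense and may start at 0. *)
Definition mode (m : R) (g x : R -> R) : Prop :=
  [/\ continuous x, continuous g & forall t, 0 < t -> is_derive t 1 x (g t - m * x t)].

Lemma mode_energy m g x s t : mode m g x -> 0 <= s -> s <= t ->
  x t ^+ 2 + Ir (fun r => 2 * m * x r ^+ 2) s t = x s ^+ 2 + Ir (fun r => 2 * (x r * g r)) s t.
Proof.
move=> [cx cg dx] s0 st.
have cx2 : continuous (fun r => x r ^+ 2).
  by move=> r; rewrite (_ : (fun r => _) = (fun r => x r * x r)); [apply: cvgM; exact: cx|apply/funext].
have cxg : continuous (fun r => 2 * (x r * g r)).
  by move=> r; apply: cvgM; [exact: cvg_cst|apply: cvgM; [exact: cx|exact: cg]].
have cmx : continuous (fun r => 2 * m * x r ^+ 2).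
  by move=> r; apply: cvgM; [exact: cvg_cst|exact: cx2].
have cm' : continuous (fun r => (-1) * (2 * m * x r ^+ 2)).
  by move=> r; apply: cvgM; [exact: cvg_cst|exact: cmx].
have H := @Ir_FTC2 (fun r => x r ^+ 2) (fun r => 2 * (x r * g r) + (-1) * (2 * m * x r ^+ 2)) s t st cx2.
have Z := IrZ (-1) s t cmx; have D := IrD s t cxg cm'; rewrite Z in D.
suff E : Ir (fun r => 2 * (x r * g r) + (-1) * (2 * m * x r ^+ 2)) s t = x t ^+ 2 - x s ^+ 2.
  by rewrite E in D; lra.
apply: H; first by move=> r; apply: cvgD; [exact: cxg|exact: cm'].
move=> r /andP[sr _]; have r0 : 0 < r by exact: le_lt_trans sr.
have d := dx r r0; rewrite (_ : (fun r => x r ^+ 2) = x * x); last by apply/funext.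
apply: (is_derive_eq (is_deriveM d d)).
by rewrite /GRing.scale /=; ring.
Qed.

(** The function e^(m r) (x r - G / m) has the nonpositive derivative e^(m r) (g r - G). The
    one-sided form is applied to [x] and to its negative. *)
Lemma mode_duhamel_le m g x s t G : mode m g x -> 0 < m -> 0 <= s -> s <= t ->
  (forall r, s <= r <= t -> g r <= G) -> 0 <= G ->
  x t <= `|x s| * expR (- (m * (t - s))) + G / m.
Proof.
move=> [cx cg dx] m0 s0 st gG G0.
have ce : continuous (fun r => expR (m * r)).
  move=> r; apply: (@continuous_comp _ _ _ (fun r => m * r) expR); last exact: continuous_expR.
  by apply: cvgM; [exact: cvg_cst|exact: cvg_id].
pose F r := expR (m * r) * (x r - G / m); pose f r := expR (m * r) * (g r - G).
have cF : continuous F.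
  by move=> r; apply: cvgM; [exact: ce|apply: cvgB; [exact: cx|exact: cvg_cst]].
have cf : continuous f.
  by move=> r; apply: cvgM; [exact: ce|apply: cvgB; [exact: cg|exact: cvg_cst]].
have := @Ir_FTC2 F f s t st cF cf.
have dF r : s < r < t -> is_derive r 1 F (f r).
  move=> /andP[sr _]; have r0 : 0 < r by exact: le_lt_trans sr.
  have d := dx r r0.
  have d1 : is_derive r 1 (fun r => m * r) m.
    have := is_deriveZ m (is_derive_id r 1); rewrite /GRing.scale /= mulr1; exact.
  have d2 : is_derive r 1 (fun r => expR (m * r)) (m * expR (m * r)).
    by have := is_derive1_comp (f := expR) (g := fun r => m * r) (is_derive_expR _) d1; rewrite mulrC.
  have d3 : is_derive r 1 (fun r => x r - G / m) (g r - m * x r).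
    have := is_deriveB d (is_derive_cst (G / m) r 1); rewrite subr0; exact.
  rewrite /F (_ : (fun r => expR (m * r) * (x r - G / m)) =
    (fun r => expR (m * r)) * (fun r => x r - G / m)); last by apply/funext.
  apply: (is_derive_eq (is_deriveM d2 d3)).
  by rewrite /f /GRing.scale /=; field; rewrite lt0r_neq0.
move=> /(_ dF) E.
have : Ir f s t <= 0.
  rewrite -(Ir0 s t); apply: Ir_le => //; first by move=> r; exact: cvg_cst.
  by move=> r sr; rewrite /f pmulr_rle0 ?expR_gt0// subr_le0 gG.
rewrite E subr_le0 /F => le1.
have e1 : expR (m * s) = expR (- (m * (t - s))) * expR (m * t).
  by rewrite -expRD; congr expR; ring.
move: le1; rewrite e1 mulrAC [leRHS]mulrC ler_pM2l ?expR_gt0// => le1.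
have Gm : 0 <= G / m by rewrite divr_ge0// ltW.
have ep := expR_gt0 (- (m * (t - s))).
have : expR (- (m * (t - s))) * (x s - G / m) <= `|x s| * expR (- (m * (t - s))).
  by rewrite mulrC (ler_wpM2r (ltW ep))//; have := ler_norm (x s); lra.
by lra.
Qed.

Lemma modeN m g x : mode m g x -> mode m (fun r => - g r) (fun r => - x r).
Proof.
move=> [cx cg dx]; split.
- by move=> r; apply: cvgN; exact: cx.
- by move=> r; apply: cvgN; exact: cg.
- move=> t t0; have d := dx t t0; have := is_deriveN d.
  by rewrite opprB mulrN opprK addrC; exact.
Qed.

Lemma modeB m g x g' x' : mode m g x -> mode m g' x' ->
  mode m (fun r => g r - g' r) (fun r => x r - x' r).
Proof.
move=> [cx cg dx] [cx' cg' dx']; split.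
- by move=> r; apply: cvgB; [exact: cx|exact: cx'].
- by move=> r; apply: cvgB; [exact: cg|exact: cg'].
- move=> t t0; have d := dx t t0; have d' := dx' t t0; have := is_deriveB d d'.
  by rewrite (_ : g t - m * x t - (g' t - m * x' t) = g t - g' t - m * (x t - x' t)); [exact|ring].
Qed.

Lemma mode_duhamel m g x s t G : mode m g x -> 0 < m -> 0 <= s -> s <= t ->
  (forall r, s <= r <= t -> `|g r| <= G) -> 0 <= G ->
  `|x t| <= `|x s| * expR (- (m * (t - s))) + G / m.
Proof.
move=> md m0 s0 st gG G0; rewrite ler_norml; apply/andP; split.
  rewrite lerNl -(normrN (x s)); apply: (mode_duhamel_le (modeN md)) => // r sr.
  by have := gG r sr; rewrite ler_norml => /andP[]; rewrite lerNl.
apply: (mode_duhamel_le md) => // r sr.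
by have := gG r sr; rewrite ler_norml => /andP[].
Qed.

(** One term of the exponential series; it converts the damping over a fixed time into any desired
    power of the frequency. *)
Lemma expR_decay (j : nat) (a : R) : 0 < a -> expR (- a) <= j`!%:R / a ^+ j.
Proof.
move=> a0; rewrite expRN ler_pdivlMr ?exprn_gt0// mulrC ler_pdivrMr ?expR_gt0//.
rewrite -ler_pdivrMl ?ltr0n ?fact_gt0// mulrC.
case: j => [|j]; first by rewrite expr0 fact0 divr1 -[leLHS]addr0 (le_trans _ (expR_ge1Dx a))// lerD2l ltW.
by apply: le_trans (expR_ge1Dxn j (ltW a0)); rewrite lerDr.
Qed.

End interval_integral.

(** * Ordinary differential equations for the modes of a weak solution *)

Section solution.
Context {R : realType}.
Variable L : R.
Hypothesis L0 : 0 < L.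
Local Notation mu := (@lebesgue_measure R).
Local Notation nrm := (nrm L).
Local Notation kap := (kap L).
Local Notation xc := (xc L).
Local Notation X := (X L).
Local Notation phi := (phi L).
Local Notation L2s := (L2s L).
Implicit Types (u v w f h : R * R -> R * R) (k : int * int) (b : bool).

Lemma normL2_comp u : L2per L u -> nrm (c1 u) <= normL2 L u /\ nrm (c2 u) <= normL2 L u.
Proof.
move=> lu; have E := normL2_sqr lu.
by split; rewrite -(@ler_pXn2r _ 2) ?nnegrE ?nrm_ge0 ?sqrtr_ge0// E ?lerDl ?lerDr sqr_ge0.
Qed.

Lemma minkowski2 (a b c d A C x y : R) : 0 <= a -> 0 <= b -> 0 <= c -> 0 <= d -> 0 <= A -> 0 <= C ->
  A ^+ 2 = a ^+ 2 + b ^+ 2 -> C ^+ 2 = c ^+ 2 + d ^+ 2 ->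
  0 <= x -> 0 <= y -> x <= a + c -> y <= b + d -> x ^+ 2 + y ^+ 2 <= (A + C) ^+ 2.
Proof.
move=> a0 b0 c0 d0 A0 C0 EA EC x0 y0 xa yb.
apply: (@le_trans _ _ ((a + c) ^+ 2 + (b + d) ^+ 2)).
  by apply: lerD; rewrite ler_pXn2r ?nnegrE ?addr_ge0.
suff : a * c + b * d <= A * C by lra.
rewrite -(@ler_pXn2r _ 2) ?nnegrE ?addr_ge0 ?mulr_ge0// exprMn EA EC.
by have := sqr_ge0 (a * d - b * c); lra.
Qed.

Lemma normL2_addZ u (z : R) v : L2per L u -> L2per L v ->
  normL2 L (addZ u z v) <= normL2 L u + `|z| * normL2 L v.
Proof.
move=> lu lv; have lz : L2per L (addZ u z v).
  have [u1 u2 pu1 pu2] := L2per_comp lu; have [v1 v2 pv1 pv2] := L2per_comp lv.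
  apply: L2per_intro.
  - exact: (L2s_D u1 (L2s_Z z v1)).
  - exact: (L2s_D u2 (L2s_Z z v2)).
  - by move=> p; rewrite /addZ /c1 /=; have [e1 e2] := pu1 p; have [e3 e4] := pv1 p;
      move: e1 e2 e3 e4; rewrite /c1 => -> -> -> ->.
  - by move=> p; rewrite /addZ /c2 /=; have [e1 e2] := pu2 p; have [e3 e4] := pv2 p;
      move: e1 e2 e3 e4; rewrite /c2 => -> -> -> ->.
have [u1 u2 _ _] := L2per_comp lu; have [v1 v2 _ _] := L2per_comp lv.
have h1 := nrmD u1 (L2s_Z z v1); rewrite nrmZ// in h1.
have h2 := nrmD u2 (L2s_Z z v2); rewrite nrmZ// in h2.
have ge0 w : 0 <= normL2 L w by exact: sqrtr_ge0.
rewrite -(@ler_pXn2r _ 2) ?nnegrE ?addr_ge0 ?mulr_ge0//.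
rewrite (normL2_sqr lz).
apply: (minkowski2 (a := nrm (c1 u)) (b := nrm (c2 u)) (c := `|z| * nrm (c1 v)) (d := `|z| * nrm (c2 v))) => //;
  rewrite ?mulr_ge0 ?nrm_ge0//.
- exact: normL2_sqr.
- by rewrite !exprMn (normL2_sqr lv) mulrDr.
Qed.

Lemma normL2_subf u v : L2per L u -> L2per L v -> normL2 L u <= normL2 L (subf u v) + normL2 L v.
Proof.
move=> lu lv; have {1}-> : u = addZ (subf u v) 1 v.
  by apply/funext => p; rewrite /addZ /subf scale1r subrK.
have ls : L2per L (subf u v).
  have [u1 u2 pu1 pu2] := L2per_comp lu; have [v1 v2 pv1 pv2] := L2per_comp lv.
  apply: L2per_intro.
  - exact: (L2s_B u1 v1).
  - exact: (L2s_B u2 v2).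
  - by move=> p; rewrite /subf /c1 /=; have [e1 e2] := pu1 p; have [e3 e4] := pv1 p;
      move: e1 e2 e3 e4; rewrite /c1 => -> -> -> ->.
  - by move=> p; rewrite /subf /c2 /=; have [e1 e2] := pu2 p; have [e3 e4] := pv2 p;
      move: e1 e2 e3 e4; rewrite /c2 => -> -> -> ->.
by apply: le_trans (normL2_addZ 1 ls lv) _; rewrite normr1 mul1r.
Qed.

Lemma normL2_subfC u v : normL2 L (subf u v) = normL2 L (subf v u).
Proof.
rewrite /normL2 /inner; congr (Num.sqrt (intT L _)); apply/funext => p.
by rewrite /subf /c1 /c2 /=; ring.
Qed.

Lemma ler_sum_diff (A S B : R) : A <= S + B -> A + B <= 2 * B + S.
Proof. lra. Qed.

(** Only L^2 norms appear on the right, because continuity in time is known in L^2 only. *)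
Lemma Bphi_lip u v k b : inH L u -> inH L v ->
  `|B_pair L u (phi k b) - B_pair L v (phi k b)| <=
  4 * kap * (br k)%:R * (normL2 L (subf u v) * (normL2 L u + normL2 L v)).
Proof.
move=> uH vH; have lu : L2per L u by case: uH.
have lv : L2per L v by case: vH.
have lw : L2per L (subf u v) by case: (inH_subf uH vH).
have [u1 u2 _ _] := L2per_comp lu; have [v1 v2 _ _] := L2per_comp lv.
have [nu1 nu2] := normL2_comp lu; have [nv1 nv2] := normL2_comp lv; have [nw1 nw2] := normL2_comp lw.
rewrite !Bphi//.
have -> : forall x y : R, - x - (- y) = y - x by move=> x y; ring.
rewrite -(mulrBr kap) dcombB.
have key (f g f' g' : R * R -> R) : L2s f -> L2s g -> L2s f' -> L2s g' ->
    nrm (fun p => f p - f' p) <= normL2 L (subf u v) -> nrm (fun p => g p - g' p) <= normL2 L (subf u v) ->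
    nrm g <= normL2 L u -> nrm f' <= normL2 L v -> forall th,
    `|Tri3 L f' g' k th - Tri3 L f g k th| <= normL2 L (subf u v) * (normL2 L u + normL2 L v).
  move=> lf lg lf' lg' h1 h2 h3 h4 th; rewrite distrC Tri3_diff//.
  apply: le_trans (ler_normD _ _) _; rewrite mulrDr (mulrC _ (normL2 L v)).
  apply: lerD.
    apply: le_trans (Tri3_bound _ _ (L2s_B lf lf') lg) _.
    exact: ler_pM (nrm_ge0 _ _) (nrm_ge0 _ _) h1 h3.
  apply: le_trans (Tri3_bound _ _ lf' (L2s_B lg lg')) _.
  exact: ler_pM (nrm_ge0 _ _) (nrm_ge0 _ _) h4 h2.
apply: B_combination => //.
- exact: (key _ _ _ _ u1 u1 v1 v1 nw1 nw1 nu1 nv1 _).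
- exact: (key _ _ _ _ u2 u1 v2 v1 nw2 nw1 nu1 nv2 _).
- exact: (key _ _ _ _ u1 u2 v1 v2 nw1 nw2 nu2 nv1 _).
- exact: (key _ _ _ _ u2 u2 v2 v2 nw2 nw2 nu2 nv2 _).
Qed.

Lemma B_phi_bound u k b : inH L u ->
  `|B_pair L u (phi k b)| <= 4 * kap * (br k)%:R * normL2 L u ^+ 2.
Proof.
move=> uH; have := Bphi_lip k b uH (inH0 L0).
have B0 : B_pair L (fun=> (0, 0)) (phi k b) = 0.
  rewrite /B_pair [X in intT L X](_ : _ = fun=> 0) ?intT0 ?oppr0//.
  by apply/funext => p; rewrite /c1 /c2 /= !mul0r !addr0.
have n0 : normL2 L (fun=> (0, 0)) = 0.
  rewrite /normL2 /inner [X in intT L X](_ : _ = fun=> 0) ?intT0 ?sqrtr0//.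
  by apply/funext => p; rewrite /c1 /c2 /= !mul0r addr0.
rewrite B0 subr0 n0 addr0 (_ : subf _ _ = u) ?expr2//.
by apply/funext => p; rewrite /subf; apply/eqP; rewrite -pair_eqE /pair_eq /= !subr0 !eqxx.
Qed.

(** The factor D + d leaves room for a quadratic term: increments of the nonlinearity are of size d
    (2 |u| + d). *)
Lemma cvg_lip (F d : R -> R) t (C D : R) : 0 <= C -> 0 <= D -> (forall r, 0 <= d r) ->
  d r @[r --> t] --> 0 -> (forall r, `|F r - F t| <= C * (d r * (D + d r))) ->
  F r @[r --> t] --> F t.
Proof.
move=> C0 D0 d0 cd H; apply/cvgrPdist_lt => e e0.
have K0 : 0 < C * (D + 1) + 1 by have := mulr_ge0 C0 (addr_ge0 D0 ler01); lra.
have e1 : 0 < Num.min 1 (e / (C * (D + 1) + 1)) by rewrite lt_min ltr01 divr_gt0.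
have /cvgrPdist_lt /(_ _ e1) := cd; apply: filterS => r.
rewrite sub0r normrN ger0_norm// lt_min => /andP[d1 d2].
rewrite distrC; apply: le_lt_trans (H r) _.
apply: (@le_lt_trans _ _ (d r * (C * (D + 1)))).
  by rewrite mulrCA ler_wpM2l// ler_wpM2l// lerD2l ltW.
move: d2; rewrite ltr_pdivlMr// => d2; apply: le_lt_trans d2.
by rewrite ler_wpM2l// lerDl.
Qed.

Variables (nu : R) (f h v0 : R * R -> R * R) (z : R -> R) (v : R -> R * R -> R * R).
Hypotheses (nu0 : 0 < nu) (fH : inH L f) (hH : inH L h) (cz : continuous z).
Hypothesis ws : weak_solution L nu f h z v0 v.

(* A solution is unconstrained at negative times. *)
Definition vc (t : R) := v (Num.max 0 t).
Definition uc (t : R) := addZ (vc t) (z t) h.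

Lemma inH_vc t : inH L (vc t).
Proof. by have [H _ _ _ _] := ws; apply: H; rewrite le_max lexx. Qed.

Lemma inH_uc t : inH L (uc t).
Proof. exact: inH_addZ (inH_vc t) hH. Qed.

Lemma L2per_vc t : L2per L (vc t). Proof. by case: (inH_vc t). Qed.
Lemma L2per_uc t : L2per L (uc t). Proof. by case: (inH_uc t). Qed.

Lemma cvg_vc (t : R) : normL2 L (subf (vc r) (vc t)) @[r --> t] --> (0 : R).
Proof.
have [_ H _ _ _] := ws; have := H (Num.max 0 t); rewrite le_max lexx => /(_ isT) H0.
apply: (@cvg_comp _ _ _ (fun r : R => Num.max 0 r) (fun r => normL2 L (subf (v r) (vc t))) _ _ _ _ H0).
have cm : (fun r : R => Num.max 0 r) x @[x --> t] --> Num.max 0 t.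
  by apply: (@continuous_max _ _ (fun=> 0) id); [exact: cvg_cst|exact: cvg_id].
move=> A /= /cm; rewrite !nbhs_filterE/=; apply: filterS => r /=; apply.
by rewrite le_max lexx.
Qed.

Lemma cvg_uc (t : R) : normL2 L (subf (uc r) (uc t)) @[r --> t] --> (0 : R).
Proof.
have H : forall r, 0 <= normL2 L (subf (uc r) (uc t)) <=
    normL2 L (subf (vc r) (vc t)) + `|z r - z t| * normL2 L h.
  move=> r; rewrite sqrtr_ge0 /=.
  have -> : subf (uc r) (uc t) = addZ (subf (vc r) (vc t)) (z r - z t) h.
    apply/funext => p; rewrite /subf /uc /addZ scalerBl.
    by rewrite opprD addrACA.
  apply: normL2_addZ; last by case: hH.
  by case: (inH_subf (inH_vc r) (inH_vc t)).
apply: (squeeze_cvgr (f := fun=> 0) (h := fun r => normL2 L (subf (vc r) (vc t)) + `|z r - z t| * normL2 L h)).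
- by apply: nearW => r; exact: H.
- exact: cvg_cst.
rewrite -[X in _ --> X](addr0 0); apply: cvgD; first exact: cvg_vc.
rewrite -[X in _ --> X](mul0r (normL2 L h)); apply: cvgM; last exact: cvg_cst.
apply/cvgrPdist_lt => e e0; have /cvgrPdist_lt/(_ _ e0) := @cz t; apply: filterS => r.
by rewrite sub0r normrN normr_id distrC.
Qed.

Definition xt k b (t : R) : R := xc (vc t) k b.
Definition gt k b (t : R) : R :=
  - B_pair L (uc t) (phi k b) / L ^+ 2 + xc f k b + z t * ((1 - nu * kap ^+ 2 * am k) * xc h k b).

Lemma continuous_xt k b : continuous (xt k b).
Proof.
move=> t; apply: (@cvg_lip (xt k b) (fun r => normL2 L (subf (vc r) (vc t))) t L^-1 1) => //.
- by rewrite invr_ge0 ltW.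
- by move=> r; exact: sqrtr_ge0.
- exact: cvg_vc.
move=> r; rewrite /xt -[xc (vc r) k b - _]/(xc (vc r) k b - xc (vc t) k b).
have -> : xc (vc r) k b - xc (vc t) k b = xc (subf (vc r) (vc t)) k b.
  by rewrite subf_addZ xc_addZ ?mulN1r//; exact: L2per_vc.
apply: le_trans (xc_X _ _ _ _) _.
apply: le_trans (X_le L0 k (inH_subf (inH_vc r) (inH_vc t))) _.
have n0 : 0 <= normL2 L (subf (vc r) (vc t)) by exact: sqrtr_ge0.
rewrite mulrC ler_wpM2l ?invr_ge0 ?(ltW L0)// mulrDr mulr1 lerDl.
exact: mulr_ge0.
Qed.

Lemma continuous_Buc k b : continuous (fun t => B_pair L (uc t) (phi k b)).
Proof.
move=> t; apply: (@cvg_lip _ (fun r => normL2 L (subf (uc r) (uc t))) t (4 * kap * (br k)%:R) (2 * normL2 L (uc t))).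
- by apply: mulr_ge0 => //; apply: mulr_ge0 => //; exact: ltW (kap_gt0 L0).
- by apply: mulr_ge0 => //; exact: sqrtr_ge0.
- by move=> r; exact: sqrtr_ge0.
- exact: cvg_uc.
move=> r; apply: le_trans (Bphi_lip k b (inH_uc r) (inH_uc t)) _.
have kp := kap_gt0 L0.
rewrite ler_wpM2l//; first by apply: mulr_ge0 => //; apply: mulr_ge0 => //; exact: ltW kp.
have n0 : 0 <= normL2 L (subf (uc r) (uc t)) by exact: sqrtr_ge0.
rewrite ler_wpM2l//.
exact: ler_sum_diff (normL2_subf (L2per_uc r) (L2per_uc t)).
Qed.

Lemma continuous_gt k b : continuous (gt k b).
Proof.
move=> t; apply: cvgD; last by apply: cvgM; [exact: cz|exact: cvg_cst].
apply: cvgD; last exact: cvg_cst.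
by apply: cvgM; [apply: cvgN; exact: continuous_Buc|exact: cvg_cst].
Qed.

Lemma xt_integral k b : exists c, forall t, 0 <= t ->
  xt k b t = c + Ir (fun r => gt k b r - nu * kap ^+ 2 * am k * xt k b r) 0 t.
Proof.
exists (inner L v0 (phi k b) / L ^+ 2) => t t0; have {}t0 : (0 : R) <= t by [].
have [_ _ _ _ /(_ _ (test_field_phi L0 k b) _ t0)] := ws.
have m0 (r : R) : 0 <= r -> Num.max 0 r = r by move=> r0; apply/max_idPr.
have L2 : L ^+ 2 != 0 by rewrite expf_neq0// lt0r_neq0.
have lf : L2per L f by case: fH.
have lh : L2per L h by case: hH.
set I1 := \int[mu]_(r in _) _; set I2 := \int[mu]_(r in _) _.
pose m := nu * kap ^+ 2 * am k.
have cx := @continuous_xt k b; have cg := @continuous_gt k b; have cB := @continuous_Buc k b.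
have c1 : continuous (fun r => L ^+ 2 * m * xt k b r).
  by move=> r; apply: cvgM; [exact: cvg_cst|exact: cx].
have c2 : continuous (fun r => L ^+ 2 * xc f k b + z r * (L ^+ 2 * (1 - m) * xc h k b)).
  by move=> r; apply: cvgD; [exact: cvg_cst|apply: cvgM; [exact: cz|exact: cvg_cst]].
have -> : I1 = Ir (fun r => L ^+ 2 * m * xt k b r + B_pair L (uc r) (phi k b)) 0 t.
  apply: eq_Rintegral => r; rewrite inE /= in_itv /= => /andP[r0 _].
  have vr : v r = vc r by rewrite /vc m0.
  rewrite vr -/(addZ (vc r) (z r) h) -/(uc r); congr (_ + _).
  by rewrite (A1_phi L0 k b (inH_vc r)) /m /xt; ring.
have -> : I2 = Ir (fun r => L ^+ 2 * xc f k b + z r * (L ^+ 2 * (1 - m) * xc h k b)) 0 t.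
  apply: eq_Rintegral => r _; rewrite !inner_phi// (A1_phi L0)// /m.
  by rewrite -!mulrA; ring.
have -> : inner L (v t) (phi k b) = L ^+ 2 * xt k b t.
  by rewrite /xt /vc m0// inner_phi//; case: ws => /(_ t t0)[].
rewrite (IrD 0 t c1 cB) => E.
have -> : Ir (fun r => gt k b r - nu * kap ^+ 2 * am k * xt k b r) 0 t =
   L ^- 2 * (Ir (fun r => L ^+ 2 * xc f k b + z r * (L ^+ 2 * (1 - m) * xc h k b)) 0 t -
      (Ir (fun r => L ^+ 2 * m * xt k b r) 0 t + Ir (fun r => B_pair L (uc r) (phi k b)) 0 t)).
  have c3 : continuous (fun r => L ^+ 2 * m * xt k b r + B_pair L (uc r) (phi k b)).
    by move=> r; apply: cvgD; [exact: c1|exact: cB].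
  rewrite -(IrD 0 t c1 cB) -(IrB 0 t c2 c3) -IrZ; last first.
    by move=> r; apply: cvgB; [exact: c2|exact: c3].
  congr Ir; apply/funext => r; rewrite /gt /m; move: (B_pair L _ _) => B.
  by field; rewrite lt0r_neq0.
move: E; move: (Ir _ _ _) (Ir _ _ _) (Ir _ _ _) (inner _ _ _) => i1 i2 i3 i0 E.
apply: (mulfI L2).
have -> : L ^+ 2 * (i0 / L ^+ 2 + L ^- 2 * (i1 - (i3 + i2))) = i0 + i1 - (i3 + i2).
  by field; exact: lt0r_neq0.
by rewrite -E addrK.
Qed.

(** Tested with one mode, the weak formulation becomes an integral equation with continuous
    integrand, so the coefficient is differentiable for t > 0. *)
Lemma mode_solution k b : mode (nu * kap ^+ 2 * am k) (gt k b) (xt k b).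
Proof.
split; [exact: continuous_xt|exact: continuous_gt|].
move=> t t0; have [c Hc] := xt_integral k b.
have cF : continuous (fun r => gt k b r - nu * kap ^+ 2 * am k * xt k b r).
  move=> r; apply: cvgB; first exact: continuous_gt.
  by apply: cvgM; [exact: cvg_cst|exact: continuous_xt].
have d := Ir_FTC1 cF t0.
have d' := is_deriveD (is_derive_cst c t 1) d; rewrite add0r in d'.
refine (near_eq_is_derive _ d').
near=> r; rewrite Hc//; near: r.
by apply: filterS (lt_nbhsr t0) => r /ltW.
Unshelve. all: by end_near. Qed.

End solution.

(** * Gronwall inequality and the weighted energy estimate *)

Section gronwall.
Context {R : realType}.
Local Notation mu := (@lebesgue_measure R).

(** On a piece where [ph] grows by at most 1/2 the supremum sigma of [y] satisfies sigma <= 2 y(s) +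
    F + sigma / 2, so [y + F] grows by a factor of at most 4; continuity of [ph] cuts the interval
    into such pieces. [y] is merely assumed bounded since it will be a supremum over all boxes. *)
Lemma gronwall_L1 (a b F Bd : R) (y ph : R -> R) (n : nat) : a <= b -> 0 <= F ->
  {within `[a, b], continuous ph} ->
  (forall s t, a <= s -> s <= t -> t <= b -> ph s <= ph t) ->
  (forall t, a <= t <= b -> 0 <= y t <= Bd) ->
  (forall s t S, a <= s -> s <= t -> t <= b -> 0 < S -> (forall r, s <= r <= t -> y r <= S) ->
     y t <= 2 * y s + F + S * (ph t - ph s)) ->
  forall t, a <= t <= b -> ph t - ph a <= n%:R / 2 -> y t + F <= 4 ^+ n.+1 * (y a + F).
Proof.
move=> ab F0 cph mph yB Hy.
have yB0 t : a <= t -> t <= b -> 0 <= y t by move=> at_ tb; have /yB/andP[] : a <= t <= b by rewrite at_.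
have yBb t : a <= t -> t <= b -> y t <= Bd by move=> at_ tb; have /yB/andP[] : a <= t <= b by rewrite at_.
have piece s t : a <= s -> s <= t -> t <= b -> ph t - ph s <= 2^-1 -> y t + F <= 4 * (y s + F).
  move=> as_ st tb pst.
  pose A := [set y r | r in [set r | s <= r <= t]].
  have supA : has_sup A.
    split; first by exists (y s), s => //=; rewrite lexx.
    exists Bd => _ [r /= /andP[sr rt] <-].
    exact: yBb (le_trans as_ sr) (le_trans rt tb).
  have ub r : s <= r <= t -> y r <= sup A by move=> sr; apply: (ub_le_sup supA.2); exists r.
  have s0 : 0 <= sup A.
    by apply: le_trans (yB0 s as_ (le_trans st tb)) (ub s _); rewrite lexx.
  have sle : sup A <= 2 * y s + F + sup A / 2.
    apply: ge_sup; first exact: supA.1.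
    move=> _ [r /= /andP[sr rt] <-]; apply/ler_addgt0Pr => e e0.
    have pr : ph r - ph s <= 2^-1.
      by have := mph r t (le_trans as_ sr) rt tb; lra.
    have := Hy s r (sup A + e) as_ sr (le_trans rt tb) (ltr_wpDl s0 e0).
    have H r' : s <= r' <= r -> y r' <= sup A + e.
      move=> /andP[sr' r'r]; have := ub r'; rewrite sr' (le_trans r'r rt) => /(_ isT); lra.
    move=> /(_ H) h1; apply: le_trans h1 _.
    have : (sup A + e) * (ph r - ph s) <= (sup A + e) * 2^-1 by rewrite ler_wpM2l// ltW// ltr_wpDl.
    by lra.
  by have := ub t; rewrite st lexx => /(_ isT); lra.
elim: n => [|n IH] t /andP[at_ tb] pt.
  have := piece a t (lexx a) at_ tb; rewrite expr1; apply; lra.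
have ya : 0 <= y a by exact: yB0.
have [le_n|gt_n] := leP (ph t - ph a) (n%:R / 2).
  apply: le_trans (IH t _ le_n) _; first by rewrite at_.
  rewrite [in leRHS]exprS -mulrA ler_peMl ?mulr_ge0 ?addr_ge0 ?exprn_ge0//; lra.
have n0 : 0 <= n%:R :> R by exact: ler0n.
have sub : {subset `[a, t] <= `[a, b]}.
  by move=> x; rewrite !in_itv /= => /andP[-> /le_trans]; apply.
have ct : {within `[a, t], continuous ph}.
  by apply: continuous_subspaceW cph => x /=; exact: sub.
have [|s] := @IVT R ph a t (ph a + n%:R / 2) at_ ct.
  by rewrite ge_min le_max; apply/andP; split; apply/orP; [left|right]; lra.
rewrite in_itv /= => /andP[as_ st] ps.
have sb : s <= b by exact: le_trans tb.
have h1 : y s + F <= 4 ^+ n.+1 * (y a + F) by apply: IH; rewrite ?as_//; lra.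
have h2 : y t + F <= 4 * (y s + F).
  by apply: piece => //; move: pt; rewrite -natr1; lra.
by rewrite exprS -mulrA; lra.
Qed.

End gronwall.

(** * Time integrals of lattice sums *)

Section lattice_integral.
Context {R : realType}.
Local Notation mu := (@lebesgue_measure R).
Implicit Types (F : int * int -> R -> R) (a b t : R).

(** The full lattice sum, taken in the extended reals because it may be infinite at exceptional
    times. *)
Definition ls (F : int * int -> R) : \bar R :=
  ereal_sup (range (fun M => (\sum_(k <- box M) F k)%:E)).

Lemma ls_ub (F : int * int -> R) M : ((\sum_(k <- box M) F k)%:E <= ls F)%E.
Proof. by apply: ereal_sup_ubound; exists M. Qed.

Lemma ls_ge0 (F : int * int -> R) : (forall k, 0 <= F k) -> (0 <= ls F)%E.
Proof. by move=> F0; apply: le_trans (ls_ub F 0); rewrite lee_fin; apply: sumr_ge0. Qed.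

Lemma sum_box_homo (F : int * int -> R) : (forall k, 0 <= F k) ->
  {homo (fun M => \sum_(k <- box M) F k) : M N / (M <= N)%N >-> M <= N}.
Proof. by move=> F0 M N MN; apply: ler_sum_subseq => //; [exact: uniq_box|exact: sub_box]. Qed.

Lemma ls_lim (F : int * int -> R) : (forall k, 0 <= F k) ->
  (\sum_(k <- box M) F k)%:E @[M --> \oo] --> ls F.
Proof.
move=> F0; apply: ereal_nondecreasing_cvgn => M N MN.
by rewrite lee_fin; exact: sum_box_homo.
Qed.

Lemma measurable_EFin_continuous (f : R -> R) (D : set R) : measurable D -> continuous f ->
  measurable_fun D (EFin \o f).
Proof.
move=> mD cf; apply/measurable_EFinP; apply: measurable_funTS.
exact: continuous_measurable_fun.
Qed.

Lemma measurable_ls F (D : set R) : measurable D -> (forall k, continuous (F k)) ->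
  (forall k t, 0 <= F k t) -> measurable_fun D (fun t => ls (fun k => F k t)).
Proof.
move=> mD cF F0; apply: (@emeasurable_fun_cvg _ _ _ D (fun M t => (\sum_(k <- box M) F k t)%:E)).
  by move=> M; apply: measurable_EFin_continuous => //; exact: continuous_sumr.
by move=> t _; exact: ls_lim.
Qed.

Lemma int_ls_le F a b (B : R) : (forall k, continuous (F k)) -> (forall k t, 0 <= F k t) ->
  (forall M, Ir (fun t => \sum_(k <- box M) F k t) a b <= B) ->
  (\int[mu]_(t in `[a, b]) ls (fun k => F k t) <= B%:E)%E.
Proof.
move=> cF F0 HB.
have cS M : continuous (fun t => \sum_(k <- box M) F k t) by exact: continuous_sumr.
under eq_integral => t _ do rewrite -(cvg_lim _ (ls_lim (F0 ^~ t)))//.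
rewrite monotone_convergence//.
- apply: lime_le.
    apply: ereal_nondecreasing_is_cvgn => M N MN; apply: ge0_le_integral => //.
    + by move=> t _; rewrite lee_fin sumr_ge0.
    + exact: measurable_EFin_continuous.
    + exact: measurable_EFin_continuous.
    + by move=> t _; rewrite lee_fin; exact: sum_box_homo.
  by apply: nearW => M; rewrite Ir_ext// lee_fin.
- by move=> M; exact: measurable_EFin_continuous.
- by move=> M t _; rewrite lee_fin sumr_ge0.
- by move=> t _ M N MN; rewrite lee_fin; exact: sum_box_homo.
Qed.

(** The integrals over boxes are bounded, so by monotone convergence the lattice sum is integrable.
    Its primitive is continuous, which is what the subdivision in Gronwall's inequality needs. *)
Lemma ls_primitive F a b (B : R) : a <= b -> (forall k, continuous (F k)) ->
  (forall k t, 0 <= F k t) -> (forall M, Ir (fun t => \sum_(k <- box M) F k t) a b <= B) ->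
  exists ph : R -> R, [/\ {within `[a, b], continuous ph}, ph b - ph a <= B &
    forall s t, a <= s -> s <= t -> t <= b ->
      ph s <= ph t /\ (\int[mu]_(r in `[s, t]) ls (fun k => F k r) = (ph t - ph s)%:E)%E].
Proof.
move=> ab cF F0 HB; pose G r := ls (fun k => F k r).
have G0 r : (0 <= G r)%E by exact: ls_ge0.
have mG s t : measurable_fun `[s, t] G by exact: measurable_ls.
have GB := int_ls_le cF F0 HB.
have iG : mu.-integrable `[a, b] G.
  apply/integrableP; split; first exact: mG.
  rewrite (_ : (fun x => `|G x|%E) = G); last by apply/funext => r; rewrite gee0_abs.
  by apply: le_lt_trans GB _; rewrite ltry.
pose g r := fine (G r).
have ig : mu.-integrable `[a, b] (EFin \o g).
  apply: (@le_integrable _ _ _ mu _ (measurable_itv _) _ G) => //.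
    by apply/measurable_EFinP; apply: (measurableT_comp (fine_measurable measurableT)); exact: mG.
  move=> r _; rewrite /g /=; case: (G r) (G0 r) => [x||] //= x0.
  by rewrite normr0 leey.
have fG : {ae mu, forall r, `[a, b]%classic r -> G r \is a fin_num}.
  exact: integrable_ae.
exists (fun x => \int[mu]_(r in `[a, x]) g r).
have key s t : a <= s -> s <= t -> t <= b ->
    (\int[mu]_(r in `[s, t]) G r = (\int[mu]_(r in `[s, t]) g r)%:E)%E.
  move=> as_ st tb; have sub : `[s, t] `<=` `[a, b].
    by apply: subset_itv; rewrite bnd_simp.
  have ig' : mu.-integrable `[s, t] (EFin \o g) by exact: integrableS ig.
  rewrite /Rintegral fineK; last by apply: (@integrable_fin_num _ _ _ mu _ (measurable_itv _) _ ig').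
  apply: ae_eq_integral; [exact: measurable_itv|exact: mG|by case/integrableP : ig'|].
  apply: (@filterS _ _ (ae_filter_ringOfSetsType mu) _ _ _ fG) => r H rst.
  by rewrite /= /g fineK// H//; exact: sub.
have diff s t : a <= s -> s <= t -> t <= b ->
    \int[mu]_(r in `[a, t]) g r - \int[mu]_(r in `[a, s]) g r = \int[mu]_(r in `[s, t]) g r.
  move=> as_ st tb.
  have sub x y : a <= x -> y <= b -> mu.-integrable `[x, y] (EFin \o g).
    move=> ax yb; apply: integrableS ig => //.
    by apply: subset_itv; rewrite bnd_simp.
  rewrite Rintegral_itvB ?bnd_simp//; last exact: sub.
  apply: Rintegral_itv_obnd_cbnd.
  apply: integrableS (sub s t as_ tb) => //.
  by apply: subset_itv; rewrite bnd_simp.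
split.
- exact: parameterized_integral_continuous.
- by rewrite diff// -lee_fin -key.
- move=> s t as_ st tb; rewrite key// diff//; split=> //.
  rewrite -subr_ge0 diff// -lee_fin -key//.
  by apply: integral_ge0.
Qed.

End lattice_integral.

(** * The weighted energy estimate *)

Section weighted_energy.
Context {R : realType}.
Local Notation mu := (@lebesgue_measure R).

Lemma young (c x y : R) : 0 < c -> x * y <= c / 2 * x ^+ 2 + y ^+ 2 / (2 * c).
Proof.
move=> c0; rewrite -subr_ge0.
have -> : c / 2 * x ^+ 2 + y ^+ 2 / (2 * c) - x * y = (c * x - y) ^+ 2 / (2 * c).
  by field; exact: lt0r_neq0.
by rewrite divr_ge0 ?sqr_ge0// mulr_ge0// ltW.
Qed.

Lemma uniform_box (P : nat -> int * int -> Prop) (s : seq (int * int)) :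
  (forall k, exists N : nat, forall M, (N <= M)%N -> P M k) ->
  exists N : nat, forall M, (N <= M)%N -> forall k, k \in s -> P M k.
Proof.
move=> H; elim: s => [|k s [N HN]]; first by exists 0%N.
have [N' HN'] := H k; exists (maxn N N') => M; rewrite geq_max => /andP[MN MN'] j.
by rewrite inE => /orP[/eqP ->|js]; [exact: HN'|exact: HN].
Qed.

Variables (c A P0 : R).
Hypotheses (c0 : 0 < c) (A0 : 0 <= A) (P00 : 0 <= P0).

(** What remains after Young's inequality with parameter c, paid by the dissipation of the box, and
    again with c / 2, paid by the full dissipation. The 72 is half of 12^2, where 12 = 2 * 6
    combines the factor of the energy identity with the constant of [trilinear_conv]. *)
Definition gcst : R := 2 * (72 * A ^+ 2 * P0 / c) ^+ 2 / c.

Lemma gcst_ge0 : 0 <= gcst.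
Proof. by rewrite /gcst divr_ge0 ?(ltW c0)// mulr_ge0 ?sqr_ge0. Qed.

(** Interpolating both H^(1/2) norms between L^2 and H^1 leaves the dissipation with total exponent
    3/4, which Young's inequality absorbs; the rest is the energy [S] times the quantity [q],
    integrable in time. Here [p] stands for the advecting field, [eta] for the known part of the
    advected one and [psi] for the forcing. *)
Lemma energy_rate (X g p ga eta psi : int * int -> R) (Eta De Psi S D q : R) (K : nat) :
  (forall k, 0 <= X k) -> (forall k, 0 <= p k) -> (forall k, 0 <= ga k) ->
  (forall k, 0 <= eta k) -> (forall k, 0 <= psi k) ->
  (forall k e, 0 < e -> exists N : nat, forall M, (N <= M)%N ->
     ga k * g k <= (br k)%:R * (A * conv M p (fun m => ga m * (X m + eta m)) k + psi k) + e) ->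
  (forall M, \sum_(k <- box M) (ga k * eta k) ^+ 2 <= Eta) ->
  (forall M, \sum_(k <- box M) (br k)%:R ^+ 2 * (ga k * eta k) ^+ 2 <= De) ->
  (forall M, \sum_(k <- box M) psi k ^+ 2 <= Psi) ->
  (forall M, \sum_(k <- box M) p k ^+ 2 <= P0 ^+ 2) ->
  (forall M, \sum_(k <- box M) (ga k * X k) ^+ 2 <= S) ->
  (forall M, \sum_(k <- box M) (br k)%:R ^+ 2 * (ga k * X k) ^+ 2 <= D) ->
  (forall M, \sum_(k <- box M) (br k)%:R ^+ 2 * p k ^+ 2 <= q) ->
  \sum_(k <- box K) 2 * (ga k ^+ 2 * (X k * g k)) <=
    c * \sum_(k <- box K) (br k)%:R ^+ 2 * (ga k * X k) ^+ 2 + c / 2 * D +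
    gcst * (S + Eta) * q + (c / 2 * De + 2 * Psi / c).
Proof.
move=> X0 p0 ga0 eta0 psi0 Hg HEta HDe HPsi Hp HS HD Hq.
have nn (F : int * int -> R) (B : R) : (forall M, \sum_(k <- box M) F k ^+ 2 <= B) -> 0 <= B.
  by move=> H; apply: le_trans (H 0%N); apply: sumr_ge0 => k _; exact: sqr_ge0.
have nn2 (F : int * int -> R) (B : R) :
    (forall M, \sum_(k <- box M) (br k)%:R ^+ 2 * F k ^+ 2 <= B) -> 0 <= B.
  by move=> H; apply: le_trans (H 0%N); apply: sumr_ge0 => k _; rewrite mulr_ge0 ?sqr_ge0.
have Eta0 := nn _ _ HEta; have De0 := nn2 _ _ HDe; have Psi0 := nn _ _ HPsi.
have S0 := nn _ _ HS; have D0 := nn2 _ _ HD; have q0 := nn2 _ _ Hq.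
pose b k := (br k)%:R * (ga k * X k).
have b0 k : 0 <= b k by rewrite !mulr_ge0.
set DK := \sum_(k <- box K) (br k)%:R ^+ 2 * (ga k * X k) ^+ 2.
have bDK : \sum_(k <- box K) b k ^+ 2 = DK by apply: eq_bigr => k _; rewrite exprMn.
have DK0 : 0 <= DK by rewrite -bDK; apply: sumr_ge0 => k _; exact: sqr_ge0.
pose Q m := ga m * (X m + eta m).
have Q0 m : 0 <= Q m by rewrite mulr_ge0 ?addr_ge0.
pose sB := Num.sqrt DK; pose sq := Num.sqrt q.
pose sE := Num.sqrt (2 * (S + Eta)); pose sD := Num.sqrt (2 * (D + De)).
have sB2 : sB ^+ 2 = DK by rewrite sqr_sqrtr.
have sq2 : sq ^+ 2 = q by rewrite sqr_sqrtr.
have sE2 : sE ^+ 2 = 2 * (S + Eta) by rewrite sqr_sqrtr// mulr_ge0 ?addr_ge0.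
have sD2 : sD ^+ 2 = 2 * (D + De) by rewrite sqr_sqrtr// mulr_ge0 ?addr_ge0.
have [sB0 sq0 sE0 sD0] : [/\ 0 <= sB, 0 <= sq, 0 <= sE & 0 <= sD] by split; exact: sqrtr_ge0.
pose P := Num.sqrt (P0 * sq); pose C := Num.sqrt (sE * sD).
have P2 : P ^+ 2 = P0 * sq by rewrite sqr_sqrtr ?mulr_ge0.
have C2 : C ^+ 2 = sE * sD by rewrite sqr_sqrtr ?mulr_ge0.
have [P'0 C0] : 0 <= P /\ 0 <= C by split; exact: sqrtr_ge0.
have HP M : \sum_(k <- box M) (br k)%:R * p k ^+ 2 <= P ^+ 2.
  rewrite P2; have := @cauchy_sum R _ (box M) p (fun k => (br k)%:R * p k) P0 sq P00 sq0 (Hp M).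
  have -> : \sum_(k <- box M) ((br k)%:R * p k) ^+ 2 = \sum_(k <- box M) (br k)%:R ^+ 2 * p k ^+ 2.
    by apply: eq_bigr => k _; rewrite exprMn.
  rewrite sq2 => /(_ (Hq M)); apply: le_trans; rewrite le_eqVlt; apply/orP; left; apply/eqP.
  by apply: eq_bigr => k _; ring.
have QE k : Q k ^+ 2 <= 2 * ((ga k * X k) ^+ 2 + (ga k * eta k) ^+ 2).
  by rewrite /Q mulrDr; have := sqr_ge0 (ga k * X k - ga k * eta k); lra.
have HQ M : \sum_(k <- box M) (br k)%:R * Q k ^+ 2 <= C ^+ 2.
  rewrite C2.
  have h1 : \sum_(k <- box M) Q k ^+ 2 <= sE ^+ 2.
    rewrite sE2; apply: le_trans (ler_sum _ (fun k _ => QE k)) _.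
    rewrite -mulr_sumr ler_wpM2l// big_split; exact: lerD.
  have h2 : \sum_(k <- box M) ((br k)%:R * Q k) ^+ 2 <= sD ^+ 2.
    rewrite sD2; apply: (@le_trans _ _ (\sum_(k <- box M) 2 * ((br k)%:R ^+ 2 * (ga k * X k) ^+ 2 +
        (br k)%:R ^+ 2 * (ga k * eta k) ^+ 2))).
      apply: ler_sum => k _; rewrite exprMn.
      have -> : 2 * ((br k)%:R ^+ 2 * (ga k * X k) ^+ 2 + (br k)%:R ^+ 2 * (ga k * eta k) ^+ 2) =
        (br k)%:R ^+ 2 * (2 * ((ga k * X k) ^+ 2 + (ga k * eta k) ^+ 2)) by ring.
      by rewrite ler_wpM2l ?sqr_ge0.
    by rewrite -mulr_sumr ler_wpM2l// big_split; exact: lerD.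
  have := @cauchy_sum R _ (box M) Q (fun k => (br k)%:R * Q k) sE sD sE0 sD0 h1 h2.
  apply: le_trans; rewrite le_eqVlt; apply/orP; left; apply/eqP.
  by apply: eq_bigr => k _; ring.
have bpsi : \sum_(k <- box K) b k * psi k <= sB * Num.sqrt Psi.
  by apply: cauchy_sum; rewrite ?sqrtr_ge0// ?bDK ?sB2// sqr_sqrtr.
have main : \sum_(k <- box K) 2 * (ga k ^+ 2 * (X k * g k)) <=
    2 * (A * (6 * (P * sB * C))) + 2 * (sB * Num.sqrt Psi).
  apply/ler_addgt0Pr => e e0.
  pose T := \sum_(k <- box K) 2 * (ga k * X k).
  have T0 : 0 <= T by apply: sumr_ge0 => k _; rewrite !mulr_ge0.
  have T1 : 0 < T + 1 by rewrite ltr_wpDl.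
  have e1 : 0 < e / (T + 1) by rewrite divr_gt0.
  have [N HN] := uniform_box (box K) (fun k => Hg k _ e1).
  apply: (@le_trans _ _ (\sum_(k <- box K) (2 * A * (b k * conv N p Q k) + 2 * (b k * psi k) +
      2 * (ga k * X k) * (e / (T + 1))))).
    rewrite big_seq [leRHS]big_seq; apply: ler_sum => k kK.
    have := HN N (leqnn N) k kK => h.
    have -> : 2 * (ga k ^+ 2 * (X k * g k)) = 2 * (ga k * X k) * (ga k * g k) by ring.
    apply: le_trans (ler_wpM2l _ h) _; first by rewrite !mulr_ge0.
    rewrite /b le_eqVlt; apply/orP; left; apply/eqP; ring.
  rewrite !big_split /= -!mulr_sumr -mulr_suml -/T.
  have tc := trilinear_conv p0 Q0 b0 P'0 sB0 C0 (HP N) (HQ N) (K := K).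
  rewrite bDK sB2 in tc; have := tc (lexx _) => {}tc.
  have te : T * (e / (T + 1)) <= e.
    by rewrite mulrCA ler_piMr ?(ltW e0)// ler_pdivrMr// mul1r lerDl.
  have := ler_wpM2l A0 tc; lra.
apply: le_trans main _.
have y1 := young sB (12 * A * (P * C)) c0.
have y2 := young sB (2 * Num.sqrt Psi) c0.
have y3 := @young (c / 2) sD (72 * A ^+ 2 * P0 / c * sq * sE).
have c2 : 0 < c / 2 by rewrite divr_gt0.
have {}y3 := y3 c2.
have cn : c != 0 by exact: lt0r_neq0.
have e1 : (12 * A * (P * C)) ^+ 2 / (2 * c) = sD * (72 * A ^+ 2 * P0 / c * sq * sE).
  have -> : (12 * A * (P * C)) ^+ 2 = 144 * A ^+ 2 * (P ^+ 2 * C ^+ 2) by ring.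
  by rewrite P2 C2; field.
have e2 : (2 * Num.sqrt Psi) ^+ 2 / (2 * c) = 2 * Psi / c.
  by rewrite exprMn sqr_sqrtr//; field.
have e3 : c / 2 / 2 * sD ^+ 2 = c / 2 * D + c / 2 * De by rewrite sD2; field.
have e4 : (72 * A ^+ 2 * P0 / c * sq * sE) ^+ 2 / (2 * (c / 2)) = gcst * (S + Eta) * q.
  rewrite exprMn exprMn sq2 sE2 /gcst; field => //.
rewrite e1 in y1; rewrite e2 in y2; rewrite e3 e4 in y3; rewrite sB2 in y1 y2.
lra.
Qed.

(** [Bd] and [Bd'] make the suprema and integrals finite beforehand and are absent from the
    conclusion, so they may depend on the truncation of the weight. *)
Lemma weighted_energy (a b Kq Bd Bd' Eta De Psi : R) (X g p : int * int -> R -> R)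
    (ga eta psi : int * int -> R) (n : nat) :
  a <= b -> b <= a + 1 -> 0 <= Kq ->
  (forall k, continuous (X k)) -> (forall k, continuous (g k)) -> (forall k, continuous (p k)) ->
  (forall k t, 0 <= X k t) -> (forall k t, 0 <= g k t) -> (forall k t, 0 <= p k t) ->
  (forall k, 0 <= ga k) -> (forall k, 0 <= eta k) -> (forall k, 0 <= psi k) ->
  (forall k s t, a <= s -> s <= t -> t <= b ->
     X k t ^+ 2 + Ir (fun r => 2 * c * ((br k)%:R ^+ 2 * X k r ^+ 2)) s t <=
     X k s ^+ 2 + Ir (fun r => 2 * (X k r * g k r)) s t) ->
  (forall t, a <= t <= b -> forall k e, 0 < e -> exists N : nat, forall M, (N <= M)%N ->
     ga k * g k t <= (br k)%:R * (A * conv M (p^~ t) (fun m => ga m * (X m t + eta m)) k + psi k) + e) ->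
  (forall M, \sum_(k <- box M) (ga k * eta k) ^+ 2 <= Eta) ->
  (forall M, \sum_(k <- box M) (br k)%:R ^+ 2 * (ga k * eta k) ^+ 2 <= De) ->
  (forall M, \sum_(k <- box M) psi k ^+ 2 <= Psi) ->
  (forall t, a <= t <= b -> forall M, \sum_(k <- box M) p k t ^+ 2 <= P0 ^+ 2) ->
  (forall M, Ir (fun t => \sum_(k <- box M) (br k)%:R ^+ 2 * p k t ^+ 2) a b <= Kq) ->
  (forall t, a <= t <= b -> forall M, \sum_(k <- box M) (ga k * X k t) ^+ 2 <= Bd) ->
  (forall M, Ir (fun t => \sum_(k <- box M) (br k)%:R ^+ 2 * (ga k * X k t) ^+ 2) a b <= Bd') ->
  2 * (gcst + 1) * Kq <= n%:R / 2 ->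
  forall E0, (forall M, \sum_(k <- box M) (ga k * X k a) ^+ 2 <= E0) ->
  forall t, a <= t <= b -> forall M, \sum_(k <- box M) (ga k * X k t) ^+ 2 <=
    4 ^+ n.+1 * (E0 + (2 * (c / 2 * De + 2 * Psi / c) + 2 * (gcst + 1) * Eta * Kq)).
Proof.
move=> ab ba1 Kq0 cX cg cp X0 g0 p0 ga0 eta0 psi0 HE Hg HEta HDe HPsi Hp HKq HBd HBd' Hn E0 HE0.
set Gc := c / 2 * De + 2 * Psi / c; set F := 2 * Gc + _.
have cX2 k : continuous (fun t => X k t ^+ 2).
  by move=> t; rewrite (_ : (fun t => _) = (fun t => X k t * X k t)); [apply: cvgM; exact: cX|apply/funext].
have cp2 k : continuous (fun t => p k t ^+ 2).
  by move=> t; rewrite (_ : (fun t => _) = (fun t => p k t * p k t)); [apply: cvgM; exact: cp|apply/funext].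
pose dD k t := (br k)%:R ^+ 2 * (ga k * X k t) ^+ 2 : R.
pose dq k t := (br k)%:R ^+ 2 * p k t ^+ 2 : R.
have cdD k : continuous (dD k).
  move=> t; rewrite /dD (_ : (fun t => _) = (fun t => ((br k)%:R ^+ 2 * ga k ^+ 2) * X k t ^+ 2)).
    by apply: cvgM; [exact: cvg_cst|exact: cX2].
  by apply/funext => r; rewrite exprMn mulrA.
have cdq k : continuous (dq k) by move=> t; apply: cvgM; [exact: cvg_cst|exact: cp2].
have dD0 k t : 0 <= dD k t by rewrite mulr_ge0 ?sqr_ge0.
have dq0 k t : 0 <= dq k t by rewrite mulr_ge0 ?sqr_ge0.
have cXg k : continuous (fun t => 2 * (X k t * g k t)).
  by move=> t; apply: cvgM; [exact: cvg_cst|apply: cvgM; [exact: cX|exact: cg]].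
pose rate k t := 2 * (ga k ^+ 2 * (X k t * g k t)).
have crate k : continuous (rate k).
  by move=> t; do 2 (apply: cvgM; [exact: cvg_cst|]); apply: cvgM; [exact: cX|exact: cg].
have rate0 k t : 0 <= rate k t by rewrite !mulr_ge0 ?sqr_ge0.
have [phD [cphD _ HphD]] := ls_primitive ab cdD dD0 HBd'.
have [phq [cphq phqB Hphq]] := ls_primitive ab cdq dq0 HKq.
(* The weighted energy of all modes at time t; as a supremum over boxes it is not known to be
   continuous. *)
pose y t := sup (range (fun M => \sum_(k <- box M) (ga k * X k t) ^+ 2)).
have sy t : a <= t <= b -> has_sup (range (fun M => \sum_(k <- box M) (ga k * X k t) ^+ 2)).
  by move=> tab; split; [eexists; exists 0%N; [|reflexivity]|exists Bd => _ [M _ <-]; exact: HBd].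
have yub t M : a <= t <= b -> \sum_(k <- box M) (ga k * X k t) ^+ 2 <= y t.
  by move=> /sy[_ ub]; apply: (ub_le_sup ub); exists M.
have yle t B : a <= t <= b -> (forall M, \sum_(k <- box M) (ga k * X k t) ^+ 2 <= B) -> y t <= B.
  by move=> /sy[ne _] H; apply: ge_sup => // _ [M _ <-].
have y0 t : a <= t <= b -> 0 <= y t.
  by move=> tab; apply: le_trans (yub t 0%N tab); apply: sumr_ge0 => k _; exact: sqr_ge0.
have Eta0 : 0 <= Eta by apply: le_trans (HEta 0%N); apply: sumr_ge0 => k _; exact: sqr_ge0.
have Gc0 : 0 <= Gc.
  have De0 : 0 <= De by apply: le_trans (HDe 0%N); apply: sumr_ge0 => k _; rewrite mulr_ge0 ?sqr_ge0.
  have Psi0 : 0 <= Psi by apply: le_trans (HPsi 0%N); apply: sumr_ge0 => k _; exact: sqr_ge0.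
  by rewrite addr_ge0// ?mulr_ge0 ?invr_ge0 ?(ltW c0)// divr_ge0// ltW.
have gc0 := gcst_ge0.
have F0 : 0 <= F by rewrite addr_ge0 ?mulr_ge0// addr_ge0.
have step s t S : a <= s -> s <= t -> t <= b -> 0 < S -> (forall r, s <= r <= t -> y r <= S) ->
    y t <= 2 * y s + F + S * (2 * (gcst + 1) * (phq t - phq s)).
  move=> as_ st tb S0 HS.
  have sab : a <= s <= b by rewrite as_ (le_trans st tb).
  have tab : a <= t <= b by rewrite tb (le_trans as_ st).
  have [_ ED] := HphD s t as_ st tb; have [mq Eq] := Hphq s t as_ st tb.
  set G1 := (gcst + 1) * (S + Eta).
  have G10 : 0 < G1 by exact: (mulr_gt0 (ltr_wpDl gc0 ltr01) (ltr_wpDr Eta0 S0)).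
  set DD := phD t - phD s in ED *; set Dq := phq t - phq s in Eq *.
  have rate_int K : Ir (fun r => \sum_(k <- box K) rate k r) s t <=
      c * Ir (fun r => \sum_(k <- box K) dD k r) s t + c / 2 * DD + G1 * Dq + Gc * (t - s).
    have cS : continuous (fun r => \sum_(k <- box K) dD k r) by exact: continuous_sumr.
    have cR : continuous (fun r => \sum_(k <- box K) rate k r) by exact: continuous_sumr.
    have ccS : continuous (fun r => c * \sum_(k <- box K) dD k r).
      by move=> r; apply: cvgM; [exact: cvg_cst|exact: cS].
    rewrite -lee_fin -Ir_ext//.
    have m1 : measurable_fun `[s, t] (fun r => (c * \sum_(k <- box K) dD k r)%:E).
      exact: measurable_EFin_continuous.
    have m2 : measurable_fun `[s, t] (fun r => ls (dD ^~ r)) by exact: measurable_ls.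
    have m3 : measurable_fun `[s, t] (fun r => ls (dq ^~ r)) by exact: measurable_ls.
    have m2' : measurable_fun `[s, t] (fun r => ((c / 2)%:E * ls (dD ^~ r))%E).
      by apply: emeasurable_funM => //; exact: measurable_cst.
    have m3' : measurable_fun `[s, t] (fun r => (G1%:E * ls (dq ^~ r))%E).
      by apply: emeasurable_funM => //; exact: measurable_cst.
    have n1 r : (0 <= (c * \sum_(k <- box K) dD k r)%:E)%E.
      by rewrite lee_fin mulr_ge0 ?(ltW c0)// sumr_ge0.
    have c20 : 0 < c / 2 by rewrite divr_gt0.
    have n2 r : (0 <= (c / 2)%:E * ls (dD ^~ r))%E.
      by apply: mule_ge0; [rewrite lee_fin ltW|exact: ls_ge0].
    have n3 r : (0 <= G1%:E * ls (dq ^~ r))%E.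
      by apply: mule_ge0; [rewrite lee_fin ltW|exact: ls_ge0].
    have -> : ((c * Ir (fun r => \sum_(k <- box K) dD k r) s t + c / 2 * DD + G1 * Dq + Gc * (t - s))%:E =
      \int[mu]_(r in `[s, t]) ((c * \sum_(k <- box K) dD k r)%:E + (c / 2)%:E * ls (dD ^~ r) +
         G1%:E * ls (dq ^~ r) + Gc%:E))%E.
      rewrite ge0_integralD//; last 2 first.
      - by move=> r _; rewrite !adde_ge0.
      - by do 2 (apply: emeasurable_funD => //).
      rewrite ge0_integralD//; last 2 first.
      - by move=> r _; rewrite adde_ge0.
      - by apply: emeasurable_funD.
      rewrite ge0_integralD// ge0_integralZl_EFin// ?(ltW c20)//; last by move=> r _; exact: ls_ge0.
      rewrite ge0_integralZl_EFin// ?(ltW G10)//; last by move=> r _; exact: ls_ge0.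
      rewrite ED Eq Ir_ext// IrZ//.
      have -> : (\int[mu]_(r in `[s, t]) Gc%:E = (Gc * (t - s))%:E)%E.
        by rewrite (Ir_ext s t (f := fun=> Gc)) ?Ir_cst// => r; exact: cvg_cst.
      by rewrite -!EFinM -!EFinD.
    apply: ge0_le_integral => //.
    - by move=> r _; rewrite lee_fin sumr_ge0.
    - exact: measurable_EFin_continuous.
    - by do 3 (apply: emeasurable_funD => //); exact: measurable_cst.
    move=> r /=; rewrite in_itv /= => rst.
    have rab : a <= r <= b by case/andP: rst => h1 h2; rewrite (le_trans as_ h1) (le_trans h2 tb).
    have lD0 := ls_ge0 (dD0 ^~ r); have lq0 := ls_ge0 (dq0 ^~ r).
    have := ls_ub (dD ^~ r); have := ls_ub (dq ^~ r).
    have := n3 r; have := n2 r.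
    (* At exceptional times where a lattice sum is infinite the right-hand side is infinite too. *)
    case: (ls (dD ^~ r)) lD0 => [Dr||] // Dr0; last first.
      move=> _ n3r _ _; rewrite gt0_muley ?lte_fin// addey// addye; last first.
        by rewrite -ltNye (lt_le_trans _ n3r).
      by rewrite addye// leey.
    case: (ls (dq ^~ r)) lq0 => [qr||] // qr0; last first.
      move=> n2r _ _ _; rewrite gt0_muley ?lte_fin// addey; last first.
        by rewrite -EFinM -EFinD.
      by rewrite addye// leey.
    move=> _ _ Hq HD; rewrite -!EFinM -!EFinD lee_fin.
    have h := @energy_rate (X^~ r) (g^~ r) (p^~ r) ga eta psi Eta De Psi S Dr qr K
      (X0^~ r) (p0^~ r) ga0 eta0 psi0 (Hg r rab) HEta HDe HPsi (Hp r rab) _ _ _.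
    have HSr M : \sum_(k <- box M) (ga k * X k r) ^+ 2 <= S by apply: le_trans (yub r M rab) (HS r rst).
    have HDr M : \sum_(k <- box M) dD k r <= Dr by rewrite -lee_fin.
    have Hqr M : \sum_(k <- box M) dq k r <= qr by rewrite -lee_fin.
    have := h HSr HDr Hqr; rewrite -/Gc -/(dD _ _).
    move=> h'; apply: le_trans h' _; rewrite lerD2r lerD2l.
    have qr0' : 0 <= qr by rewrite -lee_fin.
    rewrite ler_wpM2r// /G1 ler_wpM2r ?addr_ge0 ?(ltW S0)//; lra.
  have energy K : \sum_(k <- box K) (ga k * X k t) ^+ 2 +
      2 * c * Ir (fun r => \sum_(k <- box K) dD k r) s t <=
      \sum_(k <- box K) (ga k * X k s) ^+ 2 + Ir (fun r => \sum_(k <- box K) rate k r) s t.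
    rewrite !Ir_sum// mulr_sumr -!big_split; apply: ler_sum => k _ /=.
    have := ler_wpM2l (sqr_ge0 (ga k)) (HE k s t as_ st tb); rewrite !mulrDr.
    rewrite !exprMn -!IrZ//.
    - move=> H; apply: le_trans (le_trans H _).
        rewrite lerD2l le_eqVlt; apply/orP; left; apply/eqP; congr Ir.
        by apply/funext => r; rewrite /dD exprMn; ring.
      rewrite lerD2l le_eqVlt; apply/orP; left; apply/eqP; congr Ir.
      by apply/funext => r; rewrite /rate; ring.
    - by move=> r; do 2 (apply: cvgM; [exact: cvg_cst|]); exact: cX2.
  set rhs := y s + c / 2 * DD + G1 * Dq + Gc * (t - s).
  have both K : \sum_(k <- box K) (ga k * X k t) ^+ 2 +
      c * Ir (fun r => \sum_(k <- box K) dD k r) s t <= rhs.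
    have h1 := energy K; have h2 := rate_int K; have h3 := yub s K sab; rewrite /rhs; lra.
  (* The bound for boxes passes to the full dissipation, half of which is then absorbed; this
     produces the factor 2 in front of [y s]. *)
  have DDle : c * DD <= rhs.
    rewrite mulrC -ler_pdivlMr// -lee_fin -ED; apply: int_ls_le => // K.
    rewrite ler_pdivlMr// mulrC; apply: le_trans (both K); rewrite lerDr.
    by apply: sumr_ge0 => k _; exact: sqr_ge0.
  have ts : t - s <= 1 by lra.
  have ts0 : 0 <= t - s by rewrite subr_ge0.
  have DqK : Dq <= Kq.
    have [h1 _] := Hphq a s (lexx a) as_ (le_trans st tb); have [h2 _] := Hphq t b (le_trans as_ st) tb (lexx b).
    by rewrite /Dq; lra.
  have Dq0 : 0 <= Dq by rewrite subr_ge0.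
  apply: yle => // K; have h1 := both K.
  have h2 : 0 <= c * Ir (fun r => \sum_(k <- box K) dD k r) s t.
    rewrite mulr_ge0 ?(ltW c0)//; apply: Ir_ge0; first exact: continuous_sumr.
    by move=> r _; exact: sumr_ge0.
  have h3 : Gc * (t - s) <= Gc by rewrite ler_piMr.
  have h4 : (gcst + 1) * Eta * Dq <= (gcst + 1) * Eta * Kq.
    by rewrite ler_wpM2l// mulr_ge0// addr_ge0.
  have h5 : G1 * Dq = (gcst + 1) * Eta * Dq + S * ((gcst + 1) * Dq) by rewrite /G1; ring.
  have h6 : F = 2 * Gc + 2 * ((gcst + 1) * Eta * Kq) by rewrite /F; ring.
  have h7 : S * (2 * (gcst + 1) * Dq) = 2 * (S * ((gcst + 1) * Dq)) by ring.
  move: h1 h2 h3 h4 DDle; rewrite h7 h6 /rhs h5.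
  move: (S * _) (Gc * _) ((gcst + 1) * Eta * _) ((gcst + 1) * Eta * _) (c * Ir _ _ _) (\sum_(_ <- _) _).
  by move=> x1 x2 x3 x4 x5 x6; lra.
move=> t tab M.
have cph : {within `[a, b], continuous (fun r => 2 * (gcst + 1) * phq r)}.
  by move=> r; apply: cvgM; [exact: cvg_cst|exact: cphq].
have G20 : 0 <= 2 * (gcst + 1) by rewrite mulr_ge0// addr_ge0.
have mph s r : a <= s -> s <= r -> r <= b -> 2 * (gcst + 1) * phq s <= 2 * (gcst + 1) * phq r.
  by move=> as_ sr rb; rewrite ler_wpM2l//; have [] := Hphq s r as_ sr rb.
have yB r : a <= r <= b -> 0 <= y r <= Bd.
  by move=> rab; rewrite y0//= yle// => M'; exact: HBd.
have Hy s r S : a <= s -> s <= r -> r <= b -> 0 < S -> (forall r', s <= r' <= r -> y r' <= S) ->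
    y r <= 2 * y s + F + S * (2 * (gcst + 1) * phq r - 2 * (gcst + 1) * phq s).
  by move=> as_ sr rb S0 HS; rewrite -mulrBr; exact: step.
have aab : a <= a <= b by rewrite lexx.
have ph_n : 2 * (gcst + 1) * phq t - 2 * (gcst + 1) * phq a <= n%:R / 2.
  apply: le_trans Hn; rewrite -mulrBr ler_wpM2l//; apply: le_trans phqB; rewrite lerD2r.
  by case/andP: tab => at_ tb; have [] := Hphq t b at_ tb (lexx b).
have := gronwall_L1 ab F0 cph mph yB Hy tab ph_n.
have ya : y a <= E0 by exact: yle.
have := yub t M tab => h1 h2; apply: le_trans h1 _.
apply: le_trans (le_trans _ h2) _; first by rewrite lerDl.
by rewrite ler_wpM2l ?exprn_ge0// lerD2r.
Qed.

End weighted_energy.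

(** * The energy inequality *)

Ltac nonneg := repeat first [ assumption | apply: ltW; assumption | exact: sqr_ge0 |
  exact: normr_ge0 | exact: ler0n | exact: sqrtr_ge0 | apply: exprn_ge0 | apply: mulr_ge0 | apply: addr_ge0 ].

Section basic_energy.
Context {R : realType}.
Variable L : R.
Hypothesis L0 : 0 < L.
Local Notation mu := (@lebesgue_measure R).
Local Notation kap := (kap L).
Local Notation xc := (xc L).
Local Notation X := (X L).
Local Notation phi := (phi L).
Local Notation PM := (PM L).
Implicit Types (u v w f h : R * R -> R * R) (k : int * int) (b : bool).

Lemma sum_br_inv (j : nat) M : (3 <= j)%N -> \sum_(k <- box M) ((br k)%:R ^- j : R) <= 24.
Proof.
move=> j3; apply: le_trans (sum_rt5 (R := R) (uniq_box M)); apply: ler_sum => k _.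
rewrite -rt_sqr -exprM lef_pV2 ?posrE ?exprn_gt0 ?rt_gt0//.
by apply: ler_weXn2l; [exact: rt_ge1|lia].
Qed.

Lemma continuous_X (F : R -> R * R -> R * R) k : (forall b, continuous (fun t => xc (F t) k b)) ->
  continuous (fun t => X (F t) k).
Proof.
move=> cF t; rewrite /Submission.X.
apply: (@continuous_comp _ _ _ (fun t => xc (F t) k true ^+ 2 + xc (F t) k false ^+ 2) Num.sqrt).
  rewrite (_ : (fun t => _) = (fun t => xc (F t) k true * xc (F t) k true + xc (F t) k false * xc (F t) k false)).
    by apply: cvgD; apply: cvgM; exact: cF.
  by apply/funext => r; rewrite !expr2.
exact: sqrt_continuous.
Qed.

Lemma modes_energy (m B s t : R) (g1 g2 x1 x2 : R -> R) : mode m g1 x1 -> mode m g2 x2 ->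
  0 <= s -> s <= t -> (forall r, B * (x1 r ^+ 2 + x2 r ^+ 2) <= m * (x1 r ^+ 2 + x2 r ^+ 2)) ->
  (x1 t ^+ 2 + x2 t ^+ 2) + Ir (fun r => 2 * (B * (x1 r ^+ 2 + x2 r ^+ 2))) s t <=
  (x1 s ^+ 2 + x2 s ^+ 2) + Ir (fun r => 2 * (x1 r * g1 r + x2 r * g2 r)) s t.
Proof.
move=> m1 m2 s0 st HB; have e1 := mode_energy m1 s0 st; have e2 := mode_energy m2 s0 st.
have [cx1 cg1 _] := m1; have [cx2 cg2 _] := m2.
have csq (x : R -> R) : continuous x -> continuous (fun r => x r ^+ 2).
  by move=> cx r; rewrite (_ : (fun r => _) = (fun r => x r * x r)); [apply: cvgM; exact: cx|apply/funext].
have cm (x : R -> R) : continuous x -> continuous (fun r => 2 * m * x r ^+ 2).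
  by move=> cx r; apply: cvgM; [exact: cvg_cst|exact: csq].
have cg (x g : R -> R) : continuous x -> continuous g -> continuous (fun r => 2 * (x r * g r)).
  by move=> cx c' r; apply: cvgM; [exact: cvg_cst|apply: cvgM; [exact: cx|exact: c']].
have cs : continuous (fun r => x1 r ^+ 2 + x2 r ^+ 2).
  by move=> r; apply: cvgD; exact: csq.
have -> : Ir (fun r => 2 * (x1 r * g1 r + x2 r * g2 r)) s t =
   Ir (fun r => 2 * (x1 r * g1 r)) s t + Ir (fun r => 2 * (x2 r * g2 r)) s t.
  rewrite -(IrD s t (cg _ _ cx1 cg1) (cg _ _ cx2 cg2)); congr Ir; apply/funext => r; ring.
have : Ir (fun r => 2 * (B * (x1 r ^+ 2 + x2 r ^+ 2))) s t <=
   Ir (fun r => 2 * m * x1 r ^+ 2) s t + Ir (fun r => 2 * m * x2 r ^+ 2) s t.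
  rewrite -(IrD s t (cm _ cx1) (cm _ cx2)); apply: Ir_le.
  - by move=> r; do 2 (apply: cvgM; [exact: cvg_cst|]); exact: cs.
  - by move=> r; apply: cvgD; exact: cm.
  - by move=> r _; have := HB r; lra.
lra.
Qed.

Variables (nu n : R) (f h : R * R -> R * R).
Hypotheses (nu0 : 0 < nu) (n0 : 0 <= n) (fH : inH L f) (hH : inH L h).
Hypothesis h4 : inHs L 4 h.

Definition Gf u (zz : R) k b : R :=
  - B_pair L (addZ u zz h) (phi k b) / L ^+ 2 + xc f k b +
  zz * ((1 - nu * kap ^+ 2 * am k) * xc h k b).

Lemma abs1m k : `|1 - nu * kap ^+ 2 * am k| <= (1 + 2 * (nu * kap ^+ 2)) * (br k)%:R ^+ 2.
Proof.
have a0 := @am_ge0 R k; have a1 := @am_upper R k.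
have k2 : 0 <= nu * kap ^+ 2 by rewrite mulr_ge0 ?sqr_ge0 ?(ltW nu0).
have b1 : 1 <= (br k)%:R ^+ 2 :> R by rewrite exprn_ege1// ler1n.
have := ler_wpM2l k2 a1; have := mulr_ge0 k2 a0; rewrite ler_norml; lra.
Qed.

Lemma pair_product_bound (x y a c P C : R) : `|x| <= P -> `|y| <= P -> `|a| <= C -> `|c| <= C ->
  `|x * a + y * c| <= P ^+ 2 + C ^+ 2.
Proof.
move=> xP yP aC bC; apply: le_trans (pair_bound xP yP aC bC) _.
have := sqr_ge0 (P - C); lra.
Qed.

(** Testing with u = U - zz h, where U = u + zz h, isolates the flux <B(U), P_K U>, which will
    vanish in the limit. The remaining pairing of B(U) with the modes of [h] needs only the L^2 norm
    of U, thanks to the decay |k|^-4 of the coefficients of [h]. *)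
Lemma forcing_bound : exists a1 a2, [/\ 0 <= a1, 0 <= a2 &
  forall u zz K, inH L u -> `|zz| <= n ->
    \sum_(k <- box K) (xc u k true * Gf u zz k true + xc u k false * Gf u zz k false) <=
    L ^- 2 * `|B_pair L (addZ u zz h) (PM (addZ u zz h) K)| + a1 * normL2 L u ^+ 2 + a2].
Proof.
have [Ch Ch0 HCh] : exists2 C, 0 <= C & forall k, X h k <= C * (br k)%:R ^- 4.
  exact: (@inHs_decay _ _ L0 2 h h4).
have kp := kap_gt0 L0.
set M1 := 1 + 2 * (nu * kap ^+ 2).
have M10 : 0 <= M1 by rewrite /M1; nonneg.
pose c3 := 8 * n * kap * L ^- 2 * (24 * Ch).
have L2 : 0 < L ^+ 2 by rewrite exprn_gt0.
have Li : 0 < L ^- 2 by rewrite invr_gt0.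
have c30 : 0 <= c3 by rewrite /c3; nonneg.
exists (2 * c3 + 2 * L ^- 2), (2 * c3 * (n ^+ 2 * normL2 L h ^+ 2) + L ^- 2 * normL2 L f ^+ 2 + n ^+ 2 * M1 ^+ 2 * (24 * Ch ^+ 2)).
split.
- by nonneg.
- by nonneg.
move=> u zz K uH zn; set U := addZ u zz h.
have lu : L2per L u by case: uH.
have lh : L2per L h by case: hH.
have UH : inH L U by exact: inH_addZ.
have lU : L2per L U by case: UH.
have nU : normL2 L U ^+ 2 <= 2 * normL2 L u ^+ 2 + 2 * (n ^+ 2 * normL2 L h ^+ 2).
  have u0 : 0 <= normL2 L u by exact: sqrtr_ge0.
  have h0 : 0 <= normL2 L h by exact: sqrtr_ge0.
  have H : normL2 L U <= normL2 L u + n * normL2 L h.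
    by apply: le_trans (normL2_addZ zz lu lh) _; rewrite lerD2l ler_wpM2r.
  apply: (@le_trans _ _ ((normL2 L u + n * normL2 L h) ^+ 2)).
    by rewrite ler_pXn2r ?nnegrE//; nonneg.
  by have := sqr_ge0 (normL2 L u - n * normL2 L h); lra.
pose Bk k b := B_pair L U (phi k b).
pose T k := zz * L ^- 2 * (xc h k true * Bk k true + xc h k false * Bk k false) +
  (xc u k true * xc f k true + xc u k false * xc f k false) +
  (xc u k true * (zz * ((1 - nu * kap ^+ 2 * am k) * xc h k true)) +
   xc u k false * (zz * ((1 - nu * kap ^+ 2 * am k) * xc h k false))).
have E : \sum_(k <- box K) (xc u k true * Gf u zz k true + xc u k false * Gf u zz k false) =
    - L ^- 2 * B_pair L U (PM U K) + \sum_(k <- box K) T k.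
  rewrite (B_proj_sum L0 K lU UH) mulr_sumr -big_split; apply: eq_bigr => k _ /=.
  rewrite /Gf -/U /T !xc_addZ// -/(Bk k true) -/(Bk k false).
  by move: (Bk k true) (Bk k false) => B1 B2; ring.
have TB k : T k <= 8 * n * kap * L ^- 2 * normL2 L U ^+ 2 * (Ch * (br k)%:R ^- 3) +
    2 * X u k ^+ 2 + X f k ^+ 2 + n ^+ 2 * M1 ^+ 2 * (Ch ^+ 2 * (br k)%:R ^- 4).
  have b0 : 0 < (br k)%:R :> R by rewrite ltr0n.
  have bn : (br k)%:R != 0 :> R by exact: lt0r_neq0.
  have nU0 : 0 <= normL2 L U ^+ 2 by exact: sqr_ge0.
  have Xh0 := X_ge0 L h k.
  have h1 : zz * L ^- 2 * (xc h k true * Bk k true + xc h k false * Bk k false) <=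
      8 * n * kap * L ^- 2 * normL2 L U ^+ 2 * (Ch * (br k)%:R ^- 3).
    apply: le_trans (ler_norm _) _; rewrite !normrM (ger0_norm (ltW Li)).
    have p := pair_bound (xc_X L h k true) (xc_X L h k false) (B_phi_bound L0 k true UH) (B_phi_bound L0 k false UH).
    apply: (@le_trans _ _ (n * L ^- 2 * (2 * (X h k * (4 * kap * (br k)%:R * normL2 L U ^+ 2))))).
      apply: ler_pM => //; first by nonneg.
      by rewrite ler_wpM2r// ltW.
    have -> : n * L ^- 2 * (2 * (X h k * (4 * kap * (br k)%:R * normL2 L U ^+ 2))) =
       8 * n * kap * L ^- 2 * normL2 L U ^+ 2 * (X h k * (br k)%:R) by ring.
    rewrite ler_wpM2l//; first by nonneg.
    apply: le_trans (ler_wpM2r (ltW b0) (HCh k)) _.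
    by rewrite le_eqVlt; apply/orP; left; apply/eqP; field.
  have h2 := pair_product_bound (xc_X L u k true) (xc_X L u k false) (xc_X L f k true) (xc_X L f k false).
  have bz b : `|zz * ((1 - nu * kap ^+ 2 * am k) * xc h k b)| <= n * M1 * Ch * (br k)%:R ^- 2.
    rewrite !normrM.
    have q1 := ler_pM (normr_ge0 _) (normr_ge0 _) (abs1m k) (le_trans (xc_X L h k b) (HCh k)).
    have := ler_pM (normr_ge0 _) (mulr_ge0 (normr_ge0 _) (normr_ge0 _)) zn q1.
    move=> q2; apply: le_trans q2 _; rewrite -/M1.
    by rewrite le_eqVlt; apply/orP; left; apply/eqP; field.
  have h3 := pair_product_bound (xc_X L u k true) (xc_X L u k false) (bz true) (bz false).
  have e4 : (n * M1 * Ch * (br k)%:R ^- 2) ^+ 2 = n ^+ 2 * M1 ^+ 2 * (Ch ^+ 2 * (br k)%:R ^- 4).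
    by field.
  rewrite e4 in h3.
  have := le_trans (ler_norm _) h2; have := le_trans (ler_norm _) h3; rewrite /T.
  move: h1; clear.
  by move: (zz * _ * _) (8 * _ * _ * _ * _ * _) (_ + xc u k false * xc f k false) (_ + xc u k false * _) => *; lra.
have Xu2 : \sum_(k <- box K) X u k ^+ 2 <= L ^- 2 * normL2 L u ^+ 2.
  by rewrite ler_pdivlMl//; exact: bessel_X.
have Xf2 : \sum_(k <- box K) X f k ^+ 2 <= L ^- 2 * normL2 L f ^+ 2.
  by rewrite ler_pdivlMl//; exact: bessel_X.
have S3 := @sum_br_inv 3 K isT; have S4 := @sum_br_inv 4 K isT.
have ST : \sum_(k <- box K) T k <= 8 * n * kap * L ^- 2 * normL2 L U ^+ 2 * (Ch * 24) +
    2 * (L ^- 2 * normL2 L u ^+ 2) + L ^- 2 * normL2 L f ^+ 2 + n ^+ 2 * M1 ^+ 2 * (Ch ^+ 2 * 24).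
  apply: le_trans (ler_sum _ (fun k _ => TB k)) _; rewrite !big_split /= -!mulr_sumr.
  have q1 : 8 * n * kap * L ^- 2 * normL2 L U ^+ 2 * (Ch * \sum_(k <- box K) (br k)%:R ^- 3) <=
      8 * n * kap * L ^- 2 * normL2 L U ^+ 2 * (Ch * 24).
    rewrite ler_wpM2l//; first by nonneg.
    by rewrite ler_wpM2l.
  have q2 : n ^+ 2 * M1 ^+ 2 * (Ch ^+ 2 * \sum_(k <- box K) (br k)%:R ^- 4) <=
      n ^+ 2 * M1 ^+ 2 * (Ch ^+ 2 * 24).
    rewrite ler_wpM2l//; first by nonneg.
    by rewrite ler_wpM2l ?sqr_ge0.
  apply: lerD => //; apply: lerD => //; apply: lerD => //.
  by rewrite ler_wpM2l.
rewrite E.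
have q : - L ^- 2 * B_pair L U (PM U K) <= L ^- 2 * `|B_pair L U (PM U K)|.
  by rewrite mulNr -mulrN ler_wpM2l ?(ltW Li)// -normrN ler_norm.
have nU' := ler_wpM2l c30 nU.
have e5 : 8 * n * kap * L ^- 2 * normL2 L U ^+ 2 * (Ch * 24) = c3 * normL2 L U ^+ 2.
  by rewrite /c3; ring.
rewrite e5 in ST.
move: ST q nU'; rewrite -/U; clear.
move: (B_pair L U (PM U K)) (normL2 L U ^+ 2) (normL2 L u ^+ 2) (\sum_(k <- _) _) (n ^+ 2 * _) (normL2 L f ^+ 2) => B x1 x2 x3 x4 x5.
move: (L ^- 2) => l *; lra.
Qed.

End basic_energy.

Section monotone_integral.
Context d (T : measurableType d) (R : realType) (mu : {measure set T -> \bar R}).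

(** The integral of a nonnegative function is a supremum over simple functions below it, which is
    monotone for arbitrary functions. The H^1 norm of a solution, as a function of time, is not
    known to be measurable. *)
Lemma ge0_le_integral_nonmeasurable (D : set T) (f g : T -> \bar R) :
  (forall x, D x -> (0 <= f x)%E) -> (forall x, D x -> (f x <= g x)%E) ->
  (\int[mu]_(x in D) f x <= \int[mu]_(x in D) g x)%E.
Proof.
move=> f0 fg; rewrite !ge0_integralE//; last first.
  by move=> x Dx; apply: le_trans (fg x Dx); exact: f0.
apply: le_ereal_sup => _ [h /= hf <-]; exists h => //= x; apply: le_trans (hf x) _.
by rewrite /patch; case: ifPn => // /set_mem; exact: fg.
Qed.

End monotone_integral.

(** * Uniform bounds over all solutions with bounded data *)

Section uniform_energy.
Context {R : realType}.
Variable L : R.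
Hypothesis L0 : 0 < L.
Local Notation mu := (@lebesgue_measure R).
Local Notation kap := (kap L).
Local Notation xc := (xc L).
Local Notation X := (X L).
Local Notation phi := (phi L).
Local Notation PM := (PM L).
Implicit Types (u w : R * R -> R * R) (k : int * int) (b : bool).

Lemma br2_lamb u k : (br k)%:R ^+ 2 * X u k ^+ 2 <= 4 / kap ^+ 2 * (lamb L k * X u k ^+ 2).
Proof.
have [->|k0] := eqVneq k 0; first by rewrite X_0 expr0n !mulr0.
have kp := kap_gt0 L0; rewrite [leRHS]mulrA ler_wpM2r ?sqr_ge0// /lamb.
have -> : 4 / kap ^+ 2 * (kap ^+ 2 * en k ^+ 2) = (2 * en k) ^+ 2 by field; exact: lt0r_neq0.
by rewrite ler_pXn2r ?nnegrE ?mulr_ge0 ?en_ge0// (en_br L0).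
Qed.

Variables (nu n : R) (f h : R * R -> R * R).
Hypotheses (nu0 : 0 < nu) (n0 : 0 <= n) (fH : inH L f) (hH : inH L h).
Hypothesis h4 : inHs L 4 h.

(** One number [n] bounds the noise on [0, 1] and the initial value; the uniform constants depend on
    it and on the fixed data, not on the individual solution. *)
Definition sol (z : R -> R) (v0 : R * R -> R * R) (v : R -> R * R -> R * R) : Prop :=
  [/\ continuous z, forall t, 0 <= t <= 1 -> `|z t| <= n, inH L v0, normL2 L v0 <= n &
      weak_solution L nu f h z v0 v].

Lemma sum_chain (x c d e g y : R) : x <= c + d -> d <= e + g -> c <= y -> x <= y + e + g.
Proof. lra. Qed.

Lemma limit_left (E D I y g e yt : R) : E + D <= y + 2 * I + g -> yt <= E + e / 2 ->
  I <= e / 4 -> 0 <= D -> yt <= y + g + e.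
Proof. lra. Qed.

Lemma limit_right (E D I y g e : R) : 0 < e -> E + D <= y + 2 * I + g -> I <= e / 4 -> 0 <= E ->
  D <= y + g + e.
Proof. lra. Qed.

Section one_solution.
Variables (z : R -> R) (v0 : R * R -> R * R) (v : R -> R * R -> R * R).
Hypothesis sv : sol z v0 v.
Let cz : continuous z. Proof. by case: sv. Qed.
Let zn t : 0 <= t <= 1 -> `|z t| <= n. Proof. by case: sv => _ H _ _ _; exact: H. Qed.
Let ws : weak_solution L nu f h z v0 v. Proof. by case: sv. Qed.
Let vH t : inH L (vc v t). Proof. exact: inH_vc ws t. Qed.
Let uH t : inH L (uc h z v t). Proof. exact: (inH_uc hH ws t). Qed.
Let lv t : L2per L (vc v t). Proof. exact: L2per_vc ws t. Qed.
Let lh : L2per L h. Proof. by case: hH. Qed.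

Lemma continuous_Xv k : continuous (fun t => X (vc v t) k).
Proof. by apply: continuous_X => b; exact: (@continuous_xt _ _ L0 _ _ _ _ _ _ ws k b). Qed.

Lemma xc_uc k b t : xc (uc h z v t) k b = xc (vc v t) k b + z t * xc h k b.
Proof. by rewrite /uc xc_addZ. Qed.

Lemma continuous_xu k b : continuous (fun t => xc (uc h z v t) k b).
Proof.
have -> : (fun t => xc (uc h z v t) k b) = (fun t => xc (vc v t) k b + z t * xc h k b).
  by apply/funext => t; exact: xc_uc.
move=> t; apply: cvgD; first exact: (@continuous_xt _ _ L0 _ _ _ _ _ _ ws k b).
by apply: cvgM; [exact: cz|exact: cvg_cst].
Qed.

Lemma continuous_Xu k : continuous (fun t => X (uc h z v t) k).
Proof. by apply: continuous_X => b; exact: continuous_xu. Qed.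

Lemma X_uc k t : 0 <= t <= 1 -> X (uc h z v t) k <= X (vc v t) k + n * X h k.
Proof.
move=> t01; apply: le_trans (X_addZ (z t) k (lv t) lh) _; rewrite lerD2l.
by rewrite ler_wpM2r ?X_ge0// zn.
Qed.

Lemma continuous_normL2 : continuous (fun t => normL2 L (vc v t)).
Proof.
move=> t; apply: (@cvg_lip _ (fun t => normL2 L (vc v t)) (fun r => normL2 L (subf (vc v r) (vc v t))) t 1 1) => //.
- by move=> r; exact: sqrtr_ge0.
- exact: cvg_vc ws t.
move=> r; have h1 := normL2_subf (lv r) (lv t); have h2 := normL2_subf (lv t) (lv r).
rewrite normL2_subfC in h2.
have d0 : 0 <= normL2 L (subf (vc v r) (vc v t)) by exact: sqrtr_ge0.
move: h1 h2 d0; move: (normL2 _ _) (normL2 _ _) (normL2 _ _) => a b c h1 h2 c0.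
rewrite mul1r mulrDr mulr1; have := mulr_ge0 c0 c0.
by rewrite ler_norml; lra.
Qed.

Lemma bounded_normL2 : exists2 B, 0 <= B & forall t, 0 <= t <= 1 -> normL2 L (vc v t) <= B.
Proof.
have cw : {within `[0, 1], continuous (fun t : R => normL2 L (vc v t))}.
  by apply: continuous_subspaceT; exact: continuous_normL2.
have [c _ Hc] := EVT_max ler01 cw.
exists (normL2 L (vc v c)); first exact: sqrtr_ge0.
by move=> t t01; apply: Hc; rewrite in_itv.
Qed.

(** This bound depends on the solution and is confined to times away from 0; its purpose is to let
    the flux vanish. *)
Lemma bounded_H1 s t : 0 < s -> s <= t ->
  exists B, forall M, Ir (fun r => \sum_(k <- box M) (br k)%:R ^+ 2 * X (vc v r) k ^+ 2) s t <= B.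
Proof.
move=> s0 st; have [_ _ /(_ s t s0 st) fin _ _] := ws.
set I := (\int[mu]_(r in _) _)%E in fin.
have I0 : (0 <= I)%E.
  apply: integral_ge0 => r _; apply: expe_ge0.
  by apply: le_ereal_inf_tmp => _ [w _ <-]; rewrite lee_fin sqrtr_ge0.
have If : I \is a fin_num by rewrite ge0_fin_numE.
have kp := kap_gt0 L0.
exists (4 / kap ^+ 2 / L ^+ 2 * fine I) => M.
have cS : continuous (fun r => \sum_(k <- box M) lamb L k * X (vc v r) k ^+ 2).
  apply: continuous_sumr => k r; apply: cvgM; first exact: cvg_cst.
  rewrite (_ : (fun r => _) = (fun r => X (vc v r) k * X (vc v r) k)); last by apply/funext.
  by apply: cvgM; exact: continuous_Xv.
have L2 : 0 < L ^+ 2 by rewrite exprn_gt0.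
have key : L ^+ 2 * Ir (fun r => \sum_(k <- box M) lamb L k * X (vc v r) k ^+ 2) s t <= fine I.
  have cLS : continuous (fun r => L ^+ 2 * \sum_(k <- box M) lamb L k * X (vc v r) k ^+ 2).
    by move=> r; apply: cvgM; [exact: cvg_cst|exact: cS].
  rewrite -IrZ// -lee_fin -Ir_ext// fineK//.
  apply: ge0_le_integral_nonmeasurable => r.
    move=> _; rewrite lee_fin mulr_ge0 ?(ltW L2)//; apply: sumr_ge0 => k _.
    by rewrite mulr_ge0 ?lamb_ge0 ?sqr_ge0.
  rewrite /= in_itv /= => /andP[sr _].
  have vr : vc v r = v r.
    by rewrite /vc; congr v; apply/max_idPr; exact: le_trans (ltW s0) sr.
  rewrite -vr; have := normHs_ge L0 1 (vc v r) M.
  rewrite (_ : \sum_(k <- box M) _ = \sum_(k <- box M) lamb L k * X (vc v r) k ^+ 2)//.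
  apply: eq_bigr => k _; congr (_ * _); rewrite -powR_mulrn ?powR_ge0// -powRrM.
  by rewrite mul1r mulVf// powRr1// lamb_ge0.
have cB : continuous (fun r => \sum_(k <- box M) (br k)%:R ^+ 2 * X (vc v r) k ^+ 2).
  apply: continuous_sumr => k r; apply: cvgM; first exact: cvg_cst.
  rewrite (_ : (fun r => _) = (fun r => X (vc v r) k * X (vc v r) k)); last by apply/funext.
  by apply: cvgM; exact: continuous_Xv.
have cS4 : continuous (fun r => 4 / kap ^+ 2 * \sum_(k <- box M) lamb L k * X (vc v r) k ^+ 2).
  by move=> r; apply: cvgM; [exact: cvg_cst|exact: cS].
apply: (@le_trans _ _ (Ir (fun r => 4 / kap ^+ 2 * \sum_(k <- box M) lamb L k * X (vc v r) k ^+ 2) s t)).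
  apply: Ir_le => // r _; rewrite mulr_sumr; apply: ler_sum => k _; exact: br2_lamb.
rewrite IrZ// -mulrA; apply: ler_wpM2l; first by rewrite divr_ge0 ?sqr_ge0.
by rewrite ler_pdivlMl.
Qed.

Lemma Uc_H1 (s t B : R) : 0 <= s -> s <= t -> t <= 1 ->
  (forall M, Ir (fun r => \sum_(k <- box M) (br k)%:R ^+ 2 * X (vc v r) k ^+ 2) s t <= B) ->
  forall C, (forall k, X h k <= C * (br k)%:R ^- 4) -> 0 <= C ->
  forall M, Ir (fun r => \sum_(k <- box M) (br k)%:R ^+ 2 * X (uc h z v r) k ^+ 2) s t <=
    2 * B + 48 * (n * C) ^+ 2.
Proof.
move=> s0 st t1 HB C HC C0 M.
have csq (F : R -> R) : continuous F -> continuous (fun r => F r ^+ 2).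
  by move=> cF r; rewrite (_ : (fun r => _) = (fun r => F r * F r)); [apply: cvgM; exact: cF|apply/funext].
have cS : continuous (fun r => \sum_(k <- box M) (br k)%:R ^+ 2 * X (vc v r) k ^+ 2).
  by apply: continuous_sumr => k r; apply: cvgM; [exact: cvg_cst|exact: csq (@continuous_Xv k) r].
have cU : continuous (fun r => \sum_(k <- box M) (br k)%:R ^+ 2 * X (uc h z v r) k ^+ 2).
  by apply: continuous_sumr => k r; apply: cvgM; [exact: cvg_cst|exact: csq (@continuous_Xu k) r].
have c2S : continuous (fun r => 2 * \sum_(k <- box M) (br k)%:R ^+ 2 * X (vc v r) k ^+ 2).
  by move=> r; apply: cvgM; [exact: cvg_cst|exact: cS].
apply: (@le_trans _ _ (Ir (fun r => 2 * \sum_(k <- box M) (br k)%:R ^+ 2 * X (vc v r) k ^+ 2 + 48 * (n * C) ^+ 2) s t)).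
  apply: Ir_le => //; first by move=> r; apply: cvgD; [exact: c2S|exact: cvg_cst].
  move=> r /andP[sr rt].
  have r01 : 0 <= r <= 1 by rewrite (le_trans s0 sr) (le_trans rt t1).
  have -> : 48 * (n * C) ^+ 2 = 2 * (n * C) ^+ 2 * 24 by ring.
  apply: (@le_trans _ _ (2 * \sum_(k <- box M) (br k)%:R ^+ 2 * X (vc v r) k ^+ 2 +
     2 * (n * C) ^+ 2 * \sum_(k <- box M) (br k)%:R ^- 6)); last first.
    rewrite lerD2l; apply: ler_wpM2l; first by nonneg.
    exact: sum_br_inv.
  rewrite !mulr_sumr -big_split; apply: ler_sum => k _ /=.
  have b0 : 0 < (br k)%:R :> R by rewrite ltr0n.
  have h1 := X_uc k r01; have h2 := ler_wpM2l n0 (HC k).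
  have h3 : X (uc h z v r) k <= X (vc v r) k + n * (C * (br k)%:R ^- 4) by lra.
  have h4' : 0 <= n * (C * (br k)%:R ^- 4) by rewrite !mulr_ge0 ?invr_ge0 ?exprn_ge0.
  have h5 : X (uc h z v r) k ^+ 2 <= 2 * X (vc v r) k ^+ 2 + 2 * (n * (C * (br k)%:R ^- 4)) ^+ 2.
    apply: (@le_trans _ _ ((X (vc v r) k + n * (C * (br k)%:R ^- 4)) ^+ 2)).
      by rewrite ler_pXn2r ?nnegrE ?addr_ge0 ?X_ge0.
    move: h4' (X_ge0 L (vc v r) k); move: (n * _) (X _ _) => x y _ _.
    by have := sqr_ge0 (x - y); lra.
  apply: le_trans (ler_wpM2l (sqr_ge0 _) h5) _.
  rewrite le_eqVlt; apply/orP; left; apply/eqP; field; exact: lt0r_neq0.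
rewrite IrD//; last by move=> r; exact: cvg_cst.
rewrite IrZ// Ir_cst//; apply: lerD; first by rewrite ler_wpM2l.
by rewrite ler_piMr; [|nonneg|lra].
Qed.

Lemma continuous_flux K : continuous (fun r => `|B_pair L (uc h z v r) (PM (uc h z v r) K)|).
Proof.
have -> : (fun r => `|B_pair L (uc h z v r) (PM (uc h z v r) K)|) = (fun r => `|\sum_(k <- box K)
    (xc (uc h z v r) k true * B_pair L (uc h z v r) (phi k true) +
     xc (uc h z v r) k false * B_pair L (uc h z v r) (phi k false))|).
  by apply/funext => r; rewrite B_proj_sum//; case: (uH r).
have H : continuous (fun r => \sum_(k <- box K)
    (xc (uc h z v r) k true * B_pair L (uc h z v r) (phi k true) +
     xc (uc h z v r) k false * B_pair L (uc h z v r) (phi k false))).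
  apply: continuous_sumr => k r; apply: cvgD; apply: cvgM.
  - exact: continuous_xu.
  - exact: (@continuous_Buc _ _ L0 _ _ _ _ _ _ hH cz ws k true).
  - exact: continuous_xu.
  - exact: (@continuous_Buc _ _ L0 _ _ _ _ _ _ hH cz ws k false).
by move=> r; apply: cvg_norm; exact: H.
Qed.

(** By [B_tail] the flux at time r is at most a constant times sqrt(q) sqrt(q - q_K), where q is the
    lattice sum of the dissipation and q_K its part in the box; q is integrable in time and the
    integral of q - q_K tends to 0. *)
Lemma flux_vanishes (s t e : R) : 0 < s -> s <= t -> t <= 1 -> 0 < e ->
  exists K0 : nat, forall K, (K0 <= K)%N ->
    Ir (fun r => `|B_pair L (uc h z v r) (PM (uc h z v r) K)|) s t <= e.
Proof.
move=> s0 st t1 e0.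
have [Ch Ch0 HCh] : exists2 C, 0 <= C & forall k, X h k <= C * (br k)%:R ^- 4.
  exact: (@inHs_decay _ _ L0 2 h h4).
have [JB HJB] := bounded_H1 s0 st.
have HU := Uc_H1 (ltW s0) st t1 HJB HCh Ch0.
pose q k r : R := (br k)%:R ^+ 2 * X (uc h z v r) k ^+ 2.
have cq k : continuous (q k).
  move=> r; apply: cvgM; first exact: cvg_cst.
  rewrite (_ : (fun r => _) = (fun r => X (uc h z v r) k * X (uc h z v r) k)); last by apply/funext.
  by apply: cvgM; exact: continuous_Xu.
have q0 k r : 0 <= q k r by rewrite mulr_ge0 ?sqr_ge0.
have [ph [_ _ Hph]] := ls_primitive st cq q0 HU.
have [mph EJ] := Hph s t (lexx s) st (lexx t).
set J := ph t - ph s in EJ.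
have J0 : 0 <= J by rewrite subr_ge0.
have [B0 B00 HB0] := bounded_normL2.
pose U0 := (B0 + n * normL2 L h) / L + 1.
have U00 : 0 < U0.
  by rewrite ltr_wpDl// divr_ge0 ?(ltW L0)//; nonneg.
have HU0 r M : 0 <= r <= 1 -> \sum_(k <- box M) X (uc h z v r) k ^+ 2 <= U0 ^+ 2.
  move=> r01; have := bessel_X L0 M (uH r).
  rewrite mulrC -ler_pdivlMr ?exprn_gt0// => H; apply: le_trans H _.
  rewrite -expr_div_n ler_pXn2r ?nnegrE ?(ltW U00)//; last by rewrite divr_ge0 ?(ltW L0)// sqrtr_ge0.
  rewrite /U0 -[leLHS]addr0; apply: lerD => //; rewrite ler_pM2r ?invr_gt0//.
  apply: le_trans (normL2_addZ (z r) (lv r) lh) _; apply: lerD; first exact: HB0.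
  by rewrite ler_wpM2r ?sqrtr_ge0// zn.
have kp := kap_gt0 L0.
pose C2 := 192 * kap * L ^+ 2 * U0.
have C20 : 0 < C2.
  have p192 : 0 < 192 :> R by rewrite ltr0n.
  exact: (mulr_gt0 (mulr_gt0 (mulr_gt0 p192 kp) (exprn_gt0 2 L0)) U00).
(* [ep] makes the term with q at most e / 2, and [eta] makes the term with the tail equal to e /
   4. *)
pose ep := e / (2 * C2 * (J + 1)).
have J1 : 0 < J + 1 by rewrite ltr_wpDl.
have ep0 : 0 < ep by apply: divr_gt0 => //; apply: mulr_gt0 => //; exact: mulr_gt0.
pose eta := ep * e / C2.
have eta0 : 0 < eta by apply: divr_gt0 => //; exact: mulr_gt0.
have [K0 HK0] : exists K0, J - eta < Ir (fun r => \sum_(k <- box K0) q k r) s t.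
  apply/not_existsP => H.
  suff : J <= J - eta by lra.
  rewrite -lee_fin -EJ; apply: int_ls_le => // M.
  by rewrite leNgt; apply/negP; exact: H.
have cB K := @continuous_flux K.
exists K0 => K K0K.
have cSK : continuous (fun r => \sum_(k <- box K) q k r) by exact: continuous_sumr.
have cSK' : continuous (fun r => C2 / (4 * ep) * \sum_(k <- box K) q k r).
  by move=> r; apply: cvgM; [exact: cvg_cst|exact: cSK].
have HK : J - eta <= Ir (fun r => \sum_(k <- box K) q k r) s t.
  apply: le_trans (ltW HK0) _; apply: Ir_le => //; first exact: continuous_sumr.
  by move=> r _; exact: sum_box_homo.
pose C3 := C2 * (ep + (4 * ep)^-1).
have C30 : 0 < C3 by apply: mulr_gt0 => //; rewrite addr_gt0// invr_gt0 mulr_gt0.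
have C4 : 0 < C2 / (4 * ep) by apply: divr_gt0 => //; rewrite mulr_gt0.
have key : Ir (fun r => `|B_pair L (uc h z v r) (PM (uc h z v r) K)| + C2 / (4 * ep) * \sum_(k <- box K) q k r) s t <= C3 * J.
  have cc : continuous (fun r => `|B_pair L (uc h z v r) (PM (uc h z v r) K)| + C2 / (4 * ep) * \sum_(k <- box K) q k r).
    by move=> r; apply: cvgD; [exact: cB|exact: cSK'].
  rewrite -lee_fin -Ir_ext// EFinM -EJ -ge0_integralZl_EFin ?(ltW C30)//; last 2 first.
  - by move=> r _; exact: ls_ge0.
  - exact: measurable_ls.
  apply: ge0_le_integral_nonmeasurable => r.
    by move=> _; rewrite lee_fin addr_ge0// mulr_ge0 ?(ltW C4)// sumr_ge0.
  rewrite /= in_itv /= => /andP[sr rt].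
  have r01 : 0 <= r <= 1 by rewrite (le_trans (ltW s0) sr) (le_trans rt t1).
  have := ls_ge0 (q0^~ r); have := ls_ub (q^~ r).
  case: (ls (q^~ r)) => [qr||] //= Hq; last by move=> _; rewrite gt0_muley ?lte_fin// leey.
  rewrite lee_fin => qr0; rewrite -EFinM lee_fin.
  have {}Hq M : \sum_(k <- box M) q k r <= qr by rewrite -lee_fin.
  set DK := \sum_(k <- box K) q k r.
  have DK0 : 0 <= DK by exact: sumr_ge0.
  have D0 : 0 <= qr - DK by rewrite subr_ge0; exact: Hq.
  pose A := Num.sqrt (U0 * Num.sqrt qr); pose B := Num.sqrt (qr - DK).
  have A2 : A ^+ 2 = U0 * Num.sqrt qr by rewrite sqr_sqrtr// mulr_ge0 ?sqrtr_ge0// ltW.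
  have B2 : B ^+ 2 = qr - DK by rewrite sqr_sqrtr.
  have := @B_tail _ _ L0 (uc h z v r) K A B (uH r) (sqrtr_ge0 _) (sqrtr_ge0 _).
  have hA M : \sum_(k <- box M) (br k)%:R * X (uc h z v r) k ^+ 2 <= A ^+ 2.
    rewrite A2; have c1 := @cauchy_sum _ _ (box M) (fun k => X (uc h z v r) k) (fun k => (br k)%:R * X (uc h z v r) k)
      U0 (Num.sqrt qr) (ltW U00) (sqrtr_ge0 _) (HU0 r M r01).
    rewrite sqr_sqrtr// in c1.
    apply: le_trans (c1 _); first by rewrite le_eqVlt; apply/orP; left; apply/eqP; apply: eq_bigr => k _; ring.
    by apply: le_trans (Hq M); apply: ler_sum => k _; rewrite exprMn.
  have hB M : \sum_(k <- box M | k \notin box K) (br k)%:R ^+ 2 * X (uc h z v r) k ^+ 2 <= B ^+ 2.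
    rewrite B2 lerBrDl; apply: le_trans (Hq (maxn K M)).
    rewrite [leRHS](bigID (fun k => k \in box K)) /=; apply: lerD.
      rewrite -[leRHS]big_filter; apply: ler_sum_subseq => //; first exact: uniq_box.
      by move=> k kK; rewrite mem_filter kK (sub_box (leq_maxl K M)).
    rewrite -[leLHS]big_filter -[leRHS]big_filter; apply: ler_sum_subseq => //.
      by rewrite filter_uniq ?uniq_box.
    by move=> k; rewrite !mem_filter => /andP[-> /(sub_box (leq_maxr K M)) ->].
    by move=> k; exact: (q0 k r).
  move=> /(_ hA hB) tail.
  have sq2 : Num.sqrt qr ^+ 2 = qr by rewrite sqr_sqrtr.
  have e20 : 0 < 2 * ep by rewrite mulr_gt0.
  have y := young (Num.sqrt qr) B e20; rewrite B2 sq2 in y.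
  have : 192 * kap * L ^+ 2 * A ^+ 2 * B = C2 * (Num.sqrt qr * B) by rewrite A2 /C2; ring.
  move=> e1; rewrite e1 in tail.
  have y2 := ler_wpM2l (ltW C20) y.
  have e2 : C2 * (2 * ep / 2 * qr + (qr - DK) / (2 * (2 * ep))) = C3 * qr - C2 / (4 * ep) * DK.
    by rewrite /C3; field; exact: lt0r_neq0.
  rewrite e2 in y2; move: tail y2; move: (B_pair _ _ _) => bb; clear; lra.
rewrite IrD// in key.
rewrite (IrZ _ s t cSK) in key.
have k2 := ler_wpM2l (ltW C4) HK.
move: key k2; move: (Ir _ s t) (Ir _ s t) => I2 I1 key k2.
have : I1 <= C3 * J - C2 / (4 * ep) * (J - eta) by lra.
have -> : C3 * J - C2 / (4 * ep) * (J - eta) = C2 * ep * J + C2 / (4 * ep) * eta.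
  by rewrite /C3; field; exact: lt0r_neq0.
have -> : C2 / (4 * ep) * eta = e / 4.
  by rewrite /eta; field; rewrite !lt0r_neq0.
have : C2 * ep * J <= e / 2.
  have -> : C2 * ep * J = e / 2 * (J / (J + 1)).
    by rewrite /ep; field; rewrite !lt0r_neq0.
  by rewrite ler_piMr ?divr_ge0 ?(ltW e0)// ler_pdivrMr// mul1r lerDl.
lra.
Qed.

(** The modes of the box K are summed and K tends to infinity: Parseval recovers the energy at time
    t, and the flux disappears. The second conclusion keeps the dissipation of each box instead of
    the energy at time t. *)
Lemma energy_inequality (a1 a2 s t : R) : 0 <= a1 -> 0 <= a2 ->
  (forall u zz K, inH L u -> `|zz| <= n ->
    \sum_(k <- box K) (xc u k true * Gf L nu f h u zz k true + xc u k false * Gf L nu f h u zz k false) <=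
    L ^- 2 * `|B_pair L (addZ u zz h) (PM (addZ u zz h) K)| + a1 * normL2 L u ^+ 2 + a2) ->
  0 < s -> s <= t -> t <= 1 -> forall S, (forall r, s <= r <= t -> normL2 L (vc v r) ^+ 2 <= S) ->
  normL2 L (vc v t) ^+ 2 <= normL2 L (vc v s) ^+ 2 + 2 * L ^+ 2 * (a1 * S + a2) * (t - s) /\
  forall K, L ^+ 2 * (nu * kap ^+ 2 / 4 * Ir (fun r => \sum_(k <- box K) (br k)%:R ^+ 2 * X (vc v r) k ^+ 2) s t) <=
    normL2 L (vc v s) ^+ 2 + 2 * L ^+ 2 * (a1 * S + a2) * (t - s).
Proof.
move=> a10 a20 HF s0 st t1 S HS.
have kp := kap_gt0 L0.
have L2 : 0 < L ^+ 2 by rewrite exprn_gt0.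
have nk : 0 <= nu * kap ^+ 2 by rewrite mulr_ge0 ?sqr_ge0 ?(ltW nu0).
pose D k r : R := (br k)%:R ^+ 2 * X (vc v r) k ^+ 2.
have csq (F : R -> R) : continuous F -> continuous (fun r => F r ^+ 2).
  by move=> cF r; rewrite (_ : (fun r => _) = (fun r => F r * F r)); [apply: cvgM; exact: cF|apply/funext].
have cD k : continuous (D k).
  by move=> r; apply: cvgM; [exact: cvg_cst|exact: csq (@continuous_Xv k) r].
pose W k r : R := xc (vc v r) k true * gt L nu f h z v k true r + xc (vc v r) k false * gt L nu f h z v k false r.
have md k b := mode_solution L0 fH hH cz ws k b.
have cW k : continuous (W k).
  have [c1 c2 _] := md k true; have [c3 c4 _] := md k false.
  by move=> r; apply: cvgD; apply: cvgM; [exact: c1|exact: c2|exact: c3|exact: c4].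
have mode_e k : X (vc v t) k ^+ 2 + nu * kap ^+ 2 / 4 * Ir (D k) s t <= X (vc v s) k ^+ 2 + 2 * Ir (W k) s t.
  have := @modes_energy _ (nu * kap ^+ 2 * am k) (nu * kap ^+ 2 / 8 * (br k)%:R ^+ 2) s t _ _ _ _ (md k true) (md k false) (ltW s0) st.
  rewrite /xt => H; have {}H := H _.
  have HB r : nu * kap ^+ 2 / 8 * (br k)%:R ^+ 2 * (xc (vc v r) k true ^+ 2 + xc (vc v r) k false ^+ 2) <=
     nu * kap ^+ 2 * am k * (xc (vc v r) k true ^+ 2 + xc (vc v r) k false ^+ 2).
    rewrite -X_sqr; have := ler_wpM2l nk (am_X L0 (vc v r) k); lra.
  have := H HB; rewrite -!X_sqr.
  have -> : nu * kap ^+ 2 / 4 * Ir (D k) s t = Ir (fun r => 2 * (nu * kap ^+ 2 / 8 * (br k)%:R ^+ 2 *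
      (xc (vc v r) k true ^+ 2 + xc (vc v r) k false ^+ 2))) s t.
    by rewrite -(IrZ _ s t (cD k)); congr Ir; apply/funext => r; rewrite /D X_sqr; field.
  by rewrite -(IrZ 2 s t (cW k)).
have key K : L ^+ 2 * \sum_(k <- box K) X (vc v t) k ^+ 2 +
    L ^+ 2 * (nu * kap ^+ 2 / 4 * Ir (fun r => \sum_(k <- box K) D k r) s t) <=
    normL2 L (vc v s) ^+ 2 + 2 * Ir (fun r => `|B_pair L (uc h z v r) (PM (uc h z v r) K)|) s t +
    2 * L ^+ 2 * (a1 * S + a2) * (t - s).
  have h1 : \sum_(k <- box K) X (vc v t) k ^+ 2 + nu * kap ^+ 2 / 4 * Ir (fun r => \sum_(k <- box K) D k r) s t <=
      \sum_(k <- box K) X (vc v s) k ^+ 2 + 2 * Ir (fun r => \sum_(k <- box K) W k r) s t.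
    rewrite !Ir_sum// !mulr_sumr -!big_split; apply: ler_sum => k _; exact: mode_e.
  have h2 := bessel_X L0 K (vH s).
  have cB : continuous (fun r => `|B_pair L (uc h z v r) (PM (uc h z v r) K)|) by exact: continuous_flux.
  have h3 : Ir (fun r => \sum_(k <- box K) W k r) s t <=
      L ^- 2 * Ir (fun r => `|B_pair L (uc h z v r) (PM (uc h z v r) K)|) s t + (a1 * S + a2) * (t - s).
    have cc : continuous (fun r => L ^- 2 * `|B_pair L (uc h z v r) (PM (uc h z v r) K)|).
      by move=> r; apply: cvgM; [exact: cvg_cst|exact: cB].
    rewrite -(Ir_cst (a1 * S + a2) st) -IrZ// -IrD//; last by move=> r; exact: cvg_cst.
    apply: Ir_le.
    - exact: continuous_sumr.
    - by move=> r; apply: cvgD; [exact: cc|exact: cvg_cst].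
    move=> r rst; have r01 : 0 <= r <= 1.
      by case/andP: rst => sr rt; rewrite (le_trans (ltW s0) sr) (le_trans rt t1).
    apply: le_trans (HF (vc v r) (z r) K (vH r) (zn r01)) _.
    by rewrite -addrA lerD2l lerD2r ler_wpM2l// HS.
  have h4' := ler_wpM2l (ltW L2) h1; rewrite !(mulrDr (L ^+ 2)) in h4'.
  have h5 : L ^+ 2 * (2 * Ir (fun r => \sum_(k <- box K) W k r) s t) <=
     2 * Ir (fun r => `|B_pair L (uc h z v r) (PM (uc h z v r) K)|) s t + 2 * L ^+ 2 * (a1 * S + a2) * (t - s).
    have := ler_wpM2l (mulr_ge0 (ler0n R 2) (ltW L2)) h3.
    have -> : 2 * L ^+ 2 * (L ^- 2 * Ir (fun r => `|B_pair L (uc h z v r) (PM (uc h z v r) K)|) s t +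
       (a1 * S + a2) * (t - s)) = 2 * Ir (fun r => `|B_pair L (uc h z v r) (PM (uc h z v r) K)|) s t +
       2 * L ^+ 2 * (a1 * S + a2) * (t - s) by field; exact: lt0r_neq0.
    by rewrite mulrA (mulrC (L ^+ 2) 2).
  exact: sum_chain h4' h5 h2.
split.
  apply/ler_addgt0Pr => e e0.
  have e2 : 0 < e / 2 by rewrite divr_gt0.
  have e4 : 0 < e / 4 by rewrite divr_gt0.
  have [N1 H1] := parseval_X L0 (vH t) e2; have [N2 H2] := flux_vanishes s0 st t1 e4.
  have k1 := key (maxn N1 N2); have k2 := H1 _ (leq_maxl N1 N2); have k3 := H2 _ (leq_maxr N1 N2).
  have k4 : 0 <= L ^+ 2 * (nu * kap ^+ 2 / 4 * Ir (fun r => \sum_(k <- box (maxn N1 N2)) D k r) s t).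
    rewrite mulr_ge0 ?(ltW L2)// mulr_ge0//; first by rewrite divr_ge0.
    apply: Ir_ge0; first exact: continuous_sumr.
    by move=> r _; apply: sumr_ge0 => k _; rewrite mulr_ge0 ?sqr_ge0.
  exact: limit_left k1 k2 k3 k4.
move=> K; apply/ler_addgt0Pr => e e0.
have e4 : 0 < e / 4 by rewrite divr_gt0.
have [N2 H2] := flux_vanishes s0 st t1 e4.
have k1 := key (maxn K N2); have k3 := H2 _ (leq_maxr K N2).
have k4 : 0 <= L ^+ 2 * \sum_(k <- box (maxn K N2)) X (vc v t) k ^+ 2.
  by rewrite mulr_ge0 ?(ltW L2)//; apply: sumr_ge0 => k _; exact: sqr_ge0.
have k5 : L ^+ 2 * (nu * kap ^+ 2 / 4 * Ir (fun r => \sum_(k <- box K) D k r) s t) <=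
    L ^+ 2 * (nu * kap ^+ 2 / 4 * Ir (fun r => \sum_(k <- box (maxn K N2)) D k r) s t).
  apply: ler_wpM2l; first exact: ltW.
  apply: ler_wpM2l; first by rewrite divr_ge0.
  apply: Ir_le; try exact: continuous_sumr.
  move=> r _; apply: (sum_box_homo (F := D ^~ r)); last exact: leq_maxl.
  by move=> k; rewrite mulr_ge0 ?sqr_ge0.
apply: le_trans k5 _.
exact: limit_right e0 k1 k3 k4.
Qed.

End one_solution.

(** Gronwall's inequality starts at s > 0, as the energy inequality does, and continuity at 0 in L^2
    lets s tend to 0. *)
Lemma uniform_energy : exists2 C, 0 <= C & forall z v0 v, sol z v0 v ->
  (forall t, 0 < t <= 1 -> normL2 L (vc v t) ^+ 2 <= C) /\
  (forall s K, 0 < s <= 1 -> Ir (fun r => \sum_(k <- box K) (br k)%:R ^+ 2 * X (vc v r) k ^+ 2) s 1 <= C).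
Proof.
have [a1 [a2 [a10 a20 HF]]] := forcing_bound L0 nu0 n0 fH hH h4.
have L2 : 0 < L ^+ 2 by rewrite exprn_gt0.
have kp := kap_gt0 L0.
(* The number of pieces in Gronwall's inequality: the coefficient 2 L^2 a1 over a unit time has to
   be at most N / 2. *)
pose N := (Num.bound (4 * L ^+ 2 * a1)).
have HN : 2 * L ^+ 2 * a1 <= N%:R / 2.
  have c0 : 0 <= 4 * L ^+ 2 * a1 by nonneg.
  by have := archi_boundP c0; rewrite -/N; lra.
pose F := 2 * L ^+ 2 * a2.
have F0 : 0 <= F by rewrite /F; nonneg.
pose C1 := 4 ^+ N.+1 * (n ^+ 2 + F).
have C10 : 0 <= C1 by rewrite /C1; nonneg.
have nk : 0 < nu * kap ^+ 2 / 4 by rewrite divr_gt0// mulr_gt0// exprn_gt0.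
pose C2 := (C1 + 2 * L ^+ 2 * (a1 * C1 + a2)) / (L ^+ 2 * (nu * kap ^+ 2 / 4)).
have C20 : 0 <= C2.
  rewrite /C2 divr_ge0//; [by nonneg|by rewrite mulr_ge0 ?ltW].
exists (C1 + C2); first exact: addr_ge0.
move=> z v0 v sv; have [cz zn v0H nv0 ws] := sv.
have lv t : L2per L (vc v t) by exact: L2per_vc ws t.
pose y t := normL2 L (vc v t) ^+ 2.
have y0 t : 0 <= y t by exact: sqr_ge0.
have [B B0 HB] := bounded_normL2 sv.
have yB t : 0 <= t <= 1 -> y t <= B ^+ 2.
  by move=> t01; rewrite /y ler_pXn2r ?nnegrE ?sqrtr_ge0// HB.
have gron s t : 0 < s -> s <= t -> t <= 1 -> y t <= 4 ^+ N.+1 * (y s + F).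
  move=> s0 st t1.
  have cph : {within `[s, t], continuous (fun r : R => 2 * L ^+ 2 * a1 * r)}.
    by apply: continuous_subspaceT => r; apply: cvgM; [exact: cvg_cst|exact: cvg_id].
  have c0 : 0 <= 2 * L ^+ 2 * a1 by nonneg.
  have mph r r' : s <= r -> r <= r' -> r' <= t -> 2 * L ^+ 2 * a1 * r <= 2 * L ^+ 2 * a1 * r'.
    by move=> _ rr' _; rewrite ler_wpM2l.
  have yBd r : s <= r <= t -> 0 <= y r <= B ^+ 2.
    by move=> /andP[sr rt]; rewrite y0 yB// (le_trans (ltW s0) sr) (le_trans rt t1).
  have Hy r r' S : s <= r -> r <= r' -> r' <= t -> 0 < S -> (forall x, r <= x <= r' -> y x <= S) ->
      y r' <= 2 * y r + F + S * (2 * L ^+ 2 * a1 * r' - 2 * L ^+ 2 * a1 * r).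
    move=> sr rr' r't S0 HS.
    have [H _] := energy_inequality sv a10 a20 HF (lt_le_trans s0 sr) rr' (le_trans r't t1) HS.
    rewrite -!/(y _) in H.
    have d1 : 0 <= r' - r by rewrite subr_ge0.
    have d2 : r' - r <= 1 by lra.
    have Fd : F * (r' - r) <= F by rewrite ler_piMr.
    have e : 2 * L ^+ 2 * (a1 * S + a2) * (r' - r) = F * (r' - r) + S * (2 * L ^+ 2 * a1 * r' - 2 * L ^+ 2 * a1 * r).
      by rewrite /F; ring.
    rewrite e in H; have := y0 r; lra.
  have tst : s <= t <= t by rewrite st lexx.
  have pn : 2 * L ^+ 2 * a1 * t - 2 * L ^+ 2 * a1 * s <= N%:R / 2.
    rewrite -mulrBr; apply: le_trans HN; rewrite ler_piMr//; lra.
  have := gronwall_L1 st F0 cph mph yBd Hy tst pn; lra.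
have y_init : forall d, 0 < d -> exists2 s, 0 < s & forall r, 0 < r -> r <= s -> y r <= n ^+ 2 + d.
  move=> d d0.
  have n00 : normL2 L (vc v 0) <= n.
    have v00 : vc v 0 = v 0 by rewrite /vc maxxx.
    have [_ _ _ z0 _] := ws.
    have lv0 : L2per L v0 by case: v0H.
    have := normL2_subf (lv 0) lv0; rewrite v00 -[subf _ _]/(fun p => v 0 p - v0 p) z0 add0r.
    by move=> H; exact: le_trans nv0.
  have cy : normL2 L (vc v r) @[r --> (0 : R)] --> normL2 L (vc v 0).
    exact: (continuous_normL2 sv).
  pose d' := Num.min 1 (d / (2 * n + 1)).
  have nn1 : 0 < 2 * n + 1 by rewrite ltr_wpDl// mulr_ge0.
  have d'0 : 0 < d' by rewrite lt_min ltr01 divr_gt0.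
  have /cvgrPdist_lt/(_ _ d'0)[e /= e0 He] := cy.
  exists (e / 2); first by rewrite divr_gt0.
  move=> r r0 re; have := He r; rewrite /= sub0r normrN gtr0_norm// => /(_ _) H.
  have {}H : `|normL2 L (vc v 0) - normL2 L (vc v r)| < d' by apply: H; lra.
  have d1 : d' <= 1 by rewrite /d' ge_min lexx.
  have d2 : (2 * n + 1) * d' <= d.
    by rewrite -ler_pdivlMl// mulrC /d' ge_min lexx orbT.
  have : normL2 L (vc v r) <= n + d' by move: H; rewrite ltr_norml => /andP[]; lra.
  move=> H2; apply: (@le_trans _ _ ((n + d') ^+ 2)).
    by rewrite /y ler_pXn2r ?nnegrE ?sqrtr_ge0// addr_ge0// ltW.
  have : d' * d' <= d' by rewrite ler_piMl// ltW.
  lra.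
have ybd t : 0 < t <= 1 -> y t <= C1.
  move=> /andP[t0 t1]; apply/ler_addgt0Pr => d d0.
  have p4 : 0 < 4 ^+ N.+1 :> R by rewrite exprn_gt0.
  have d1 : 0 < d / 4 ^+ N.+1 by rewrite divr_gt0.
  have [s s0 Hs] := y_init _ d1.
  have m0 : 0 < Num.min s t by rewrite lt_min s0.
  have := gron (Num.min s t) t m0; rewrite ge_min lexx orbT => /(_ isT t1) H.
  have := Hs (Num.min s t) m0; rewrite ge_min lexx => /(_ isT) H2.
  apply: le_trans H _; rewrite /C1.
  apply: (@le_trans _ _ (4 ^+ N.+1 * (n ^+ 2 + d / 4 ^+ N.+1 + F))).
    by rewrite ler_wpM2l ?(ltW p4)// lerD2r.
  rewrite le_eqVlt; apply/orP; left; apply/eqP; field; exact: lt0r_neq0.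
split=> [t t01|s K /andP[s0 s1]]; first by apply: le_trans (ybd t t01) _; rewrite lerDl.
have HS r : s <= r <= 1 -> y r <= C1.
  by move=> /andP[sr r1]; apply: ybd; rewrite r1 andbT; exact: lt_le_trans sr.
have [_ /(_ K)] := energy_inequality sv a10 a20 HF s0 s1 (lexx 1) HS.
rewrite mulrA => H.
have q : 0 < L ^+ 2 * (nu * kap ^+ 2 / 4) by exact: mulr_gt0.
have : Ir (fun r => \sum_(k <- box K) (br k)%:R ^+ 2 * X (vc v r) k ^+ 2) s 1 <= C2; last first.
  by move=> H2; apply: le_trans H2 _; rewrite lerDr.
rewrite /C2 ler_pdivlMr// mulrC; apply: le_trans H _; apply: lerD.
  by apply: HS; rewrite lexx.
rewrite ler_piMr//; [by nonneg|lra].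
Qed.

End uniform_energy.

(** * First order regularity and dependence on the initial value *)

Section higher_energy.
Context {R : realType}.
Variable L : R.
Hypothesis L0 : 0 < L.
Local Notation mu := (@lebesgue_measure R).
Local Notation kap := (kap L).
Local Notation xc := (xc L).
Local Notation X := (X L).
Local Notation phi := (phi L).
Implicit Types (u w : R * R -> R * R) (k : int * int) (b : bool).

Lemma continuous_sqr (F : R -> R) : continuous F -> continuous (fun r => F r ^+ 2).
Proof.
by move=> cF r; rewrite (_ : (fun r => _) = (fun r => F r * F r)); [apply: cvgM; exact: cF|apply/funext].
Qed.

Lemma pair_energy (m c B s t : R) (g1 g2 x1 x2 : R -> R) : mode m g1 x1 -> mode m g2 x2 ->
  0 <= s -> s <= t ->
  (forall r, c * (B ^+ 2 * (x1 r ^+ 2 + x2 r ^+ 2)) <= m * (x1 r ^+ 2 + x2 r ^+ 2)) ->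
  Num.sqrt (x1 t ^+ 2 + x2 t ^+ 2) ^+ 2 +
    Ir (fun r => 2 * c * (B ^+ 2 * Num.sqrt (x1 r ^+ 2 + x2 r ^+ 2) ^+ 2)) s t <=
  Num.sqrt (x1 s ^+ 2 + x2 s ^+ 2) ^+ 2 +
    Ir (fun r => 2 * (Num.sqrt (x1 r ^+ 2 + x2 r ^+ 2) * (`|g1 r| + `|g2 r|))) s t.
Proof.
move=> m1 m2 s0 st H; have [cx1 cg1 _] := m1; have [cx2 cg2 _] := m2.
have sq r : Num.sqrt (x1 r ^+ 2 + x2 r ^+ 2) ^+ 2 = x1 r ^+ 2 + x2 r ^+ 2.
  by rewrite sqr_sqrtr// addr_ge0 ?sqr_ge0.
rewrite !sq.
have := @modes_energy _ m (c * B ^+ 2) s t _ _ _ _ m1 m2 s0 st.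
have H' r : c * B ^+ 2 * (x1 r ^+ 2 + x2 r ^+ 2) <= m * (x1 r ^+ 2 + x2 r ^+ 2) by rewrite -mulrA.
move=> /(_ H'); have -> : Ir (fun r => 2 * c * (B ^+ 2 * Num.sqrt (x1 r ^+ 2 + x2 r ^+ 2) ^+ 2)) s t =
   Ir (fun r => 2 * (c * B ^+ 2 * (x1 r ^+ 2 + x2 r ^+ 2))) s t.
  by congr Ir; apply/funext => r; rewrite sq; ring.
move=> E; apply: le_trans E _; rewrite lerD2l.
have cs : continuous (fun r => Num.sqrt (x1 r ^+ 2 + x2 r ^+ 2)).
  move=> r; apply: (@continuous_comp _ _ _ (fun r => x1 r ^+ 2 + x2 r ^+ 2) Num.sqrt).
    by apply: cvgD; [exact: continuous_sqr cx1 r|exact: continuous_sqr cx2 r].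
  exact: sqrt_continuous.
apply: Ir_le.
- move=> r; apply: cvgM; first exact: cvg_cst.
  by apply: cvgD; apply: cvgM; [exact: cx1|exact: cg1|exact: cx2|exact: cg2].
- move=> r; apply: cvgM; first exact: cvg_cst.
  apply: cvgM; first exact: cs.
  by apply: cvgD; apply: cvg_norm; [exact: cg1|exact: cg2].
move=> r _; rewrite ler_wpM2l// mulrDr; apply: lerD.
  apply: le_trans (ler_norm _) _; rewrite normrM ler_wpM2r//.
  by rewrite -sqrtr_sqr ler_sqrt ?addr_ge0 ?sqr_ge0// lerDl sqr_ge0.
apply: le_trans (ler_norm _) _; rewrite normrM ler_wpM2r//.
by rewrite -sqrtr_sqr ler_sqrt ?addr_ge0 ?sqr_ge0// lerDr sqr_ge0.
Qed.

(** At k = l + m the weight is at most the sum of the weights at l and at m; by symmetry both cases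
    give the same convolution. *)
Lemma conv_weight (ga P : int * int -> R) M k : (forall l m, ga (l + m) <= ga l + ga m) ->
  (forall l, 0 <= P l) -> ga k * conv M P P k <= 2 * conv M P (fun m => ga m * P m) k.
Proof.
move=> sub P0; have -> : 2 * conv M P (fun m => ga m * P m) k =
    conv M (fun m => ga m * P m) P k + conv M P (fun m => ga m * P m) k.
  by rewrite (convC _ (fun m => ga m * P m)) mulr_natl mulr2n.
rewrite !conv_cond -big_split mulr_sumr; apply: ler_sum => l _ /=.
rewrite -big_split mulr_sumr; apply: ler_sum => m _ /=.
have [<-|_] := eqVneq (l + m) k; last by rewrite !mulr0 addr0.
rewrite !mulr1; have := ler_wpM2r (mulr_ge0 (P0 l) (P0 m)) (sub l m); lra.
Qed.

(** Truncation keeps the weight subadditive and makes it bounded, so the weighted sums are finite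
    before any pointwise H^1 bound is known. *)
Definition trunc_weight (N : nat) k : R := (minn (br k) N)%:R.

Lemma trunc_weight_sub N l m : trunc_weight N (l + m) <= trunc_weight N l + trunc_weight N m.
Proof. by rewrite /trunc_weight -natrD ler_nat; have := br_add l m; lia. Qed.

Variables (nu n : R) (f h : R * R -> R * R).
Hypotheses (nu0 : 0 < nu) (n0 : 0 <= n) (fH : inH L f) (hH : inH L h).
Hypotheses (f2 : inHs L 2 f) (h4 : inHs L 4 h).
Local Notation sol := (sol L nu n f h).

Definition M1 : R := 1 + 2 * (nu * kap ^+ 2).

(** A bound for the part of the drive without the quadratic term, cosine and sine together, whence
    the factors 2. *)
Definition force k : R := 2 * X f k + 2 * n * M1 * ((br k)%:R ^+ 2 * X h k).

Lemma M1_ge0 : 0 <= M1. Proof. by rewrite /M1; nonneg. Qed.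

Lemma force_ge0 k : 0 <= force k.
Proof.
have := M1_ge0; have := X_ge0 L f k; have := X_ge0 L h k; rewrite /force; move=> *.
by nonneg.
Qed.

Lemma force_decay : exists2 C, 0 <= C & forall k, force k <= C * (br k)%:R ^- 2.
Proof.
have [Ch Ch0 HCh] : exists2 C, 0 <= C & forall k, X h k <= C * (br k)%:R ^- 4.
  exact: (@inHs_decay _ _ L0 2 h h4).
have [Cf Cf0 HCf] : exists2 C, 0 <= C & forall k, X f k <= C * (br k)%:R ^- 2.
  exact: (@inHs_decay _ _ L0 1 f f2).
have m0 := M1_ge0.
exists (2 * Cf + 2 * n * M1 * Ch); first by nonneg.
move=> k; rewrite /force [leRHS]mulrDl; apply: lerD; first by rewrite -mulrA ler_wpM2l.
rewrite -[leRHS]mulrA; apply: ler_wpM2l; first by nonneg.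
have b0 : 0 < (br k)%:R :> R by rewrite ltr0n.
apply: le_trans (ler_wpM2l (sqr_ge0 _) (HCh k)) _.
rewrite le_eqVlt; apply/orP; left; apply/eqP; field; exact: lt0r_neq0.
Qed.

Definition drive z v k t : R := `|gt L nu f h z v k true t| + `|gt L nu f h z v k false t|.

Lemma drive_bound z v0 v t k (e : R) : sol z v0 v -> 0 <= t <= 1 -> 0 < e ->
  exists N : nat, forall M, (N <= M)%N ->
    drive z v k t <= 32 * kap * ((br k)%:R * conv M (X (uc h z v t)) (X (uc h z v t)) k) + force k + e.
Proof.
move=> sv t01 e0; have [cz zn _ _ ws] := sv.
have uH : inH L (uc h z v t) by exact: (inH_uc hH ws t).
have L2 : 0 < L ^+ 2 by rewrite exprn_gt0.
have e1 : 0 < e * L ^+ 2 / 2 by apply: divr_gt0 => //; exact: mulr_gt0.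
have [N1 H1] := Bphi_conv L0 k true uH e1; have [N2 H2] := Bphi_conv L0 k false uH e1.
exists (maxn N1 N2) => M; rewrite geq_max => /andP[M1' M2].
have one b : `|B_pair L (uc h z v t) (phi k b)| <=
    16 * kap * L ^+ 2 * (br k)%:R * conv M (X (uc h z v t)) (X (uc h z v t)) k + e * L ^+ 2 / 2 ->
    `|gt L nu f h z v k b t| <= 16 * kap * ((br k)%:R * conv M (X (uc h z v t)) (X (uc h z v t)) k) + force k / 2 + e / 2.
  move=> HB; rewrite /gt.
  apply: le_trans (ler_normD _ _) _; apply: le_trans (lerD (ler_normD _ _) (lexx _)) _.
  have b1 : `|- B_pair L (uc h z v t) (phi k b) / L ^+ 2| <=
     16 * kap * ((br k)%:R * conv M (X (uc h z v t)) (X (uc h z v t)) k) + e / 2.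
    rewrite normrM normrN normfV (ger0_norm (ltW L2)) ler_pdivrMr//; apply: le_trans HB _.
    by rewrite le_eqVlt; apply/orP; left; apply/eqP; field.
  have b2 := xc_X L f k b.
  have b3 : `|z t * ((1 - nu * kap ^+ 2 * am k) * xc h k b)| <= n * M1 * ((br k)%:R ^+ 2 * X h k).
    rewrite normrM (normrM (1 - _)).
    have q := ler_pM (normr_ge0 _) (normr_ge0 _) (abs1m L nu0 k) (xc_X L h k b).
    have := ler_pM (normr_ge0 _) (mulr_ge0 (normr_ge0 _) (normr_ge0 _)) (zn t t01) q.
    by rewrite -/M1 -!mulrA.
  rewrite /force; move: b1 b2 b3; move: `|_| `|_| `|_| => x y w; lra.
have := one true (H1 M M1'); have := one false (H2 M M2); rewrite /drive.
move: `|_| `|_| (force k) (_ * conv _ _ _ _) => x y w c; lra.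
Qed.

Lemma uc_bounds : exists P0 Kq, [/\ 0 <= P0, 0 <= Kq & forall z v0 v, sol z v0 v ->
  (forall t, 0 < t <= 1 -> forall M, \sum_(k <- box M) X (uc h z v t) k ^+ 2 <= P0 ^+ 2) /\
  (forall s, 0 < s <= 1 -> forall M, Ir (fun t => \sum_(k <- box M) (br k)%:R ^+ 2 * X (uc h z v t) k ^+ 2) s 1 <= Kq)].
Proof.
have [C C0 HC] := uniform_energy L0 nu0 n0 fH hH h4.
have [Ch Ch0 HCh] : exists2 C, 0 <= C & forall k, X h k <= C * (br k)%:R ^- 4.
  exact: (@inHs_decay _ _ L0 2 h h4).
have lh : L2per L h by case: hH.
exists ((Num.sqrt C + n * normL2 L h) / L), (2 * C + 48 * (n * Ch) ^+ 2); split.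
- by rewrite divr_ge0 ?(ltW L0)// addr_ge0 ?sqrtr_ge0// mulr_ge0// sqrtr_ge0.
- by nonneg.
move=> z v0 v sv; have [H1 H2] := HC _ _ _ sv; have [_ zn _ _ ws] := sv.
split=> [t t01 M|s s01 M].
  have uH : inH L (uc h z v t) by exact: (inH_uc hH ws t).
  have lv : L2per L (vc v t) by exact: L2per_vc ws t.
  have := bessel_X L0 M uH; rewrite mulrC -ler_pdivlMr ?exprn_gt0// => H; apply: le_trans H _.
  have s0 : 0 <= Num.sqrt C + n * normL2 L h.
    by rewrite addr_ge0 ?sqrtr_ge0// mulr_ge0// sqrtr_ge0.
  rewrite expr_div_n ler_pM2r ?invr_gt0 ?exprn_gt0// ler_pXn2r ?nnegrE ?sqrtr_ge0//.
  apply: le_trans (normL2_addZ (z t) lv lh) _; apply: lerD.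
    by rewrite -(ger0_norm (sqrtr_ge0 _ : 0 <= normL2 L _)) -sqrtr_sqr ler_sqrt// H1.
  rewrite ler_wpM2r ?sqrtr_ge0// zn//.
  by case/andP: t01 => t0 ->; rewrite (ltW t0).
case/andP: (s01) => s0 s1.
exact: (Uc_H1 L0 n0 hH sv (ltW s0) s1 (lexx 1) (fun M => H2 s M s01) HCh Ch0).
Qed.

(** If the sums exceeded 4 C + 1 throughout [1/4, 1/2], the integral over this interval of length
    1/4 would exceed C. *)
Lemma good_time (C : R) z v0 v : 0 <= C -> sol z v0 v ->
  (forall s K, 0 < s <= 1 -> Ir (fun r => \sum_(k <- box K) (br k)%:R ^+ 2 * X (vc v r) k ^+ 2) s 1 <= C) ->
  exists2 tau, 4^-1 <= tau <= 2^-1 & forall M, \sum_(k <- box M) (br k)%:R ^+ 2 * X (vc v tau) k ^+ 2 <= 4 * C + 1.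
Proof.
move=> C0 sv HC; pose D k r : R := (br k)%:R ^+ 2 * X (vc v r) k ^+ 2.
have cD k : continuous (D k).
  by move=> r; apply: cvgM; [exact: cvg_cst|exact: continuous_sqr (@continuous_Xv _ _ L0 _ _ _ _ _ _ _ sv k) r].
have D0 k r : 0 <= D k r by rewrite mulr_ge0 ?sqr_ge0.
have cS M : continuous (fun r => \sum_(k <- box M) D k r) by exact: continuous_sumr.
have q0 : 0 < 4^-1 :> R by rewrite invr_gt0.
have q1 : 4^-1 <= 2^-1 :> R by lra.
have q2 : 2^-1 <= 1 :> R by lra.
have HI M : Ir (fun r => \sum_(k <- box M) D k r) 4^-1 2^-1 <= C.
  have q3 : 0 < (4^-1 : R) <= 1 by rewrite q0 (le_trans q1 q2).
  apply: le_trans (HC 4^-1 M q3); rewrite (Ir_split (cS M) q1 q2) lerDl.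
  by apply: Ir_ge0 => // r _; exact: sumr_ge0.
have := int_ls_le cD D0 HI => HL.
have [//|H] := pselect (exists2 tau, 4^-1 <= tau <= 2^-1 & forall M, \sum_(k <- box M) D k tau <= 4 * C + 1).
have : ((C + 4^-1)%:E <= \int[mu]_(t in `[4^-1%R, 2^-1%R]) ls (fun k => D k t))%E.
  have -> : C + 4^-1 = Ir (fun=> 4 * C + 1) 4^-1 2^-1 by rewrite Ir_cst//; field.
  rewrite -Ir_ext; last by move=> r; exact: cvg_cst.
  apply: ge0_le_integral_nonmeasurable => r.
    by move=> _; rewrite lee_fin addr_ge0// mulr_ge0.
  rewrite /= in_itv /= => rI.
  have [M HM] : exists M, 4 * C + 1 < \sum_(k <- box M) D k r.
    apply/not_existsP => H'; apply: H; exists r => // M.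
    by rewrite leNgt; apply/negP; exact: H'.
  by apply: le_trans (ls_ub _ M); rewrite lee_fin ltW.
by move=> /le_trans /(_ HL); rewrite lee_fin => ?; exfalso; lra.
Qed.

(** The weighted estimate runs from a time [tau] with controlled H^1 norm up to 1. The weight
    truncated at M + 1 agrees with [br] on the box M, and the resulting bound is independent of
    M. *)
Lemma uniform_H1 : exists2 C, 0 <= C & forall z v0 v, sol z v0 v ->
  forall t, 2^-1 <= t <= 1 -> forall M, \sum_(k <- box M) (br k)%:R ^+ 2 * X (vc v t) k ^+ 2 <= C.
Proof.
have [C C0 HC] := uniform_energy L0 nu0 n0 fH hH h4.
have [P0 [Kq [P00 Kq0 HU]]] := uc_bounds.
have [Ch Ch0 HCh] : exists2 C, 0 <= C & forall k, X h k <= C * (br k)%:R ^- 4.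
  exact: (@inHs_decay _ _ L0 2 h h4).
have [Cf Cf0 HCf] := force_decay.
have kp := kap_gt0 L0.
pose c := nu * kap ^+ 2 / 8; pose A := 64 * kap.
have c0 : 0 < c by rewrite /c divr_gt0// mulr_gt0// exprn_gt0.
have A0 : 0 <= A by rewrite /A; nonneg.
have g0 := gcst_ge0 A P0 c0.
pose nn := Num.bound (4 * (gcst c A P0 + 1) * Kq).
have Hnn : 2 * (gcst c A P0 + 1) * Kq <= nn%:R / 2.
  have p0 : 0 <= 4 * (gcst c A P0 + 1) * Kq by nonneg.
  by have := archi_boundP p0; rewrite -/nn; lra.
pose Eta := (n * Ch) ^+ 2 * 24; pose Psi := Cf ^+ 2 * 24.
pose C1 := 4 ^+ nn.+1 * (4 * C + 1 + (2 * (c / 2 * Eta + 2 * Psi / c) + 2 * (gcst c A P0 + 1) * Eta * Kq)).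
exists C1.
  have ci : 0 <= c^-1 by rewrite invr_ge0 ltW.
  by rewrite /C1 /Eta /Psi; nonneg.
move=> z v0 v sv; have [H1 H2] := HC _ _ _ sv; have [HU1 HU2] := HU _ _ _ sv.
have [_ zn _ _ ws] := sv; have [cz _ _ _ _] := sv.
have [tau /andP[tau4 tau2] Htau] := good_time C0 sv H2.
move=> t /andP[t2 t1] M.
have tau0 : 0 < tau by apply: lt_le_trans tau4; rewrite invr_gt0.
have md k b := mode_solution L0 fH hH cz ws k b.
have r01 r : tau <= r <= 1 -> 0 < r <= 1.
  by move=> /andP[tr ->]; rewrite andbT; exact: lt_le_trans tr.
have r01' r : tau <= r <= 1 -> 0 <= r <= 1 by move=> /r01/andP[/ltW -> ->].
pose ga := trunc_weight M.+1.
have ga0 k : 0 <= ga k by exact: ler0n.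
have gab k : ga k <= (br k)%:R by rewrite /ga /trunc_weight ler_nat geq_minl.
have gaN k : ga k <= M.+1%:R by rewrite /ga /trunc_weight ler_nat geq_minr.
have gaM k : k \in box M -> ga k = (br k)%:R.
  by rewrite mem_box /ga /trunc_weight => kM; rewrite (minn_idPl kM).
pose eta k := n * X h k.
have eta0 k : 0 <= eta k by rewrite mulr_ge0 ?X_ge0.
have b1 k : 1 <= (br k)%:R :> R by rewrite ler1n.
have gaeta k : (br k)%:R ^+ 2 * (ga k * eta k) ^+ 2 <= (n * Ch) ^+ 2 * (br k)%:R ^- 4.
  have b0 : 0 < (br k)%:R :> R by rewrite ltr0n.
  have : ga k * eta k <= (br k)%:R * (n * (Ch * (br k)%:R ^- 4)).
    by apply: ler_pM => //; rewrite ler_wpM2l.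
  have : 0 <= ga k * eta k by rewrite mulr_ge0.
  move: (ga k * eta k) => x x0 xle.
  apply: (@le_trans _ _ ((br k)%:R ^+ 2 * ((br k)%:R * (n * (Ch * (br k)%:R ^- 4))) ^+ 2)).
    by rewrite ler_wpM2l ?sqr_ge0// ler_pXn2r ?nnegrE// (le_trans x0 xle).
  by rewrite le_eqVlt; apply/orP; left; apply/eqP; field; exact: lt0r_neq0.
have HEta2 K : \sum_(k <- box K) (br k)%:R ^+ 2 * (ga k * eta k) ^+ 2 <= Eta.
  apply: le_trans (ler_sum _ (fun k _ => gaeta k)) _; rewrite -mulr_sumr ler_wpM2l ?sqr_ge0//.
  exact: sum_br_inv.
have HEta1 K : \sum_(k <- box K) (ga k * eta k) ^+ 2 <= Eta.
  apply: le_trans (HEta2 K); apply: ler_sum => k _.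
  by rewrite ler_peMl ?sqr_ge0// exprn_ege1.
have HPsi K : \sum_(k <- box K) force k ^+ 2 <= Psi.
  apply: (@le_trans _ _ (\sum_(k <- box K) Cf ^+ 2 * (br k)%:R ^- 4)).
    apply: ler_sum => k _.
    have -> : Cf ^+ 2 * (br k)%:R ^- 4 = (Cf * (br k)%:R ^- 2) ^+ 2.
      by rewrite exprMn exprVn -exprM.
    rewrite ler_pXn2r ?nnegrE ?force_ge0//; first exact: le_trans (force_ge0 k) (HCf k).
  by rewrite -mulr_sumr ler_wpM2l ?sqr_ge0//; exact: sum_br_inv.
(* This bound depends on M, but it only has to be finite. *)
have HX r : tau <= r <= 1 -> forall K, \sum_(k <- box K) (ga k * X (vc v r) k) ^+ 2 <= M.+1%:R ^+ 2 * (C / L ^+ 2).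
  move=> rI K; apply: (@le_trans _ _ (\sum_(k <- box K) M.+1%:R ^+ 2 * X (vc v r) k ^+ 2)).
    apply: ler_sum => k _; rewrite -exprMn ler_pXn2r ?nnegrE ?mulr_ge0 ?X_ge0//.
    by rewrite ler_wpM2r ?X_ge0.
  rewrite -mulr_sumr ler_wpM2l ?sqr_ge0// ler_pdivlMr ?exprn_gt0// mulrC.
  by apply: le_trans (bessel_X L0 K (inH_vc ws r)) (H1 r (r01 r rI)).
have cXv k := @continuous_Xv _ _ L0 _ _ _ _ _ _ _ sv k.
have cD k : continuous (fun r => (br k)%:R ^+ 2 * X (vc v r) k ^+ 2).
  by move=> r; apply: cvgM; [exact: cvg_cst|exact: continuous_sqr (cXv k) r].
have tau1 : tau <= 1 by lra.
have HD K : Ir (fun r => \sum_(k <- box K) (br k)%:R ^+ 2 * (ga k * X (vc v r) k) ^+ 2) tau 1 <= M.+1%:R ^+ 2 * C.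
  have cS : continuous (fun r => \sum_(k <- box K) (br k)%:R ^+ 2 * X (vc v r) k ^+ 2) by exact: continuous_sumr.
  apply: (@le_trans _ _ (Ir (fun r => M.+1%:R ^+ 2 * \sum_(k <- box K) (br k)%:R ^+ 2 * X (vc v r) k ^+ 2) tau 1)).
    apply: Ir_le.
    - apply: continuous_sumr => k r; apply: cvgM; first exact: cvg_cst.
      have cgX : continuous (fun r => ga k * X (vc v r) k).
        by move=> r'; apply: cvgM; [exact: cvg_cst|exact: cXv].
      exact: continuous_sqr cgX r.
    - by move=> r; apply: cvgM; [exact: cvg_cst|exact: cS].
    move=> r _; rewrite mulr_sumr; apply: ler_sum => k _; rewrite exprMn mulrCA.
    apply: ler_wpM2r; first by rewrite mulr_ge0 ?sqr_ge0.
    by rewrite ler_pXn2r ?nnegrE.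
  by rewrite IrZ// ler_wpM2l ?sqr_ge0// H2// tau0.
have HE k s r : tau <= s -> s <= r -> r <= 1 ->
   X (vc v r) k ^+ 2 + Ir (fun r => 2 * c * ((br k)%:R ^+ 2 * X (vc v r) k ^+ 2)) s r <=
   X (vc v s) k ^+ 2 + Ir (fun r => 2 * (X (vc v r) k * drive z v k r)) s r.
  move=> taus sr _; have := @pair_energy _ c (br k)%:R s r _ _ _ _ (md k true) (md k false)
     (ltW (lt_le_trans tau0 taus)) sr; apply=> r'.
  rewrite /xt -X_sqr /c; have nk : 0 <= nu * kap ^+ 2 by rewrite mulr_ge0 ?sqr_ge0 ?(ltW nu0).
  have := ler_wpM2l nk (am_X L0 (vc v r') k); lra.
have Hg r : tau <= r <= 1 -> forall k e, 0 < e -> exists N : nat, forall K, (N <= K)%N ->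
    ga k * drive z v k r <= (br k)%:R * (A * conv K (X (uc h z v r)) (fun m => ga m * (X (vc v r) m + eta m)) k + force k) + e.
  move=> rI k e e0.
  have g1 : 0 < ga k + 1 by rewrite ltr_wpDl.
  have e1 : 0 < e / (ga k + 1) by rewrite divr_gt0.
  have [N HN] := drive_bound k sv (r01' r rI) e1; exists N => K NK.
  apply: le_trans (ler_wpM2l (ga0 k) (HN K NK)) _.
  rewrite (mulrDr (ga k)) (mulrDr (ga k)) (mulrDr (br k)%:R).
  have t3 : ga k * (e / (ga k + 1)) <= e.
    by rewrite mulrCA ler_piMr ?(ltW e0)// ler_pdivrMr// mul1r lerDl.
  have t2' : ga k * force k <= (br k)%:R * force k by rewrite ler_wpM2r ?force_ge0.
  have t1' : ga k * (32 * kap * ((br k)%:R * conv K (X (uc h z v r)) (X (uc h z v r)) k)) <=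
     (br k)%:R * (A * conv K (X (uc h z v r)) (fun m => ga m * (X (vc v r) m + eta m)) k).
    have -> : ga k * (32 * kap * ((br k)%:R * conv K (X (uc h z v r)) (X (uc h z v r)) k)) =
       32 * kap * (br k)%:R * (ga k * conv K (X (uc h z v r)) (X (uc h z v r)) k) by ring.
    have -> : (br k)%:R * (A * conv K (X (uc h z v r)) (fun m => ga m * (X (vc v r) m + eta m)) k) =
       32 * kap * (br k)%:R * (2 * conv K (X (uc h z v r)) (fun m => ga m * (X (vc v r) m + eta m)) k).
      by rewrite /A; ring.
    rewrite ler_wpM2l//; first by nonneg.
    apply: le_trans (conv_weight K k (trunc_weight_sub M.+1) (X_ge0 L _)) _.
    rewrite ler_wpM2l//; apply: ler_conv => l; first by rewrite X_ge0 lexx.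
    by rewrite mulr_ge0 ?X_ge0//= ler_wpM2l//; exact: (X_uc hH sv l (r01' r rI)).
  by apply: lerD => //; apply: lerD.
have cg k : continuous (drive z v k).
  have [_ c1 _] := md k true; have [_ c2 _] := md k false.
  by move=> r; apply: cvgD; apply: cvg_norm; [exact: c1|exact: c2].
have HE0 K : \sum_(k <- box K) (ga k * X (vc v tau) k) ^+ 2 <= 4 * C + 1.
  apply: le_trans (Htau K); apply: ler_sum => k _; rewrite -exprMn.
  by rewrite ler_pXn2r ?nnegrE ?mulr_ge0 ?X_ge0// ler_wpM2r ?X_ge0.
have tauI : 0 < tau <= 1 by rewrite tau0.
have := @weighted_energy _ c A P0 c0 A0 P00 tau 1 Kq _ _ Eta Eta Psi (fun k r => X (vc v r) k) (drive z v)
  (fun k r => X (uc h z v r) k) ga eta force nn tau1 _ Kq0 cXv cg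
  (fun k => @continuous_Xu _ _ L0 _ _ _ _ hH _ _ _ sv k) (fun k r => X_ge0 L _ k)
  (fun k r => addr_ge0 (normr_ge0 _) (normr_ge0 _)) (fun k r => X_ge0 L _ k) ga0 eta0 force_ge0 HE Hg
  HEta1 HEta2 HPsi (fun r rI => HU1 r (r01 r rI)) (HU2 tau tauI) HX HD Hnn _ HE0 t _ M.
have q1 : 1 <= tau + 1 by lra.
have q2 : tau <= t <= 1 by rewrite t1 (le_trans tau2).
move=> /(_ q1 q2); apply: le_trans.
rewrite le_eqVlt; apply/orP; left; apply/eqP; rewrite big_seq [RHS]big_seq.
by apply: eq_bigr => k kM; rewrite gaM// exprMn.
Qed.

Definition dw v1 v2 (t : R) := subf (vc v1 t) (vc v2 t).

Section two_solutions.
Variables (z : R -> R) (v10 v20 : R * R -> R * R) (v1 v2 : R -> R * R -> R * R).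
Hypotheses (s1 : sol z v10 v1) (s2 : sol z v20 v2).

Let ws1 : weak_solution L nu f h z v10 v1. Proof. by case: s1. Qed.
Let ws2 : weak_solution L nu f h z v20 v2. Proof. by case: s2. Qed.
Let cz : continuous z. Proof. by case: s1. Qed.
Let l1 t : L2per L (vc v1 t). Proof. exact: L2per_vc ws1 t. Qed.
Let l2 t : L2per L (vc v2 t). Proof. exact: L2per_vc ws2 t. Qed.

Lemma inH_dw t : inH L (dw v1 v2 t).
Proof. exact: inH_subf (inH_vc ws1 t) (inH_vc ws2 t). Qed.

Lemma xc_dw k b t : xc (dw v1 v2 t) k b = xt L v1 k b t - xt L v2 k b t.
Proof. by rewrite /dw subf_addZ xc_addZ// mulN1r. Qed.

Lemma mode_dw k b : mode (nu * kap ^+ 2 * am k)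
  (fun r => gt L nu f h z v1 k b r - gt L nu f h z v2 k b r) (fun r => xc (dw v1 v2 r) k b).
Proof.
have := modeB (mode_solution L0 fH hH cz ws1 k b) (mode_solution L0 fH hH cz ws2 k b).
by rewrite (_ : (fun r => xt L v1 k b r - _) = (fun r => xc (dw v1 v2 r) k b))//; apply/funext => r; rewrite xc_dw.
Qed.

Definition drive_dw k t : R := `|gt L nu f h z v1 k true t - gt L nu f h z v2 k true t| +
  `|gt L nu f h z v1 k false t - gt L nu f h z v2 k false t|.

Lemma drive_dw_bound t k (e : R) : 0 < e -> exists N : nat, forall M, (N <= M)%N ->
  drive_dw k t <= 32 * kap * ((br k)%:R *
    conv M (fun m => X (uc h z v1 t) m + X (uc h z v2 t) m) (X (dw v1 v2 t)) k) + e.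
Proof.
move=> e0.
have u1 : inH L (uc h z v1 t) by exact: (inH_uc hH ws1 t).
have u2 : inH L (uc h z v2 t) by exact: (inH_uc hH ws2 t).
have L2 : 0 < L ^+ 2 by rewrite exprn_gt0.
have e1 : 0 < e * L ^+ 2 / 2 by apply: divr_gt0 => //; exact: mulr_gt0.
have Ew : subf (uc h z v1 t) (uc h z v2 t) = dw v1 v2 t.
  by apply/funext => p; rewrite /dw /subf /uc /addZ opprD addrACA subrr addr0.
have [N1 H1] := Bphi_sub L0 k true u1 u2 e1; have [N2 H2] := Bphi_sub L0 k false u1 u2 e1.
rewrite Ew in H1 H2.
exists (maxn N1 N2) => M; rewrite geq_max => /andP[M1' M2'].
have one b : `|B_pair L (uc h z v1 t) (phi k b) - B_pair L (uc h z v2 t) (phi k b)| <=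
    16 * kap * L ^+ 2 * (br k)%:R * conv M (X (dw v1 v2 t)) (fun m => X (uc h z v1 t) m + X (uc h z v2 t) m) k + e * L ^+ 2 / 2 ->
    `|gt L nu f h z v1 k b t - gt L nu f h z v2 k b t| <= 16 * kap * ((br k)%:R *
      conv M (fun m => X (uc h z v1 t) m + X (uc h z v2 t) m) (X (dw v1 v2 t)) k) + e / 2.
  move=> HB; rewrite /gt convC.
  have -> : - B_pair L (uc h z v1 t) (phi k b) / L ^+ 2 + xc f k b +
      z t * ((1 - nu * kap ^+ 2 * am k) * xc h k b) -
     (- B_pair L (uc h z v2 t) (phi k b) / L ^+ 2 + xc f k b +
      z t * ((1 - nu * kap ^+ 2 * am k) * xc h k b)) =
     - (B_pair L (uc h z v1 t) (phi k b) - B_pair L (uc h z v2 t) (phi k b)) / L ^+ 2.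
    by move: (B_pair _ _ _) (B_pair _ _ _) => x y; ring.
  rewrite normrM normrN normfV (ger0_norm (ltW L2)) ler_pdivrMr//; apply: le_trans HB _.
  by rewrite le_eqVlt; apply/orP; left; apply/eqP; field.
have := one true (H1 M M1'); have := one false (H2 M M2'); rewrite /drive_dw.
move: `|_| `|_| (_ * conv _ _ _ _) => x y c; lra.
Qed.

End two_solutions.

(** The forcing cancels in the difference, so the weighted estimate applies with weight 1 and with
    zero [eta] and [psi], which makes it homogeneous in the initial value; the advecting amplitude
    is the sum of those of the two solutions. The estimate starts at a > 0, and a tends to 0. *)
Lemma uniform_dw : exists2 C, 0 <= C & forall z v10 v20 v1 v2, sol z v10 v1 -> sol z v20 v2 ->
  forall t, 0 < t <= 1 -> forall M,
    \sum_(k <- box M) X (dw v1 v2 t) k ^+ 2 <= C * normL2 L (subf v10 v20) ^+ 2.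
Proof.
have [C C0 HC] := uniform_energy L0 nu0 n0 fH hH h4.
have [P1 [Kq1 [P10 Kq10 HU]]] := uc_bounds.
pose P0 := 2 * P1; pose Kq := 4 * Kq1.
have P00 : 0 <= P0 by rewrite /P0; nonneg.
have Kq0 : 0 <= Kq by rewrite /Kq; nonneg.
have kp := kap_gt0 L0.
pose c := nu * kap ^+ 2 / 8; pose A := 32 * kap.
have c0 : 0 < c by rewrite /c divr_gt0// mulr_gt0// exprn_gt0.
have A0 : 0 <= A by rewrite /A; nonneg.
have g0 := gcst_ge0 A P0 c0.
pose nn := Num.bound (4 * (gcst c A P0 + 1) * Kq).
have Hnn : 2 * (gcst c A P0 + 1) * Kq <= nn%:R / 2.
  have p0 : 0 <= 4 * (gcst c A P0 + 1) * Kq by nonneg.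
  by have := archi_boundP p0; rewrite -/nn; lra.
have p4 : 0 < 4 ^+ nn.+1 :> R by rewrite exprn_gt0.
have L2 : 0 < L ^+ 2 by rewrite exprn_gt0.
exists (4 ^+ nn.+1 / L ^+ 2); first by rewrite divr_ge0 ?ltW.
move=> z v10 v20 v1 v2 s1 s2.
have [H1 H1'] := HC _ _ _ s1; have [H2 H2'] := HC _ _ _ s2.
have [U1 U1'] := HU _ _ _ s1; have [U2 U2'] := HU _ _ _ s2.
have [_ _ v10H _ ws1] := s1; have [cz _ v20H _ ws2] := s2.
have lv1 t : L2per L (vc v1 t) by exact: L2per_vc ws1 t.
have lv2 t : L2per L (vc v2 t) by exact: L2per_vc ws2 t.
pose W k r := X (dw v1 v2 r) k; pose p k r := X (uc h z v1 r) k + X (uc h z v2 r) k.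
have WV k r : W k r <= X (vc v1 r) k + X (vc v2 r) k.
  rewrite /W /dw subf_addZ; apply: le_trans (X_addZ (-1) k (lv1 r) (lv2 r)) _.
  by rewrite normrN1 mul1r.
have sq2 (x y w : R) : 0 <= x -> x <= y + w -> 0 <= y -> 0 <= w -> x ^+ 2 <= 2 * (y ^+ 2 + w ^+ 2).
  move=> x0 xyw y0 w0; apply: (@le_trans _ _ ((y + w) ^+ 2)).
    by rewrite ler_pXn2r ?nnegrE// addr_ge0.
  by have := sqr_ge0 (y - w); lra.
have lin2 (x y b : R) : x <= b -> y <= b -> 2 * (x + y) <= 4 * b by move=> *; lra.
have wsq2 (b x y w : R) : 0 <= x -> x <= y + w -> 0 <= y -> 0 <= w ->
    b ^+ 2 * x ^+ 2 <= 2 * (b ^+ 2 * y ^+ 2 + b ^+ 2 * w ^+ 2).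
  move=> x0 xyw y0 w0; have := ler_wpM2l (sqr_ge0 b) (sq2 x y w x0 xyw y0 w0).
  by rewrite -mulrDr [leRHS]mulrCA.
have cX1 k := @continuous_Xv _ _ L0 _ _ _ _ _ _ _ s1 k.
have cX2 k := @continuous_Xv _ _ L0 _ _ _ _ _ _ _ s2 k.
have cU1 k := @continuous_Xu _ _ L0 _ _ _ _ hH _ _ _ s1 k.
have cU2 k := @continuous_Xu _ _ L0 _ _ _ _ hH _ _ _ s2 k.
have cW k : continuous (W k).
  by apply: continuous_X => b; have [] := mode_dw s1 s2 k b.
have cp k : continuous (p k) by move=> r; apply: cvgD; [exact: cU1|exact: cU2].
have cg k : continuous (drive_dw z v1 v2 k).
  have [_ c1 _] := mode_dw s1 s2 k true; have [_ c2 _] := mode_dw s1 s2 k false.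
  by move=> r; apply: cvgD; apply: cvg_norm; [exact: c1|exact: c2].
have cb (F : R -> R) (d : R) : continuous F -> continuous (fun r => d * F r ^+ 2).
  by move=> cF r; apply: cvgM; [exact: cvg_cst|exact: continuous_sqr cF r].
have W0 k r : 0 <= W k r by exact: X_ge0.
have p0 k r : 0 <= p k r by rewrite addr_ge0 ?X_ge0.
have step a t M : 0 < a -> a <= t -> t <= 1 ->
    \sum_(k <- box M) W k t ^+ 2 <= 4 ^+ nn.+1 / L ^+ 2 * normL2 L (dw v1 v2 a) ^+ 2.
  move=> a0 at_ t1.
  have a1 : a <= 1 by exact: le_trans at_ t1.
  have aI : 0 < a <= 1 by rewrite a0.
  have r01 r : a <= r <= 1 -> 0 < r <= 1.
    by move=> /andP[ar ->]; rewrite andbT; exact: lt_le_trans ar.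
  have HE k s r : a <= s -> s <= r -> r <= 1 ->
     W k r ^+ 2 + Ir (fun r => 2 * c * ((br k)%:R ^+ 2 * W k r ^+ 2)) s r <=
     W k s ^+ 2 + Ir (fun r => 2 * (W k r * drive_dw z v1 v2 k r)) s r.
    move=> as_ sr _; have := @pair_energy _ c (br k)%:R s r _ _ _ _ (mode_dw s1 s2 k true) (mode_dw s1 s2 k false)
       (ltW (lt_le_trans a0 as_)) sr; apply=> r'.
    rewrite -X_sqr /c; have nk : 0 <= nu * kap ^+ 2 by rewrite mulr_ge0 ?sqr_ge0 ?(ltW nu0).
    have := ler_wpM2l nk (am_X L0 (dw v1 v2 r') k); lra.
  have Hg r : a <= r <= 1 -> forall k e, 0 < e -> exists N : nat, forall K, (N <= K)%N ->
      1 * drive_dw z v1 v2 k r <= (br k)%:R * (A * conv K (p^~ r) (fun m => 1 * (W m r + 0)) k + 0) + e.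
    move=> rI k e e0; have [N HN] := drive_dw_bound s1 s2 r k e0; exists N => K NK.
    rewrite mul1r addr0; apply: le_trans (HN K NK) _.
    rewrite (_ : (fun m => 1 * (W m r + 0)) = X (dw v1 v2 r)); last first.
      by apply/funext => m; rewrite mul1r addr0.
    by rewrite /A lerD2r le_eqVlt; apply/orP; left; apply/eqP; ring.
  have Z0 (F : int * int -> R) : (forall k, F k = 0) -> forall K, \sum_(k <- box K) F k <= 0.
    by move=> F0 K; rewrite big1.
  have HP r : a <= r <= 1 -> forall K, \sum_(k <- box K) p k r ^+ 2 <= P0 ^+ 2.
    move=> rI K; apply: (@le_trans _ _ (\sum_(k <- box K) 2 * (X (uc h z v1 r) k ^+ 2 + X (uc h z v2 r) k ^+ 2))).
      by apply: ler_sum => k _; apply: sq2; rewrite ?X_ge0.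
    rewrite -mulr_sumr big_split /=; have := U1 r (r01 r rI) K; have := U2 r (r01 r rI) K.
    by rewrite /P0; lra.
  have HKq K : Ir (fun r => \sum_(k <- box K) (br k)%:R ^+ 2 * p k r ^+ 2) a 1 <= Kq.
    have c1 : continuous (fun r => \sum_(k <- box K) (br k)%:R ^+ 2 * X (uc h z v1 r) k ^+ 2).
      by apply: continuous_sumr => k; exact: cb.
    have c2 : continuous (fun r => \sum_(k <- box K) (br k)%:R ^+ 2 * X (uc h z v2 r) k ^+ 2).
      by apply: continuous_sumr => k; exact: cb.
    have c12 : continuous (fun r => \sum_(k <- box K) (br k)%:R ^+ 2 * X (uc h z v1 r) k ^+ 2 +
        \sum_(k <- box K) (br k)%:R ^+ 2 * X (uc h z v2 r) k ^+ 2).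
      by move=> r; apply: cvgD; [exact: c1|exact: c2].
    apply: (@le_trans _ _ (Ir (fun r => 2 * (\sum_(k <- box K) (br k)%:R ^+ 2 * X (uc h z v1 r) k ^+ 2 +
        \sum_(k <- box K) (br k)%:R ^+ 2 * X (uc h z v2 r) k ^+ 2)) a 1)).
      apply: Ir_le.
      - by apply: continuous_sumr => k; exact: cb.
      - by move=> r; apply: cvgM; [exact: cvg_cst|exact: c12].
      move=> r _; rewrite -big_split mulr_sumr; apply: ler_sum => k _ /=.
      by apply: wsq2; rewrite ?X_ge0 ?p0.
    rewrite (IrZ 2 a 1 c12) (IrD a 1 c1 c2).
    exact: lin2 (U1' a aI K) (U2' a aI K).
  have HW r : a <= r <= 1 -> forall K, \sum_(k <- box K) (1 * W k r) ^+ 2 <= 4 * C / L ^+ 2.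
    move=> rI K; apply: (@le_trans _ _ (\sum_(k <- box K) 2 * (X (vc v1 r) k ^+ 2 + X (vc v2 r) k ^+ 2))).
      by apply: ler_sum => k _; rewrite mul1r; apply: sq2; rewrite ?X_ge0.
    rewrite -mulr_sumr big_split /= ler_pdivlMr// mulrC.
    have := bessel_X L0 K (inH_vc ws1 r); have := bessel_X L0 K (inH_vc ws2 r).
    have := H1 r (r01 r rI); have := H2 r (r01 r rI).
    move: (normL2 _ _ ^+ 2) (normL2 _ _ ^+ 2) (\sum_(_ <- _) _) (\sum_(_ <- _) _) => x y x' y'; lra.
  have HWD K : Ir (fun r => \sum_(k <- box K) (br k)%:R ^+ 2 * (1 * W k r) ^+ 2) a 1 <= 4 * C.
    have c1 : continuous (fun r => \sum_(k <- box K) (br k)%:R ^+ 2 * X (vc v1 r) k ^+ 2).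
      by apply: continuous_sumr => k; exact: cb.
    have c2 : continuous (fun r => \sum_(k <- box K) (br k)%:R ^+ 2 * X (vc v2 r) k ^+ 2).
      by apply: continuous_sumr => k; exact: cb.
    have c12 : continuous (fun r => \sum_(k <- box K) (br k)%:R ^+ 2 * X (vc v1 r) k ^+ 2 +
        \sum_(k <- box K) (br k)%:R ^+ 2 * X (vc v2 r) k ^+ 2).
      by move=> r; apply: cvgD; [exact: c1|exact: c2].
    apply: (@le_trans _ _ (Ir (fun r => 2 * (\sum_(k <- box K) (br k)%:R ^+ 2 * X (vc v1 r) k ^+ 2 +
        \sum_(k <- box K) (br k)%:R ^+ 2 * X (vc v2 r) k ^+ 2)) a 1)).
      apply: Ir_le.
      - apply: continuous_sumr => k; apply: cb => r.
        by apply: cvgM; [exact: cvg_cst|exact: cW].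
      - by move=> r; apply: cvgM; [exact: cvg_cst|exact: c12].
      move=> r _; rewrite -big_split mulr_sumr; apply: ler_sum => k _ /=.
      by rewrite mul1r; apply: wsq2; rewrite ?X_ge0.
    rewrite (IrZ 2 a 1 c12) (IrD a 1 c1 c2).
    exact: lin2 (H1' a K aI) (H2' a K aI).
  have HE0 K : \sum_(k <- box K) (1 * W k a) ^+ 2 <= normL2 L (dw v1 v2 a) ^+ 2 / L ^+ 2.
    under eq_bigr do rewrite mul1r.
    by rewrite ler_pdivlMr// [leLHS]mulrC; exact: (bessel_X L0 K (inH_dw s1 s2 a)).
  have q1 : 1 <= a + 1 by lra.
  have q2 : a <= t <= 1 by rewrite at_.
  have := @weighted_energy _ c A P0 c0 A0 P00 a 1 Kq _ _ 0 0 0 W (drive_dw z v1 v2)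
    p (fun=> 1) (fun=> 0) (fun=> 0) nn a1 q1 Kq0 cW cg cp W0
    (fun k r => addr_ge0 (normr_ge0 _) (normr_ge0 _)) p0 (fun k => ler01) (fun k => lexx 0) (fun k => lexx 0) HE Hg
    (Z0 _ _) (Z0 _ _) (Z0 _ _) HP HKq HW HWD Hnn _ HE0 t q2 M.
  have E1 : forall k : int * int, (1 * 0) ^+ 2 = 0 :> R by move=> k; rewrite mulr0 expr0n.
  have E2 : forall k : int * int, (br k)%:R ^+ 2 * (1 * 0) ^+ 2 = 0 :> R by move=> k; rewrite mulr0 expr0n mulr0.
  have E3 : forall k : int * int, 0 ^+ 2 = 0 :> R by move=> k; rewrite expr0n.
  move=> /(_ E1 E2 E3); under eq_bigr do rewrite mul1r.
  move=> H; apply: le_trans H _.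
  by rewrite le_eqVlt; apply/orP; left; apply/eqP; field; rewrite !lt0r_neq0.
move=> t t01 M.
pose d0 := normL2 L (subf v10 v20).
have d00 : 0 <= d0 by exact: sqrtr_ge0.
have lw0 : L2per L (subf v10 v20) by case: (inH_subf v10H v20H).
have Cc : 0 < 4 ^+ nn.+1 / L ^+ 2 :> R by rewrite divr_gt0.
(* Both solutions are continuous at 0 in L^2, but their values at 0 agree with the initial values
   only up to norm zero, hence the extra differences. *)
have near0 e : 0 < e -> exists2 a, 0 < a <= t & normL2 L (dw v1 v2 a) <= d0 + e.
  move=> e0; have e2 : 0 < e / 2 by rewrite divr_gt0.
  have /cvgrPdist_lt/(_ _ e2)[x1 /= x10 Hx1] := cvg_vc ws1 0.
  have /cvgrPdist_lt/(_ _ e2)[x2 /= x20 Hx2] := cvg_vc ws2 0.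
  have t0 : 0 < t by case/andP: t01.
  pose a := Num.min t (Num.min (x1 / 2) (x2 / 2)).
  have a0 : 0 < a by rewrite !lt_min t0 !divr_gt0.
  have at_ : a <= t by rewrite ge_min lexx.
  have ax1 : a < x1.
    apply: (@le_lt_trans _ _ (x1 / 2)); last by lra.
    by rewrite /a ge_min ge_min lexx orbT.
  have ax2 : a < x2.
    apply: (@le_lt_trans _ _ (x2 / 2)); last by lra.
    by rewrite /a ge_min ge_min lexx !orbT.
  exists a; first by rewrite a0.
  have n1 : normL2 L (subf (vc v1 a) (vc v1 0)) <= e / 2.
    have := Hx1 a; rewrite /= sub0r normrN gtr0_norm// => /(_ ax1).
    by rewrite sub0r normrN ger0_norm ?sqrtr_ge0// => /ltW.
  have n2 : normL2 L (subf (vc v2 a) (vc v2 0)) <= e / 2.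
    have := Hx2 a; rewrite /= sub0r normrN gtr0_norm// => /(_ ax2).
    by rewrite sub0r normrN ger0_norm ?sqrtr_ge0// => /ltW.
  have i1 : normL2 L (subf (vc v1 0) v10) = 0.
    by case: ws1 => _ _ _ i _; rewrite /vc maxxx; exact: i.
  have i2 : normL2 L (subf (vc v2 0) v20) = 0.
    by case: ws2 => _ _ _ i _; rewrite /vc maxxx; exact: i.
  have a1H := inH_subf (inH_vc ws1 a) (inH_vc ws1 0); have a2H := inH_subf (inH_vc ws2 a) (inH_vc ws2 0).
  have b1H := inH_subf (inH_vc ws1 0) v10H; have b2H := inH_subf (inH_vc ws2 0) v20H.
  pose r1 := addZ (subf (vc v1 a) (vc v1 0)) 1 (subf (vc v1 0) v10).
  pose r2 := addZ (subf (vc v2 a) (vc v2 0)) 1 (subf (vc v2 0) v20).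
  have r1H : inH L r1 by exact: inH_addZ a1H b1H.
  have r2H : inH L r2 by exact: inH_addZ a2H b2H.
  have Er : dw v1 v2 a = addZ (addZ (subf v10 v20) 1 r1) (-1) r2.
    apply/funext => p'; rewrite /r1 /r2 /dw /addZ /subf !scale1r scaleN1r.
    move: (vc v1 a p') (vc v1 0 p') (vc v2 a p') (vc v2 0 p') (v10 p') (v20 p').
    move=> [x y] [x' y'] [u u'] [w w'] [q q'] [s s'].
    by apply/eqP; rewrite -pair_eqE /pair_eq /=; apply/andP; split; apply/eqP; ring.
  have lr1 : L2per L r1 by case: r1H.
  have lr2 : L2per L r2 by case: r2H.
  have ls : L2per L (addZ (subf v10 v20) 1 r1) by case: (inH_addZ 1 (inH_subf v10H v20H) r1H).
  have nr1 : normL2 L r1 <= e / 2.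
    have la : L2per L (subf (vc v1 a) (vc v1 0)) by case: a1H.
    have lb : L2per L (subf (vc v1 0) v10) by case: b1H.
    by apply: le_trans (normL2_addZ 1 la lb) _; rewrite i1 mulr0 addr0.
  have nr2 : normL2 L r2 <= e / 2.
    have la : L2per L (subf (vc v2 a) (vc v2 0)) by case: a2H.
    have lb : L2per L (subf (vc v2 0) v20) by case: b2H.
    by apply: le_trans (normL2_addZ 1 la lb) _; rewrite i2 mulr0 addr0.
  rewrite Er; apply: le_trans (normL2_addZ (-1) ls lr2) _.
  rewrite normrN1 mul1r; apply: le_trans (lerD (normL2_addZ 1 lw0 lr1) (lexx _)) _.
  rewrite normr1 mul1r -/d0.
  move: nr1 nr2; move: (normL2 _ _) (normL2 _ _) => x y; lra.
apply/ler_addgt0Pr => e e0.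
have d1 : 0 < 2 * d0 + 1 by rewrite ltr_wpDl// mulr_ge0.
pose q := Num.min 1 (e / (4 ^+ nn.+1 / L ^+ 2 * (2 * d0 + 1))).
have q0 : 0 < q by rewrite lt_min ltr01 divr_gt0// mulr_gt0.
have q1 : q <= 1 by rewrite /q ge_min lexx.
have q2 : (4 ^+ nn.+1 / L ^+ 2 * (2 * d0 + 1)) * q <= e.
  have K0 : 0 < 4 ^+ nn.+1 / L ^+ 2 * (2 * d0 + 1) by exact: mulr_gt0.
  by rewrite mulrC -ler_pdivlMr// /q ge_min lexx orbT.
have [a /andP[a0 at_] Ha] := near0 q q0.
have t1 : t <= 1 by case/andP: t01.
apply: le_trans (step a t M a0 at_ t1) _.
have : normL2 L (dw v1 v2 a) ^+ 2 <= (d0 + q) ^+ 2.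
  by rewrite ler_pXn2r ?nnegrE ?sqrtr_ge0// addr_ge0// ltW.
have : q * q <= q by rewrite ler_piMl// ltW.
rewrite -/d0; move: (normL2 _ _ ^+ 2) => x qq xd.
apply: (@le_trans _ _ (4 ^+ nn.+1 / L ^+ 2 * (d0 ^+ 2 + (2 * d0 + 1) * q))).
  by rewrite ler_wpM2l ?(ltW Cc)//; lra.
by rewrite mulrDr lerD2l [leLHS]mulrA.
Qed.

End higher_energy.

(** * Decay of the Fourier coefficients *)

Section decay.
Context {R : realType}.
Variable L : R.
Hypothesis L0 : 0 < L.
Local Notation kap := (kap L).
Local Notation X := (X L).
Implicit Types (u w : R * R -> R * R) (k : int * int) (b : bool).

(** A bound for each value of a convolution by square sums alone; it starts the bootstrap, where no
    pointwise decay is known yet. *)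
Lemma conv_young M (P Q : int * int -> R) k :
  2 * conv M P Q k <= \sum_(l <- box M) P l ^+ 2 + \sum_(l <- box M) Q l ^+ 2.
Proof.
have one (F : int * int -> R) l : (forall m, 0 <= F m) ->
    \sum_(m <- box M) F l * (l + m == k)%:R <= F l.
  move=> F0; rewrite -mulr_sumr -[leRHS]mulr1 ler_wpM2l//.
  under eq_bigr => m _ do rewrite -(inj_eq (addrI (- l))) addKr.
  rewrite (eq_bigr (fun m : int * int => if m == - l + k then 1 : R else 0)); last by move=> m _; case: eqP.
  by rewrite -big_mkcond (big_uniq1 _ (fun=> 1 : R) (uniq_box M)); case: ifP.
apply: (@le_trans _ _ (\sum_(l <- box M) \sum_(m <- box M) P l ^+ 2 * (l + m == k)%:R +
    \sum_(m <- box M) \sum_(l <- box M) Q m ^+ 2 * (m + l == k)%:R)).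
  rewrite [X in _ <= _ + X]exchange_big conv_cond mulr_sumr -big_split; apply: ler_sum => l _ /=.
  rewrite mulr_sumr -big_split; apply: ler_sum => m _ /=.
  rewrite (addrC m) -mulrDl mulrA ler_wpM2r//.
  by have := sqr_ge0 (P l - Q m); lra.
by apply: lerD; apply: ler_sum => l _; apply: (one (fun m => _ m ^+ 2)) => m; exact: sqr_ge0.
Qed.

Lemma br_rt k (j : nat) : (br k)%:R ^- j = rt k ^- j.*2 :> R.
Proof. by rewrite -rt_sqr -exprM mul2n. Qed.

Lemma rtV_homo k (i j : nat) : (i <= j)%N -> rt k ^- j <= rt k ^- i :> R.
Proof.
by move=> ij; rewrite lef_pV2 ?posrE ?exprn_gt0 ?rt_gt0//; apply: ler_weXn2l => //; exact: rt_ge1.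
Qed.

Lemma rtV_ge0 k (j : nat) : 0 <= rt k ^- j :> R.
Proof. by rewrite invr_ge0 exprn_ge0// ltW// rt_gt0. Qed.

Variable nu : R.
Hypothesis nu0 : 0 < nu.

(** The damping rate is of order rt^4, so the forcing may exceed the desired decay by that factor,
    while the initial value is damped within time 1/20 by an exponential that beats every power. *)
Lemma decay_step (q : nat) : exists2 K, 0 <= K & forall k (x1 x2 g1 g2 : R -> R) s t B G,
  k != 0 -> mode (nu * kap ^+ 2 * am k) g1 x1 -> mode (nu * kap ^+ 2 * am k) g2 x2 ->
  0 <= s -> s + 20^-1 <= t -> 0 <= B -> 0 <= G ->
  (forall r, s <= r <= t -> `|g1 r| + `|g2 r| <= G * (rt k ^+ 4 * rt k ^- q)) ->
  Num.sqrt (x1 s ^+ 2 + x2 s ^+ 2) <= B ->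
  Num.sqrt (x1 t ^+ 2 + x2 t ^+ 2) <= K * (B + G) * rt k ^- q.
Proof.
have kp := kap_gt0 L0; pose c := nu * kap ^+ 2 / 8.
have c0 : 0 < c by rewrite /c divr_gt0// mulr_gt0// exprn_gt0.
pose E := q`!%:R * (20 / c) ^+ q; have E0 : 0 <= E.
  by rewrite /E mulr_ge0// exprn_ge0// divr_ge0// ltW.
have cV0 : 0 <= c^-1 by rewrite invr_ge0 ltW.
exists (2 * (E + c^-1)); first by rewrite mulr_ge0// addr_ge0.
move=> k x1 x2 g1 g2 s t B G k0 m1 m2 s0 st B0 G0 gG xB.
set m := nu * _ ^+ 2 * _ in m1 m2.
have r0 : 0 < rt k :> R by exact: rt_gt0.
have r1 : 1 <= rt k :> R by exact: rt_ge1.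
have r40 : 0 < rt k ^+ 4 :> R by rewrite exprn_gt0.
have mc : c * rt k ^+ 4 <= m.
  have H : rt k ^+ 4 <= 8 * am k :> R.
    by rewrite -[4%N]/(2 * 2)%N exprM rt_sqr; exact: (am_lower L0 k0).
  have nk : 0 <= nu * kap ^+ 2 by rewrite mulr_ge0 ?sqr_ge0 ?(ltW nu0).
  by have := ler_wpM2l nk H; rewrite /c /m; lra.
have cr0 : 0 < c * rt k ^+ 4 by rewrite mulr_gt0.
have m0 : 0 < m by exact: lt_le_trans mc.
have ex : expR (- (m * (t - s))) <= E * rt k ^- q.
  apply: (@le_trans _ _ (expR (- (c * rt k ^+ 4 / 20)))).
    rewrite ler_expR lerN2; apply: ler_pM => //; [exact: ltW|lra].
  have a0 : 0 < c * rt k ^+ 4 / 20 by rewrite divr_gt0.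
  apply: le_trans (expR_decay q a0) _; rewrite /E -[leRHS]mulrA ler_wpM2l//.
  (* The chosen term of the series even yields rt^(-4q), which is weakened to rt^(-q). *)
  have -> : (c * rt k ^+ 4 / 20) ^- q = (20 / c) ^+ q * rt k ^- (4 * q)%N.
    by rewrite exprM -!exprVn -exprMn; congr (_ ^+ q); field; rewrite !lt0r_neq0.
  by apply: ler_wpM2l; [rewrite exprn_ge0// divr_ge0// ltW|exact: rtV_homo (leq_pmull q (isT : (0 < 4)%N))].
have rq := rtV_ge0 k q.
have one (g x : R -> R) : mode m g x -> `|x s| <= B ->
    (forall r, s <= r <= t -> `|g r| <= G * (rt k ^+ 4 * rt k ^- q)) ->
    `|x t| <= (E + c^-1) * (B + G) * rt k ^- q.
  move=> md xs Hg; have G40 : 0 <= G * (rt k ^+ 4 * rt k ^- q).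
    by rewrite mulr_ge0// mulr_ge0// ltW.
  have st' : s <= t by lra.
  apply: le_trans (mode_duhamel md m0 s0 st' Hg G40) _.
  apply: (@le_trans _ _ (B * (E * rt k ^- q) + G * rt k ^- q * c^-1)).
    apply: lerD; first by apply: ler_pM => //; exact: expR_ge0.
    rewrite ler_pdivrMr//; apply: (@le_trans _ _ (G * rt k ^- q * c^-1 * (c * rt k ^+ 4))).
      rewrite le_eqVlt; apply/orP; left; apply/eqP; move: (rt k ^- q) (rt k ^+ 4) => d r4.
      by field; rewrite lt0r_neq0.
    by rewrite ler_wpM2l// mulr_ge0// mulr_ge0.
  have := mulr_ge0 (mulr_ge0 E0 G0) rq; have := mulr_ge0 (mulr_ge0 cV0 B0) rq; lra.
have sq (x y : R) : Num.sqrt (x ^+ 2 + y ^+ 2) <= `|x| + `|y|.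
  rewrite -(@ler_pXn2r _ 2) ?nnegrE ?sqrtr_ge0 ?addr_ge0// sqr_sqrtr ?addr_ge0 ?sqr_ge0//.
  rewrite sqrrD !real_normK ?num_real//.
  by have := mulr_ge0 (normr_ge0 x) (normr_ge0 y); lra.
have sl (x y : R) : `|x| <= Num.sqrt (x ^+ 2 + y ^+ 2).
  by rewrite -sqrtr_sqr ler_wsqrtr// lerDl sqr_ge0.
apply: le_trans (sq _ _) _.
have h1 := one _ _ m1 (le_trans (sl _ _) xB) (fun r rI => le_trans (ler_wpDr (normr_ge0 _) (lexx _)) (gG r rI)).
have xB2 : `|x2 s| <= B by apply: le_trans xB; rewrite addrC; exact: sl.
have h2 := one _ _ m2 xB2 (fun r rI => le_trans (ler_wpDl (normr_ge0 _) (lexx _)) (gG r rI)).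
apply: le_trans (lerD h1 h2) _; rewrite le_eqVlt; apply/orP; left; apply/eqP.
by move: (rt k ^- q) c^-1 => d c'; ring.
Qed.

Variables (n : R) (f h : R * R -> R * R).
Hypotheses (n0 : 0 <= n) (fH : inH L f) (hH : inH L h) (f2 : inHs L 2 f) (h4 : inHs L 4 h).
Local Notation sol := (sol L nu n f h).

Lemma force_rt : exists2 C, 0 <= C & forall k, force L nu n f h k <= C * rt k ^- 4.
Proof.
have [C C0 HC] := force_decay L0 nu0 n0 f2 h4.
by exists C => // k; apply: le_trans (HC k) _; rewrite br_rt.
Qed.

Lemma X_rt8 : exists2 C, 0 <= C & forall k, X h k <= C * rt k ^- 8.
Proof.
have [C C0 HC] : exists2 C, 0 <= C & forall k, X h k <= C * (br k)%:R ^- 4.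
  exact: (@inHs_decay _ _ L0 2 h h4).
by exists C => // k; apply: le_trans (HC k) _; rewrite br_rt.
Qed.

Definition decays (q : nat) (s : R) : Prop := exists2 A, 0 <= A & forall z v0 v, sol z v0 v ->
  forall t, s <= t <= 1 -> forall k, X (vc v t) k <= A * rt k ^- q.

Lemma drive_decays (q : nat) (s : R) : 2^-1 <= s ->
  (exists2 A, 0 <= A & forall z v0 v, sol z v0 v -> forall t, s <= t <= 1 -> forall k,
     X (vc v t) k <= A) ->
  (exists2 G, 0 <= G & forall z v0 v, sol z v0 v -> forall t, s <= t <= 1 -> forall k e, 0 < e ->
     drive L nu f h z v k t <= G * (rt k ^+ 4 * rt k ^- q) + e) ->
  decays q (s + 20^-1).
Proof.
move=> s2 [B B0 HB] [G G0 HG]; have [K K0 HK] := decay_step q.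
have s0 : 0 <= s by apply: le_trans s2; rewrite invr_ge0.
exists (K * (B + G)); first by rewrite mulr_ge0// addr_ge0.
move=> z v0 v sv t /andP[st t1] k; have [cz zn v0H _ ws] := sv.
have [->|k0] := eqVneq k 0; first by rewrite X_0 mulr_ge0 ?rtV_ge0// mulr_ge0// addr_ge0.
apply: (HK k _ _ _ _ s t B G k0 (mode_solution L0 fH hH cz ws k true)
  (mode_solution L0 fH hH cz ws k false) s0 st B0 G0).
  move=> r /andP[sr rt_]; apply/ler_addgt0Pr => e e0; apply: (HG z v0 v sv r _ k e e0).
  by rewrite sr (le_trans rt_ t1).
have s1 : s <= s <= 1 by rewrite lexx /=; lra.
exact: (HB z v0 v sv s s1 k).
Qed.

Lemma decays_weaken (q : nat) (s s' : R) : s <= s' -> decays q s -> decays q s'.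
Proof.
move=> ss [A A0 HA]; exists A => // z v0 v sv t /andP[st t1] k; apply: HA sv _ _ _.
by rewrite t1 (le_trans ss st).
Qed.

Lemma decays_bound (q : nat) (s : R) : decays q s ->
  exists2 A, 0 <= A & forall z v0 v, sol z v0 v -> forall t, s <= t <= 1 -> forall k, X (vc v t) k <= A.
Proof.
move=> [A A0 HA]; exists A => // z v0 v sv t st k; apply: le_trans (HA _ _ _ sv _ st k) _.
by rewrite ler_piMr// -[leRHS]invr1 -(expr0 (rt k)) rtV_homo.
Qed.

Lemma decays_uc (al : nat) (s : R) : 0 <= s -> (al <= 8)%N -> decays al s ->
  exists2 A, 0 <= A & forall z v0 v, sol z v0 v ->
    forall t, s <= t <= 1 -> forall k, X (uc h z v t) k <= A * rt k ^- al.
Proof.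
move=> s0 al8 [A A0 HA]; have [Ch Ch0 HCh] := X_rt8.
exists (A + n * Ch); first by rewrite addr_ge0// mulr_ge0.
move=> z v0 v sv t /andP[st t1] k; have t01 : 0 <= t <= 1 by rewrite t1 (le_trans s0 st).
have st1 : s <= t <= 1 by rewrite st.
apply: le_trans (X_uc hH sv k t01) _; rewrite mulrDl; apply: lerD; first exact: HA sv _ st1 k.
rewrite -mulrA ler_wpM2l//; apply: le_trans (HCh k) _.
by rewrite ler_wpM2l// rtV_homo.
Qed.

(** The H^1 bound, valid from time 1/2 on, lets the factor |k| of the quadratic term move into the
    convolution, which is then bounded by square sums; a bounded forcing yields the decay |k|^-2. *)
Lemma decays4 : decays 4 (2^-1 + 20^-1).
Proof.
have [C C0 HC] := uniform_H1 L0 nu0 n0 fH hH f2 h4.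
have [Ch Ch0 HCh] := X_rt8; have [Cf Cf0 HCf] := force_rt.
have [P0 [Kq [P00 Kq0 HU]]] := uc_bounds L0 nu0 n0 fH hH h4.
have kp := kap_gt0 L0.
have half0 : 0 <= 2^-1 :> R by rewrite invr_ge0.
have t01 (t : R) : 2^-1 <= t <= 1 -> 0 <= t <= 1 by move=> /andP[a ->]; rewrite (le_trans half0).
have t01' (t : R) : 2^-1 <= t <= 1 -> 0 < t <= 1.
  by move=> /andP[a ->]; rewrite andbT; apply: lt_le_trans a; rewrite invr_gt0.
have br1 k : 1 <= (br k)%:R :> R by rewrite ler1n.
apply: drive_decays => //.
  exists (Num.sqrt C) => [|z v0 v sv t tI k]; first exact: sqrtr_ge0.
  have kM : k \in box (br k) by rewrite mem_box.
  have := HC z v0 v sv t tI (br k); rewrite (big_rem k)//= => H.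
  rewrite -[leLHS]ger0_norm ?X_ge0// -sqrtr_sqr; apply: ler_wsqrtr; apply: le_trans H.
  apply: (@le_trans _ _ ((br k)%:R ^+ 2 * X (vc v t) k ^+ 2)).
    by rewrite ler_peMl ?sqr_ge0// exprn_ege1.
  by rewrite lerDl; apply: sumr_ge0 => l _; rewrite mulr_ge0 ?sqr_ge0.
have sq_young (x y a i : R) : 0 <= x -> 0 <= y -> 0 <= a -> 0 <= i -> i <= 1 -> y <= x + a * i ->
    y ^+ 2 <= 2 * x ^+ 2 + 2 * a ^+ 2 * i.
  move=> x0 y0 a0 i0 i1 H; have i2 : i * i <= i by rewrite ler_piMl.
  have ai : 0 <= a * i by rewrite mulr_ge0.
  have := ler_wpM2l (sqr_ge0 a) i2.
  have : y ^+ 2 <= (x + a * i) ^+ 2 by rewrite ler_pXn2r ?nnegrE// addr_ge0.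
  by have := sqr_ge0 (x - a * i); lra.
pose Q := P0 ^+ 2 + 2 * C + 48 * (n * Ch) ^+ 2.
have Q0 : 0 <= Q by rewrite /Q; nonneg.
exists (32 * kap * Q + Cf); first by nonneg.
move=> z v0 v sv t tI k e e0.
have [N HN] := drive_bound L0 nu0 hH k sv (t01 t tI) e0.
apply: le_trans (HN N (leqnn N)) _; rewrite lerD2r mulfV ?mulr1; last first.
  by rewrite expf_neq0// lt0r_neq0// rt_gt0.
apply: lerD; last first.
  apply: le_trans (HCf k) _; rewrite -[leRHS]mulr1 ler_wpM2l//.
  by rewrite -[leRHS]invr1 -(expr0 (rt k)) rtV_homo.
rewrite ler_wpM2l//; first by nonneg.
apply: le_trans (@conv_weight _ (fun m => (br m)%:R) _ N k _ _) _.
- by move=> l m; rewrite -natrD ler_nat br_add.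
- by move=> l; exact: X_ge0.
apply: le_trans (conv_young _ _ _ _) _; rewrite /Q -addrA; apply: lerD.
  by have [H _] := HU _ _ _ sv; exact: H (t01' t tI) N.
apply: (@le_trans _ _ (\sum_(l <- box N) (2 * ((br l)%:R ^+ 2 * X (vc v t) l ^+ 2) +
    2 * (n * Ch) ^+ 2 * (br l)%:R ^- 3))).
  apply: ler_sum => l _; have bl : 0 < (br l)%:R :> R by rewrite ltr0n.
  have b1 := br1 l.
  have u1 := X_uc hH sv l (t01 t tI); have h1 := HCh l.
  have hb : (br l)%:R * (n * X h l) <= n * Ch * (br l)%:R ^- 3.
    have -> : n * Ch * (br l)%:R ^- 3 = (br l)%:R * (n * (Ch * (br l)%:R ^- 4)).
      by field; rewrite lt0r_neq0.
    by rewrite ler_wpM2l ?(ltW bl)// ler_wpM2l// br_rt.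
  have hb2 : (br l)%:R * X (uc h z v t) l <= (br l)%:R * X (vc v t) l + n * Ch * (br l)%:R ^- 3.
    by apply: le_trans (ler_wpM2l (ltW bl) u1) _; rewrite mulrDr lerD2l.
  have i3 : 0 <= (br l)%:R ^- 3 :> R by rewrite invr_ge0 exprn_ge0// ltW.
  have i31 : (br l)%:R ^- 3 <= 1 :> R by rewrite invf_le1 ?exprn_gt0// exprn_ege1.
  have nc : 0 <= n * Ch by rewrite mulr_ge0.
  have x0 := X_ge0 L (vc v t) l; have x1 := X_ge0 L (uc h z v t) l.
  rewrite -(exprMn _ _ (X (vc v t) l)).
  exact: sq_young (mulr_ge0 (ltW bl) x0) (mulr_ge0 (ltW bl) x1) nc i3 i31 hb2.
rewrite big_split /= -!mulr_sumr; apply: lerD; first by rewrite ler_wpM2l//; exact: HC sv _ tI N.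
have S3 : \sum_(k <- box N) ((br k)%:R ^- 3 : R) <= 24 by apply: sum_br_inv.
have := ler_wpM2l (sqr_ge0 (n * Ch)) S3.
by move: (\sum_(_ <- _) _) ((n * Ch) ^+ 2) => x y; lra.
Qed.

(** The derivative in the quadratic term costs rt^2 and the damping returns rt^4, so a convolution
    decaying like rt^-j gives rt^-(j + 2). The restriction j <= 6 reflects the decay rt^-4 of the
    forcing. *)
Lemma decays_next (al j : nat) (s : R) : 2^-1 <= s -> (al <= 8)%N -> (j <= al)%N -> (j <= 6)%N ->
  (j + 5 <= al + al)%N -> decays al s -> decays j.+2 (s + 20^-1).
Proof.
move=> s2 al8 jal j6 j5 dal; have s0 : 0 <= s by apply: le_trans s2; rewrite invr_ge0.
apply: drive_decays => //; first exact: decays_bound dal.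
have [A A0 HA] := decays_uc s0 al8 dal; have [Cf Cf0 HCf] := force_rt.
have kp := kap_gt0 L0.
exists (32 * kap * (2 ^+ j * 96 * A * A) + Cf); first by nonneg.
move=> z v0 v sv t tI k e e0.
have t01 : 0 <= t <= 1 by case/andP: tI => st ->; rewrite (le_trans s0 st).
have [N HN] := drive_bound L0 nu0 hH k sv t01 e0.
apply: le_trans (HN N (leqnn N)) _; rewrite lerD2r (mulrDl _ Cf).
have r0 : rt k != 0 :> R by rewrite lt0r_neq0// rt_gt0.
have E : rt k ^+ 4 * rt k ^- j.+2 = rt k ^+ 2 * rt k ^- j :> R.
  rewrite -(addn2 j) (exprD _ j) invfM; move: (rt k) r0 (rt k ^- j) => r r0 d.
  by field.
have U0 l : 0 <= X (uc h z v t) l by exact: X_ge0.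
apply: lerD.
  rewrite E -[leRHS]mulrA -rt_sqr; apply: ler_wpM2l; first by nonneg.
  rewrite [leRHS]mulrCA ler_wpM2l ?sqr_ge0//.
  exact: (conv_decay N k jal jal j5 A0 A0 U0 U0 (HA _ _ _ sv _ tI) (HA _ _ _ sv _ tI)).
apply: le_trans (HCf k) _; rewrite ler_wpM2l// E.
apply: (@le_trans _ _ (rt k ^+ 2 * rt k ^- 6)).
  rewrite le_eqVlt; apply/orP; left; apply/eqP.
  by move: (rt k) r0 => r r0; field.
by rewrite ler_wpM2l ?sqr_ge0// rtV_homo.
Qed.

(** The exponents are 4, 5, 7, 8: a convolution of two factors of exponent 4 or 5 admits j = 3 or j
    = 5, and in the last step the forcing limits j to 6. *)
Lemma decays8 : decays 8 (2^-1 + 4 / 20).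
Proof.
have d := decays4.
have d5 := decays_next (s := 2^-1 + 20^-1) _ (isT : (4 <= 8)%N) (isT : (3 <= 4)%N) isT isT d.
have {}d5 : decays 5 (2^-1 + 2 / 20) by apply: decays_weaken (d5 _); lra.
have d7 := decays_next (s := 2^-1 + 2 / 20) _ (isT : (5 <= 8)%N) (isT : (5 <= 5)%N) isT isT d5.
have {}d7 : decays 7 (2^-1 + 3 / 20) by apply: decays_weaken (d7 _); lra.
have d8 := decays_next (s := 2^-1 + 3 / 20) _ (isT : (7 <= 8)%N) (isT : (6 <= 7)%N) isT isT d7.
by apply: decays_weaken (d8 _); lra.
Qed.

Definition diff_decays (q : nat) (s : R) : Prop := exists2 A, 0 <= A &
  forall z v10 v20 v1 v2, sol z v10 v1 -> sol z v20 v2 ->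
  forall t, s <= t <= 1 -> forall k, X (dw v1 v2 t) k <= A * normL2 L (subf v10 v20) * rt k ^- q.

Lemma diff_decays0 : diff_decays 0 2^-1.
Proof.
have [C C0 HC] := uniform_dw L0 nu0 n0 fH hH h4.
exists (Num.sqrt C) => [|z v10 v20 v1 v2 s1 s2 t /andP[t2 t1] k]; first exact: sqrtr_ge0.
have t01 : 0 < t <= 1 by rewrite t1 andbT; apply: lt_le_trans t2; rewrite invr_gt0.
have d0 : 0 <= normL2 L (subf v10 v20) by exact: sqrtr_ge0.
have kM : k \in box (br k) by rewrite mem_box.
have := HC z v10 v20 v1 v2 s1 s2 t t01 (br k); rewrite (big_rem k)//= expr0 invr1 mulr1 => H.
rewrite -[leLHS]ger0_norm ?X_ge0// -[X in _ * X]ger0_norm// -!sqrtr_sqr -sqrtrM//.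
apply: ler_wsqrtr; apply: le_trans H.
by rewrite lerDl; apply: sumr_ge0 => l _; exact: sqr_ge0.
Qed.

(** Convolution with amplitudes decaying like rt^-8 leaves the decay of the difference unchanged,
    since 8 >= 5; hence every step gains the full rt^2. *)
Lemma diff_decays_next (j : nat) (s : R) : 2^-1 + 4 / 20 <= s -> (j <= 8)%N ->
  diff_decays j s -> diff_decays j.+2 (s + 20^-1).
Proof.
move=> s2 j8 [B B0 HB]; have [K K0 HK] := decay_step j.+2.
have s0 : 0 <= s by lra.
have [A A0 HA] := decays_uc s0 (leqnn 8) (decays_weaken s2 decays8).
have kp := kap_gt0 L0; pose G := 32 * kap * (2 ^+ j * 96 * (A + A) * B).
have G0 : 0 <= G by rewrite /G; nonneg.
exists (K * (B + G)); first by rewrite mulr_ge0// addr_ge0.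
move=> z v10 v20 v1 v2 s1 s2' t /andP[st t1] k; have [cz zn v10H _ ws1] := s1; have [_ _ v20H _ ws2] := s2'.
set d := normL2 L _; have d0 : 0 <= d by exact: sqrtr_ge0.
have [->|k0] := eqVneq k 0; first by rewrite X_0 mulr_ge0 ?rtV_ge0// mulr_ge0// mulr_ge0// addr_ge0.
have -> : K * (B + G) * d = K * (B * d + G * d) by rewrite -mulrA mulrDl.
have Bd : 0 <= B * d by rewrite mulr_ge0.
have Gd : 0 <= G * d by rewrite mulr_ge0.
apply: (HK k _ _ _ _ s t _ _ k0 (mode_dw L0 fH hH s1 s2' k true) (mode_dw L0 fH hH s1 s2' k false) s0 st Bd Gd).
  move=> r /andP[sr rt_]; apply/ler_addgt0Pr => e e0.
  have [N HN] := drive_dw_bound L0 hH s1 s2' r k e0.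
  apply: le_trans (HN N (leqnn N)) _; rewrite lerD2r.
  have rI : s <= r <= 1 by rewrite sr (le_trans rt_ t1).
  have r0 : rt k != 0 :> R by rewrite lt0r_neq0// rt_gt0.
  have E : rt k ^+ 4 * rt k ^- j.+2 = rt k ^+ 2 * rt k ^- j :> R.
    rewrite -(addn2 j) (exprD _ j) invfM; move: (rt k) r0 (rt k ^- j) => x x0 y.
    by field.
  rewrite E; have -> : G * d * (rt k ^+ 2 * rt k ^- j) =
      32 * kap * (rt k ^+ 2 * (2 ^+ j * 96 * (A + A) * (B * d) * rt k ^- j)).
    by rewrite /G; move: (rt k ^- j) => y; ring.
  rewrite -rt_sqr; apply: ler_wpM2l; first by nonneg.
  rewrite ler_wpM2l ?sqr_ge0//.
  apply: (conv_decay N k j8 (leqnn j) _ (addr_ge0 A0 A0) Bd).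
  - by rewrite addnC leq_add2r.
  - by move=> l; rewrite addr_ge0 ?X_ge0.
  - by move=> l; exact: X_ge0.
  - move=> l; rewrite mulrDl; apply: lerD; [exact: (HA _ _ _ s1 _ rI)|exact: (HA _ _ _ s2' _ rI)].
  - by move=> l; exact: (HB _ _ _ _ _ s1 s2' _ rI l).
have sI : s <= s <= 1 by rewrite lexx /=; lra.
apply: le_trans (HB _ _ _ _ _ s1 s2' _ sI k) _; rewrite -/d.
by rewrite ler_piMr// -[leRHS]invr1 -(expr0 (rt k)) rtV_homo.
Qed.

(** Five steps of length 1/20 lead from time 7/10 to 19/20, before the final time 1. *)
Lemma diff_decays10 : exists2 A, 0 <= A & forall z v10 v20 v1 v2, sol z v10 v1 -> sol z v20 v2 ->
  forall k, X (dw v1 v2 1) k <= A * normL2 L (subf v10 v20) * rt k ^- 10.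
Proof.
have d0 : diff_decays 0 (2^-1 + 4 / 20).
  have [A A0 HA] := diff_decays0; exists A => // z v10 v20 v1 v2 s1 s2 t /andP[a b] k.
  by apply: HA s1 s2 _ _ _; rewrite b andbT; apply: le_trans a; lra.
have q0 : 2^-1 + 4 / 20 <= 2^-1 + 4 / 20 :> R by [].
have q1 : 2^-1 + 4 / 20 <= 2^-1 + 4 / 20 + 20^-1 :> R by lra.
have q2 : 2^-1 + 4 / 20 <= 2^-1 + 4 / 20 + 20^-1 + 20^-1 :> R by lra.
have q3 : 2^-1 + 4 / 20 <= 2^-1 + 4 / 20 + 20^-1 + 20^-1 + 20^-1 :> R by lra.
have q4 : 2^-1 + 4 / 20 <= 2^-1 + 4 / 20 + 20^-1 + 20^-1 + 20^-1 + 20^-1 :> R by lra.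
have d2 := diff_decays_next q0 (leq0n 8) d0.
have d4 := diff_decays_next q1 (isT : (2 <= 8)%N) d2.
have d6 := diff_decays_next q2 (isT : (4 <= 8)%N) d4.
have d8 := diff_decays_next q3 (isT : (6 <= 8)%N) d6.
have [A A0 HA] := diff_decays_next q4 (leqnn 8) d8; exists A => // z v10 v20 v1 v2 s1 s2 k.
by apply: HA s1 s2 _ _ _; rewrite lexx andbT; lra.
Qed.

Lemma lamb_br k : lamb L k <= 2 * kap ^+ 2 * (br k)%:R ^+ 2.
Proof.
rewrite /lamb (mulrC 2) -[leRHS]mulrA ler_wpM2l ?sqr_ge0// en_sqr.
have [k1 k2] := absz_br (R := R) k.
have H (a d : R) : `|a| <= d -> a ^+ 2 <= d ^+ 2.
  by move=> ad; rewrite -[leLHS]real_normK ?num_real// ler_pXn2r ?nnegrE//; exact: le_trans ad.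
by have := H _ _ k1; have := H _ _ k2; lra.
Qed.

(** Three powers of the eigenvalue contribute br^6 and the squared coefficients br^-10; the
    remaining br^-4 is summable in the plane. *)
Lemma smoothing : exists2 C, 0 <= C & forall z v10 v20 v1 v2, sol z v10 v1 -> sol z v20 v2 ->
  (normHs L 3 (subf (v1 1%R) (v2 1%R)) ^+ 2 <= (C * normL2 L (subf v10 v20) ^+ 2)%:E)%E.
Proof.
have [A A0 HA] := diff_decays10; have kp := kap_gt0 L0.
pose c := L ^+ 2 * ((2 * kap ^+ 2) ^+ 3 * A ^+ 2 * 24).
exists c => [|z v10 v20 v1 v2 s1 s2]; first by rewrite /c; nonneg.
have d0 : 0 <= normL2 L (subf v10 v20) by exact: sqrtr_ge0.
have -> : subf (v1 1) (v2 1) = dw v1 v2 1 by rewrite /dw /vc max_r.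
apply: normHs_le => //; first exact: (inH_dw s1 s2).
move=> M; rewrite /c -[leRHS]mulrA; apply: ler_wpM2l; first exact: sqr_ge0.
move: (normL2 L (subf v10 v20)) d0 (HA _ _ _ _ _ s1 s2) => d d0 {}HA.
have kap2 : 0 <= 2 * kap ^+ 2 by nonneg.
have -> : (2 * kap ^+ 2) ^+ 3 * A ^+ 2 * 24 * d ^+ 2 = (2 * kap ^+ 2) ^+ 3 * (A * d) ^+ 2 * 24 by ring.
apply: (@le_trans _ _ (\sum_(k <- box M) (2 * kap ^+ 2) ^+ 3 * (A * d) ^+ 2 * (br k)%:R ^- 4)).
  apply: ler_sum => k _.
  have -> : (lamb L k `^ (3 / 2)) ^+ 2 = lamb L k ^+ 3.
    by rewrite -powR_mulrn ?powR_ge0// -powRrM divfK// powR_mulrn ?lamb_ge0.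
  apply: (@le_trans _ _ ((2 * kap ^+ 2 * (br k)%:R ^+ 2) ^+ 3 * (A * d * rt k ^- 10) ^+ 2)).
    apply: ler_pM; rewrite ?exprn_ge0 ?lamb_ge0 ?X_ge0//.
      by rewrite ler_pXn2r ?nnegrE ?lamb_ge0 ?lamb_br// mulr_ge0 ?sqr_ge0.
    by rewrite ler_pXn2r ?nnegrE ?X_ge0 ?HA// mulr_ge0 ?rtV_ge0// mulr_ge0.
  rewrite -[10%N]/(5.*2) -br_rt le_eqVlt; apply/orP; left; apply/eqP.
  by field; rewrite lt0r_neq0// ltr0n.
rewrite -mulr_sumr; apply: ler_wpM2l; first by nonneg.
by apply: sum_br_inv.
Qed.

End decay.

(** * Measurability *)

Section wiener_measurability.
Context {R : realType}.
Local Notation mu := (@lebesgue_measure R).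
Local Notation TR := (measurableTypeR R).

(** Tonelli's theorem for the positive and the negative part gives measurability of the parametric
    integral even where it diverges. *)
Lemma measurable_Rintegral d (T : measurableType d) (D : set R) (F : T * TR -> R) :
  measurable D -> measurable_fun setT F ->
  measurable_fun setT (fun x => \int[mu]_(r in D) F (x, r)).
Proof.
move=> mD mF; apply: (@measurableT_comp _ _ _ _ _ _ fine) => //.
pose g (x : T * TR) := (F x * \1_D x.2)%:E.
have mg : measurable_fun setT g.
  apply/measurable_EFinP; apply: measurable_funM => //.
  by apply: measurableT_comp; [exact: measurable_indic|exact: measurable_snd].
rewrite (_ : (fun x => _) = (fun x => \int[mu]_r (g^\+ (x, r))%E - \int[mu]_r (g^\- (x, r)))%E).
  apply: emeasurable_funB.
    exact: (@measurable_fun_fubini_tonelli_F _ _ T TR R mu (g^\+)%E (measurable_funepos mg) (@funepos_ge0 _ _ g)).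
  exact: (@measurable_fun_fubini_tonelli_F _ _ T TR R mu (g^\-)%E (measurable_funeneg mg) (@funeneg_ge0 _ _ g)).
apply/funext => x; rewrite integral_mkcond integralE; congr (_ - _)%E; apply: eq_integral => r _.
  by rewrite !funeposE /g /= patchE indicE; case: (r \in D) => /=; rewrite ?mulr1 ?mulr0.
by rewrite !funenegE /g /= patchE indicE; case: (r \in D) => /=; rewrite ?mulr1 ?mulr0.
Qed.

Lemma nbhs_path (w : R -> R) (K : set R) (e : R) : continuous w -> compact K -> 0 < e ->
  \forall g \near (w : {compact-open, R -> R}), forall s, K s -> `|w s - g s| < e.
Proof.
move=> cw cK e0.
have H : {compact-open, nbhs (w : {compact-open, R -> R}) --> w} by exact: cvg_id.
have FF : Filter (nbhs (w : {compact-open, R -> R})) by exact: nbhs_filter.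
move/(compact_open_fam_compactP cw FF)/fam_cvgP : H => /(_ K cK); apply.
apply/uniform_nbhs; exists [set xy : R * R | ball xy.1 e xy.2]; split => //.
  by rewrite -entourage_ballE; exists e.
by move=> g H s Ks; exact: H.
Qed.

(** For continuous paths compact-open convergence is uniform convergence on compact sets, and the
    shifted path on K involves the path on t + K and at t. *)
Lemma shift_cvg (w : R -> R) (t : R) : continuous w ->
  {compact-open, (fun g : R -> R => fun s => g (t + s) - g t) @ nbhs (w : {compact-open, R -> R}) -->
     (fun s => w (t + s) - w t)}.
Proof.
move=> cw.
have csh : continuous (fun s => t + s) by move=> s; apply: cvgD; [exact: cvg_cst|exact: cvg_id].
apply/compact_open_fam_compactP.
  move=> s; apply: cvgB; last exact: cvg_cst.
  by apply: continuous_comp; [exact: csh|exact: cw].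
apply/fam_cvgP => K cK P /uniform_nbhs[E [+ EP]].
rewrite -entourage_ballE => -[e e0 eE].
have e2 : 0 < e / 2 by rewrite divr_gt0.
have cK' : compact ((fun s => t + s) @` K).
  by apply: continuous_compact => //; exact: continuous_subspaceT.
apply: (@filterS2 _ _ _ _ _ _ _ (nbhs_path cw cK' e2) (nbhs_path cw (@compact_set1 _ t) e2)).
move=> g H1 H2; apply: EP => s Ks; apply: eE => /=.
rewrite /ball /= (_ : _ - _ = (w (t + s) - g (t + s)) - (w t - g t)); last by ring.
apply: le_lt_trans (ler_normB _ _) _; rewrite [ltRHS](splitr e); apply: ltrD; last exact: H2.
by apply: H1; exists s.
Qed.

Lemma measurable_theta (t : R) : measurable_fun setT (theta t : Omega R -> Omega R).
Proof.
apply: (@measurability _ _ _ (Omega R) setT (theta t) (@wpath_open R) erefl) => _ [_ [U oU ->] <-].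
rewrite setTI; apply: sub_sigma_algebra.
pose sh (g : R -> R) := fun s => g (t + s) - g t.
exists (interior ([set g : R -> R | U (sh g)] : set {compact-open, R -> R})); first exact: open_interior.
apply/seteqP; split => w /=.
  move=> Uw; apply: (shift_cvg (svalP w).1); exact: open_nbhs_nbhs.
by move/nbhs_singleton.
Qed.

(** Evaluation at a point pulls an open interval back to a subbasic set of the compact-open
    topology, with a singleton as compact set. *)
Lemma measurable_eval (s : R) : measurable_fun setT (fun w : Omega R => w s).
Proof.
apply: (measurability _ (RGenOpens.measurableE R)) => _ [_ [a [b ->] <-]].
rewrite setTI; apply: sub_sigma_algebra.
exists [set g | g @` [set s] `<=` `]a, b[%classic].
  by apply: compact_open_open; [exact: compact_set1|exact: interval_open].
apply/seteqP; split => w /= H; first by move=> _ [_ -> <-].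
by apply: H; exists s.
Qed.

Lemma measurable_path : measurable_fun setT (fun p : TR * Omega R => p.2 p.1).
Proof.
apply: (@measurable_caratheodory R _ (Omega R)) => [w|x] /=; first exact: (svalP w).1.
exact: measurable_eval.
Qed.

Lemma measurable_path_comp d (T : measurableType d) (a : T -> R) (b : T -> Omega R) :
  measurable_fun setT a -> measurable_fun setT b -> measurable_fun setT (fun x => b x (a x)).
Proof.
move=> ma mb; have mab : measurable_fun setT (fun x => (a x, b x) : TR * Omega R) by exact: measurable_fun_pair.
exact: (measurableT_comp measurable_path mab).
Qed.

Variable delta : R.

Lemma measurable_y_delta : measurable_fun setT (y_delta delta).
Proof.
apply: (@measurable_Rintegral _ (Omega R) `]-oo, 0%R]
  (fun p : Omega R * TR => expR p.2 * zeta_delta delta (theta p.2 p.1))) => //.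
apply: measurable_funM.
  by apply: measurableT_comp; [exact: measurable_expR|exact: measurable_snd].
rewrite (_ : (fun p => _) = (fun p : Omega R * TR => - delta ^- 2 *
    \int[mu]_(r in `]-oo, 0%R]) (expR (r / delta) * theta p.2 p.1 r))); last first.
  by apply/funext => p; rewrite mulNr.
apply: measurable_funM => //.
apply: (@measurable_Rintegral _ (Omega R * TR)%type `]-oo, 0%R]
  (fun q : (Omega R * TR) * TR => expR (q.2 / delta) * theta q.1.2 q.1.1 q.2)) => //.
apply: measurable_funM.
  by apply: measurableT_comp; [exact: measurable_expR|apply: measurable_funM => //; exact: measurable_snd].
have m1 : measurable_fun setT (fun q : (Omega R * TR) * TR => q.1.1).
  by apply: measurableT_comp; exact: measurable_fst.
have m2 : measurable_fun setT (fun q : (Omega R * TR) * TR => q.1.2).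
  by apply: measurableT_comp; [exact: measurable_snd|exact: measurable_fst].
apply: measurable_funB; last exact: measurable_path_comp.
by apply: measurable_path_comp => //; apply: measurable_funD => //; exact: measurable_snd.
Qed.

Lemma clamp01 (t : R) : 0 <= Num.min 1 (Num.max 0 t) <= 1.
Proof. by rewrite ge_min lexx /= le_min ler01 le_max lexx. Qed.

(** A bound on all of [0, 1] becomes a countable condition; clamping extends the function to the
    line, where the rationals are dense. *)
Lemma rat_dense_bound (z : R -> R) (n : R) : continuous z ->
  (forall q : rat, `|z (Num.min 1 (Num.max 0 (ratr q)))| <= n) ->
  forall t, 0 <= t <= 1 -> `|z t| <= n.
Proof.
move=> cz H t /andP[t0 t1].
have cc : continuous (fun t : R => `|z (Num.min 1 (Num.max 0 t))|).
  move=> x; apply: cvg_norm.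
  apply: (@continuous_comp R R R (fun t => Num.min 1 (Num.max 0 t)) z); last exact: cz.
  apply: (@continuous_comp R R R (fun t => Num.max 0 t) (fun t => Num.min 1 t)).
    by apply: continuous_max; [exact: cvg_cst|exact: cvg_id].
  by apply: continuous_min; [exact: cvg_cst|exact: cvg_id].
have -> : z t = z (Num.min 1 (Num.max 0 t)) by rewrite max_r// min_r.
rewrite leNgt; apply/negP => lt.
have op : open ((fun t : R => `|z (Num.min 1 (Num.max 0 t))|) @^-1` [set x | n < x]).
  by move/continuousP : cc; apply; exact: open_gt.
have [x [/= nx [q _ qx]]] := @dense_rat R _ (ex_intro _ t lt) op.
by have := H q; rewrite qx leNgt nx.
Qed.

Variables (P : probability (Omega R) R) (Om : set (Omega R)).
Hypothesis adm : admissible delta P Om.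
Variable X : Omega R -> R.
Hypothesis mX : measurable_fun Om X.

(** Everything is evaluated along the path shifted by -1, since the solutions compared at [w] start
    from [theta (-1) w]. *)
Definition sublevel (n : nat) : set (Omega R) := [set w | [/\ Om w, X (theta (-1) w) <= n%:R &
  forall t, 0 <= t <= 1 -> `|y_delta delta (theta t (theta (-1) w))| <= n%:R]].

Lemma measurable_sublevel n : measurable (sublevel n).
Proof.
have [mOm [_ [inv cty]]] := adm.
have -> : sublevel n = Om `&` (theta (-1) @^-1` (Om `&` X @^-1` `]-oo, n%:R])) `&`
   ~` (\bigcup_(q : rat) ((fun w => `|y_delta delta (theta (Num.min 1 (Num.max 0 (ratr q))) (theta (-1) w))|)
      @^-1` `]n%:R, +oo[)).
  apply/seteqP; split => w.
    move=> [Ow Xw yw]; split; first by split => //; split; [exact: inv|rewrite /= in_itv].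
    by move=> [q _]; rewrite /= in_itv /= andbT ltNge yw// clamp01.
  move=> [[Ow [Otw]]]; rewrite /= in_itv /= => Xw Hq; split => //.
  have [cz _ _ _] := cty _ Otw; apply: (rat_dense_bound cz) => q.
  by rewrite leNgt; apply/negP => lt; apply: Hq; exists q => //=; rewrite in_itv /= lt.
apply: measurableI.
  apply: measurableI => //; rewrite -[X in measurable X]setTI; apply: measurable_theta => //.
  by apply: mX => //; exact: measurable_itv.
apply: measurableC; apply: bigcupT_measurable_rat => q.
rewrite -[X in measurable X]setTI.
apply: (measurableT_comp (@normr_measurable R setT) (measurableT_comp measurable_y_delta
   (measurableT_comp (measurable_theta _) (measurable_theta _)))) => //.
Qed.

Lemma sublevel_cover w : Om w -> exists n, sublevel n w.
Proof.
move=> Ow; have [mOm [_ [inv cty]]] := adm.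
have [cz _ _ _] := cty _ (inv (-1) _ Ow).
have [c _ Hc] := @EVT_max R (fun t => `|y_delta delta (theta t (theta (-1) w))|) 0 1 ler01
  (continuous_subspaceT (fun t => cvg_norm (cz t))).
set M := Num.max `|X (theta (-1) w)| `|y_delta delta (theta c (theta (-1) w))|.
have M0 : 0 <= M by rewrite le_max normr_ge0.
exists (Num.bound M); have MB := ltW (archi_boundP M0); split => //.
  by apply: le_trans MB; apply: le_trans (ler_norm _) _; rewrite le_max lexx.
move=> t t01; apply: le_trans MB; apply: le_trans (Hc t _) _; first by rewrite in_itv.
by rewrite le_max lexx orbT.
Qed.

(** The value 0 is a default outside [Om], where no sublevel set contains [w]. *)
Definition level (w : Omega R) : nat :=
  if pselect (exists n, `[< sublevel n w >]) is left H then ex_minn H else 0.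

Lemma levelP w : Om w -> sublevel (level w) w.
Proof.
move=> /sublevel_cover[n Hn]; rewrite /level; case: pselect => [H|]; last by case; exists n; apply/asboolP.
by case: ex_minnP => m /asboolP.
Qed.

Lemma level_le w n : sublevel n w -> (level w <= n)%N.
Proof.
move=> Hn; rewrite /level; case: pselect => [H|//].
by case: ex_minnP => m _; apply; exact/asboolP.
Qed.

(** The level cuts [Om] into countably many measurable pieces, so that any sequence of constants
    composed with it is measurable. *)
Lemma measurable_comp_level (C : nat -> R) : measurable_fun Om (fun w => C (level w)).
Proof.
move=> mOm Y mY.
have -> : Om `&` (fun w => C (level w)) @^-1` Y =
    \bigcup_(n in [set n | Y (C n)]) (sublevel n `\` \bigcup_(m in [set m | (m < n)%N]) sublevel m).
  apply/seteqP; split => w.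
    move=> [Ow Yw]; exists (level w) => //; split; first exact: levelP.
    by move=> [m /= ml /level_le]; rewrite leqNgt ml.
  move=> [n Yn [Hn Hm]]; have [Ow _ _] := Hn; split => //=.
  rewrite (_ : level w = n)//; apply/eqP; rewrite eqn_leq level_le//= leqNgt; apply/negP => lt.
  by apply: Hm; exists (level w) => //; exact: levelP.
apply: bigcup_measurable => n _; apply: measurableD; first exact: measurable_sublevel.
by apply: bigcup_measurable => m _; exact: measurable_sublevel.
Qed.

End wiener_measurability.

Theorem theorem5 (R : realType) (L nu delta : R)
  (L_gt0 : 0 < L) (nu_gt0 : 0 < nu) (delta_gt0 : 0 < delta)
  (P : probability (Omega R) R) (wienerP : is_wiener P)
  (Om : set (Omega R)) (Om_adm : admissible delta P Om)
  (f h : R * R -> R * R)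
  (f_H2 : inHs L 2 f) (h_H4 : inHs L 4 h) (h_div : div_free L h)
  (h_small : (grad_Linfty L h
              < (Num.sqrt (pi * delta) * 2^-1 * nu * lambda1 L)%:E)%E)
  (D : Omega R -> set (R * R -> R * R)) (D_tempered : tempered_set L Om D) :
  exists T Lip : Omega R -> R,
    [/\ measurable_fun Om T, measurable_fun Om Lip,
        forall w, Om w -> 0 < T w /\ 0 < Lip w &
        forall w, Om w ->
          let w' := theta (- T w) w in
          forall v10 v20 : R * R -> R * R, D w' v10 -> D w' v20 ->
          forall v1 v2 : R -> R * R -> R * R,
            weak_solution L nu f h (fun t => y_delta delta (theta t w')) v10 v1 ->
            weak_solution L nu f h (fun t => y_delta delta (theta t w')) v20 v2 ->
            (normHs L 3 (fun p => v1 (T w) p - v2 (T w) p)%R ^+ 2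
             <= (Lip w * normL2 L (fun p => v10 p - v20 p) ^+ 2)%:E)%E].
Proof.
have [[DH _] [X [[mX _] HX]]] := D_tempered.
have fH := inHs_inH f_H2; have hH := inHs_inH h_H4.
(* One smoothing constant is fixed for every integer bound on the data before any path is
   considered. *)
have [C HC] := choice (fun n : nat =>
  let: ex_intro2 c c0 Hc := smoothing L_gt0 nu_gt0 (ler0n R n) fH hH f_H2 h_H4 in ex_intro _ c (conj c0 Hc)).
(* Adding 1 makes the Lipschitz constant positive. *)
exists (fun=> 1), (fun w => C (level delta Om X w) + 1); split.
- exact: measurable_cst.
- exact: (measurable_comp_level Om_adm mX (fun n => C n + 1)).
- by move=> w _; split => //; rewrite ltr_wpDl//; case: (HC (level delta Om X w)).
move=> w Ow w' v10 v20 D1 D2 v1 v2 ws1 ws2.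
have [_ [_ [inv cty]]] := Om_adm.
have Ow' : Om w' by exact: inv.
have [cz _ _ _] := cty _ Ow'.
(* The level of [w] already bounds the noise and the radius of the tempered set along the shifted
   path [w']. *)
have [_ Xw Hz] := levelP Om_adm X Ow.
have [C0 {}HC] := HC (level delta Om X w).
have s v0 v : D w' v0 -> weak_solution L nu f h (fun t => y_delta delta (theta t w')) v0 v ->
    sol L nu (level delta Om X w)%:R f h (fun t => y_delta delta (theta t w')) v0 v.
  move=> D0 ws; split => //; first exact: (DH _ Ow').2.
  exact: le_trans (HX _ Ow' _ D0) Xw.
apply: le_trans (HC _ _ _ _ _ (s _ _ D1 ws1) (s _ _ D2 ws2)) _.
by rewrite lee_fin ler_wpM2r ?sqr_ge0// lerDl.
Qed.
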